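(* Let $q$ be a power of a prime, $G=\mathrm{GL}_{4,\mathbb{F}_q}$ with $\mu(x)=\mathrm{diag}(xI_3,I_1)$, $T,B$ as in the context, and $(S,\zeta)$ satisfying conditions (a), (b), (c) of the context. Let $\lambda=(a_1,a_2,a_3,a_4)\in\mathbb{Z}^4$ with $q^2(a_1-a_4)+q(a_2-a_4)+(a_3-a_4)>0$ and $f\in H^0(\mathrm{Flag}(S),\mathcal{V}_{\mathrm{flag}}(\lambda))$. Then $f$ is divisible by the partial Hasse invariant $\mathrm{Ha}_{\alpha_3}$, $\alpha_3=e_3-e_4$.
   Context: Notation: $k=\overline{\mathbb{F}}_q$, $\sigma$ the $q$-power Frobenius. For a connected reductive group $G$ over $\mathbb{F}_q$ and a cocharacter $\mu\colon\mathbb{G}_{m,k}\to G_k$: let $P=P_-(\mu)$ (resp. $P_+(\mu)$) be the parabolic subgroup of $G_k$ consisting of $g$ such that $t\mapsto\mu(t)^{-1}g\mu(t)$ (resp. $t\mapsto\mu(t)g\mu(t)^{-1}$) extends to a morphism $\mathbb{A}^1_k\to G_k$; $L$ the centralizer of $\mu$; $Q=(P_+(\mu))^{(q)}$, $M=L^{(q)}$, $\varphi\colon L\to M$ the $q$-Frobenius. The zip group is $E=\{(x,y)\in P\times Q:\varphi(\bar x)=\bar y\}$ ($\bar x$, $\bar y$ the Levi components), acting on $G_k$ by $(x,y)\cdot g=xgy^{-1}$; $G\text{-}\mathtt{Zip}^\mu:=[E\backslash G_k]$. Fix a Borel pair $(B,T)$ over $\mathbb{F}_q$ with $B\subset P$;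 positive roots are those with root groups in the opposite Borel $B^+$; $\Delta$ the simple roots, $I$ the simple roots of $L$, $W$ the Weyl group, $s_\alpha$ reflections, $w_0$ the longest element, $w_{0,I}$ the longest element of $W_I$, $\le$ the Bruhat order, $z=\sigma(w_{0,I})w_0$. For $\lambda\in X^*(T)$, $V_I(\lambda)=\mathrm{Ind}_B^P(\lambda)$ and $\mathcal{V}_I(\lambda)$ its vector bundle on $G\text{-}\mathtt{Zip}^\mu$. The zip flag stack $G\text{-}\mathtt{ZipFlag}^\mu=[E'\backslash G_k]$, $E'=E\cap(B\times G_k)$, carries the line bundle $\mathcal{V}_{\mathrm{flag}}(\lambda)$ attached to the character $(x,y)\mapsto\lambda(x)$ of $E'$; its pushforward to $G\text{-}\mathtt{Zip}^\mu$ is $\mathcal{V}_I(\lambda)$. Flag strata: $\mathcal{F}_w=[E'\backslash BwBz^{-1}]$, with closure $\bigcup_{w'\le w}\mathcal{F}_{w'}$. For $\alpha\in\Delta$, a partial Hasse invariant $\mathrm{Ha}_\alpha$ is a global section over $G\text{-}\mathtt{ZipFlag}^\mu$ of some $\mathcal{V}_{\mathrm{flag}}(\lambda_\alpha)$ whose divisor is exactly $\overline{\mathcal{F}}_{w_0s_\alpha}$ with multiplicity one (such sections exist). Condition on $(S,\zeta)$, $\zeta\colon S\to G\text{-}\mathtt{Zip}^\mu$ a morphism from a $k$-scheme: (a) $\zeta$ smooth; (b) $\zeta$ surjective on each connected component; (c) for each $w$ of length 1, $\overline{\mathrm{Flag}(S)}_w$ is pseudo-complete, where $\mathrm{Flag}(S)=S\times_{G\text{-}\mathtt{Zip}^\mu}G\text{-}\mathtt{ZipFlag}^\mu$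 with projection $\zeta_{\mathrm{flag}}$, $\mathrm{Flag}(S)_w=\zeta_{\mathrm{flag}}^{-1}(\mathcal{F}_w)$ (reduced). Line bundles and $\mathrm{Ha}_\alpha$ on $\mathrm{Flag}(S)$ denote pullbacks via $\zeta_{\mathrm{flag}}$. Specifics: $T$ diagonal, $B$ lower-triangular in $\mathrm{GL}_4$, $X^*(T)=\mathbb{Z}^4$ via $\prod x_i^{a_i}$, standard basis $e_i$, simple roots $\alpha_i=e_i-e_{i+1}$. The weight of $\mathrm{Ha}_{\alpha_3}$ is $(1,0,-q,0)$ up to multiples of $(1-q,1-q,1-q,1-q)$. *)

(* Defs.v *)
(* Schemes over k are set up through their functors of points (Demazure-Gabriel):
   a k-functor is a functor from k-algebras to types, and a scheme is a Zariski
   sheaf covered by open affine subfunctors. *)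
From HB Require Import structures.
From mathcomp Require Import all_boot all_order all_fingroup all_algebra.
From mathcomp Require Import mpoly.
From Stdlib Require Import ProofIrrelevance.

Set Implicit Arguments.
Unset Strict Implicit.
Unset Printing Implicit Defensive.

Import GRing.Theory.
Local Open Scope ring_scope.

Section RingNotions.
Variable k : fieldType.
(* [comUnitAlgType k] is the type of nonzero commutative k-algebras.  Nothing is
   lost by leaving out the zero algebra: a Zariski sheaf has exactly one point
   over it. *)
Implicit Types A B C D K : comUnitAlgType k.

Definition is_field K := forall a : K, a != 0 -> a \is a GRing.unit.

Definition is_localization A B (a : A) (phi : {lrmorphism A -> B}) : Prop :=
  [/\ phi a \is a GRing.unit,
      forall b : B, exists c n, phi c = b * phi a ^+ n
    & forall c : A, phi c = 0 -> exists n, a ^+ n * c = 0].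

(* B is isomorphic, as an A-algebra, to A[X_1, ..., X_n] / (r_1, ..., r_m). *)
Definition finitely_presented A B (phi : {lrmorphism A -> B}) : Prop :=
  exists n (b : 'I_n -> B) m (r : 'I_m -> {mpoly A[n]}),
    (forall c : B, exists P : {mpoly A[n]}, mmap phi b P = c) /\
    (forall P : {mpoly A[n]}, mmap phi b P = 0 <->
       exists u : 'I_m -> {mpoly A[n]}, P = \sum_j u j * r j).

Definition square_zero_thickening A B (phi : {lrmorphism A -> B}) : Prop :=
  (forall b : B, exists a, phi a = b) /\
  (forall a a' : A, phi a = 0 -> phi a' = 0 -> a * a' = 0).

Definition formally_etale_alg A B (phi : {lrmorphism A -> B}) : Prop :=
  forall C D (theta : {lrmorphism C -> D}), square_zero_thickening theta ->
  forall (alpha : {lrmorphism A -> C}) (beta : {lrmorphism B -> D}),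
    (forall a, theta (alpha a) = beta (phi a)) ->
    exists gamma : {lrmorphism B -> C},
      ((forall a, gamma (phi a) = alpha a) /\
       (forall b, theta (gamma b) = beta b)) /\
      forall gamma' : {lrmorphism B -> C},
        (forall a, gamma' (phi a) = alpha a) ->
        (forall b, theta (gamma' b) = beta b) -> gamma' =1 gamma.

Definition spec_surjective A B (phi : {lrmorphism A -> B}) : Prop :=
  forall K (psi : {lrmorphism A -> K}), is_field K ->
    exists K' (iota : {lrmorphism K -> K'}) (chi : {lrmorphism B -> K'}),
      is_field K' /\ forall a, chi (phi a) = iota (psi a).

Definition etale_cover A B (phi : {lrmorphism A -> B}) : Prop :=
  [/\ finitely_presented phi, formally_etale_alg phi & spec_surjective phi].

End RingNotions.

Record kfunctor (k : fieldType) := KFunctor {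
  kobj :> comUnitAlgType k -> Type;
  fmap : forall A B : comUnitAlgType k, {lrmorphism A -> B} -> kobj A -> kobj B;
  fmap_id : forall (A : comUnitAlgType k) (phi : {lrmorphism A -> A}) x, phi =1 id -> fmap phi x = x;
  fmap_comp : forall (A B C : comUnitAlgType k) (phi : {lrmorphism A -> B})
      (psi : {lrmorphism B -> C}) (chi : {lrmorphism A -> C}) x,
    (forall a, chi a = psi (phi a)) -> fmap chi x = fmap psi (fmap phi x)
}.

Record kmorph (k : fieldType) (X Y : kfunctor k) := KMorph {
  kapp :> forall A : comUnitAlgType k, X A -> Y A;
  kapp_nat : forall (A B : comUnitAlgType k) (phi : {lrmorphism A -> B}) x,
    kapp (fmap phi x) = fmap phi (kapp x)
}.

Record subfunctor (k : fieldType) (X : kfunctor k) := SubFunctor {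
  smem :> forall A : comUnitAlgType k, X A -> Prop;
  smem_stable : forall (A B : comUnitAlgType k) (phi : {lrmorphism A -> B}) (x : X A),
    smem x -> smem (fmap phi x)
}.

Section SubObject.
Variables (k : fieldType) (X : kfunctor k) (U : subfunctor X).
Implicit Types A B C : comUnitAlgType k.

Definition sub_obj (A : comUnitAlgType k) := {x : X A | U A x}.

Definition sub_fmap A B (phi : {lrmorphism A -> B}) (x : sub_obj A) : sub_obj B :=
  exist _ (fmap phi (sval x)) (smem_stable phi (svalP x)).

Lemma sub_obj_inj A (x y : sub_obj A) : sval x = sval y -> x = y.
Proof.
case: x y => [x hx] [y hy] /= e; subst y.
by rewrite (proof_irrelevance _ hx hy).
Qed.

Lemma sub_fmap_id A (phi : {lrmorphism A -> A}) x :
  phi =1 id -> sub_fmap phi x = x.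
Proof. by move=> e; apply: sub_obj_inj; apply: fmap_id. Qed.

Lemma sub_fmap_comp A B C (phi : {lrmorphism A -> B})
    (psi : {lrmorphism B -> C}) (chi : {lrmorphism A -> C}) x :
  (forall a, chi a = psi (phi a)) ->
  sub_fmap chi x = sub_fmap psi (sub_fmap phi x).
Proof. by move=> e; apply: sub_obj_inj; apply: fmap_comp. Qed.

Definition sub_kfunctor : kfunctor k := KFunctor sub_fmap_id sub_fmap_comp.

End SubObject.

Section AffineLine.
Variable k : fieldType.

Definition A1_fmap (A B : comUnitAlgType k) (phi : {lrmorphism A -> B}) (a : A) : B :=
  phi a.

Lemma A1_fmap_id (A : comUnitAlgType k) (phi : {lrmorphism A -> A}) (a : A) :
  phi =1 id -> A1_fmap phi a = a.
Proof. exact. Qed.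

Lemma A1_fmap_comp (A B C : comUnitAlgType k) (phi : {lrmorphism A -> B})
    (psi : {lrmorphism B -> C}) (chi : {lrmorphism A -> C}) (a : A) :
  (forall a, chi a = psi (phi a)) ->
  A1_fmap chi a = A1_fmap psi (A1_fmap phi a).
Proof. exact. Qed.

Definition A1 : kfunctor k :=
  @KFunctor k (fun A => A : Type) A1_fmap A1_fmap_id A1_fmap_comp.

End AffineLine.

(* H^0(X, O_X) *)
Definition regular_function (k : fieldType) (X : kfunctor k) := kmorph X (A1 k).

Section Schemes.
Variable k : fieldType.
Implicit Types X Y : kfunctor k.
Implicit Types A B C K : comUnitAlgType k.

(* The points of U lying over x : Spec A -> X are those of the open subscheme of
   Spec A complementary to the closed subscheme defined by the ideal (I). *)
Definition is_open X (U : subfunctor X) : Prop :=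
  forall A (x : X A), exists I : A -> Prop,
  forall B (phi : {lrmorphism A -> B}),
    U B (fmap phi x) <->
    exists n (a : 'I_n -> A) (b : 'I_n -> B),
      (forall i, I (a i)) /\ \sum_i b i * phi (a i) = 1.

Definition is_closed X (Z : subfunctor X) : Prop :=
  forall A (x : X A), exists I : A -> Prop,
  forall B (phi : {lrmorphism A -> B}),
    Z B (fmap phi x) <-> (forall a, I a -> phi a = 0).

Definition represents X A (u : X A) : Prop :=
  forall B (x : X B), exists phi : {lrmorphism A -> B},
    fmap phi u = x /\
    forall psi : {lrmorphism A -> B}, fmap psi u = x -> psi =1 phi.

Definition is_affine X : Prop := exists A (u : X A), represents u.

Definition zariski_sheaf X : Prop :=
  forall A n (a c : 'I_n -> A), \sum_i c i * a i = 1 ->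
  forall (A_ : 'I_n -> comUnitAlgType k) (phi : forall i, {lrmorphism A -> A_ i}),
    (forall i, is_localization (a i) (phi i)) ->
  forall x : forall i, X (A_ i),
    (forall i j C (alpha : {lrmorphism A_ i -> C}) (beta : {lrmorphism A_ j -> C}),
       (forall b, alpha (phi i b) = beta (phi j b)) ->
       fmap alpha (x i) = fmap beta (x j)) ->
    exists! y : X A, forall i, fmap (phi i) y = x i.

Definition is_scheme X : Prop :=
  zariski_sheaf X /\
  forall K (x : X K), is_field K ->
    exists U : subfunctor X,
      [/\ is_open U, is_affine (sub_kfunctor U) & U K x].

Definition formally_smooth X Y (f : kmorph X Y) : Prop :=
  forall A B (phi : {lrmorphism A -> B}), square_zero_thickening phi ->
  forall (y : Y A) (x : X B), f B x = fmap phi y ->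
    exists x' : X A, fmap phi x' = x /\ f A x' = y.

Definition locally_finitely_presented X Y (f : kmorph X Y) : Prop :=
  forall K (x : X K), is_field K ->
  exists (U : subfunctor X) (V : subfunctor Y),
    [/\ is_open U, is_open V, U K x & forall A (x' : X A), U A x' -> V A (f A x')] /\
    exists B (u : sub_kfunctor U B) A (v : sub_kfunctor V A)
      (phi : {lrmorphism A -> B}),
      [/\ represents u, represents v, f B (sval u) = fmap phi (sval v)
        & finitely_presented phi].

Definition smooth_morphism X Y (f : kmorph X Y) : Prop :=
  formally_smooth f /\ locally_finitely_presented f.

(* A subset of the underlying space |X| is given by the points of X with values
   in fields that it contains; only the values at fields are ever used.  It is
   [saturated] when it is a union of points of |X|, i.e. compatible with the
   identification of a field-valued point with its images under field
   extensions. *)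
Definition point_set X := forall K : comUnitAlgType k, X K -> Prop.

Definition saturated X (C : point_set X) : Prop :=
  forall K K' (phi : {lrmorphism K -> K'}) (x : X K), is_field K -> is_field K' ->
    (C K' (fmap phi x) <-> C K x).

Definition inhabited_set X (C : point_set X) : Prop :=
  exists K (x : X K), is_field K /\ C K x.

Definition connected_set X (C : point_set X) : Prop :=
  inhabited_set C /\
  forall U V : subfunctor X, is_open U -> is_open V ->
    (forall K (x : X K), is_field K -> C K x -> U K x \/ V K x) ->
    inhabited_set (fun K x => C K x /\ U K x) ->
    inhabited_set (fun K x => C K x /\ V K x) ->
    inhabited_set (fun K x => [/\ C K x, U K x & V K x]).

Definition connected_component X (C : point_set X) : Prop :=
  [/\ saturated C, connected_set C
    & forall C' : point_set X, saturated C' -> connected_set C' ->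
        (forall K (x : X K), is_field K -> C K x -> C' K x) ->
        forall K (x : X K), is_field K -> C' K x -> C K x].

(* The smallest closed subscheme through all the points of D, that is, the
   Zariski closure of D with its reduced structure. *)
Definition reduced_closure_mem X (D : point_set X) A (x : X A) : Prop :=
  forall Y : subfunctor X, is_closed Y ->
    (forall K (y : X K), is_field K -> D K y -> Y K y) -> Y A x.

Lemma reduced_closure_stable X (D : point_set X) A B (phi : {lrmorphism A -> B})
    (x : X A) : reduced_closure_mem D x -> reduced_closure_mem D (fmap phi x).
Proof. by move=> h Y cY DY; apply: smem_stable; apply: h. Qed.

Definition reduced_closure X (D : point_set X) : subfunctor X :=
  SubFunctor (@reduced_closure_stable X D).

Definition locally_constant X (h : regular_function X) : Prop :=
  forall K (x : X K), is_field K ->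
    exists (U : subfunctor X) (c : k),
      [/\ is_open U, U K x & forall A (y : X A), U A y -> h A y = c%:A].

Definition pseudo_complete X : Prop :=
  forall h : regular_function X, locally_constant h.

End Schemes.

Section GL4.
Variable k : fieldType.
Implicit Types A B C K : comUnitAlgType k.

Definition GL4_obj A := {g : 'M[A]_4 | g \in unitmx}.

Lemma map_mx_unit A B (phi : {lrmorphism A -> B}) (g : 'M[A]_4) :
  g \in unitmx -> map_mx phi g \in unitmx.
Proof. by rewrite !unitmxE det_map_mx; apply: rmorph_unit. Qed.

Definition GL4_fmap A B (phi : {lrmorphism A -> B}) (g : GL4_obj A) : GL4_obj B :=
  exist _ (map_mx phi (sval g)) (map_mx_unit phi (svalP g)).

Lemma GL4_fmap_id A (phi : {lrmorphism A -> A}) g :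
  phi =1 id -> GL4_fmap phi g = g.
Proof. by move=> e; apply/val_inj/matrixP=> i j; rewrite !mxE e. Qed.

Lemma GL4_fmap_comp A B C (phi : {lrmorphism A -> B}) (psi : {lrmorphism B -> C})
    (chi : {lrmorphism A -> C}) g :
  (forall a, chi a = psi (phi a)) ->
  GL4_fmap chi g = GL4_fmap psi (GL4_fmap phi g).
Proof. by move=> e; apply/val_inj/matrixP=> i j; rewrite !mxE e. Qed.

Definition GL4 : kfunctor k := KFunctor GL4_fmap_id GL4_fmap_comp.

Definition mu (R : nzRingType) (t : R) : 'M[R]_4 :=
  diag_mx (\row_(i < 4) if (i < 3)%N then t else 1).

Definition invertible_mx (R : nzRingType) (p : 'M[R]_4) : Prop :=
  exists p' : 'M[R]_4, p *m p' = 1%:M /\ p' *m p = 1%:M.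

(* p is the extension A^1 -> G of t |-> mu(t)^-1 x mu(t) (resp. of
   t |-> mu(t) y mu(t)^-1); the equation is multiplied through by mu(t), which
   is not a zero divisor in A[t]. *)
Definition extends_minus A (x : 'M[A]_4) (p : 'M[{poly A}]_4) : Prop :=
  invertible_mx p /\ map_mx polyC x *m mu 'X = mu 'X *m p.

Definition extends_plus A (y : 'M[A]_4) (p : 'M[{poly A}]_4) : Prop :=
  invertible_mx p /\ mu 'X *m map_mx polyC y = p *m mu 'X.

Definition eval0 A (p : 'M[{poly A}]_4) : 'M[A]_4 := map_mx (fun c => c.[0]) p.

(* The zip group E, as a subgroup of GL_4 x GL_4.  The Levi component of an
   element of P_-(mu) or P_+(mu) is the value at t = 0 of its extension p.
   Since mu is defined over F_q, P_+(mu)^(q) = P_+(mu); the q-Frobenius is the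
   q-power map on matrix entries. *)
Definition zip_group (q : nat) A (e : 'M[A]_4 * 'M[A]_4) : Prop :=
  [/\ e.1 \in unitmx, e.2 \in unitmx &
      exists p r : 'M[{poly A}]_4,
        [/\ extends_minus e.1 p, extends_plus e.2 r &
            map_mx (fun a => a ^+ q) (eval0 p) = eval0 r]].

Definition borel A (b : 'M[A]_4) : bool := (b \in unitmx) && is_trig_mx b.

Definition flag_group (q : nat) A (e : 'M[A]_4 * 'M[A]_4) : Prop :=
  zip_group q e /\ borel e.1.

Definition row4 (a1 a2 a3 a4 : int) : 'rV[int]_4 :=
  \row_(i < 4) [:: a1; a2; a3; a4]`_i.

Definition character (lambda : 'rV[int]_4) A (x : 'M[A]_4) : A :=
  \prod_(i < 4) x i i ^ lambda 0 i.

(* W is identified with 'S_4 by the group isomorphism s |-> perm_mx s. *)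
Definition simple_refl (i : 'I_3) : 'S_4 := tperm (inord i) (inord i.+1).

Definition is_word (s : seq 'I_3) (w : 'S_4) : Prop :=
  w = (\prod_(i <- s) simple_refl i)%g.

Definition has_length (w : 'S_4) (n : nat) : Prop :=
  (exists2 s, is_word s w & size s = n) /\
  (forall s, is_word s w -> (n <= size s)%N).

Definition w0 : 'S_4 := perm rev_ord_inj.

(* I = {alpha_1, alpha_2}, so W_I permutes the first three indices. *)
Definition w0I : 'S_4 := tperm (inord 0) (inord 2).

(* sigma acts trivially on W because T is split over F_q. *)
Definition zperm : 'S_4 := (w0I * w0)%g.

(* B w B z^-1 *)
Definition flag_stratum (w : 'S_4) : point_set GL4 := fun K g =>
  exists b b' : 'M[K]_4, [/\ borel b, borel b' &
    sval g = b *m perm_mx w *m b' *m invmx (perm_mx zperm)].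

(* H^0(G-ZipFlag^mu, V_flag(lambda)) *)
Definition zipflag_section (q : nat) (lambda : 'rV[int]_4)
    (h : regular_function GL4) : Prop :=
  forall A (e : 'M[A]_4 * 'M[A]_4) (g g' : GL4 A), flag_group q e ->
    sval g' = e.1 *m sval g *m invmx e.2 ->
    h A g' = character lambda e.1 * h A g.

(* [div h] is the closure of F_(w_0 s_alpha) with multiplicity one: the zero
   scheme of h is this closure with its reduced structure. *)
Definition partial_hasse (q : nat) (alpha : 'I_3) (lambda : 'rV[int]_4)
    (h : regular_function GL4) : Prop :=
  zipflag_section q lambda h /\
  forall A (g : GL4 A),
    h A g = 0 <->
    reduced_closure (flag_stratum (w0 * simple_refl alpha)%g) A g.

End GL4.
Arguments zip_group {k} q {A} e.
Arguments flag_group {k} q {A} e.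

Section ZipMaps.
Variables (k : fieldType) (q : nat).
Implicit Types A B K : comUnitAlgType k.

(* The laws quantify over arbitrary membership proofs of the elements involved,
   so that no closure property of E is needed to state them. *)
Record zip_action (X : kfunctor k) := ZipAction {
  zip_act : forall (A : comUnitAlgType k) (e : 'M[A]_4 * 'M[A]_4),
    zip_group q e -> X A -> X A;
  act1 : forall A (h : zip_group q (1%:M : 'M[A]_4, 1%:M : 'M[A]_4)) x, zip_act h x = x;
  actM : forall A (e e' : 'M[A]_4 * 'M[A]_4) (h : zip_group q e)
      (h' : zip_group q e') (h'' : zip_group q (e.1 *m e'.1, e.2 *m e'.2)) x,
    zip_act h'' x = zip_act h (zip_act h' x);
  act_nat : forall A B (phi : {lrmorphism A -> B}) (e : 'M[A]_4 * 'M[A]_4)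
      (h : zip_group q e) (h' : zip_group q (map_mx phi e.1, map_mx phi e.2)) x,
    zip_act h' (fmap phi x) = fmap phi (zip_act h x)
}.

(* Torsor (locally trivial for the etale topology) under the subgroup H of E. *)
Definition is_torsor (X Y : kfunctor k) (a : zip_action X)
    (H : forall A : comUnitAlgType k, 'M[A]_4 * 'M[A]_4 -> Prop)
    (p : kmorph X Y) : Prop :=
  [/\ forall A (x x' : X A), p A x = p A x' <->
        exists (e : 'M[A]_4 * 'M[A]_4) (h : zip_group q e), H A e /\ zip_act a h x = x',
      forall A (e : 'M[A]_4 * 'M[A]_4) (h : zip_group q e) (x : X A),
        H A e -> zip_act a h x = x -> e = (1%:M, 1%:M)
    & forall A (y : Y A), exists B (phi : {lrmorphism A -> B}) (x : X B),
        etale_cover phi /\ p B x = fmap phi y].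

(* A morphism from S to the quotient stack G-Zip^mu = [E \ G_k]: an E-torsor over
   S with an E-equivariant morphism to G_k. *)
Record zip_morphism (S : kfunctor k) := ZipMorphism {
  ztot : kfunctor k;
  ztot_scheme : is_scheme ztot;
  zact : zip_action ztot;
  zproj : kmorph ztot S;
  zproj_torsor : is_torsor zact (fun A => @zip_group k q A) zproj;
  zmap : kmorph ztot (GL4 k);
  zmap_equivariant : forall A (e : 'M[A]_4 * 'M[A]_4) (h : zip_group q e) x,
    sval (zmap A (zip_act zact h x)) = e.1 *m sval (zmap A x) *m invmx e.2
}.

Section OverS.
Variables (S : kfunctor k) (zeta : zip_morphism S).

(* The base change of zeta along the atlas G_k -> [E \ G_k] is [zmap zeta]. *)
Definition zip_smooth : Prop := smooth_morphism (zmap zeta).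

(* Every field-valued point of [E \ G_k] comes, after a field extension, from a
   point g of G_k; it lies in the image of C when g is in the image of the part
   of the torsor over C. *)
Definition zip_surjective_on_components : Prop :=
  forall C : point_set S, connected_component C ->
  forall K (g : GL4 k K), is_field K ->
  exists K' (iota : {lrmorphism K -> K'}) (x : ztot zeta K'),
    [/\ is_field K', zmap zeta K' x = fmap iota g & C K' (zproj zeta K' x)].

(* Flag(S) = S x_[E \ G] [E' \ G] is the quotient by E' of the total space of the
   E-torsor; it is determined up to unique isomorphism as the base of an
   E'-torsor on that total space. *)
Record flag_space := FlagSpace {
  flag_base : kfunctor k;
  flag_base_scheme : is_scheme flag_base;
  flag_proj : kmorph (ztot zeta) flag_base;
  flag_proj_torsor : is_torsor (zact zeta) (fun A => @flag_group k q A) flag_proj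
}.

(* H^0(Flag(S), V_flag(lambda)), the sections being E'-equivariant functions on
   the total space of the E'-torsor. *)
Definition flag_section (lambda : 'rV[int]_4)
    (f : regular_function (ztot zeta)) : Prop :=
  forall A (e : 'M[A]_4 * 'M[A]_4) (h : zip_group q e) (x : ztot zeta A),
    flag_group q e -> f A (zip_act (zact zeta) h x) = character lambda e.1 * f A x.

Variable Fl : flag_space.

(* zeta_flag^-1(F_w) *)
Definition Flag_stratum (w : 'S_4) : point_set (flag_base Fl) := fun K y =>
  exists K' (iota : {lrmorphism K -> K'}) (x : ztot zeta K'),
    [/\ is_field K', flag_proj Fl K' x = fmap iota y
      & flag_stratum w (zmap zeta K' x)].

Definition flag_curves_pseudo_complete : Prop :=
  forall w : 'S_4, has_length w 1 ->
    pseudo_complete (sub_kfunctor (reduced_closure (Flag_stratum w))).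

End OverS.

(* f, of weight lambda, is the product of the pullback of h, of weight lambda_h,
   with a section over Flag(S) of V_flag(lambda - lambda_h). *)
Definition divisible_by (S : kfunctor k) (zeta : zip_morphism S)
    (lambda lambda_h : 'rV[int]_4) (f : regular_function (ztot zeta))
    (h : regular_function (GL4 k)) : Prop :=
  exists2 g : regular_function (ztot zeta),
    flag_section (lambda - lambda_h) g
    & forall A (x : ztot zeta A), f A x = g A x * h A (zmap zeta A x).

End ZipMaps.

(* Main.v *)
Require Import Defs.
From HB Require Import structures.
From mathcomp Require Import all_boot all_order all_fingroup all_algebra.
From mathcomp Require Import pgroup abelian finfield.
From mathcomp Require Import mpoly boolp classical_sets.
From mathcomp Require Import ring zify.

Set Implicit Arguments.
Unset Strict Implicit.
Unset Printing Implicit Defensive.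

Import GRing.Theory.
Local Open Scope ring_scope.

(** All work takes place on the total space [T] of the E-torsor of [zeta], with its smooth map to
    [GL4]: sections over the flag space are functions on [T] on which E' acts through a character.
    Let X_ij be the matrix entries, numbered from 0. Right multiplication by [zperm] turns the flag
    strata into Bruhat cells, and the six entries X_ij with i <= j < 3 serve as coordinates: all six
    vanish on a locus T_e over the stratum of the identity, all but X_mm on the locus over the
    closure of a one-dimensional stratum, and the divisor of Ha lies in the locus D where X_02 = 0.
    Where the entries above X_ij and to its right vanish, X_ij is itself a section, of weight e_i -
    q e_j ([entry_weight]).

    The core is that f vanishes on D. On each of the three curves, a section phi of negative degree
    is completed to an E'-invariant function phi^(N+1) v X_mm^n with v invertible and n > 0. It
    descends to a pseudo-complete curve, hence is locally constant, and it is 0 along T_e; so phi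
    vanishes near T_e ([curve_vanish], [kill]). On a larger locus T_J, a section that vanishes near
    T_e on the divisor X_ij = 0 is divisible there by X_ij, and the quotient has weight w - (e_i - q
    e_j). If the condition on the weight survives this subtraction, the division never stops, and a
    section divisible indefinitely by functions vanishing on T_e is 0 near T_e ([divide],
    [divisible_vanish], [descent]). Coordinates are freed one at a time, from the curves up to D.
    With b_i = w_i - w_3, the form q^2 b_0 + q b_1 + b_2 kills the weights of X_12 and X_01, and its
    positivity forces some b_i > 0, which is the condition needed in dimension three ([vanishing3],
    [vanishing_divisor]).

    Vanishing near T_e then spreads over D. The loci T_J are smooth, so annihilators are generated
    by idempotents and the points of D near which f vanishes form an open and closed set
    ([vanish_locally_constant]). Points of D in one fibre over S are joined by rational curves
    inside D ([fibre]), and D has sections over S locally ([slice]), so this set comes from an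
    idempotent function on S ([sweep_idempotent]). By condition (b), every component of S meets the
    image of T_e, so the idempotent is 1 ([sweep_spread]).

    Finally X_02 is a nonzerodivisor and a multiple of Ha on charts, so Ha is a nonzerodivisor as
    well; f vanishes on the zero scheme of Ha, and the local quotients are unique, glue and are
    equivariant ([division], [division_weight]).

    In the commutative algebra, smoothness enters as a lift of the identity of A[X]/I to a map into
    A[X]/I^2 ([smooth_lift]). Iterating the underlying substitution moves I into I^(2^N), and a
    finiteness argument extracts flatness ([smooth_flat]), hence etale descent, and over a perfect
    field reducedness and flatness of Frobenius. *)

(** * Ideals, quotient algebras and homomorphisms *)

Section Ideals.
Variable R : comNzRingType.
Implicit Types (I J : R -> Prop) (x y : R).

Definition idealP I : Prop :=
  [/\ I 0, forall x y, I x -> I y -> I (x + y) & forall a x, I x -> I (a * x)].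

Definition gen (S : R -> Prop) x : Prop := forall I, idealP I -> (forall y, S y -> I y) -> I x.

Lemma gen_ideal S : idealP (gen S).
Proof.
split=> [I [h _ _] _|x y hx hy I hI hS|a x hx I hI hS] //; case: (hI) => _ hD hM.
  by apply: hD; [apply: hx | apply: hy].
by apply: hM; apply: hx.
Qed.

Lemma gen_sub (S : R -> Prop) x : S x -> gen S x. Proof. by move=> Sx I _; apply. Qed.

Lemma gen_min S I : idealP I -> (forall y, S y -> I y) -> forall x, gen S x -> I x.
Proof. by move=> hI hS x; apply. Qed.

Lemma idl0 I : idealP I -> I 0. Proof. by case. Qed.
Lemma idlD I x y : idealP I -> I x -> I y -> I (x + y). Proof. by case=> _ h _; apply: h. Qed.
Lemma idlM I a x : idealP I -> I x -> I (a * x). Proof. by case=> _ _; apply. Qed.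
Lemma idlMr I a x : idealP I -> I x -> I (x * a).
Proof. by move=> hI hx; rewrite mulrC; apply: idlM. Qed.
Lemma idlN I x : idealP I -> I x -> I (- x).
Proof. by move=> hI hx; rewrite -mulN1r; apply: idlM. Qed.
Lemma idlB I x y : idealP I -> I x -> I y -> I (x - y).
Proof. by move=> hI hx hy; apply: idlD => //; apply: idlN. Qed.
Lemma idl_sum I (T : Type) (r : seq T) (P : pred T) (F : T -> R) :
  idealP I -> (forall i, P i -> I (F i)) -> I (\sum_(i <- r | P i) F i).
Proof.
move=> hI hF; elim/big_rec: _ => [|i x Pi hx]; first exact: idl0.
by apply: idlD => //; apply: hF.
Qed.
Lemma idlX I x n : idealP I -> I x -> I (x ^+ n.+1).
Proof. by move=> hI hx; rewrite exprS; apply: idlMr. Qed.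

Lemma gen_finP m (r : 'I_m -> R) x :
  gen (fun y => exists j, y = r j) x <-> exists u : 'I_m -> R, x = \sum_j u j * r j.
Proof.
split; last first.
  case=> u ->; apply: idl_sum (gen_ideal _) _ => j _.
  by apply: idlM (gen_ideal _) _; apply: gen_sub; exists j.
move=> h; apply: (h (fun x => exists u : 'I_m -> R, x = \sum_j u j * r j)) => [|_ [j ->]]; last first.
  exists (fun i => (i == j)%:R); rewrite (bigD1 j) //= eqxx mul1r big1 ?addr0 // => i /negPf->.
  by rewrite mul0r.
split.
- by exists (fun=> 0); rewrite big1 // => i _; rewrite mul0r.
- move=> _ _ [u ->] [v ->]; exists (fun i => u i + v i).
  by rewrite -big_split; apply: eq_bigr => i _; rewrite mulrDl.
- move=> a _ [u ->]; exists (fun i => a * u i).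
  by rewrite mulr_sumr; apply: eq_bigr => i _; rewrite mulrA.
Qed.

Definition prodI I J := gen (fun z => exists x y, [/\ I x, J y & z = x * y]).

Lemma prodI_ideal I J : idealP (prodI I J). Proof. exact: gen_ideal. Qed.
Lemma prodI_mul I J x y : I x -> J y -> prodI I J (x * y).
Proof. by move=> hx hy; apply: gen_sub; exists x, y. Qed.
Lemma prodI_subl I J x : idealP I -> prodI I J x -> I x.
Proof. by move=> hI; apply: gen_min => // _ [y [z [hy _ ->]]]; apply: idlMr. Qed.

Record pideal := PIdeal { imem :> R -> Prop; imemP : idealP imem; imem1 : ~ imem 1 }.

End Ideals.
Arguments idl0 {R I}.
Arguments idlD {R I x y}.
Arguments idlM {R I a x}.
Arguments idlMr {R I a x}.
Arguments idlN {R I x}.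
Arguments idlB {R I x y}.
Arguments idl_sum {R I T r P F}.
Arguments idlX {R I x n}.

Section Quotient.
Variables (k : fieldType) (R : comNzRingType) (iota : {rmorphism k -> R}) (I : pideal R).
Let hI := imemP I.

(** A class is the predicate of its coset, so that equality of classes is extensional equality of
    predicates. *)
Definition quo : Type := {c : R -> Prop | exists x, c = (fun y => imem I (y - x))}.

Definition cls (x : R) : quo := exist _ (fun y => imem I (y - x)) (ex_intro _ x erefl).
Definition qrepr (a : quo) : R := projT1 (cid (svalP a)).

Lemma quo_inj (a b : quo) : sval a = sval b -> a = b.
Proof. by case: a b => [a ha] [b hb] /= e; subst b; rewrite (Prop_irrelevance ha hb). Qed.

Lemma clsP x y : cls x = cls y <-> imem I (x - y).
Proof.
split=> [/(congr1 (fun a => sval a x)) /= <-|h]; first by rewrite subrr; apply: idl0.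
apply: quo_inj; apply/funext=> z; apply/propext; split=> /= hz.
  by rewrite -(subrK x z) -addrA; apply: idlD.
by rewrite -(subrK y z) -addrA; apply: idlD => //; rewrite -opprB; apply: idlN.
Qed.

Lemma qreprK a : cls (qrepr a) = a.
Proof. by apply: quo_inj; rewrite /qrepr; case: cid => x /= ->. Qed.

Lemma quoW (P : quo -> Prop) : (forall x, P (cls x)) -> forall a, P a.
Proof. by move=> h a; rewrite -(qreprK a). Qed.

HB.instance Definition _ := gen_eqMixin quo.
HB.instance Definition _ := gen_choiceMixin quo.

Let qadd a b := cls (qrepr a + qrepr b).
Let qopp a := cls (- qrepr a).
Let qmul a b := cls (qrepr a * qrepr b).

Lemma qrepr_cls x : imem I (qrepr (cls x) - x).
Proof. by apply/clsP; rewrite qreprK. Qed.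

Lemma qaddE x y : qadd (cls x) (cls y) = cls (x + y).
Proof.
apply/clsP; rewrite opprD addrACA; apply: idlD => //; exact: qrepr_cls.
Qed.
Lemma qoppE x : qopp (cls x) = cls (- x).
Proof. apply/clsP; rewrite -opprD; apply: idlN => //; exact: qrepr_cls. Qed.
Lemma qmulE x y : qmul (cls x) (cls y) = cls (x * y).
Proof.
apply/clsP; set x' := qrepr _; set y' := qrepr _.
have -> : x' * y' - x * y = (x' - x) * y' + x * (y' - y) by ring.
by apply: idlD => //; [apply: idlMr | apply: idlM] => //; apply: qrepr_cls.
Qed.

Lemma qaddA : associative qadd.
Proof. by elim/quoW=> x; elim/quoW=> y; elim/quoW=> z; rewrite !qaddE addrA. Qed.
Lemma qaddC : commutative qadd.
Proof. by elim/quoW=> x; elim/quoW=> y; rewrite !qaddE addrC. Qed.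
Lemma qadd0 : left_id (cls 0) qadd.
Proof. by elim/quoW=> x; rewrite qaddE add0r. Qed.
Lemma qaddN : left_inverse (cls 0) qopp qadd.
Proof. by elim/quoW=> x; rewrite qoppE qaddE addNr. Qed.
HB.instance Definition _ := GRing.isZmodule.Build quo qaddA qaddC qadd0 qaddN.

Lemma qmulA : associative qmul.
Proof. by elim/quoW=> x; elim/quoW=> y; elim/quoW=> z; rewrite !qmulE mulrA. Qed.
Lemma qmulC : commutative qmul.
Proof. by elim/quoW=> x; elim/quoW=> y; rewrite !qmulE mulrC. Qed.
Lemma qmul1 : left_id (cls 1) qmul.
Proof. by elim/quoW=> x; rewrite qmulE mul1r. Qed.
Lemma qmulD : left_distributive qmul +%R.
Proof.
elim/quoW=> x; elim/quoW=> y; elim/quoW=> z; rewrite -[_ + _]/(qadd _ _) -[qmul _ _ + _]/(qadd _ _).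
by rewrite !(qaddE, qmulE) mulrDl.
Qed.
Lemma qone_neq0 : cls 1 != 0.
Proof. by apply/eqP=> /clsP; rewrite subr0; apply: imem1. Qed.
HB.instance Definition _ := GRing.Zmodule_isComNzRing.Build quo qmulA qmulC qmul1 qmulD qone_neq0.

Lemma cls_is_zmod : zmod_morphism cls.
Proof. by move=> x y; rewrite -qaddE -qoppE. Qed.
Lemma cls_is_monoid : monoid_morphism cls.
Proof. by split=> // x y; rewrite -qmulE. Qed.
HB.instance Definition _ := GRing.isZmodMorphism.Build R quo cls cls_is_zmod.
HB.instance Definition _ := GRing.isMonoidMorphism.Build R quo cls cls_is_monoid.

Lemma cls0P x : cls x = 0 <-> imem I x.
Proof. by rewrite -[0]/(cls 0) clsP subr0. Qed.

Let qunit : pred quo := fun a => `[< exists b, b * a = 1 >].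
Let qinv (a : quo) : quo := if pselect (exists b, b * a = 1) is left h then projT1 (cid h) else a.
Lemma qmulVx : {in qunit, left_inverse 1 qinv *%R}.
Proof. by move=> a /asboolP h; rewrite /qinv; case: pselect => // h'; case: cid. Qed.
Lemma qunitPl : forall x y, y * x = 1 -> qunit x.
Proof. by move=> x y h; apply/asboolP; exists y. Qed.
Lemma qinv_out : {in [predC qunit], qinv =1 id}.
Proof.
move=> a /negP h; rewrite /qinv; case: pselect => // h'; case: h; exact/asboolP.
Qed.
HB.instance Definition _ := GRing.ComNzRing_hasMulInverse.Build quo qmulVx qunitPl qinv_out.

(** The dummy argument records the structure map from k, so that the scalar action can be found from
    the type. *)
Definition quoA (_ : {rmorphism k -> R}) : Type := quo.
Local Notation Q := (quoA iota).
HB.instance Definition _ := GRing.ComUnitRing.on Q.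

Let qscale (c : k) (a : Q) : Q := (cls (iota c) : Q) * a.
Lemma qscaleA a b v : qscale a (qscale b v) = qscale (a * b) v.
Proof. by rewrite /qscale mulrA -!rmorphM. Qed.
Lemma qscale1 : left_id 1 qscale.
Proof. by move=> v; rewrite /qscale rmorph1 mul1r. Qed.
Lemma qscaleDr : right_distributive qscale +%R.
Proof. by move=> a u v; rewrite /qscale mulrDr. Qed.
Lemma qscaleDl v : {morph qscale^~ v : a b / a + b}.
Proof. by move=> a b; rewrite /qscale rmorphD rmorphD mulrDl. Qed.
HB.instance Definition _ := GRing.Zmodule_isLmodule.Build k Q qscaleA qscale1 qscaleDr qscaleDl.
Lemma qscaleAl (a : k) (u v : Q) : a *: (u * v) = (a *: u) * v.
Proof. by rewrite -[_ *: _]/(qscale _ _) -[a *: u]/(qscale _ _) /qscale mulrA. Qed.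
HB.instance Definition _ := GRing.Lmodule_isLalgebra.Build k Q qscaleAl.
HB.instance Definition _ := GRing.Lalgebra_isComAlgebra.Build k Q.

Definition qalg : comUnitAlgType k := Q.
Definition qmap : R -> qalg := cls.
HB.instance Definition _ := GRing.RMorphism.on qmap.
Lemma qmapE c : qmap (iota c) = c%:A.
Proof. by rewrite -[c%:A]/(qscale c 1) /qscale mulr1. Qed.
Lemma qmap0P x : qmap x = 0 <-> imem I x. Proof. exact: cls0P. Qed.
Lemma qmapP x y : qmap x = qmap y <-> imem I (x - y). Proof. exact: clsP. Qed.
Lemma qmap_surj (a : qalg) : exists x, qmap x = a.
Proof. by exists (qrepr a); apply: qreprK. Qed.

End Quotient.
Arguments qmap {k R} iota I.

Section MakeHom.
Variables (k : fieldType) (A B : comUnitAlgType k) (f : A -> B).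
Hypotheses (fB : zmod_morphism f) (fM : monoid_morphism f) (fZ : forall c : k, f c%:A = c%:A).
Let g := f.
HB.instance Definition _ := GRing.isZmodMorphism.Build A B g fB.
HB.instance Definition _ := GRing.isMonoidMorphism.Build A B g fM.
Lemma mkhom_scalable : scalable g.
Proof.
move=> c x; have -> : c *: x = c%:A * x by rewrite -scalerAl mul1r.
by rewrite rmorphM /= /g fZ -scalerAl mul1r.
Qed.
HB.instance Definition _ := GRing.isScalable.Build k A B *:%R g mkhom_scalable.
Definition mkhom : {lrmorphism A -> B} := g.
Lemma mkhomE x : mkhom x = f x. Proof. by []. Qed.
End MakeHom.

(** * Maximal ideals, field-valued points and localization *)

Section Algebras.
Variable k : fieldType.
Implicit Types A B C K : comUnitAlgType k.

Lemma hom_alg A B (f : {lrmorphism A -> B}) (c : k) : f c%:A = c%:A.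
Proof. exact: rmorph_alg. Qed.

Lemma quo_hom (R : comNzRingType) (iota : {rmorphism k -> R}) (I : pideal R) B
    (f : {rmorphism R -> B}) :
  (forall c, f (iota c) = c%:A) -> (forall x, imem I x -> f x = 0) ->
  exists g : {lrmorphism qalg iota I -> B}, forall x, g (qmap iota I x) = f x.
Proof.
move=> fc fI.
pose g (a : qalg iota I) := f (qrepr (a : quo I)).
have gE x : g (qmap iota I x) = f x.
  by apply/eqP; rewrite /g -subr_eq0 -rmorphB /= (fI _ (@qrepr_cls R I x)).
have gB : zmod_morphism g.
  move=> a b; have [x <-] := qmap_surj a; have [y <-] := qmap_surj b.
  by rewrite -rmorphB !gE rmorphB.
have gM : monoid_morphism g.
  split=> [|a b]; first by rewrite -(rmorph1 (qmap iota I)) gE rmorph1.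
  have [x <-] := qmap_surj a; have [y <-] := qmap_surj b.
  by rewrite -rmorphM !gE rmorphM.
have gZ c : g c%:A = c%:A by rewrite -qmapE gE.
by exists (mkhom gB gM gZ) => x; rewrite mkhomE gE.
Qed.

Lemma qalg_ext (R : comNzRingType) (iota : {rmorphism k -> R}) (I : pideal R) B
    (f g : qalg iota I -> B) :
  (forall x, f (qmap iota I x) = g (qmap iota I x)) -> f =1 g.
Proof. by move=> h a; have [x <-] := qmap_surj a. Qed.

Lemma qalg_exists A (I : A -> Prop) : idealP I -> ~ I 1 ->
  exists (B : comUnitAlgType k) (p : {lrmorphism A -> B}),
    [/\ forall b, exists a, p a = b, forall a, p a = 0 <-> I a
      & forall C (f : {lrmorphism A -> C}), (forall a, I a -> f a = 0) ->
          exists g : {lrmorphism B -> C}, forall a, g (p a) = f a].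
Proof.
move=> hI h1; pose J := PIdeal hI h1; pose i : {rmorphism k -> A} := in_alg A.
have pZ c : qmap i J (c%:A) = c%:A by rewrite -qmapE.
have pB : zmod_morphism (qmap i J) by move=> x y; apply: rmorphB.
have pM : monoid_morphism (qmap i J) by split=> [|x y]; [apply: rmorph1 | apply: rmorphM].
exists (qalg i J), (mkhom pB pM pZ); split=> [b|a|C f fI].
- exact: qmap_surj.
- exact: qmap0P.
- have fc c : f (i c) = c%:A by exact: hom_alg.
  by have [g hg] := @quo_hom A i J C f fc fI; exists g.
Qed.

Lemma maximal_ideal A (I : A -> Prop) : idealP I -> ~ I 1 ->
  exists J : pideal A, (forall a, I a -> imem J a) /\
    forall J' : pideal A, (forall a, imem J a -> imem J' a) -> forall a, imem J' a -> imem J a.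
Proof.
move=> hI h1; pose T := {J : pideal A | forall a, I a -> imem J a}.
pose t0 : T := exist (fun J : pideal A => forall a, I a -> imem J a) (PIdeal hI h1) (fun a h => h).
pose R (s t : T) := `[< forall a, imem (sval s) a -> imem (sval t) a >].
have [|||t ht] := @ZL_preorder T t0 R.
- by move=> t; apply/asboolP.
- by move=> r s t /asboolP rs /asboolP st; apply/asboolP => a /rs/st.
- move=> F Ftot; case: (pselect (exists t, F t)) => [[t1 Ft1]|hF]; last first.
    by exists t0 => s Fs; case: hF; exists s.
  pose U a := exists2 t, F t & imem (sval t) a.
  have UI : idealP U.
    split; first by exists t1 => //; apply: idl0; apply: imemP.
      move=> x y [s Fs sx] [t Ft ty].
      case: (Ftot s t Fs Ft) => /asboolP h.
        by exists t => //; apply: idlD (imemP _) _ _ => //; apply: h.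
      by exists s => //; apply: idlD (imemP _) _ _ => //; apply: h.
    by move=> a x [s Fs sx]; exists s => //; apply: idlM (imemP _) _.
  have U1 : ~ U 1 by case=> t _; apply: imem1.
  have IU a : I a -> imem (PIdeal UI U1) a by move=> Ia; exists t1 => //; apply: (svalP t1 a).
  pose u : T := exist (fun J : pideal A => forall a, I a -> imem J a) (PIdeal UI U1) IU.
  by exists u => s Fs; apply/asboolP => a sa; exists s.
- exists (sval t); split; first exact: (svalP t).
  move=> J' hJ'; have IJ' a : I a -> imem J' a by move=> Ia; apply/hJ'/(svalP t).
  pose u : T := exist (fun J : pideal A => forall a, I a -> imem J a) J' IJ'.
  by have /asboolP := ht u (asboolT hJ').
Qed.

Lemma field_point A (I : A -> Prop) : idealP I -> ~ I 1 ->
  exists K (psi : {lrmorphism A -> K}), is_field K /\ forall a, I a -> psi a = 0.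
Proof.
move=> hI h1; have [J [IJ Jmax]] := maximal_ideal hI h1.
have [K [psi [psur pker _]]] := qalg_exists (imemP J) (@imem1 _ J).
exists K, psi; split=> [x x0|a /IJ /pker //].
have [a ax] := psur x.
pose J1 b := exists c d, imem J c /\ b = c + d * a.
have hJ1 : idealP J1.
  split; first by exists 0, 0; split; [apply: idl0 (imemP _)|rewrite mul0r addr0].
    move=> _ _ [c [d [hc ->]]] [c' [d' [hc' ->]]]; exists (c + c'), (d + d').
    by split; [apply: idlD (imemP _) _ _|ring].
  move=> e _ [c [d [hc ->]]]; exists (e * c), (e * d).
  by split; [apply: idlM (imemP _) _|ring].
have [[c [d [hc e]]]|hJ1'] := pselect (J1 1).
  apply/unitrPr; exists (psi d); have := congr1 psi e.
  by rewrite rmorph1 rmorphD /= (proj2 (pker c) hc) add0r rmorphM /= ax mulrC => <-.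
have JJ1 b : imem J b -> imem (PIdeal hJ1 hJ1') b by move=> hb; exists b, 0; rewrite mul0r addr0.
have J1a : imem (PIdeal hJ1 hJ1') a.
  by exists 0, 1; split; [apply: idl0 (imemP _)|rewrite mul1r add0r].
by have /pker e := Jmax _ JJ1 _ J1a; rewrite -ax e eqxx in x0.
Qed.

(** Otherwise a maximal ideal containing I gives a field point killing it. Every local-to-global
    argument on Spec A below goes through this criterion. *)
Lemma ideal1_field A (I : A -> Prop) : idealP I ->
  (forall K (psi : {lrmorphism A -> K}), is_field K -> exists a, I a /\ psi a != 0) -> I 1.
Proof.
move=> hI h; have [//|h1] := pselect (I 1).
have [K [psi [hK hpsi]]] := field_point hI h1.
by have [a [/hpsi->]] := h _ psi hK; rewrite eqxx.
Qed.

Lemma field_points A : exists K (psi : {lrmorphism A -> K}), is_field K.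
Proof.
have [|/eqP|K [psi [hK _]]] := @field_point A (fun a => a = 0).
- by split=> // [x y -> ->|a x ->]; rewrite ?addr0 ?mulr0.
- by rewrite oner_eq0.
- by exists K, psi.
Qed.

Lemma unit_field A (a : A) :
  (forall K (psi : {lrmorphism A -> K}), is_field K -> psi a != 0) -> a \is a GRing.unit.
Proof.
move=> h; have [||c e] := @ideal1_field A (fun b => exists c, b = c * a); last first.
- by apply/unitrPr; exists c; rewrite mulrC.
- by move=> K psi hK; exists a; split; [exists 1; rewrite mul1r | apply: h].
- split; first by exists 0; rewrite mul0r.
    by move=> _ _ [c ->] [d ->]; exists (c + d); rewrite mulrDl.
  by move=> b _ [c ->]; exists (b * c); rewrite mulrA.
Qed.

Lemma eq0_local A (a : A) :
  (forall K (psi : {lrmorphism A -> K}), is_field K -> exists s, psi s != 0 /\ s * a = 0) -> a = 0.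
Proof.
move=> h; rewrite -[a]mul1r; apply: (@ideal1_field A (fun s => s * a = 0)).
- by split=> [|x y hx hy|b x hx]; rewrite ?mul0r // ?mulrDl ?hx ?hy ?addr0 // -mulrA hx mulr0.
- by move=> K psi /(h K psi) [s [s0 sa]]; exists s.
Qed.

Lemma field_mul0 K (a b : K) : is_field K -> a != 0 -> a * b = 0 -> b = 0.
Proof. by move=> hK /hK ua /(congr1 (fun x => a^-1 * x)); rewrite mulKr // mulr0. Qed.

Lemma field_mulf_neq0 K (a b : K) : is_field K -> a != 0 -> b != 0 -> a * b != 0.
Proof. by move=> hK a0 b0; apply/eqP=> /(field_mul0 hK a0) e; rewrite e eqxx in b0. Qed.

Lemma field_expf_neq0 K (a : K) n : is_field K -> a != 0 -> a ^+ n != 0.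
Proof.
move=> hK a0; elim: n => [|n IH]; first by rewrite expr0 oner_eq0.
by rewrite exprS field_mulf_neq0.
Qed.

Lemma field_hom_neq0 K A (f : {lrmorphism K -> A}) (a : K) : is_field K -> a != 0 -> f a != 0.
Proof.
by move=> hK /hK /(rmorph_unit f) u; apply: contraTneq u => /= ->; rewrite unitr0.
Qed.

Lemma field_hom_inj K A (f : {lrmorphism K -> A}) : is_field K -> injective f.
Proof.
move=> hK a b e; apply/eqP; rewrite -subr_eq0; apply: contraT => h.
by have := field_hom_neq0 f hK h; rewrite rmorphB /= e subrr eqxx.
Qed.

Section Localization.
Variables (S : comNzRingType) (iota : {rmorphism k -> S}) (s : S).
Hypothesis s_nnil : forall n, s ^+ n != 0.

Let J : {poly S} -> Prop := gen (fun p => p = s *: 'X - 1).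

Lemma loc_idealP p : J p <-> exists g, p = g * (s *: 'X - 1).
Proof.
split=> [h|[g ->]]; last by apply: idlM (gen_ideal _) _; apply: gen_sub.
apply: (h (fun p => exists g, p = g * (s *: 'X - 1))) => [|_ ->]; last by exists 1; rewrite mul1r.
split; first by exists 0; rewrite mul0r.
  by move=> _ _ [g ->] [g' ->]; exists (g + g'); rewrite mulrDl.
by move=> a _ [g ->]; exists (a * g); rewrite mulrA.
Qed.

(** Comparing coefficients in c = g (s X - 1) gives g_i = - s^i c, and g has only finitely many
    nonzero coefficients. *)
Lemma loc_ker c : J c%:P -> exists n, s ^+ n * c = 0.
Proof.
case/loc_idealP=> g e; exists (size g).
have h i : g`_i = - (s ^+ i * c).
  elim: i => [|i IH].
    move/(congr1 (fun p : {poly S} => p`_0)): e.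
    rewrite mulrBr mulr1 coefC eqxx coefB -scalerAr coefZ coefMX eqxx mulr0 sub0r => ->.
    by rewrite expr0 mul1r opprK.
  move/(congr1 (fun p : {poly S} => p`_i.+1)): e.
  rewrite mulrBr mulr1 coefC coefB -scalerAr coefZ coefMX /= IH => /esym/eqP.
  by rewrite subr_eq0 => /eqP <-; rewrite exprS mulrN mulrA.
by apply/eqP; rewrite -oppr_eq0 -h nth_default.
Qed.

Lemma loc_proper : ~ J 1.
Proof.
by move=> h; have [n] := @loc_ker 1 h; rewrite mulr1; apply/eqP.
Qed.

Let I := PIdeal (gen_ideal _ : idealP J) loc_proper.
Let iotaP : {rmorphism k -> {poly S}} := polyC \o iota.
Definition loc : comUnitAlgType k := qalg iotaP I.
Definition locmap : {rmorphism S -> loc} := qmap iotaP I \o polyC.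

Lemma loc_inv : locmap s * qmap iotaP I 'X = 1.
Proof.
rewrite -[locmap s]/(qmap iotaP I s%:P) -rmorphM -[1](rmorph1 (qmap iotaP I)); apply/qmapP.
by rewrite mul_polyC; apply: gen_sub.
Qed.

Lemma locmap_unit : locmap s \is a GRing.unit.
Proof. by apply/unitrPr; exists (qmap iotaP I 'X); apply: loc_inv. Qed.

Lemma locmap_alg c : locmap (iota c) = c%:A.
Proof. by rewrite -qmapE. Qed.

Lemma locmap_ker c : locmap c = 0 -> exists n, s ^+ n * c = 0.
Proof. by move/qmap0P; apply: loc_ker. Qed.

Lemma locmap_surj b : exists c n, locmap c = b * locmap s ^+ n.
Proof.
have [p <-] := qmap_surj b; pose q : {rmorphism {poly S} -> loc} := qmap iotaP I.
have qX : q s%:P * q 'X = 1 by apply: loc_inv.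
suff: exists c n, q c%:P = q p * q s%:P ^+ n by [].
elim/poly_ind: p => [|p c [d [n e]]].
  exists 0, 0%N; rewrite polyC0 (rmorph0 q) mul0r //.
exists (d + c * s ^+ n.+1), n.+1.
rewrite polyCD polyCM polyC_exp !rmorphD !rmorphM rmorphXn e exprS.
transitivity (q p * q s%:P ^+ n * (q s%:P * q 'X) + q c%:P * (q s%:P * q s%:P ^+ n)).
  by rewrite qX mulr1.
by rewrite mulrDl -!mulrA; congr (_ * _ + _); rewrite mulrCA mulrC -!mulrA mulrC mulrA.
Qed.

Lemma loc_hom B (f : {rmorphism S -> B}) : (forall c, f (iota c) = c%:A) ->
  f s \is a GRing.unit -> exists g : {lrmorphism loc -> B}, forall x, g (locmap x) = f x.
Proof.
move=> fc fs; pose F : {rmorphism {poly S} -> B} := horner_eval (f s)^-1 \o map_poly f.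
have FC c : F c%:P = f c by rewrite /= /horner_eval map_polyC hornerC.
have FX : F 'X = (f s)^-1 by rewrite /= /horner_eval map_polyX hornerX.
have [|x /loc_idealP [g ->]|g hg] := @quo_hom _ iotaP I B F.
- by move=> c; rewrite FC.
- by rewrite -mul_polyC (rmorphM F) (rmorphB F) (rmorphM F) FC FX (rmorph1 F) divrr // subrr mulr0.
- by exists g => x; rewrite hg FC.
Qed.

Lemma loc_ext B (f g : {lrmorphism loc -> B}) :
  (forall x, f (locmap x) = g (locmap x)) -> f =1 g.
Proof.
move=> h b; have [c [n e]] := locmap_surj b.
have u : locmap s ^+ n \is a GRing.unit by rewrite unitrX // locmap_unit.
apply: (mulIr (rmorph_unit f u)); transitivity (f (b * locmap s ^+ n)); first by rewrite rmorphM.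
rewrite -e; transitivity (g (locmap c)); first exact: h.
rewrite e rmorphM.
by congr (_ * _); rewrite !rmorphXn; congr (_ ^+ _); exact/esym/h.
Qed.
End Localization.

(** If a is not nilpotent, A[1/a] is nonzero and has a field point, at which a is invertible. *)
Lemma nil_field A (a : A) :
  (forall K (psi : {lrmorphism A -> K}), is_field K -> psi a = 0) -> exists n, a ^+ n = 0.
Proof.
move=> h; apply: contrapT => hn.
have an n : a ^+ n != 0 by apply/eqP=> e; apply: hn; exists n.
have [K [psi hK]] := field_points (loc (in_alg A) an).
have pB : zmod_morphism (psi \o locmap (in_alg A) an) by move=> x y; apply: rmorphB.
have pM : monoid_morphism (psi \o locmap (in_alg A) an).
  by split=> [|x y]; [apply: rmorph1 | apply: rmorphM].
have pZ c : (psi \o locmap (in_alg A) an) c%:A = c%:A.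
  transitivity (psi c%:A); last exact: hom_alg.
  exact: (congr1 psi (locmap_alg (in_alg A) an c)).
have e : psi (locmap (in_alg A) an a) = 0 by exact: (h K (mkhom pB pM pZ) hK).
have u : psi (locmap (in_alg A) an a) \is a GRing.unit.
  by apply: rmorph_unit; apply: locmap_unit.
by rewrite e unitr0 in u.
Qed.

Lemma loc_exists A (a : A) : (exists K (psi : {lrmorphism A -> K}), is_field K /\ psi a != 0) ->
  exists (B : comUnitAlgType k) (p : {lrmorphism A -> B}),
    [/\ is_localization a p,
        forall C (f : {lrmorphism A -> C}), f a \is a GRing.unit ->
          exists g : {lrmorphism B -> C}, forall a, g (p a) = f a
      & forall C (f g : {lrmorphism B -> C}), (forall a, f (p a) = g (p a)) -> f =1 g].
Proof.
move=> [K [psi [hK ha]]].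
have an n : a ^+ n != 0.
  apply/eqP=> /(congr1 psi); rewrite rmorphXn rmorph0; apply/eqP.
  exact: field_expf_neq0.
pose p0 := locmap (in_alg A) an.
have pB : zmod_morphism p0 by move=> x y; apply: rmorphB.
have pM : monoid_morphism p0 by split=> [|x y]; [apply: rmorph1 | apply: rmorphM].
have pZ c : p0 c%:A = c%:A by exact: (locmap_alg (in_alg A) an c).
exists (loc (in_alg A) an), (mkhom pB pM pZ); split.
- split; first exact: locmap_unit.
    exact: locmap_surj.
  exact: locmap_ker.
- move=> C f fa; have fc c : f (in_alg A c) = c%:A by exact: hom_alg.
  by have [g hg] := @loc_hom A (in_alg A) a an C f fc fa; exists g.
- exact: loc_ext.
Qed.

End Algebras.

(** * Noetherian rings and finitely generated subalgebras *)

Section Noetherian.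
Variable R : comNzRingType.

Definition spans (g : nat -> R) n x := exists h : 'I_n -> R, x = \sum_(i < n) h i * g i.

(** The ascending chain condition, phrased so that using it yields a linear relation; [noeth_fg] and
    [fg_noeth] link it to finite generation of ideals. *)
Definition noeth := forall g : nat -> R, exists n, spans g n (g n).

Definition fgI (I : R -> Prop) := exists m (r : 'I_m -> R),
  (forall j, I (r j)) /\ forall x, I x -> exists u : 'I_m -> R, x = \sum_j u j * r j.

Lemma spans_gen g n x : spans g n x <-> gen (fun y => exists j : 'I_n, y = g j) x.
Proof. by split=> h; apply/gen_finP. Qed.

Lemma spans_le g n m x : (n <= m)%N -> spans g n x -> spans g m x.
Proof.
move=> le /spans_gen h; apply/spans_gen; apply: gen_min h; first exact: gen_ideal.
by move=> _ [j ->]; apply: gen_sub; exists (widen_ord le j).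
Qed.

Lemma spans_ideal g n : idealP (spans g n).
Proof.
have := gen_ideal (fun y => exists j : 'I_n, y = g j); case=> h0 hD hM; split.
- exact/spans_gen.
- by move=> x y /spans_gen hx /spans_gen hy; apply/spans_gen; apply: hD.
- by move=> a x /spans_gen hx; apply/spans_gen; apply: hM.
Qed.

Lemma spans_eq g g' n x : (forall i, (i < n)%N -> g i = g' i) -> spans g n x -> spans g' n x.
Proof. by move=> e [h ->]; exists h; apply: eq_bigr => i _; rewrite e. Qed.

(** The greedy choice in Hilbert's basis theorem: each term has least measure among the elements of
    I outside the span of the previous terms. A constant measure gives the plain non-terminating
    sequence. *)
Lemma minimal_sequence (I : R -> Prop) (m : R -> nat) : ~ fgI I ->
  exists g : nat -> R, forall n, [/\ I (g n), ~ spans g n (g n)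
    & forall x, I x -> ~ spans g n x -> (m (g n) <= m x)%N].
Proof.
move=> nfg; pose sp (s : seq R) := spans (nth 0 s) (size s).
have next (s : {s : seq R | forall x, x \in s -> I x}) :
    exists x, [/\ I x, ~ sp (sval s) x & forall y, I y -> ~ sp (sval s) y -> (m x <= m y)%N].
  case: s => s hs /=.
  have [x0 Ix0 sx0] : exists2 x, I x & ~ sp s x.
    apply: contrapT => h; apply: nfg; exists (size s), (fun i => nth 0 s i); split.
      by move=> j; apply: hs; rewrite mem_nth.
    by move=> x Ix; apply: contrapT => sx; apply: h; exists x.
  have ex : exists n, `[< exists x, [/\ I x, ~ sp s x & m x = n] >].
    by exists (m x0); apply/asboolP; exists x0.
  case: (ex_minnP ex) => n /asboolP [x [Ix sx mx]] hn; exists x; split=> // y Iy sy.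
  by rewrite mx; apply: hn; apply/asboolP; exists y.
pose nx s := projT1 (cid (next s)).
have nxP s : [/\ I (nx s), ~ sp (sval s) (nx s)
    & forall y, I y -> ~ sp (sval s) y -> (m (nx s) <= m y)%N].
  by rewrite /nx; case: cid.
have hr (s : {s : seq R | forall x, x \in s -> I x}) x : x \in rcons (sval s) (nx s) -> I x.
  rewrite mem_rcons inE => /orP [/eqP->|]; first by case: (nxP s).
  exact: (svalP s).
pose step s : {s : seq R | forall x, x \in s -> I x} := exist _ _ (hr s).
have h0 x : x \in [::] -> I x by [].
pose F n := iter n step (exist (fun s : seq R => forall x, x \in s -> I x) [::] h0).
pose g n := nx (F n).
have sF n : size (sval (F n)) = n by elim: n => //= n IH; rewrite size_rcons IH.
have nF n i : (i < n)%N -> nth 0 (sval (F n)) i = g i.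
  elim: n => // n IH; rewrite ltnS leq_eqVlt /= nth_rcons sF => /orP [/eqP->|h].
    by rewrite ltnn eqxx.
  by rewrite h IH.
have spE n x : sp (sval (F n)) x <-> spans g n x.
  rewrite /sp sF; split; apply: spans_eq => i hi; rewrite nF //.
exists g => n; have [h1 h2 h3] := nxP (F n); split=> // [/spE //|x Ix nx'].
by apply: h3 => // /spE.
Qed.

Lemma noeth_fg (I : R -> Prop) : noeth -> fgI I.
Proof.
move=> hR; apply: contrapT => /(minimal_sequence (fun=> 0%N)) [g hg].
by have [n hn] := hR g; case: (hg n).
Qed.

Lemma fg_noeth : (forall I, idealP I -> fgI I) -> noeth.
Proof.
move=> h g; pose I x := exists n, spans g n x.
have hI : idealP I.
  split; first by exists 0%N; apply: idl0; apply: spans_ideal.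
    move=> x y [n hx] [m hy]; exists (maxn n m); apply: idlD; first exact: spans_ideal.
      exact: spans_le (leq_maxl _ _) hx.
    exact: spans_le (leq_maxr _ _) hy.
  by move=> a x [n hx]; exists n; apply: idlM hx; apply: spans_ideal.
have [m [r [rI rgen]]] := h I hI.
have [N hN] := choice rI; pose n := \max_j N j.
exists n; have Ign : I (g n).
  by exists n.+1; apply/spans_gen; apply: gen_sub; exists ord_max.
have [u ->] := rgen _ Ign; apply: idl_sum; first exact: spans_ideal.
move=> j _; apply: idlM; first exact: spans_ideal.
by apply: spans_le (hN j); apply: leq_bigmax.
Qed.
End Noetherian.

Lemma noeth_field (k : fieldType) : noeth k.
Proof.
move=> g; have [e|ne] := eqVneq (g 0%N) 0.
  by exists 0%N, (fun=> 0); rewrite big_ord0.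
by exists 1%N, (fun=> g 1%N / g 0%N); rewrite big_ord1 divfK.
Qed.

Lemma noeth_is_field (k : fieldType) (K : comUnitAlgType k) : is_field K -> noeth K.
Proof.
move=> hK g; have [e|ne] := eqVneq (g 0%N) 0.
  by exists 0%N, (fun=> 0); rewrite big_ord0.
by exists 1%N, (fun=> g 1%N / g 0%N); rewrite big_ord1 divrK //; apply: hK.
Qed.

Lemma noeth_im (R S : comNzRingType) (f : {rmorphism R -> S}) :
  (forall y, exists x, f x = y) -> noeth R -> noeth S.
Proof.
move=> fs hR g; have [g' hg'] := choice (fun n => fs (g n)).
have [n [h e]] := hR g'; exists n, (fun i => f (h i)).
by rewrite -hg' e rmorph_sum; apply: eq_bigr => i _; rewrite rmorphM hg'.
Qed.

(** Hilbert's basis theorem: a relation between leading coefficients of a greedy sequence, with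
    shifted exponents, lowers the degree of the last term and contradicts its minimality. *)
Lemma noeth_poly (R : comNzRingType) : noeth R -> noeth {poly R}.
Proof.
move=> hR; apply: fg_noeth => I hI; apply: contrapT.
move=> /(minimal_sequence (fun p : {poly R} => size p)) [f hf].
have [n [h e]] := hR (fun i => lead_coef (f i)).
have [fI fn fmin] := hf n.
have ssz i : (i <= n)%N -> (size (f i) <= size (f n))%N.
  move=> le; have [_ _] := hf i; apply=> // si; apply: fn.
  exact: spans_le le si.
have fn0 : f n != 0.
  by apply/eqP=> e0; apply: fn; rewrite e0; apply: idl0; apply: spans_ideal.
pose s := \sum_(i < n) (h i)%:P * 'X^(size (f n) - size (f i)) * f i.
have sS : spans f n s by exists (fun i => (h i)%:P * 'X^(size (f n) - size (f i))).
have Is : I s by apply: idl_sum => // i _; apply: idlM => //; case: (hf i).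
have nS : ~ spans f n (f n - s).
  move=> h1; apply: fn; rewrite -[f n](subrK s); apply: idlD => //; exact: spans_ideal.
have := fmin (f n - s) (idlB hI fI Is) nS; rewrite leqNgt => /negP; apply.
have sz0 : (0 < size (f n))%N by rewrite size_poly_gt0.
rewrite -(prednK sz0) ltnS; apply/leq_sizeP => j hj.
have si i : (h i)%:P * 'X^(size (f n) - size (f i)) * f i = h i *: ('X^(size (f n) - size (f i)) * f i).
  by rewrite -mulrA mul_polyC.
rewrite coefB; have [lt|] := ltnP (size (f n)).-1 j.
  rewrite nth_default ?coef_sum ?big1 ?subr0 //; last by rewrite -(prednK sz0).
  move=> i _; rewrite si coefZ coefXnM; case: ltnP => h1; first by rewrite mulr0.
  rewrite nth_default ?mulr0 //.
  have := ssz i (ltnW (ltn_ord i)); move: (size (f i)) (size (f n)) lt h1 sz0 => a b; lia.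
move=> hj2; have -> : j = (size (f n)).-1 by apply/eqP; rewrite eqn_leq hj hj2.
rewrite -lead_coefE e coef_sum -sumrB big1 // => i _.
rewrite si coefZ coefXnM; have := ssz i (ltnW (ltn_ord i)).
have [-> _|fi0 le] := eqVneq (f i) 0.
  by rewrite lead_coef0 coef0 mulr0 if_same mulr0 subrr.
have szi : (0 < size (f i))%N by rewrite size_poly_gt0.
have -> : ((size (f n)).-1 < size (f n) - size (f i))%N = false.
  by apply/negbTE; move: (size (f i)) (size (f n)) szi le sz0 => a b; lia.
have -> : ((size (f n)).-1 - (size (f n) - size (f i)) = (size (f i)).-1)%N.
  by move: (size (f i)) (size (f n)) szi le sz0 => a b; lia.
by rewrite -lead_coefE subrr.
Qed.

Lemma mpoly_closed_ind (R : comNzRingType) n (P : {mpoly R[n]} -> Prop) :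
  (forall c, P c%:MP) -> (forall i, P 'X_i) ->
  (forall p q, P p -> P q -> P (p + q)) -> (forall p q, P p -> P q -> P (p * q)) ->
  forall p, P p.
Proof.
move=> hC hX hD hM p; rewrite (mpolyE p); elim/big_rec: _ => [|m q _ hq].
  by rewrite -mpolyC0.
apply: hD hq; rewrite -mul_mpolyC; apply: (hM) => //.
rewrite mpolyXE_id; elim/big_rec: _ => [|i q' _ hq']; first by rewrite -mpolyC1.
apply: (hM) hq'; elim: (m i) => [|j IH]; first by rewrite expr0 -mpolyC1.
by rewrite exprS; apply: (hM).
Qed.

Lemma mmap_Xi (R S : comNzRingType) n (f : {rmorphism R -> S}) (h : 'I_n -> S) i :
  mmap f h 'X_i = h i.
Proof. by rewrite mmapX mmap1U. Qed.

Lemma mpoly_rmorph_ext (R S : comNzRingType) n (f g : {rmorphism {mpoly R[n]} -> S}) :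
  (forall c, f c%:MP = g c%:MP) -> (forall i, f 'X_i = g 'X_i) -> f =1 g.
Proof.
move=> hC hX; apply: mpoly_closed_ind => // p q hp hq.
  by rewrite !rmorphD hp hq.
by rewrite !rmorphM hp hq.
Qed.

Lemma noeth_mpoly (R : comNzRingType) n : noeth R -> noeth {mpoly R[n]}.
Proof.
move=> hR; elim: n => [|n IH].
  apply: (@noeth_im R _ (@mpolyC 0 R)) hR => p.
  elim/mpoly_closed_ind: p => [c|[]//|_ _ [c <-] [d <-]|_ _ [c <-] [d <-]].
  - by exists c.
  - by exists (c + d); rewrite rmorphD.
  - by exists (c * d); rewrite rmorphM.
pose g : {rmorphism {mpoly R[n]} -> {mpoly R[n.+1]}} :=
  mmap (@mpolyC n.+1 R) (fun i => 'X_(widen_ord (leqnSn n) i)).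
pose F : {rmorphism {poly {mpoly R[n]}} -> {mpoly R[n.+1]}} := horner_eval 'X_ord_max \o map_poly g.
apply: (@noeth_im _ _ F) (noeth_poly IH) => p.
elim/mpoly_closed_ind: p => [c|i|_ _ [c <-] [d <-]|_ _ [c <-] [d <-]].
- by exists (c%:MP)%:P; rewrite /= /horner_eval map_polyC hornerC /= mmapC.
- have [lt|ge] := ltnP i n.
    exists ('X_(Ordinal lt))%:P; rewrite /= /horner_eval map_polyC hornerC /= mmap_Xi.
    by congr 'X_(_); apply: val_inj.
  exists 'X; rewrite /= /horner_eval map_polyX hornerX; congr 'X_(_); apply: val_inj => /=.
  by apply/eqP; rewrite eqn_leq ge -ltnS ltn_ord.
- by exists (c + d); rewrite rmorphD.
- by exists (c * d); rewrite rmorphM.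
Qed.

Section Subalgebra.
Variables (k : comNzRingType) (S : comNzRingType) (iota : {rmorphism k -> S}) (l : seq S).

(* The subring generated over the image of iota by the entries of l. *)
Definition subalg x := exists G : {mpoly k[size l]}, mmap iota (fun i => nth 0 l i) G = x.

Lemma subalgC c : subalg (iota c). Proof. by exists c%:MP; rewrite mmapC. Qed.
Lemma subalg_mem x : x \in l -> subalg x.
Proof.
move=> hx; have lt : (index x l < size l)%N by rewrite index_mem.
by exists 'X_(Ordinal lt); rewrite mmap_Xi nth_index.
Qed.
Lemma subalgD x y : subalg x -> subalg y -> subalg (x + y).
Proof. by move=> [G <-] [H <-]; exists (G + H); rewrite rmorphD. Qed.
Lemma subalgM x y : subalg x -> subalg y -> subalg (x * y).
Proof. by move=> [G <-] [H <-]; exists (G * H); rewrite rmorphM. Qed.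
Lemma subalg0 : subalg 0. Proof. by rewrite -(rmorph0 iota); apply: subalgC. Qed.
Lemma subalg1 : subalg 1. Proof. by rewrite -(rmorph1 iota); apply: subalgC. Qed.
Lemma subalgX x n : subalg x -> subalg (x ^+ n).
Proof. by move=> h; elim: n => [|n IH]; rewrite ?expr0 ?exprS; [apply: subalg1|apply: subalgM]. Qed.
Lemma subalg_sum (T : Type) (r : seq T) (P : pred T) (F : T -> S) :
  (forall i, P i -> subalg (F i)) -> subalg (\sum_(i <- r | P i) F i).
Proof.
move=> hF; elim/big_rec: _ => [|i x Pi hx]; first exact: subalg0.
by apply: subalgD => //; apply: hF.
Qed.

Lemma subalg_ind (P : S -> Prop) : (forall c, P (iota c)) -> (forall x, x \in l -> P x) ->
  (forall x y, P x -> P y -> P (x + y)) -> (forall x y, P x -> P y -> P (x * y)) ->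
  forall x, subalg x -> P x.
Proof.
move=> hC hl hD hM _ [G <-].
elim/mpoly_closed_ind: G => [c|i|p q hp hq|p q hp hq].
- by rewrite mmapC; apply: hC.
- by rewrite mmap_Xi; apply: hl; rewrite mem_nth.
- by rewrite rmorphD; apply: hD.
- by rewrite rmorphM; apply: hM.
Qed.

(** Lifting to the polynomial ring on the generators gives noetherian relations inside a finitely
    generated subalgebra of a possibly huge ring S. *)
Lemma subalg_noeth (g : nat -> S) : noeth k -> (forall n, subalg (g n)) ->
  exists n (h : 'I_n -> S), (forall i, subalg (h i)) /\ g n = \sum_(i < n) h i * g i.
Proof.
move=> hk hg; have [G hG] := choice hg.
have [n [h e]] := noeth_mpoly hk G.
exists n, (fun i => mmap iota (fun i => nth 0 l i) (h i)); split; first by move=> i; exists (h i).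
by rewrite -hG e rmorph_sum; apply: eq_bigr => i _; rewrite rmorphM /= hG.
Qed.
End Subalgebra.

(** * Flatness of smooth algebras by iterated lifting *)

Lemma prodI_genP (R : comNzRingType) m (r : 'I_m -> R) x :
  let I := gen (fun y => exists j, y = r j) in
  prodI I I x -> exists v : 'I_m -> 'I_m -> R, x = \sum_i \sum_j v i j * (r i * r j).
Proof.
move=> I h; apply: (h (fun x => exists v : 'I_m -> 'I_m -> R, x = \sum_i \sum_j v i j * (r i * r j)))
  => [|_ [a [b [/gen_finP [u ->] /gen_finP [w ->] ->]]]].
  split; first by exists (fun _ _ => 0); rewrite big1 // => i _; rewrite big1 // => j _; rewrite mul0r.
    move=> _ _ [v ->] [w ->]; exists (fun i j => v i j + w i j); rewrite -big_split.
    by apply: eq_bigr => i _; rewrite -big_split; apply: eq_bigr => j _; rewrite mulrDl.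
  move=> a _ [v ->]; exists (fun i j => a * v i j); rewrite mulr_sumr.
  by apply: eq_bigr => i _; rewrite mulr_sumr; apply: eq_bigr => j _; rewrite mulrA.
exists (fun i j => u i * w j); rewrite mulr_suml; apply: eq_bigr => i _.
by rewrite mulr_sumr; apply: eq_bigr => j _; rewrite mulrACA.
Qed.

Section Smooth.
Variables (A : comNzRingType) (n m : nat) (r : 'I_m -> {mpoly A[n]}) (u : 'I_n -> {mpoly A[n]}).
Local Notation P := {mpoly A[n]}.

Definition presI : P -> Prop := gen (fun y => exists j, y = r j).
Definition shift : {rmorphism P -> P} := mmap (@mpolyC n A) (fun i => 'X_i + u i).

(* The identity of A[X]/(r) lifts to an A-algebra map A[X]/(r) -> A[X]/(r)^2. *)
Definition smooth_lift := (forall i, presI (u i)) /\ (forall j, prodI presI presI (shift (r j))).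

Lemma shiftC c : shift c%:MP = c%:MP. Proof. exact: mmapC. Qed.
Lemma shiftX i : shift 'X_i = 'X_i + u i. Proof. exact: mmap_Xi. Qed.

Hypothesis hs : smooth_lift.

Lemma shift_id p : presI (shift p - p).
Proof.
have hI : idealP presI := gen_ideal _.
elim/mpoly_closed_ind: p => [c|i|p q hp hq|p q hp hq].
- by rewrite shiftC subrr; exact: (idl0 hI).
- by rewrite shiftX addrAC subrr add0r; case: hs.
- by rewrite rmorphD opprD addrACA; apply: (idlD hI).
- rewrite rmorphM (_ : _ - _ = (shift p - p) * shift q + p * (shift q - q)); last by ring.
  by apply: (idlD hI) => //; [apply: (idlMr hI) | apply: (idlM hI)].
Qed.

Lemma iter_shift_id N p : presI (iter N shift p - p).
Proof.
elim: N => [|N IH] /=; first by rewrite subrr; exact: (idl0 (gen_ideal _)).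
rewrite -(subrK (iter N shift p) (shift _)) -addrA; apply: (idlD (gen_ideal _)) => //.
exact: shift_id.
Qed.

Section Flat.
Variables (k : comNzRingType) (iota : {rmorphism k -> A}).
Hypothesis noeth_k : noeth k.

Section Relation.
Variables (w0 : P).
Hypothesis w0I : presI w0.

Let vEx : exists v : 'I_m -> 'I_m -> 'I_m -> P,
  forall l, shift (r l) = \sum_i \sum_j v l i j * (r i * r j).
Proof.
have h l : exists v : 'I_m -> 'I_m -> P, shift (r l) = \sum_i \sum_j v i j * (r i * r j).
  by apply: prodI_genP; case: hs.
by have [v hv] := choice h; exists v.
Qed.

(* The Rees elements w_N s^(2^N) all lie in one finitely generated k-subalgebra of P[s]. *)
Lemma shift_recurrence : exists N (h : 'I_N -> P),
  (forall i, presI (h i)) /\ iter N shift w0 = \sum_(i < N) h i * iter i shift w0.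
Proof.
have hI : idealP presI := gen_ideal _.
have [v hv] := vEx; have [s hw0] := (iffLR (gen_finP _ _)) w0I.
(* The subalgebra S is generated over k by the variables, the Rees elements r_j s, and all
   coefficients in A of the polynomials in [ps]; these are exactly what is needed to make S stable
   under [sg]. *)
pose ps : seq P := codom u ++ codom s ++ codom (fun x : 'I_m * 'I_m * 'I_m => v x.1.1 x.1.2 x.2).
pose cst (c : A) : {poly P} := (c%:MP)%:P.
pose l : seq {poly P} := flatten [seq [seq cst p@_mo | mo <- msupp p] | p <- ps]
   ++ codom (fun i : 'I_n => ('X_i)%:P : {poly P}) ++ codom (fun j : 'I_m => (r j)%:P * 'X).
pose i0 : {rmorphism k -> {poly P}} := polyC \o (@mpolyC n A) \o iota.
pose S := subalg i0 l.
have SX i : S ('X_i)%:P.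
  by apply: subalg_mem; rewrite !mem_cat; apply/or3P/Or32; apply: (codom_f (fun i : 'I_n => ('X_i)%:P : {poly P})).
have Sr j : S ((r j)%:P * 'X).
  by apply: subalg_mem; rewrite !mem_cat; apply/or3P/Or33; apply: (codom_f (fun j : 'I_m => (r j)%:P * 'X)).
have Sps p : p \in ps -> S p%:P.
  move=> hp; rewrite (mpolyE p) rmorph_sum /=.
  rewrite big_seq_cond; apply: subalg_sum => mo; rewrite andbT => hmo.
  rewrite -mul_mpolyC polyCM; apply: subalgM.
    apply: subalg_mem; rewrite mem_cat; apply/orP; left; apply/flattenP.
    exists [seq cst p@_mo | mo <- msupp p].
      exact: (map_f (fun p : P => [seq cst p@_mo | mo <- msupp p]) hp).
    exact: (map_f (fun mo => cst p@_mo) hmo).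
  rewrite mpolyXE_id; elim/big_rec: _ => [|i q' _ hq']; first by rewrite polyC1; apply: subalg1.
  rewrite polyCM polyC_exp; apply: subalgM hq'; exact: subalgX (SX _).
have Su i : S (u i)%:P by apply: Sps; rewrite mem_cat; apply/orP; left; apply: codom_f.
have Ss i : S (s i)%:P by apply: Sps; rewrite !mem_cat; apply/or3P/Or32; apply: codom_f.
have Sv i j h : S (v i j h)%:P.
  apply: Sps; rewrite !mem_cat; apply/or3P/Or33.
  exact: (codom_f (fun x : 'I_m * 'I_m * 'I_m => v x.1.1 x.1.2 x.2) (i, j, h)).
(* [sg] shifts the coefficients and squares the Rees variable, so r_j s goes to a combination of
   products (r_i s)(r_h s). *)
pose sg : {rmorphism {poly P} -> {poly P}} := comp_poly 'X^2 \o map_poly shift.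
have sgC c : sg c%:P = (shift c)%:P by rewrite /= map_polyC comp_polyC.
have sgX : sg 'X = 'X^2 by rewrite /= map_polyX comp_polyX.
have Ssg x : S x -> S (sg x).
  apply: (@subalg_ind _ _ _ _ (fun x => S (sg x))) => [c|y|y z hy hz|y z hy hz].
  - by rewrite sgC /= shiftC; apply: subalgC.
  - rewrite !mem_cat => /or3P [/flattenP [_ /mapP [p hp ->] /mapP [mo hmo ->]]|/codomP [i ->]|/codomP [j ->]].
    + rewrite sgC shiftC; apply: subalg_mem; rewrite mem_cat; apply/orP; left; apply/flattenP.
      exists [seq cst p@_mo | mo <- msupp p].
      exact: (map_f (fun p : P => [seq cst p@_mo | mo <- msupp p]) hp).
    exact: (map_f (fun mo => cst p@_mo) hmo).
    + by rewrite sgC shiftX polyCD; exact: subalgD (SX i) (Su i).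
    + rewrite rmorphM sgC sgX hv rmorph_sum /= mulr_suml; apply: subalg_sum => i _.
      rewrite rmorph_sum /= mulr_suml; apply: subalg_sum => h _.
      rewrite !polyCM expr2 -mulrA mulrACA.
      by apply: (subalgM (Sv j i h)); exact: subalgM (Sr i) (Sr h).
  - by rewrite (rmorphD sg); exact: subalgD hy hz.
  - by rewrite (rmorphM sg); exact: subalgM hy hz.
pose w N := iter N shift w0.
pose W N : {poly P} := (w N)%:P * 'X^(2 ^ N).
have SW N : S (W N).
  elim: N => [|N IH].
    rewrite /W expn0 expr1 /w /= hw0 rmorph_sum mulr_suml /=; apply: subalg_sum => j _.
    by rewrite polyCM -mulrA; exact: subalgM (Ss j) (Sr j).
  have -> : W N.+1 = sg (W N); last exact: Ssg.
  by rewrite /W rmorphM sgC rmorphXn sgX -exprM expnS.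
(* On generators the only contribution in positive degree is r_j s, so coefficients of positive
   degree of elements of S lie in the ideal. *)
have coefI x : S x -> forall d, (0 < d)%N -> presI x`_d.
  apply: (@subalg_ind _ _ _ _ (fun x : {poly P} => forall d, (0 < d)%N -> presI x`_d)).
  - by move=> c [//|d] _; rewrite /= coefC; exact: (idl0 hI).
  - move=> y; rewrite !mem_cat => /or3P [/flattenP [_ /mapP [p hp ->] /mapP [mo hmo ->]]|/codomP [i ->]|/codomP [j ->]] [//|d] _.
    + by rewrite coefC; exact: (idl0 hI).
    + by rewrite coefC; exact: (idl0 hI).
    + rewrite coefCM coefX; case: (d.+1 == 1)%N; rewrite ?mulr1 ?mulr0; last exact: (idl0 hI).
      by apply: gen_sub; exists j.
  - by move=> y z hy hz d d0; rewrite coefD; apply: (idlD hI) => //; [apply: hy | apply: hz].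
  - move=> y z hy hz d d0; rewrite coefM; apply: (idl_sum hI) => // i _.
    have [/eqP i0'|i0'] := posnP (i : nat); last by apply: (idlMr hI) => //; apply: hy.
    by apply: (idlM hI) => //; apply: hz; rewrite (eqP i0') subn0.
have [N [h [hS e]]] := subalg_noeth noeth_k SW.
exists N, (fun i : 'I_N => (h i)`_(2 ^ N - 2 ^ i)); split.
  by move=> i; apply: coefI (hS i) _ _; rewrite subn_gt0 ltn_exp2l.
(* In degree 2^N the factor h_i contributes its coefficient of degree 2^N - 2^i > 0, which lies in
   the ideal. *)
have := congr1 (fun p : {poly P} => p`_(2 ^ N)) e.
rewrite /W coefMXn ltnn subnn coefC eqxx /w => ->; rewrite coef_sum; apply: eq_bigr => i _.
rewrite mulrA coefMXn ltnNge leq_exp2l // (ltnW (ltn_ord i)) /= mulrC coefCM mulrC.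
by rewrite mulrC.
Qed.
End Relation.

(** The shift is A-linear, so the operator shift^N - sum c_j shift^j from [shift_recurrence], which
    kills the sum of the p_i z_i, may be applied to each z_i separately. Since the c_j lie in the
    ideal, it does not change z_i modulo the ideal. *)
Lemma smooth_flat1 s (p : 'I_s -> A) (z : 'I_s -> P) :
  presI (\sum_i (p i)%:MP * z i) ->
  exists z' : 'I_s -> P, (forall i, presI (z i - z' i)) /\ \sum_i (p i)%:MP * z' i = 0.
Proof.
move=> h; have hI : idealP presI := gen_ideal _.
have [N [c [cI e]]] := shift_recurrence h.
exists (fun i => iter N shift (z i) - \sum_(j < N) c j * iter j shift (z i)); split.
  move=> i; rewrite opprB addrCA; apply: (idlD hI) => //.
    by apply: (idl_sum hI) => // j _; apply: (idlMr hI).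
  by rewrite -opprB; apply: (idlN hI) => //; apply: iter_shift_id.
have hw j : iter j shift (\sum_i (p i)%:MP * z i) = \sum_i (p i)%:MP * iter j shift (z i).
  elim: j => //= j ->; rewrite rmorph_sum; apply: eq_bigr => i _.
  by rewrite rmorphM shiftC.
under eq_bigr do rewrite mulrBr.
rewrite sumrB -hw e.
under [X in _ - X]eq_bigr do rewrite mulr_sumr.
rewrite exchange_big /= -sumrB big1 // => j _.
rewrite hw mulr_sumr -sumrB big1 // => i _; ring.
Qed.

(** The equational criterion of flatness for A[X]/I. Equations are added one at a time; the exact
    relation supplied by [smooth_flat1] is split into its coefficients at each monomial, which give
    the new solutions over A. *)
Lemma smooth_flat t s (M : nat -> 'I_s -> A) (z : 'I_s -> P) :
  (forall a, (a < t)%N -> presI (\sum_i (M a i)%:MP * z i)) ->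
  exists (T : finType) (b : T -> 'I_s -> A) (c : T -> P),
    (forall x a, (a < t)%N -> \sum_i M a i * b x i = 0) /\
    (forall i, presI (z i - \sum_x c x * (b x i)%:MP)).
Proof.
have hI : idealP presI := gen_ideal _.
elim: t => [|t IH] h.
  exists 'I_s, (fun x i => (x == i)%:R), z; split=> // i.
  rewrite (bigD1 i) //= eqxx mpolyC1 mulr1 big1 ?addr0 ?subrr; first exact: (idl0 hI).
  by move=> j /negPf->; rewrite mpolyC0 mulr0.
have [|T [b [c [hb hz]]]] := IH; first by move=> a lt; apply: h; apply: ltnW.
pose p x := \sum_i M t i * b x i.
have e1 : presI (\sum_x (p x)%:MP * c x).
  have := h t (ltnSn t).
  have -> : \sum_x (p x)%:MP * c x = \sum_i (M t i)%:MP * z i -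
      \sum_i (M t i)%:MP * (z i - \sum_x c x * (b x i)%:MP).
    rewrite -sumrB; under [RHS]eq_bigr do rewrite mulrBr opprB addrC subrK mulr_sumr.
    rewrite exchange_big; apply: eq_bigr => x _; rewrite /p rmorph_sum mulr_suml.
    by apply: eq_bigr => i _; rewrite rmorphM /= mulrAC mulrA.
  by move=> h1; apply: (idlB hI) => //; apply: (idl_sum hI) => // i _; apply: (idlM hI).
pose p' (j : 'I_#|T|) := p (enum_val j); pose c' (j : 'I_#|T|) := c (enum_val j).
have [|c1 [c1I c1e]] := @smooth_flat1 _ p' c'.
  by move: e1; rewrite (reindex (@enum_val T predT)) //; apply: onW_bij; apply: enum_val_bij.
pose D := (\max_j msize (c1 j))%N.
have hD j : (msize (c1 j) <= D)%N by apply: leq_bigmax.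
exists ('X_{1..n < D} : finType), (fun (mo : 'X_{1..n < D}) i => \sum_j (c1 j)@_mo * b (enum_val j) i),
  (fun mo : 'X_{1..n < D} => 'X_[mo]).
split=> [mo a|i].
  rewrite ltnS leq_eqVlt => /orP [/eqP ->|lt].
    have := congr1 (fun p => p@_mo) c1e; rewrite raddf_sum mcoeff0 /= => e2.
    rewrite -[RHS]e2; under eq_bigr do rewrite mulr_sumr.
    rewrite exchange_big; apply: eq_bigr => j _; rewrite mcoeffCM /p' /p mulr_suml.
    by apply: eq_bigr => i _; ring.
  under eq_bigr do rewrite mulr_sumr.
  rewrite exchange_big big1 // => j _.
  under eq_bigr do rewrite mulrCA.
  by rewrite -mulr_sumr hb // mulr0.
rewrite -(subrK (\sum_x c x * (b x i)%:MP) (z i)) -addrA; apply: (idlD hI) => //.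
have -> : \sum_x c x * (b x i)%:MP = \sum_j c' j * (b (enum_val j) i)%:MP.
  by rewrite (reindex (@enum_val T predT)) //; apply: onW_bij; apply: enum_val_bij.
rewrite (_ : \sum_(mo : 'X_{1..n < D}) _ = \sum_j c1 j * (b (enum_val j) i)%:MP).
  by rewrite -sumrB; apply: (idl_sum hI) => // j _; rewrite -mulrBl; apply: (idlMr hI).
under eq_bigr do rewrite rmorph_sum mulr_sumr.
rewrite exchange_big; apply: eq_bigr => j _ /=.
rewrite [in RHS](mpolywE (hD j)) mulr_suml; apply: eq_bigr => mo _.
by rewrite rmorphM /= -mul_mpolyC; ring.
Qed.
End Flat.
End Smooth.

Section BaseChange.
Variables (A C : comNzRingType) (f : {rmorphism A -> C}) (n m : nat).
Variables (r : 'I_m -> {mpoly A[n]}) (u : 'I_n -> {mpoly A[n]}).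
Local Notation fm := (map_mpoly f : {rmorphism {mpoly A[n]} -> {mpoly C[n]}}).

Lemma map_mpolyCE c : fm c%:MP = (f c)%:MP. Proof. exact: map_mpolyC. Qed.
Lemma map_mpolyXiE i : fm 'X_i = 'X_i. Proof. exact: map_mpolyX. Qed.

Lemma presI_map p : presI r p -> presI (fun j => fm (r j)) (fm p).
Proof.
have hI : idealP (presI (fun j => fm (r j))) := gen_ideal _.
move=> h; apply: (h (fun p => presI (fun j => fm (r j)) (fm p))) => [|_ [j ->]]; last first.
  by apply: gen_sub; exists j.
split=> [|x y hx hy|a x hx]; first by rewrite rmorph0; apply: (idl0 hI).
  by rewrite rmorphD; apply: (idlD hI).
by rewrite rmorphM; apply: (idlM hI).
Qed.

Lemma prodI_map p : prodI (presI r) (presI r) p ->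
  prodI (presI (fun j => fm (r j))) (presI (fun j => fm (r j))) (fm p).
Proof.
set J := presI (fun j => fm (r j)); have hI := prodI_ideal J J.
move=> h; apply: (h (fun p => prodI J J (fm p))) => [|_ [x [y [hx hy ->]]]]; last first.
  by rewrite rmorphM; apply: prodI_mul; apply: presI_map.
split=> [|x y hx hy|a x hx]; first by rewrite rmorph0; apply: (idl0 hI).
  by rewrite rmorphD; apply: (idlD hI).
by rewrite rmorphM; apply: (idlM hI).
Qed.

Lemma shift_map p : shift (fun i => fm (u i)) (fm p) = fm (shift u p).
Proof.
pose F : {rmorphism {mpoly A[n]} -> {mpoly C[n]}} := shift (fun i => fm (u i)) \o fm.
pose G : {rmorphism {mpoly A[n]} -> {mpoly C[n]}} := fm \o shift u.
suff : F =1 G by apply.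
apply: mpoly_rmorph_ext => [c|i] /=.
  by rewrite map_mpolyCE !shiftC map_mpolyCE.
by rewrite map_mpolyXiE !shiftX rmorphD /= map_mpolyXiE.
Qed.

Lemma smooth_lift_map : smooth_lift r u -> smooth_lift (fun j => fm (r j)) (fun i => fm (u i)).
Proof.
move=> [hu hr]; split=> [i|j]; first exact: presI_map.
by rewrite shift_map; apply: prodI_map.
Qed.
End BaseChange.

(** * Faithfully flat covers and etale descent *)

Section Cover.
Variable k : fieldType.
Implicit Types A B C D K : comUnitAlgType k.

(** Surjectivity on spectra, stated on the presentation so that it passes to every base change by
    [point_lift_map]. *)
Definition point_lift A n m (r : 'I_m -> {mpoly A[n]}) :=
  forall K (psi : {lrmorphism A -> K}), is_field K ->
    exists K' (iota : {lrmorphism K -> K'}) (y : 'I_n -> K'),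
      is_field K' /\ forall j, mmap (iota \o psi) y (r j) = 0.

Lemma mmap_map_mpoly (A C E : comNzRingType) (f : {rmorphism A -> C}) (g : {rmorphism C -> E})
    n (y : 'I_n -> E) p : mmap g y (map_mpoly f p) = mmap (g \o f) y p.
Proof.
pose F : {rmorphism {mpoly A[n]} -> E} := mmap g y \o map_mpoly f.
pose G : {rmorphism {mpoly A[n]} -> E} := mmap (g \o f) y.
suff : F =1 G by apply.
apply: mpoly_rmorph_ext => [c|i] /=.
  by rewrite map_mpolyC !mmapC.
by rewrite (map_mpolyX f) !mmap_Xi.
Qed.

Lemma point_lift_map A C (f : {lrmorphism A -> C}) n m (r : 'I_m -> {mpoly A[n]}) :
  point_lift r -> point_lift (fun j => map_mpoly f (r j)).
Proof.
move=> h K psi hK; have [K' [iota [y [hK' hy]]]] := h K (psi \o f) hK.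
exists K', iota, y; split=> // j; rewrite (mmap_map_mpoly f (iota \o psi)).
exact: (hy j).
Qed.

Lemma presI_mmap (A E : comNzRingType) n m (r : 'I_m -> {mpoly A[n]}) (f : {rmorphism A -> E})
    (y : 'I_n -> E) p : (forall j, mmap f y (r j) = 0) -> presI r p -> mmap f y p = 0.
Proof.
move=> hr h; apply: (h (fun p => mmap f y p = 0)) => [|_ [j ->] //].
split=> [|x z hx hz|a x hx]; first by rewrite rmorph0.
  by rewrite rmorphD /= hx hz addr0.
by rewrite rmorphM /= hx mulr0.
Qed.

(** By flatness the relation a 1 = 0 modulo I comes from some z congruent to 1 with a z = 0. Over
    each field point z has a nonzero coefficient, since it takes the value 1 at a lifted point;
    these coefficients kill a, so a is locally 0. *)
Lemma cover_inj A n m (r : 'I_m -> {mpoly A[n]}) u (a : A) :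
  smooth_lift r u -> point_lift r -> presI r a%:MP -> a = 0.
Proof.
move=> hs hl h.
have [|z [hz e]] := @smooth_flat1 A n m r u hs k (in_alg A) (@noeth_field k) 1 (fun=> a) (fun=> 1).
  by rewrite big_ord1 mulr1.
rewrite big_ord1 in e; apply: eq0_local => K psi hK.
have [K' [iota [y [hK' hy]]]] := hl K psi hK.
apply: contrapT => hn.
have z0 : mmap (iota \o psi) y (z ord0) = 0.
  rewrite (mpolyE (z ord0)) rmorph_sum big1 // => mo _.
  rewrite -mul_mpolyC rmorphM /= mmapC /=.
  have -> : psi (z ord0)@_mo = 0; last by rewrite rmorph0 mul0r.
  apply: contrapT => /eqP h0; apply: hn; exists (z ord0)@_mo; split=> //.
  by have := congr1 (mcoeff mo) e; rewrite mcoeffCM mcoeff0 mulrC.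
have := presI_mmap hy (hz ord0); rewrite rmorphB /= z0 subr0 rmorph1 => /eqP.
by rewrite oner_eq0.
Qed.

Section Pres.
Variables (A B : comUnitAlgType k) (phi : {lrmorphism A -> B}).
Variables (n m : nat) (b : 'I_n -> B) (r : 'I_m -> {mpoly A[n]}) (u : 'I_n -> {mpoly A[n]}).
Hypothesis psurj : forall c : B, exists P : {mpoly A[n]}, mmap phi b P = c.
Hypothesis pker : forall P : {mpoly A[n]}, mmap phi b P = 0 <-> presI r P.

Lemma pres_hom D (f : {rmorphism {mpoly A[n]} -> D}) :
  (forall c : k, f (c%:A)%:MP = c%:A) -> (forall j, f (r j) = 0) ->
  exists g : {lrmorphism B -> D}, forall P, g (mmap phi b P) = f P.
Proof.
move=> fc fr; have [lift hlift] := choice psurj.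
have fI P : presI r P -> f P = 0.
  move=> h; apply: (h (fun P => f P = 0)) => [|_ [j ->] //].
  split=> [|x z hx hz|a x hx]; first by rewrite rmorph0.
    by rewrite rmorphD /= hx hz addr0.
  by rewrite rmorphM /= hx mulr0.
pose g c := f (lift c).
have gE P : g (mmap phi b P) = f P.
  apply/eqP; rewrite /g -subr_eq0 -rmorphB; apply/eqP/fI/pker.
  by rewrite rmorphB /= hlift subrr.
have gB : zmod_morphism g.
  move=> x y; have [P <-] := psurj x; have [Q <-] := psurj y.
  by rewrite -(rmorphB (mmap phi b)) !gE rmorphB.
have gM : monoid_morphism g.
  split=> [|x y]; first by rewrite -(rmorph1 (mmap phi b)) gE rmorph1.
  have [P <-] := psurj x; have [Q <-] := psurj y.
  by rewrite -(rmorphM (mmap phi b)) !gE rmorphM.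
have gZ c : g c%:A = c%:A.
  have <- : mmap phi b (c%:A)%:MP = c%:A by transitivity (phi c%:A); [exact: mmapC | exact: hom_alg].
  by rewrite gE fc.
by exists (mkhom gB gM gZ) => P; rewrite mkhomE gE.
Qed.

Hypothesis hs : smooth_lift r u.
Hypothesis hl : point_lift r.

(* The pushout of phi along psi; faithful flatness makes C -> C (x) B injective. *)
Lemma pushout_exists C (psi : {lrmorphism A -> C}) :
  exists D (g : {lrmorphism C -> D}) (d : {lrmorphism B -> D}),
  [/\ forall a, g (psi a) = d (phi a), injective g,
      forall y, exists Q : {mpoly C[n]}, mmap g (d \o b) Q = y
    & forall (Q : {mpoly C[n]}), mmap g (d \o b) Q = 0 -> presI (fun j => map_mpoly psi (r j)) Q].
Proof.
pose rC j := map_mpoly psi (r j); pose I := presI rC.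
have hI : idealP I := gen_ideal _.
have hsC := smooth_lift_map psi hs; have hlC := point_lift_map psi hl.
have Cinj c : I c%:MP -> c = 0 := @cover_inj C n m rC _ c hsC hlC.
have I1 : ~ I 1 by rewrite -mpolyC1 => /Cinj/eqP; rewrite oner_eq0.
pose J := PIdeal hI I1; pose i : {rmorphism k -> {mpoly C[n]}} := @mpolyC n C \o in_alg C.
pose q : {rmorphism {mpoly C[n]} -> qalg i J} := qmap i J.
pose g0 (c : C) := q c%:MP.
have gB : zmod_morphism g0 by move=> x y; rewrite /g0 rmorphB rmorphB.
have gM : monoid_morphism g0.
  by split=> [|x y]; rewrite /g0 ?rmorph1 ?rmorphM //= ?rmorphM.
have gZ c : g0 c%:A = c%:A by exact: (qmapE i J c).
pose g := mkhom gB gM gZ.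
pose f : {rmorphism {mpoly A[n]} -> qalg i J} := q \o map_mpoly psi.
have fc c : f (c%:A)%:MP = c%:A.
  transitivity (g0 (psi c%:A)); first by rewrite /f /= map_mpolyC.
  by rewrite hom_alg; apply: gZ.
have fr j : f (r j) = 0 by apply/qmap0P; apply: gen_sub; exists j.
have [d hd] := pres_hom fc fr.
have qE Q : mmap g (d \o b) Q = q Q.
  pose F : {rmorphism {mpoly C[n]} -> qalg i J} := mmap g (d \o b).
  suff : F =1 q by apply.
  apply: mpoly_rmorph_ext => [c|j]; first by rewrite /F /= mmapC.
  transitivity (d (b j)); first exact: mmap_Xi.
  have <- : mmap phi b 'X_j = b j by exact: mmap_Xi.
  by rewrite hd /f /= (map_mpolyX psi).
exists (qalg i J), g, d; split=> [a|x y e|y|Q].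
- have <- : mmap phi b a%:MP = phi a by exact: mmapC.
  by rewrite hd /f /= map_mpolyC.
- apply/eqP; rewrite -subr_eq0; apply/eqP/Cinj/(@qmap0P _ _ i J).
  by rewrite rmorphB; apply/eqP; rewrite (rmorphB q) subr_eq0; apply/eqP.
- by have [Q hQ] := qmap_surj y; exists Q; rewrite qE.
- by rewrite qE => /qmap0P.
Qed.

(** A polynomial relation is a finite linear system, one equation per monomial of bounded degree, to
    which [smooth_flat] applies. *)
Lemma cover_flat (T : finType) (p : T -> {mpoly A[n]}) (z : T -> B) :
  \sum_x (z x)%:MP * map_mpoly phi (p x) = 0 ->
  exists (S : finType) (c : S -> B) (w : S -> T -> A),
    (forall s, \sum_x (w s x)%:MP * p x = 0) /\ (forall x, z x = \sum_s c s * phi (w s x)).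
Proof.
move=> h; pose D := (\max_x msize (p x))%N.
have hD x : (msize (p x) <= D)%N by apply: leq_bigmax.
have [Z hZ] := choice (fun x => psurj (z x)).
pose ms := enum ('X_{1..n < D} : finType).
pose ms2 : seq 'X_{1..n} := [seq bmnm mo | mo : 'X_{1..n < D} <- ms].
pose M a (i : 'I_#|T|) := (p (enum_val i))@_(nth 0%MM ms2 a).
have [a lt|S [w [c [hw hc]]]] := @smooth_flat A n m r u hs k (in_alg A) (@noeth_field k)
    (size ms) #|T| M (fun i => Z (enum_val i)).
  apply/pker; rewrite rmorph_sum /=.
  have := congr1 (mcoeff (nth 0%MM ms2 a)) h.
  rewrite raddf_sum mcoeff0 /= => e; rewrite -[RHS]e.
  rewrite [RHS](reindex (@enum_val T predT)) /=; last by apply: onW_bij; apply: enum_val_bij.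
  apply: eq_bigr => i _; rewrite rmorphM /= mmapC hZ mcoeffCM mulrC; congr (_ * _).
  by rewrite mcoeff_map_mpoly.
exists S, (fun s => mmap phi b (c s)), (fun s x => w s (enum_rank x)); split=> [s|x].
  apply/mpolyP => mo; rewrite mcoeff0 raddf_sum /=.
  have [lt|ge] := ltnP (mdeg mo) D; last first.
    rewrite big1 // => x _; rewrite mcoeffCM memN_msupp_eq0 ?mulr0 //.
    by apply: contraTN isT => /msize_mdeg_lt; rewrite ltnNge (leq_trans (hD x)).
  have [a lta ea] : exists2 a, (a < size ms)%N & mo = nth 0%MM ms2 a.
    have mem : BMultinom lt \in ms by rewrite mem_enum.
    exists (index (BMultinom lt) ms); first by rewrite index_mem.
    by rewrite (nth_map (BMultinom lt)) ?index_mem // nth_index.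
  rewrite -[RHS](hw s a lta) (reindex (@enum_val T predT)) /=; last by apply: onW_bij; apply: enum_val_bij.
  by apply: eq_bigr => i _; rewrite mcoeffCM enum_valK /M -ea mulrC.
rewrite -hZ; have /pker := hc (enum_rank x); rewrite enum_rankK rmorphB /= => /eqP.
rewrite subr_eq0 => /eqP ->; rewrite rmorph_sum /=; apply: eq_bigr => s _.
by rewrite rmorphM /= mmapC.
Qed.

(** A field point of A killing all the w_s would lift to a field point of B at which 1 = 0. *)
Lemma cover_faithful (S : finType) (c : S -> B) (w : S -> A) :
  \sum_s c s * phi (w s) = 1 -> exists d : S -> A, \sum_s d s * w s = 1.
Proof.
move=> h.
have : gen (fun y => exists j : 'I_#|S|, y = w (enum_val j)) 1.
  apply: (ideal1_field (gen_ideal _)) => K psi hK.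
  have [K' [iota [y [hK' hy]]]] := hl psi hK.
  pose f : {rmorphism {mpoly A[n]} -> K'} := mmap (iota \o psi) y.
  have fc c0 : f (c0%:A)%:MP = c0%:A by rewrite /f /= mmapC /= !hom_alg.
  have [g hg] := pres_hom fc hy.
  apply: contrapT => hn.
  have : g 1 = 0.
    rewrite -h rmorph_sum big1 // => s _; rewrite rmorphM /=.
    have <- : mmap phi b (w s)%:MP = phi (w s) by exact: mmapC.
    rewrite hg /f /= mmapC /=.
    have -> : psi (w s) = 0; last by rewrite rmorph0 mulr0.
    apply: contrapT => /eqP h0; apply: hn; exists (w s); split=> //.
    by apply: gen_sub; exists (enum_rank s); rewrite enum_rankK.
  by rewrite rmorph1 => /eqP; rewrite oner_eq0.
case/gen_finP => v e; exists (fun s => v (enum_rank s)).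
rewrite e (reindex (@enum_val S predT)) /=; last by apply: onW_bij; apply: enum_val_bij.
by apply: eq_bigr => i _; rewrite enum_valK.
Qed.
End Pres.
End Cover.

Section Etale.
Variable k : fieldType.
Implicit Types A B C D K : comUnitAlgType k.

Definition etale_data A B (phi : {lrmorphism A -> B}) n m (b : 'I_n -> B)
    (r : 'I_m -> {mpoly A[n]}) u :=
  [/\ forall c : B, exists P : {mpoly A[n]}, mmap phi b P = c,
      forall P : {mpoly A[n]}, mmap phi b P = 0 <-> presI r P,
      smooth_lift r u & point_lift r].

(** Formal etaleness is applied to the thickening A[X]/I^2 of B = A[X]/I: the lift of the identity
    gives the substitution [u] of [smooth_lift]. *)
Lemma etale_presentation A B (phi : {lrmorphism A -> B}) : etale_cover phi ->
  exists n m (b : 'I_n -> B) (r : 'I_m -> {mpoly A[n]}) u, etale_data phi b r u.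
Proof.
case=> [[n [b [m [r [psurj pker0]]]]] fe ss].
have pker P : mmap phi b P = 0 <-> presI r P.
  by rewrite pker0; split=> h; apply/gen_finP.
have hI : idealP (presI r) := gen_ideal _.
pose I2 := prodI (presI r) (presI r).
have I21 : ~ I2 1.
  move=> /(prodI_subl hI) /pker; rewrite rmorph1 => /eqP; by rewrite oner_eq0.
pose J := PIdeal (prodI_ideal _ _ : idealP I2) I21.
pose i : {rmorphism k -> {mpoly A[n]}} := @mpolyC n A \o in_alg A.
pose q : {rmorphism {mpoly A[n]} -> qalg i J} := qmap i J.
pose f : {rmorphism {mpoly A[n]} -> B} := mmap phi b.
have fi c : f (i c) = c%:A.
  by transitivity (phi c%:A); [exact: mmapC | exact: hom_alg].
have fJ x : imem J x -> f x = 0 by move=> /(prodI_subl hI) /pker.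
have [th hth] := quo_hom fi fJ.
pose a0 (a : A) := q a%:MP.
have aB : zmod_morphism a0 by move=> x y; rewrite /a0 rmorphB rmorphB.
have aM : monoid_morphism a0 by split=> [|x y]; rewrite /a0 ?rmorph1 ?rmorphM //= ?rmorphM.
have aZ c : a0 c%:A = c%:A by exact: (qmapE i J c).
pose al := mkhom aB aM aZ.
have thq x : th (q x) = f x by exact: hth.
have sq : square_zero_thickening th.
  split=> [c|x y]; first by have [P hP] := psurj c; exists (q P); rewrite thq.
  have [P <-] := qmap_surj x; have [Q <-] := qmap_surj y.
  rewrite -[qmap i J P]/(q P) -[qmap i J Q]/(q Q) !thq => /pker hP /pker hQ.
  by rewrite -rmorphM; apply/qmap0P; apply: prodI_mul.
have he a : th (al a) = (idfun : {lrmorphism B -> B}) (phi a).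
  by rewrite /al mkhomE /a0 thq; exact: mmapC.
have [ga [[ga1 ga2] _]] := fe _ _ th sq al idfun he.
have [Y hY] := choice (fun j => qmap_surj (ga (b j))).
exists n, m, b, r, (fun j => Y j - 'X_j); split=> //; last first.
  move=> K psi hK; have [K' [io [chi [hK' hchi]]]] := ss K psi hK.
  exists K', io, (chi \o b); split=> // j.
  have <- : chi (mmap phi b (r j)) = mmap (io \o psi) (chi \o b) (r j).
    pose F : {rmorphism {mpoly A[n]} -> K'} := chi \o mmap phi b.
    pose G : {rmorphism {mpoly A[n]} -> K'} := mmap (io \o psi) (chi \o b).
    suff : F =1 G by apply.
    by apply: mpoly_rmorph_ext => [c|l]; rewrite /F /G /= ?mmapC ?mmap_Xi //= hchi.
  have -> : mmap phi b (r j) = 0 by apply/pker; apply: gen_sub; exists j.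
  by rewrite rmorph0.
split=> [j|j].
  apply/pker; rewrite rmorphB /=; apply/eqP; rewrite subr_eq0; apply/eqP.
  transitivity (th (q (Y j))); first by rewrite thq.
  by rewrite [q _](hY j) ga2 /= mmap_Xi.
suff h P : q (shift (fun j => Y j - 'X_j) P) = ga (f P).
  apply/(@qmap0P _ _ i J); rewrite -[qmap i J _]/(q _) h.
  have -> : f (r j) = 0 by apply/pker; apply: gen_sub; exists j.
  by rewrite rmorph0.
pose F : {rmorphism {mpoly A[n]} -> qalg i J} := q \o shift (fun j => Y j - 'X_j).
pose G : {rmorphism {mpoly A[n]} -> qalg i J} := ga \o f.
suff : F =1 G by apply.
apply: mpoly_rmorph_ext => [c|l].
  rewrite /F /G /= shiftC mmapC; exact/esym/ga1.
by rewrite /F /G /= shiftX mmap_Xi addrC subrK; apply: hY.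
Qed.

Lemma etale_pushout A B C (phi : {lrmorphism A -> B}) (psi : {lrmorphism A -> C}) :
  etale_cover phi -> exists D (g : {lrmorphism C -> D}) (d : {lrmorphism B -> D}),
    (forall a, g (psi a) = d (phi a)) /\ injective g.
Proof.
move=> /etale_presentation [n [m [b [r [u [h1 h2 h3 h4]]]]]].
by have [D [g [d [e1 e2 _ _]]]] := pushout_exists h1 h2 h3 h4 psi; exists D, g, d.
Qed.

Lemma presI_exp A n m (r : 'I_m -> {mpoly A[n]}) P : presI r P ->
  exists V : 'I_m -> {mpoly A[n]}, P = \sum_j V j * r j.
Proof. by case/gen_finP => V ->; exists V. Qed.

Lemma mpoly_expand (R : comNzRingType) n (D : nat) (V Q : {mpoly R[n]}) : (msize V <= D)%N ->
  V * Q = \sum_(mo : 'X_{1..n < D}) (V@_mo)%:MP * ('X_[mo] * Q).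
Proof.
move=> hD; rewrite {1}(mpolywE hD) mulr_suml; apply: eq_bigr => mo _.
by rewrite -mul_mpolyC mulrA.
Qed.

(* A relation z = sum V_l f_l over B[X] between polynomials f_l defined over A. *)
Lemma cover_relation A B (phi : {lrmorphism A -> B}) n m (b : 'I_n -> B)
    (r : 'I_m -> {mpoly A[n]}) u (T L : finType) (p : T -> {mpoly A[n]}) (z : T -> B)
    (f : L -> {mpoly A[n]}) (V : L -> {mpoly B[n]}) :
  etale_data phi b r u ->
  \sum_x (z x)%:MP * map_mpoly phi (p x) = \sum_l V l * map_mpoly phi (f l) ->
  exists (S : finType) (c : S -> B) (w : S -> T -> A) (W : S -> L -> {mpoly A[n]}),
    (forall s, \sum_x (w s x)%:MP * p x = \sum_l W s l * f l) /\
    (forall x, z x = \sum_s c s * phi (w s x)).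
Proof.
move=> [h1 h2 h3 h4] e; pose D := (\max_l msize (V l))%N.
have hD l : (msize (V l) <= D)%N by apply: leq_bigmax.
pose T' := (T + L * 'X_{1..n < D})%type.
pose p' (x : T') := match x with inl t => p t | inr y => 'X_[y.2] * f y.1 end.
pose z' (x : T') := match x with inl t => z t | inr y => - (V y.1)@_y.2 end.
have [|S [c [w [hw hz]]]] := cover_flat h1 h2 h3 (p := p') (z := z').
  rewrite big_sumType /= e; apply/eqP; rewrite addrC addr_eq0 -sumrN; apply/eqP.
  rewrite -(pair_bigA _ (fun l (mo : 'X_{1..n < D}) =>
     (- (V l)@_mo)%:MP * map_mpoly phi ('X_[mo] * f l))) /=.
  apply: eq_bigr => l _; rewrite (mpoly_expand _ (hD l)) -sumrN; apply: eq_bigr => mo _.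
  by rewrite mpolyCN mulNr rmorphM /= (map_mpolyX phi).
exists S, c, (fun s t => w s (inl t)), (fun s l => - \sum_(mo : 'X_{1..n < D}) (w s (inr (l, mo)))%:MP * 'X_[mo]).
split=> [s|x]; last exact: hz (inl x).
have := hw s; rewrite big_sumType /= => /eqP; rewrite addr_eq0 => /eqP ->.
rewrite (_ : \sum_i _ = \sum_l \sum_(mo : 'X_{1..n < D}) (w s (inr (l, mo)))%:MP * ('X_[mo] * f l)).
  2: by rewrite pair_bigA; apply: eq_bigr => -[].
rewrite -sumrN; apply: eq_bigr => l _.
rewrite mulNr mulr_suml; congr (- _); apply: eq_bigr => mo _; exact: mulrA.
Qed.

(** Write c as the value of a polynomial P. Equality of the two pullbacks puts P - c in the ideal of
    the relations over B. By flatness this is a B-combination of relations w P + w' over A, and by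
    faithfulness some A-combination of them has leading coefficient 1, so c comes from A. *)
Lemma etale_descent A B (phi : {lrmorphism A -> B}) (c : B) : etale_cover phi ->
  (forall D (d1 d2 : {lrmorphism B -> D}), (forall a, d1 (phi a) = d2 (phi a)) -> d1 c = d2 c) ->
  exists a, phi a = c.
Proof.
move=> /etale_presentation [n [m [b [r [u hd]]]]] hc; have [h1 h2 h3 h4] := hd.
have [D [g [d [e1 _ _ e2]]]] := pushout_exists h1 h2 h3 h4 phi.
have [P hP] := h1 c.
have : mmap g (d \o b) (map_mpoly phi P - c%:MP) = 0.
  have E : mmap g (d \o b) c%:MP = d c.
    by transitivity (g c); [exact: mmapC | exact: hc].
  rewrite rmorphB /= E -hP mmap_map_mpoly.
  pose F : {rmorphism {mpoly A[n]} -> D} := mmap (g \o phi) (d \o b).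
  pose G : {rmorphism {mpoly A[n]} -> D} := d \o mmap phi b.
  suff h : F =1 G by apply/eqP; rewrite subr_eq0; apply/eqP; exact: h.
  by apply: mpoly_rmorph_ext => [x|l]; rewrite /F /G /= ?mmapC ?mmap_Xi //= e1.
move/e2/presI_exp => [V hV].
have [|S [c' [w [W [hw hz]]]]] := @cover_relation A B phi n m b r u bool 'I_m
    (fun x => if x then P else 1) (fun x => if x then 1 else - c) r V hd.
  by rewrite big_bool /= mpolyC1 mul1r rmorph1 mulr1 mpolyCN hV.
have := hz true; rewrite /= => /esym e3.
have [d' hd'] := cover_faithful h1 h2 h4 e3.
exists (- \sum_s d' s * w s false).
pose Q := \sum_s (d' s)%:MP * ((w s true)%:MP * P + (w s false)%:MP).
have : mmap phi b Q = 0.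
  apply/h2; apply: (idl_sum (gen_ideal _)) => s _; apply: (idlM (gen_ideal _)).
  have := hw s; rewrite big_bool /= mulr1 => ->.
  by apply/gen_finP; exists (W s).
have -> : Q = P + (\sum_s d' s * w s false)%:MP.
  rewrite /Q; under eq_bigr do rewrite mulrDr mulrA -!rmorphM.
  by rewrite big_split /= -mulr_suml -!rmorph_sum hd' rmorph1 mul1r.
rewrite rmorphD /= mmapC hP => /eqP; rewrite addr_eq0 => /eqP ->.
by rewrite rmorphN.
Qed.

(** Descent of a closed subscheme: the ideal of the contraction of (c_i) to A works, since equality
    of the two pullbacks of (c_i) and flatness express each c_i through elements of this
    contraction. *)
Lemma etale_closed A B (phi : {lrmorphism A -> B}) t (c : 'I_t -> B) : etale_cover phi ->
  (forall D (d1 d2 : {lrmorphism B -> D}), (forall a, d1 (phi a) = d2 (phi a)) ->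
     forall i, gen (fun y => exists j, y = d2 (c j)) (d1 (c i))) ->
  exists I : A -> Prop, forall C (psi : {lrmorphism A -> C}),
    (forall a, I a -> psi a = 0) <->
    (forall D (g : {lrmorphism C -> D}) (d : {lrmorphism B -> D}),
       (forall a, g (psi a) = d (phi a)) -> forall i, d (c i) = 0).
Proof.
move=> het hc; have [n [m [b [r [u hd]]]]] := etale_presentation het.
have [h1 h2 h3 h4] := hd.
pose J := gen (fun y => exists j, y = c j).
exists (fun a => J (phi a)) => C psi; split=> [hI D g d e i|h a /gen_finP [v e]]; last first.
  have [D [g [d [e1 ginj]]]] := etale_pushout psi het.
  apply: ginj; rewrite rmorph0 e1 e rmorph_sum big1 // => j _.
  by rewrite rmorphM /= (h D g d e1) mulr0.
have [D' [g' [d' [e1 _ gsurj e2]]]] := pushout_exists h1 h2 h3 h4 phi.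
have [P hP] := choice (fun j => h1 (c j)).
have dP Q : d' (mmap phi b Q) = mmap g' (d' \o b) (map_mpoly phi Q).
  rewrite mmap_map_mpoly.
  pose F : {rmorphism {mpoly A[n]} -> D'} := mmap (g' \o phi) (d' \o b).
  pose G : {rmorphism {mpoly A[n]} -> D'} := d' \o mmap phi b.
  suff h : G =1 F by exact: h.
  by apply: mpoly_rmorph_ext => [x|l]; rewrite /F /G /= ?mmapC ?mmap_Xi //= e1.
have /gen_finP [v hv] := hc D' g' d' e1 i.
have [V hV] := choice (fun j => gsurj (v j)).
have : mmap g' (d' \o b) ((c i)%:MP - \sum_j V j * map_mpoly phi (P j)) = 0.
  have E : mmap g' (d' \o b) (c i)%:MP = g' (c i) by exact: mmapC.
  rewrite rmorphB /= E hv rmorph_sum /= -sumrB big1 // => j _.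
  by rewrite rmorphM /= hV -dP hP subrr.
move/e2/presI_exp => [W hW].
have [|S [c' [w [W' [hw hz]]]]] := @cover_relation A B phi n m b r u unit ('I_t + 'I_m)%type
    (fun=> 1) (fun=> c i) (fun l => match l with inl j => P j | inr j => r j end)
    (fun l => match l with inl j => V j | inr j => W j end) hd.
  rewrite (big_pred1 tt) /=; last by case.
  by rewrite rmorph1 mulr1 big_sumType /= -hW addrC subrK.
rewrite (hz tt) rmorph_sum big1 // => s _; rewrite rmorphM /= -e hI ?rmorph0 ?mulr0 //.
have := hw s; rewrite (big_pred1 tt) /=; last by case.
rewrite mulr1 big_sumType /= => /(congr1 (mmap phi b)).
rewrite mmapC rmorphD /= => ->.
have -> : mmap phi b (\sum_j W' s (inr j) * r j) = 0.
  by apply/h2; apply/gen_finP; exists (fun j => W' s (inr j)).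
rewrite addr0 rmorph_sum; apply: (idl_sum (gen_ideal _)) => j _.
rewrite rmorphM /= hP; apply: (idlM (gen_ideal _)).
by apply: gen_sub; exists j.
Qed.
End Etale.

(** * Nilpotent kernels and open subfunctors *)

Section Helpers.
Variable k : fieldType.
Implicit Types A B C D E K : comUnitAlgType k.

Lemma gen_finite (R : comNzRingType) (S : R -> Prop) x : gen S x ->
  exists n (a b : 'I_n -> R), (forall i, S (a i)) /\ \sum_i b i * a i = x.
Proof.
move=> h; apply: (h (fun x => exists n (a b : 'I_n -> R), (forall i, S (a i)) /\ \sum_i b i * a i = x)).
  split.
  - by exists 0%N, (fun=> 0), (fun=> 0); split; [case|rewrite big_ord0].
  - move=> _ _ [n [a [b [ha <-]]]] [n' [a' [b' [ha' <-]]]].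
    exists (n + n')%N, (fun i => match split i with inl j => a j | inr j => a' j end),
      (fun i => match split i with inl j => b j | inr j => b' j end).
    split=> [i|]; first by case: split.
    rewrite big_split_ord /=; congr (_ + _); apply: eq_bigr => i _.
      by rewrite -[lshift _ _]/(unsplit (inl i)) unsplitK.
    by rewrite -[rshift _ _]/(unsplit (inr i)) unsplitK.
  - move=> c _ [n [a [b [ha <-]]]]; exists n, a, (fun i => c * b i); split=> //.
    by rewrite mulr_sumr; apply: eq_bigr => i _; rewrite mulrA.
move=> y hy; exists 1%N, (fun=> y), (fun=> 1); split=> //.
by rewrite big_ord1 mul1r.
Qed.

Lemma factor_surj C D E (th : {lrmorphism C -> D}) (f : {lrmorphism C -> E}) :
  (forall d, exists c, th c = d) -> (forall c, th c = 0 -> f c = 0) ->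
  exists g : {lrmorphism D -> E}, forall c, g (th c) = f c.
Proof.
move=> hs hk; have [l hl] := choice hs; pose g d := f (l d).
have gE c : g (th c) = f c.
  apply/eqP; rewrite /g -subr_eq0 -rmorphB; apply/eqP/hk.
  by rewrite rmorphB /= hl subrr.
have gB : zmod_morphism g.
  by move=> x y; have [a <-] := hs x; have [b <-] := hs y; rewrite -rmorphB !gE rmorphB.
have gM : monoid_morphism g.
  split=> [|x y]; first by rewrite -(rmorph1 th) gE rmorph1.
  by have [a <-] := hs x; have [b <-] := hs y; rewrite -rmorphM !gE rmorphM.
have gZ c : g c%:A = c%:A by rewrite -(hom_alg th) gE hom_alg.
by exists (mkhom gB gM gZ).
Qed.

Definition nil_ker C D (th : {lrmorphism C -> D}) := forall c, th c = 0 -> exists n, c ^+ n = 0.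

Lemma nil_ker_field C D K (th : {lrmorphism C -> D}) (psi : {lrmorphism C -> K}) :
  (forall d, exists c, th c = d) -> nil_ker th -> is_field K ->
  exists g : {lrmorphism D -> K}, forall c, g (th c) = psi c.
Proof.
move=> hs hn hK; apply: factor_surj => // c /hn [n cn].
apply/eqP; apply: contraT => h; have := field_expf_neq0 n hK h.
by rewrite -rmorphXn cn rmorph0 eqxx.
Qed.

Lemma nil_ker_unit C D (th : {lrmorphism C -> D}) c :
  (forall d, exists c, th c = d) -> nil_ker th -> th c \is a GRing.unit -> c \is a GRing.unit.
Proof.
move=> hs hn u; apply: unit_field => K psi hK.
have [g hg] := nil_ker_field psi hs hn hK; rewrite -hg.
by apply: contraTneq (rmorph_unit g u) => /= ->; rewrite unitr0.
Qed.

Lemma thickening_nil C D (th : {lrmorphism C -> D}) : square_zero_thickening th -> nil_ker th.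
Proof. by move=> [_ h] c hc; exists 2; rewrite expr2; apply: h. Qed.

Definition hom_comp A B C (g : {lrmorphism B -> C}) (f : {lrmorphism A -> B}) :
  {lrmorphism A -> C} := g \o f.

Lemma fmap_comp' (X : kfunctor k) A B C (f : {lrmorphism A -> B}) (g : {lrmorphism B -> C}) (x : X A) :
  fmap (hom_comp g f) x = fmap g (fmap f x).
Proof. exact: fmap_comp. Qed.

Lemma fmap_id' (X : kfunctor k) A (x : X A) : fmap (idfun : {lrmorphism A -> A}) x = x.
Proof. exact: fmap_id. Qed.

Lemma fmap_ext (X : kfunctor k) A B (f g : {lrmorphism A -> B}) (x : X A) :
  f =1 g -> fmap f x = fmap g x.
Proof. by move=> h; rewrite (fmap_comp (phi := f) (psi := idfun) (chi := g)) ?fmap_id' // => a; rewrite /= h. Qed.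

Lemma GL4_eq A (g h : GL4 k A) : (forall i j, sval g i j = sval h i j) -> g = h.
Proof. by move=> e; apply/val_inj/matrixP. Qed.

Lemma open_field (X : kfunctor k) (U : subfunctor X) A (t : X A) : is_open U ->
  (forall K (psi : {lrmorphism A -> K}), is_field K -> U K (fmap psi t)) -> U A t.
Proof.
move=> hU ht; have [I hI] := hU A t.
rewrite -(fmap_id' t); apply/hI.
have /gen_finite [n [a [b [ha e]]]] : gen I 1.
  apply: (ideal1_field (gen_ideal _)) => K psi hK.
  have /hI [n [a [b [ha e]]]] := ht K psi hK.
  apply: contrapT => hn; have : 1 = 0 :> K; last by apply/eqP; rewrite oner_eq0.
  rewrite -e big1 // => i _; have -> : psi (a i) = 0; last by rewrite mulr0.
  apply: contrapT => /eqP h; apply: hn; exists (a i); split=> //; exact: gen_sub.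
by exists n, a, b.
Qed.

Lemma open_point (X : kfunctor k) (U : subfunctor X) A K (t : X A) (psi : {lrmorphism A -> K}) :
  is_open U -> is_field K -> U K (fmap psi t) ->
  exists a, psi a != 0 /\
    forall B (f : {lrmorphism A -> B}), f a \is a GRing.unit -> U B (fmap f t).
Proof.
move=> hU hK ht; have [I hI] := hU A t; have /hI [n [a [b [ha e]]]] := ht.
have [i hi] : exists i, psi (a i) != 0.
  apply: contrapT => hn; have : 1 = 0 :> K; last by apply/eqP; rewrite oner_eq0.
  rewrite -e big1 // => i _; have -> : psi (a i) = 0; last by rewrite mulr0.
  by apply: contrapT => /eqP h; apply: hn; exists i.
exists (a i); split=> // B f u; apply/hI; exists 1%N, (fun=> a i), (fun=> (f (a i))^-1).
by split=> //; rewrite big_ord1 mulVr.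
Qed.
End Helpers.

(** * The coordinate ring of GL_4 *)

Section UniversalMatrix.
Variable k : fieldType.
Implicit Types A B C D E K : comUnitAlgType k.
Local Notation S := {mpoly k[4 * 4]}.

Definition gmx : 'M[S]_4 := \matrix_(i, j) 'X_(mxvec_index i j).

Definition evalg (R : comNzRingType) (iota : {rmorphism k -> R}) (g : 'M[R]_4) : {rmorphism S -> R} :=
  mmap iota (fun x => mxvec g 0 x).

Lemma evalg_gmx (R : comNzRingType) (iota : {rmorphism k -> R}) (g : 'M[R]_4) :
  map_mx (evalg iota g) gmx = g.
Proof. by apply/matrixP=> i j; rewrite !mxE /evalg /= mmap_Xi mxvecE. Qed.

Lemma gdet_nnil n : (\det gmx) ^+ n != 0.
Proof.
apply/eqP=> /(congr1 (evalg idfun 1%:M)).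
rewrite rmorphXn rmorph0 -det_map_mx evalg_gmx det1 expr1n => /eqP.
by rewrite oner_eq0.
Qed.

Definition GLring : comUnitAlgType k := loc (@mpolyC (4 * 4) k) gdet_nnil.
Definition GLmap : {rmorphism S -> GLring} := locmap (@mpolyC (4 * 4) k) gdet_nnil.

Lemma gGL_unit : map_mx GLmap gmx \in unitmx.
Proof. by rewrite unitmxE det_map_mx; apply: locmap_unit. Qed.

Definition gGL : GL4 k GLring := exist (fun g : 'M[GLring]_4 => g \in unitmx) _ gGL_unit.

Lemma GLclassify A (g : GL4 k A) : exists f : {lrmorphism GLring -> A}, fmap f gGL = g.
Proof.
have h c : evalg (in_alg A) (sval g) (@mpolyC (4 * 4) k c) = c%:A by rewrite /evalg /= mmapC.
have h1 : evalg (in_alg A) (sval g) (\det gmx) \is a GRing.unit.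
  by rewrite -det_map_mx evalg_gmx -unitmxE; apply: (svalP g).
have [f hf] := loc_hom gdet_nnil h h1.
exists f; apply: GL4_eq => i j.
transitivity (f (GLmap (gmx i j))); first by rewrite /= !mxE.
transitivity (evalg (in_alg A) (sval g) (gmx i j)); first exact: hf.
by rewrite -[RHS](congr1 (fun M : 'M[A]_4 => M i j) (evalg_gmx (in_alg A) (sval g))) [RHS]mxE.
Qed.

Lemma GLring_ext A (f f' : {lrmorphism GLring -> A}) : fmap f gGL = fmap f' gGL -> f =1 f'.
Proof.
move=> e; apply: loc_ext => x.
pose F : {rmorphism S -> A} := f \o GLmap.
pose F' : {rmorphism S -> A} := f' \o GLmap.
suff : F =1 F' by apply.
apply: mpoly_rmorph_ext => [c|x'].
  have h : GLmap c%:MP = c%:A by exact: locmap_alg.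
  by transitivity (f (GLmap c%:MP)) => //; transitivity (f' (GLmap c%:MP)) => //; rewrite h !hom_alg.
case/mxvec_indexP: x' => i j.
have := congr1 (fun g : GL4 k A => sval g i j) e; rewrite /= !mxE.
by [].
Qed.

Lemma GLring_gen : exists l : seq GLring, forall x, subalg (in_alg GLring) l x.
Proof.
have [y hy] : exists y, GLmap (\det gmx) * y = 1.
  by apply/unitrPr; apply: locmap_unit.
exists (y :: codom (fun i => GLmap 'X_i)) => x.
have [c [n e]] := locmap_surj x.
have -> : x = GLmap c * y ^+ n.
  have -> : GLmap c = x * GLmap (\det gmx) ^+ n by exact: e.
  by rewrite -mulrA -exprMn hy expr1n mulr1.
apply: subalgM; last by apply: subalgX; apply: subalg_mem; rewrite mem_head.
elim/mpoly_closed_ind: c {e} => [c|i|p q hp hq|p q hp hq].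
- have -> : GLmap c%:MP = in_alg GLring c by exact: locmap_alg.
  exact: subalgC.
- by apply: subalg_mem; rewrite inE; apply/orP; right; exact: (codom_f (fun i => GLmap 'X_i) i).
- by rewrite rmorphD; exact: subalgD hp hq.
- by rewrite rmorphM; exact: subalgM hp hq.
Qed.
End UniversalMatrix.

Lemma subalg_hom (k : fieldType) (A B : comUnitAlgType k) (f : {lrmorphism A -> B}) (l : seq A) (l' : seq B) :
  (forall x, x \in l -> subalg (in_alg B) l' (f x)) ->
  forall x, subalg (in_alg A) l x -> subalg (in_alg B) l' (f x).
Proof.
move=> h; apply: subalg_ind => [c|//|x y hx hy|x y hx hy].
- have -> : f (in_alg A c) = in_alg B c by exact: hom_alg.
  exact: subalgC.
- by rewrite rmorphD; exact: subalgD hx hy.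
- by rewrite rmorphM; exact: subalgM hx hy.
Qed.

(** * Affine charts of the loci cut out by entries *)

Section Charts.
Variables (k : fieldType) (T : kfunctor k) (zm : kmorph T (GL4 k)).
Implicit Types (A B C D E K R : comUnitAlgType k) (J : pred ('I_4 * 'I_4)) (Om : point_set T).

Definition ent A (t : T A) (i j : 'I_4) : A := sval (zm A t) i j.

Lemma ent_fmap A B (f : {lrmorphism A -> B}) t i j : ent (fmap f t) i j = f (ent t i j).
Proof. by rewrite /ent kapp_nat mxE. Qed.

(** Openness of a set of field-valued points, tested along every Spec A -> T. In this form unions
    with complements and sets defined by local vanishing can be handled without exhibiting a
    subfunctor. *)
Definition p_open Om := forall A (t : T A) K (psi : {lrmorphism A -> K}),
  is_field K -> Om K (fmap psi t) -> exists a, psi a != 0 /\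
    forall K' (psi' : {lrmorphism A -> K'}), is_field K' -> psi' a != 0 -> Om K' (fmap psi' t).

Definition inside Om A (t : T A) := forall K (psi : {lrmorphism A -> K}), is_field K -> Om K (fmap psi t).

Definition zeroes J A (t : T A) := forall i j, J (i, j) -> ent t i j = 0.

(* The points of T lying in Om at which the entries indexed by J vanish. *)
Definition tmem Om J A (t : T A) := zeroes J t /\ inside Om t.

Lemma inside_fmap Om A B (f : {lrmorphism A -> B}) (t : T A) : inside Om t -> inside Om (fmap f t).
Proof. by move=> h K psi hK; rewrite -fmap_comp'; apply: h. Qed.

Lemma zeroes_fmap J A B (f : {lrmorphism A -> B}) (t : T A) : zeroes J t -> zeroes J (fmap f t).
Proof. by move=> h i j hij; rewrite ent_fmap h // rmorph0. Qed.

Lemma tmem_fmap Om J A B (f : {lrmorphism A -> B}) (t : T A) : tmem Om J t -> tmem Om J (fmap f t).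
Proof. by move=> [h1 h2]; split; [apply: zeroes_fmap | apply: inside_fmap]. Qed.

Lemma p_open_ext Om K K' (f : {lrmorphism K -> K'}) (t : T K) : p_open Om -> is_field K -> is_field K' ->
  Om K t -> Om K' (fmap f t).
Proof.
move=> h hK hK' ht; have [|a [a0 ha]] := h K t K idfun hK; first by rewrite fmap_id'.
by apply: ha => //; apply: field_hom_neq0.
Qed.

Lemma inside_point Om K (t : T K) : p_open Om -> is_field K -> Om K t -> inside Om t.
Proof. by move=> hO hK ht K' psi hK'; apply: (p_open_ext psi hO). Qed.

Lemma inside_field Om K (t : T K) : is_field K -> inside Om t -> Om K t.
Proof. by move=> hK /(_ K idfun hK); rewrite fmap_id'. Qed.

Lemma p_openI Om Om' : p_open Om -> p_open Om' -> p_open (fun K t => Om K t /\ Om' K t).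
Proof.
move=> h h' A t K psi hK [ht ht'].
have [a [a0 ha]] := h A t K psi hK ht; have [b [b0 hb]] := h' A t K psi hK ht'.
exists (a * b); split=> [|K' psi' hK' ab]; first by rewrite rmorphM field_mulf_neq0.
split; [apply: ha | apply: hb] => //; apply: contraNneq ab => e; rewrite rmorphM /= e.
  by rewrite mul0r.
by rewrite mulr0.
Qed.

(* The affine open piece U of (Om, J), represented by the point u over the
   finitely generated algebra R. *)
Record chart Om J R (u : T R) (U : point_set T) : Prop := Chart {
  ch_mem : tmem Om J u;
  ch_in : inside U u;
  ch_open : p_open U;
  ch_rep : forall C (t : T C), tmem Om J t -> inside U t -> exists f : {lrmorphism R -> C}, fmap f u = t;
  ch_ext : forall C (f f' : {lrmorphism R -> C}), fmap f u = fmap f' u -> f =1 f';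
  ch_gen : exists l, forall x, subalg (in_alg R) l x
}.

Lemma represents_ext (X : kfunctor k) A (x : X A) B (f f' : {lrmorphism A -> B}) :
  represents x -> fmap f x = fmap f' x -> f =1 f'.
Proof.
move=> h e; have [g [_ hg]] := h B (fmap f x).
by move=> a; rewrite (hg f erefl) (hg f' (esym e)).
Qed.

Lemma chart_exists Om J K (t : T K) : locally_finitely_presented zm -> p_open Om ->
  is_field K -> tmem Om J t -> exists R (u : T R) (U : point_set T), chart Om J u U /\ U K t.
Proof.
move=> lfp hOm hK [zt it].
have [U0 [V0 [[U0o V0o U0t U0V] [B [u0 [A [v [f [u0rep vrep zu fp]]]]]]]]] := lfp K t hK.
have [n [y [m [r [ysurj yker]]]]] := fp.
have [th [hth _]] := u0rep K (exist _ t U0t).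
have {}hth : fmap th (sval u0) = t by exact: (congr1 sval hth).
have [om [om0 hom]] : exists a, th a != 0 /\ forall K' (psi' : {lrmorphism B -> K'}),
    is_field K' -> psi' a != 0 -> Om K' (fmap psi' (sval u0)).
  by apply: hOm => //; rewrite hth; apply: inside_field.
have [pv hpv] := GLclassify (sval v).
have [pg hpg] := GLclassify (zm K t).
have pgE : pg =1 hom_comp th (hom_comp f pv).
  apply: GLring_ext; rewrite hpg !fmap_comp' hpv -[fmap f _]zu.
  by rewrite -kapp_nat hth.
have [be [be0 hbe]] : exists a, pg a != 0 /\
    forall C (g : {lrmorphism GLring k -> C}), g a \is a GRing.unit -> V0 C (fmap g (gGL k)).
  by apply: open_point => //; rewrite hpg; apply: U0V.
(* Inverting [om] keeps the chart inside Om; inverting the image of [be] places it over a principal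
   open of GL_4 contained in V0, which is what makes R finitely generated over k. *)
pose b0 := f (pv be) * om.
have thb0 : th b0 != 0.
  by rewrite /b0 rmorphM field_mulf_neq0 //=; rewrite pgE in be0.
have [B1 [p1 [p1s p1J p1u]]] : exists B1 (p1 : {lrmorphism B -> B1}),
    [/\ forall b, exists a, p1 a = b, forall i j, J (i, j) -> p1 (ent (sval u0) i j) = 0
      & forall C (g : {lrmorphism B -> C}), (forall i j, J (i, j) -> g (ent (sval u0) i j) = 0) ->
          exists g' : {lrmorphism B1 -> C}, forall a, g' (p1 a) = g a].
  pose S (x : B) := exists i j, J (i, j) /\ x = ent (sval u0) i j.
  have S1 : ~ gen S 1.
    move=> h; have : th 1 = 0; last by rewrite rmorph1 => /eqP; rewrite oner_eq0.
    apply: (h (fun x => th x = 0)) => [|_ [i [j [hJ ->]]]].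
      split=> [|a b ha hb|a b hb]; first exact: rmorph0.
        by rewrite rmorphD /= ha hb addr0.
      by rewrite rmorphM /= hb mulr0.
    by rewrite -ent_fmap hth zt.
  have [B1 [p1 [s1 k1 u1]]] := @qalg_exists k B (gen S) (gen_ideal S) S1.
  exists B1, p1; split=> // [i j hJ|C g hg].
    by apply/k1; apply: (@gen_sub _ S); exists i, j.
  apply: u1 => a h; apply: (h (fun x => g x = 0)) => [|_ [i [j [hJ ->]]]]; last by apply: hg.
  split=> [|x z hx hz|x z hz]; first exact: rmorph0.
    by rewrite rmorphD /= hx hz addr0.
  by rewrite rmorphM /= hz mulr0.
have [|th1 hth1] := p1u K th; first by move=> i j hJ; rewrite -ent_fmap hth zt.
have [|R [p2 [p2loc p2u p2e]]] := @loc_exists k B1 (p1 b0).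
  by exists K, th1; split=> //; rewrite hth1.
pose p := hom_comp p2 p1.
have pb0 : p b0 \is a GRing.unit by case: p2loc.
pose u := fmap p (sval u0).
pose U : point_set T := fun K' t' => is_field K' /\ U0 K' t' /\
  forall th' : {lrmorphism B -> K'}, fmap th' (sval u0) = t' -> th' b0 != 0.
have unit0 K' (x : K') : x \is a GRing.unit -> x != 0.
  by move=> hx; apply: contraTneq hx => ->; rewrite unitr0.
exists R, u, U; split; last first.
  split=> //; split=> // th' e.
  have -> : th' b0 = th b0; last by [].
  by apply: (represents_ext (x := u0)) => //; apply: sub_obj_inj; rewrite /= e hth.
split.
- split=> [i j hJ|K' psi hK'].
    by rewrite /u ent_fmap /p /= p1J // rmorph0.
  rewrite /u -fmap_comp'; apply: hom => //=; apply: unit0.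
  apply: (rmorph_unit psi); move: pb0; rewrite /b0 rmorphM unitrM => /andP [_ h]; exact: h.
- move=> K' psi hK'; split=> //; split.
    by rewrite /u -!fmap_comp'; apply: smem_stable; apply: (svalP u0).
  move=> th' e; have -> : th' b0 = psi (p b0).
    apply: (represents_ext (x := u0) (f := th') (f' := hom_comp psi p)) => //.
    by apply: sub_obj_inj; rewrite /= e fmap_comp'.
  by apply: unit0; apply: (rmorph_unit psi).
- move=> A' t' K' psi hK' [_ [U0t' ht']].
  have [a [a0 ha]] := open_point U0o hK' U0t'.
  have [|L [la [laloc lau lae]]] := @loc_exists k A' a; first by exists K', psi.
  have laU : la a \is a GRing.unit by case: laloc.
  have [ths [hths _]] := u0rep L (exist _ (fmap la t') (ha L la laU)).
  have {}hths : fmap ths (sval u0) = fmap la t' by exact: (congr1 sval hths).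
  have [c [N ec]] : exists c N, la c = ths b0 * la a ^+ N by case: laloc => _ h _; apply: h.
  have ext K2 (psi2 : {lrmorphism A' -> K2}) : is_field K2 -> psi2 a != 0 ->
      exists q : {lrmorphism L -> K2}, forall x, q (la x) = psi2 x.
    by move=> hK2 /hK2; apply: lau.
  exists (a * c); split.
    have [q hq] := ext K' psi hK' a0.
    rewrite rmorphM; apply: field_mulf_neq0 => //=; rewrite -hq ec rmorphM rmorphXn /= hq.
    apply: field_mulf_neq0 => //; last exact: field_expf_neq0.
    have := ht' (hom_comp q ths); apply; rewrite fmap_comp' hths -fmap_comp'.
    by apply: fmap_ext => x /=; rewrite hq.
  move=> K2 psi2 hK2; rewrite rmorphM /= => h2.
  have a2 : psi2 a != 0 by apply: contraNneq h2 => ->; rewrite mul0r.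
  have c2 : psi2 c != 0 by apply: contraNneq h2 => ->; rewrite mulr0.
  have [q hq] := ext K2 psi2 hK2 a2.
  have e2 : fmap psi2 t' = fmap (hom_comp q la) t' by apply: fmap_ext => x /=; rewrite hq.
  split=> //; split; first by apply: ha; apply: hK2.
  move=> th' e'; have -> : th' b0 = q (ths b0).
    apply: (represents_ext (x := u0) (f := th') (f' := hom_comp q ths)) => //.
    by apply: sub_obj_inj; rewrite /= e' e2 !fmap_comp' hths.
  apply: contraNneq c2 => h; rewrite -hq ec rmorphM /= h mul0r //.
- move=> C t' [zt' _] iU.
  have U0t' : U0 C t' by apply: open_field => // K' psi hK'; have [_ []] := iU K' psi hK'.
  have [th' [hth' _]] := u0rep C (exist _ t' U0t').
  have {}hth' : fmap th' (sval u0) = t' by exact: (congr1 sval hth').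
  have [|th1' hth1'] := p1u C th'; first by move=> i j hJ; rewrite -ent_fmap hth' zt'.
  have [|q hq] := p2u C th1'.
    rewrite hth1'; apply: unit_field => K' psi hK'.
    have [_ [_ h]] := iU K' psi hK'; apply: (h (hom_comp psi th')).
    by rewrite fmap_comp' hth'.
  exists q; rewrite /u -fmap_comp' -hth'; apply: fmap_ext => x.
  by rewrite /= hq hth1'.
- move=> C q q' e; apply: p2e => x; have [b <-] := p1s x.
  apply: (represents_ext (x := u0) (f := hom_comp q p) (f' := hom_comp q' p)) => //.
  by apply: sub_obj_inj; rewrite /= (fmap_comp' p q) (fmap_comp' p q').
(* The map from A to R factors through the localization of the coordinate ring of GL_4 at [be], so
   its image is generated by that of GL_4 and one inverse; finite presentation of B over A adds the
   [y i]. *)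
- have [l hl] := @GLring_gen k.
  pose pA := hom_comp p f.
  have pAbe : pA (pv be) \is a GRing.unit.
    by move: pb0; rewrite /b0 rmorphM unitrM => /andP [h _]; exact: h.
  have [|Lb [lb [lbloc lbu lbe]]] := @loc_exists k (GLring k) be; first by exists K, pg.
  have [tv [htv _]] := vrep Lb (exist _ (fmap lb (gGL k)) (hbe Lb lb (let: And3 h _ _ := lbloc in h))).
  have {}htv : fmap tv (sval v) = fmap lb (gGL k) by exact: (congr1 sval htv).
  have [ka hka] := lbu R (hom_comp pA pv) pAbe.
  have kE : hom_comp ka tv =1 pA.
    apply: (represents_ext (x := v)) => //; apply: sub_obj_inj.
    transitivity (fmap ka (fmap tv (sval v))); first exact: fmap_comp'.
    transitivity (fmap pA (sval v)); last by [].
    rewrite htv -hpv -!fmap_comp'; apply: fmap_ext => x.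
    exact: hka.
  pose lr := [seq pA (pv x) | x <- l] ++ (pA (pv be))^-1 :: (p b0)^-1 :: codom (fun i => p (y i)).
  have Sl x : x \in lr -> subalg (in_alg R) lr x by apply: subalg_mem.
  have SG x : subalg (in_alg R) lr (pA (pv x)).
    apply: (subalg_hom (f := hom_comp pA pv) (l := l)) => // z hz; apply: Sl.
    by rewrite mem_cat; apply/orP; left; exact: (map_f (fun x => pA (pv x)) hz).
  have SA a : subalg (in_alg R) lr (pA a).
    have [c [N e]] : exists c N, lb c = tv a * lb be ^+ N by case: lbloc => _ h _; apply: h.
    have e2 : pA (pv c) = pA a * pA (pv be) ^+ N.
      transitivity (ka (lb c)); first exact/esym/hka.
      by rewrite e rmorphM rmorphXn; congr (_ * _ ^+ _); [exact: kE | exact: hka].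
    have -> : pA a = pA (pv c) * (pA (pv be))^-1 ^+ N.
      by rewrite e2 -mulrA -exprMn divrr // expr1n mulr1.
    apply: subalgM (SG c) _; apply: subalgX; apply: Sl.
    by rewrite mem_cat !inE eqxx orbT.
  have SB b : subalg (in_alg R) lr (p b).
    have [P <-] := ysurj b.
    elim/mpoly_closed_ind: P => [c|i|P Q hP hQ|P Q hP hQ].
    - by rewrite mmapC; apply: SA.
    - rewrite mmap_Xi; apply: Sl; rewrite mem_cat !inE.
      by rewrite (codom_f (fun i => p (y i)) i) !orbT.
    - by rewrite !rmorphD; exact: subalgD hP hQ.
    - by rewrite !rmorphM; exact: subalgM hP hQ.
  exists lr => x.
  have [c [N e]] : exists c N, p2 c = x * p2 (p1 b0) ^+ N by case: p2loc => _ h _; apply: h.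
  have [b hb] := p1s c.
  have -> : x = p b * (p b0)^-1 ^+ N.
    have -> : p b = x * p b0 ^+ N by rewrite /p /= hb e.
    by rewrite -mulrA -exprMn divrr // expr1n mulr1.
  apply: subalgM (SB b) _; apply: subalgX; apply: Sl.
  by rewrite mem_cat !inE eqxx !orbT.
Qed.
End Charts.

(** * Smoothness of the charts, and entries as nonzerodivisors *)

Section SmoothCharts.
Variables (k : fieldType) (T : kfunctor k) (zm : kmorph T (GL4 k)).
Implicit Types (A B C D E K R : comUnitAlgType k) (J : pred ('I_4 * 'I_4)) (Om : point_set T).
Hypothesis zm_smooth : formally_smooth zm.

(** With Q -> R surjective of kernel I, the matrix Y modulo I^2 is a point of GL_4 lifting that of
    u, so formal smoothness lifts u to Q/I^2. The lift stays in T_J because Y vanishes on J, and in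
    Om and U because these only see field points. *)
Lemma chart_lift Om J R (u : T R) U (Q : comNzRingType) (iota : {rmorphism k -> Q})
    (F : {rmorphism Q -> R}) (Y : 'M[Q]_4) :
  chart zm Om J u U -> (forall c, F (iota c) = c%:A) -> (forall a, exists x, F x = a) ->
  (forall i j, F (Y i j) = ent zm u i j) -> (forall i j, J (i, j) -> Y i j = 0) ->
  let I := fun x => F x = 0 in
  exists D (q : {rmorphism Q -> D}) (g : {lrmorphism R -> D}),
    [/\ forall d, exists x, q x = d, forall x, q x = 0 <-> prodI I I x,
        forall c, q (iota c) = c%:A, forall a x, g a = q x -> F x = a
      & forall i j, g (ent zm u i j) = q (Y i j)].
Proof.
move=> hch Fc Fs FY YJ I.
have hI : idealP I.
  split=> [|x y hx hy|a x hx]; rewrite /I; first exact: rmorph0.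
    by rewrite rmorphD hx hy addr0.
  by rewrite rmorphM hx mulr0.
have I21 : ~ prodI I I 1 by move=> /(prodI_subl hI); rewrite /I rmorph1 => /eqP; rewrite oner_eq0.
pose JJ := PIdeal (prodI_ideal I I) I21.
pose D := qalg iota JJ; pose q : {rmorphism Q -> D} := qmap iota JJ.
have qE x : qmap iota JJ x = q x by [].
have FJ x : imem JJ x -> F x = 0 by move=> /(prodI_subl hI).
have [th hth] := quo_hom Fc FJ.
have thq x : th (q x) = F x by exact: hth.
have ths d : exists c, th c = d by have [x hx] := Fs d; exists (q x); rewrite thq.
have sq : square_zero_thickening th.
  split=> // x y; have [P <-] := qmap_surj x; have [P' <-] := qmap_surj y.
  rewrite !qE !thq => hP hP'.
  by rewrite -rmorphM; apply/qmap0P; apply: prodI_mul.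
have nil := thickening_nil sq.
pose y0 := map_mx q Y.
have y0u : y0 \in unitmx.
  rewrite unitmxE det_map_mx; apply: (nil_ker_unit ths nil); rewrite thq -det_map_mx.
  rewrite (_ : map_mx F Y = sval (zm R u)) -?unitmxE; first exact: (svalP (zm R u)).
  by apply/matrixP=> i j; rewrite mxE FY.
pose y : GL4 k D := exist (fun g : 'M[D]_4 => g \in unitmx) y0 y0u.
have [|x' [x'u x'y]] := zm_smooth sq (y := y) (x := u).
  by apply: GL4_eq => i j; rewrite /= !mxE thq FY.
have inx (Om' : point_set T) : inside Om' u -> inside Om' x'.
  move=> h K psi hK; have [g hg] := nil_ker_field psi ths nil hK.
  rewrite (fmap_ext (g := hom_comp g th)) ?fmap_comp' ?x'u; first exact: h.
  by move=> c; rewrite /= hg.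
have [[zu iu] Uu _ rep ext _] := hch.
have [|g hg] := rep D x' _ (inx U Uu).
  split; last exact: inx.
  by move=> i j hJ; rewrite /ent x'y /= mxE YJ // rmorph0.
have thg : hom_comp th g =1 idfun.
  by apply: ext; rewrite fmap_comp' hg x'u fmap_id'.
exists D, q, g; split.
- exact: qmap_surj.
- by move=> x; exact: (@qmap0P _ _ iota JJ).
- by move=> c; exact: qmapE.
- by move=> a x e; rewrite -thq -e; exact: (thg a).
- by move=> i j; rewrite -ent_fmap hg /ent x'y /= mxE.
Qed.

(** The lift g of [chart_lift], made A-linear by the last hypothesis, provides the shift. This shows
    smoothness of T_J over A, for A such as k or the line of one free entry. *)
Lemma chart_smooth Om J R (u : T R) U (A : comNzRingType) n (iota : {rmorphism k -> A})
    (F : {rmorphism {mpoly A[n]} -> R}) (Y : 'M[{mpoly A[n]}]_4) :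
  chart zm Om J u U -> noeth A -> (forall c, F (iota c)%:MP = c%:A) -> (forall a, exists x, F x = a) ->
  (forall i j, F (Y i j) = ent zm u i j) -> (forall i j, J (i, j) -> Y i j = 0) ->
  (forall (D : comUnitAlgType k) (q : {rmorphism {mpoly A[n]} -> D}) (g : {lrmorphism R -> D}),
     (forall c, q (iota c)%:MP = c%:A) -> (forall i j, g (ent zm u i j) = q (Y i j)) ->
     forall a : A, g (F a%:MP) = q a%:MP) ->
  exists m (r : 'I_m -> {mpoly A[n]}) v,
    smooth_lift r v /\ forall P, presI r P <-> F P = 0.
Proof.
move=> hch hA Fc Fs FY YJ hlin.
pose i0 : {rmorphism k -> {mpoly A[n]}} := @mpolyC n A \o iota.
have [D [q [g [qs q0 qc gF gY]]]] := @chart_lift Om J R u U _ i0 F Y hch Fc Fs FY YJ.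
have hgl := hlin D q g qc gY.
have hI : idealP (fun x => F x = 0).
  split=> [|x y hx hy|a x hx]; first exact: rmorph0.
    by rewrite rmorphD hx hy addr0.
  by rewrite rmorphM hx mulr0.
have [m [r [r0 rgen]]] := noeth_fg (fun x => F x = 0) (noeth_mpoly (n := n) hA).
have pE P : presI r P <-> F P = 0.
  split=> [|/rgen [w ->]]; last by apply/gen_finP; exists w.
  by apply: (gen_min hI) => _ [j ->].
have [Z hZ] := choice (fun i => qs (g (F 'X_i))).
exists m, r, (fun i => Z i - 'X_i); split=> //.
have predE : presI r = (fun x => F x = 0) by apply/funext=> P; apply/propext.
split=> [i|j].
  by apply/pE; rewrite rmorphB (gF (F 'X_i) (Z i)) ?subrr.
rewrite predE; apply/q0.
suff h P : q (shift (fun i => Z i - 'X_i) P) = g (F P) by rewrite h r0 rmorph0.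
pose G1 : {rmorphism {mpoly A[n]} -> D} := q \o shift (fun i => Z i - 'X_i).
pose G2 : {rmorphism {mpoly A[n]} -> D} := g \o F.
suff : G1 =1 G2 by apply.
apply: mpoly_rmorph_ext => [c|i].
  by rewrite /G1 /G2 /= shiftC hgl.
by rewrite /G1 /G2 /= shiftX addrC subrK hZ.
Qed.

(** An entry outside J can be prescribed freely when lifting, so the chart is smooth over the affine
    line through this entry. Flatness over k[X] and the fact that X is a nonzerodivisor in the
    polynomial ring conclude. *)
Lemma chart_nzd Om J R (u : T R) U i0 j0 (z : R) : chart zm Om J u U -> ~~ J (i0, j0) ->
  ent zm u i0 j0 * z = 0 -> z = 0.
Proof.
move=> hch nJ xz; have [[zu iu] _ _ _ _ [l hl]] := hch.
set x := ent zm u i0 j0 in xz.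
pose f : {rmorphism {poly k} -> R} := horner_eval x \o map_poly (in_alg R).
have fC c : f c%:P = c%:A by rewrite /f /= /horner_eval map_polyC hornerC.
have fX : f 'X = x by rewrite /f /= /horner_eval map_polyX hornerX.
pose n := size l.
pose F : {rmorphism {mpoly {poly k}[n]} -> R} := mmap f (fun i => nth 0 l i).
have FC a : F a%:MP = f a by exact: mmapC.
have Fs a : exists X, F X = a.
  have [G <-] := hl a; exists (map_mpoly (@polyC k) G).
  rewrite /F /= mmap_map_mpoly.
  pose G1 : {rmorphism {mpoly k[n]} -> R} := mmap (f \o polyC) (fun i => nth 0 l i).
  pose G2 : {rmorphism {mpoly k[n]} -> R} := mmap (in_alg R) (fun i => nth 0 l i).
  suff h : G1 =1 G2 by exact: h.
  by apply: mpoly_rmorph_ext => [c|i]; rewrite /G1 /G2 /= ?mmapC ?mmap_Xi //= -[RHS]fC.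
have [Y0 hY0] := choice (fun ij : 'I_4 * 'I_4 => Fs (ent zm u ij.1 ij.2)).
pose Y : 'M[{mpoly {poly k}[n]}]_4 := \matrix_(i, j)
  if J (i, j) then 0 else if (i, j) == (i0, j0) then 'X%:MP else Y0 (i, j).
have hk : noeth {poly k} by apply: noeth_poly; apply: noeth_field.
have [|||||m [r [v [hs hp]]]] := @chart_smooth Om J R u U {poly k} n polyC F Y hch hk.
- by move=> c; rewrite FC fC.
- exact: Fs.
- move=> i j; rewrite mxE; case: ifP => [hJ|_]; first by rewrite rmorph0 zu.
  by case: eqP => [[-> ->]|_]; [rewrite FC fX | rewrite hY0].
- by move=> i j hJ; rewrite mxE hJ.
- move=> D q g qc gY a; rewrite FC.
  elim/poly_ind: a => [|p c IH]; first by rewrite !rmorph0.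
  have e1 : f (p * 'X + c%:P) = f p * x + c%:A by rewrite rmorphD rmorphM fX fC.
  have e2 : q (p * 'X + c%:P)%:MP = q p%:MP * q 'X%:MP + c%:A.
    by rewrite mpolyCD rmorphD mpolyCM rmorphM qc.
  rewrite e1 e2 rmorphD rmorphM /= IH hom_alg; congr (_ * _ + _).
  by rewrite gY mxE (negbTE nJ) eqxx.
have [Z hZ] := Fs z.
have [|Z' [hZ' e]] := @smooth_flat1 _ n m r v hs k (@polyC k) (@noeth_field k) 1 (fun=> 'X) (fun=> Z).
  by rewrite big_ord1; apply/hp; rewrite rmorphM FC fX hZ.
rewrite big_ord1 in e; have /hp := hZ' ord0; rewrite rmorphB hZ.
suff -> : Z' ord0 = 0 by rewrite rmorph0 subr0.
apply/mpolyP => mo; rewrite mcoeff0; have := congr1 (mcoeff mo) e.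
rewrite mcoeffCM mcoeff0 => /eqP; rewrite mulf_eq0 polyX_eq0 /= => /eqP //.
Qed.
End SmoothCharts.

(** * Frobenius of smooth algebras over a perfect field *)

Section Frobenius.
Variables (k : fieldType) (q : nat).
Hypothesis q_pchar : [pchar k].-nat q.
Hypothesis q_root : forall c : k, exists d, d ^+ q = c.

Lemma frobD (R : comNzRingType) (iota : {rmorphism k -> R}) (x y : R) :
  (x + y) ^+ q = x ^+ q + y ^+ q.
Proof.
apply: exprDn_pchar; apply: sub_in_pnat q_pchar => p _; exact: (rmorph_pchar iota).
Qed.

Lemma q_gt0 : (0 < q)%N. Proof. by have /andP[] := q_pchar. Qed.

Lemma frob0 (R : comNzRingType) : (0 : R) ^+ q = 0.
Proof. by rewrite expr0n; case: q q_gt0. Qed.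

Lemma frob_sum (R : comNzRingType) (iota : {rmorphism k -> R}) (I : Type) (r : seq I) (P : pred I) (F : I -> R) :
  (\sum_(i <- r | P i) F i) ^+ q = \sum_(i <- r | P i) F i ^+ q.
Proof.
elim/big_rec2: _ => [|i x y _ IH]; first exact: frob0.
by rewrite (frobD iota) IH.
Qed.

Definition qroot (c : k) : k := projT1 (cid (q_root c)).
Lemma qrootK c : qroot c ^+ q = c. Proof. by rewrite /qroot; case: cid. Qed.
Lemma frob_inj : injective (fun c : k => c ^+ q).
Proof.
move=> c d /= e; have : (c - d) ^+ q = 0.
  apply: (addIr (d ^+ q)); rewrite -(frobD idfun) subrK e add0r //.
by move/eqP; rewrite expf_eq0 => /andP [_]; rewrite subr_eq0 => /eqP.
Qed.
Lemma qrootX c : qroot (c ^+ q) = c. Proof. by apply: frob_inj; rewrite /= qrootK. Qed.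
Lemma qroot0 : qroot 0 = 0. Proof. by apply: frob_inj; rewrite /= qrootK frob0. Qed.
Lemma qroot1 : qroot 1 = 1. Proof. by apply: frob_inj; rewrite /= qrootK expr1n. Qed.
Lemma qrootD c d : qroot (c + d) = qroot c + qroot d.
Proof. by apply: frob_inj; rewrite /= (frobD idfun) !qrootK. Qed.
Lemma qrootM c d : qroot (c * d) = qroot c * qroot d.
Proof. by apply: frob_inj; rewrite /= exprMn !qrootK. Qed.

Section FrobeniusBasis.
Variable n : nat.
Local Notation P := {mpoly k[n]}.

Implicit Types (h : P) (mo : 'X_{1..n}) (f : {ffun 'I_n -> 'I_q}).
Definition resm f : 'X_{1..n} := [multinom f i : nat | i < n].

(* P is free over P^q on the monomials with exponents less than q; this is the
   q-th root of the coefficient of such a monomial. *)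
Definition frob_coef f h : P :=
  \sum_(mo : 'X_{1..n < msize h}) qroot h@_(mo *+ q + resm f) *: 'X_[mo].

Lemma frob_coefE f h mo : (frob_coef f h)@_mo = qroot h@_(mo *+ q + resm f).
Proof.
have [lt|ge] := ltnP (mdeg mo) (msize h).
  exact: (mcoeff_mpoly (fun mo => qroot h@_(mo *+ q + resm f))).
rewrite [in RHS]memN_msupp_eq0 ?qroot0; last first.
  apply: contraL ge => /msize_mdeg_lt; rewrite -ltnNge mdegD mdegMn => h1.
  apply: leq_ltn_trans h1; apply: leq_trans (leq_addr _ _).
  by rewrite -{1}[mdeg mo]muln1 leq_mul2l q_gt0 orbT.
rewrite raddf_sum big1 //= => m1 _; rewrite mcoeffZ mcoeffX.
case: eqP => [e|]; last by rewrite mulr0.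
by have := bmdeg m1; rewrite e ltnNge ge.
Qed.

Lemma frob_coefD f h h' : frob_coef f (h + h') = frob_coef f h + frob_coef f h'.
Proof. by apply/mpolyP => mo; rewrite mcoeffD !frob_coefE mcoeffD qrootD. Qed.

Lemma frob_coef0 f : frob_coef f 0 = 0.
Proof. by apply/mpolyP => mo; rewrite frob_coefE !mcoeff0 qroot0. Qed.

Lemma frob_coefM f c h : frob_coef f (c ^+ q * h) = c * frob_coef f h.
Proof.
elim/mpoly_closed_ind: c h => [c|i|c d hc hd|c d hc hd] h.
- apply/mpolyP => mo; rewrite frob_coefE -rmorphXn !mcoeffCM frob_coefE qrootM qrootX //.
- apply/mpolyP => mo; rewrite frob_coefE mpolyXn mulrC [in RHS]mulrC.
  have [mi|mi] := posnP (mo i).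
    rewrite !memN_msupp_eq0 ?qroot0 //.
      rewrite (perm_mem (msuppMX _ _)); apply/mapP=> -[m1 _ /mnmP /(_ i)].
      by rewrite mi mnmDE mnm1E eqxx.
    rewrite (perm_mem (msuppMX _ _)); apply/mapP=> -[m1 _ /mnmP /(_ i)].
    rewrite !mnmDE !mulmnE mi mul0n mnm1E eqxx mul1n mnmE.
    by have := ltn_ord (f i); lia.
  pose m1 := (mo - U_(i))%MM.
  have e : mo = (U_(i) + m1)%MM.
    by rewrite addmC /m1 submK //; apply/mnm_lepP => j; rewrite mnm1E; case: eqP => [<-|].
  rewrite e; have -> : ((U_(i) + m1) *+ q + resm f = U_(i) *+ q + (m1 *+ q + resm f))%MM.
    by apply/mnmP => j; rewrite !(mulmnE, mnmDE) mulnDl addnA.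
  by rewrite !mcoeffMX frob_coefE.
- have e : (c + d) ^+ q = c ^+ q + d ^+ q by exact: (frobD (@mpolyC n k)).
  rewrite e mulrDl frob_coefD.
  by rewrite [RHS]mulrDl; congr (_ + _); [exact: hc | exact: hd].
- by rewrite exprMn -mulrA hc hd mulrA.
Qed.

Lemma frob_expand h : h = \sum_f frob_coef f h ^+ q * 'X_[resm f].
Proof.
elim/mpolyind: h => [|c mo p _ _ IH].
  by rewrite big1 // => f _; rewrite frob_coef0 (frob0 _) mul0r.
pose f0 : {ffun 'I_n -> 'I_q} := [ffun i => Ordinal (ltn_pmod (mo i) q_gt0)].
pose m0 : 'X_{1..n} := [multinom (mo i %/ q)%N | i < n].
have em : mo = (m0 *+ q + resm f0)%MM.
  by apply/mnmP => i; rewrite mnmDE mulmnE !mnmE ffunE /= -divn_eq.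
have ec f : frob_coef f (c *: 'X_[mo]) = if f == f0 then qroot c *: 'X_[m0] else 0.
  have -> : c *: 'X_[mo] = ((qroot c)%:MP * 'X_[m0]) ^+ q * 'X_[resm f0] :> P.
    by rewrite exprMn -rmorphXn qrootK mpolyXn -mulrA -mpolyXD -em mul_mpolyC.
  rewrite frob_coefM; suff -> : frob_coef f 'X_[resm f0] = (f == f0)%:R.
    by case: eqP => _; rewrite ?mulr1 ?mulr0 // mul_mpolyC.
  apply/mpolyP => m1; rewrite frob_coefE mcoeffX -(rmorph_nat (@mpolyC n k)) mcoeffC.
  have -> : ((resm f0 == m1 *+ q + resm f)%MM) = (f == f0) && (m1 == 0%MM).
    apply/eqP/andP => [/mnmP e|[/eqP -> /eqP ->]]; last first.
      by apply/mnmP => i; rewrite mnmDE mulmnE mnm0E.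
    have e1 i : m1 i = 0%N /\ f0 i = f i :> nat.
      move: (e i); rewrite mnmDE mulmnE [resm f0 i]mnmE [resm f i]mnmE.
      have := ltn_ord (f0 i); have := ltn_ord (f i).
      by case: (m1 i) => [|l] /= h1 h2 e'; [split; lia | exfalso; nia].
    split; apply/eqP; first by apply/ffunP => i; apply/val_inj; rewrite /= (e1 i).2.
    by apply/mnmP => i; rewrite mnm0E (e1 i).1.
  by case: (f == f0); case: eqP => _ //=; rewrite ?mulr1 ?mulr0 ?qroot0 ?qroot1.
transitivity (\sum_f (frob_coef f (c *: 'X_[mo]) ^+ q * 'X_[resm f] + frob_coef f p ^+ q * 'X_[resm f])).
  rewrite big_split /= -IH; congr (_ + _).
  rewrite (bigD1 f0) //= big1 ?addr0 => [|f nf]; last by rewrite ec (negbTE nf) (frob0 _) mul0r.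
  by rewrite ec eqxx exprZn mpolyXn qrootK -scalerAl -mpolyXD -em.
by apply: eq_bigr => f _; rewrite frob_coefD (frobD (@mpolyC n k)) mulrDl.
Qed.

(** [frob_coef f] takes c^q h to c times the coefficient of h, so it can be applied to a combination
    of the g_j^q term by term. *)
Lemma frob_flat m (g : 'I_m -> P) c h : presI (fun j => g j ^+ q) (c ^+ q * h) ->
  forall f, presI g (c * frob_coef f h).
Proof.
case/gen_finP => v e f; apply/gen_finP; exists (fun j => frob_coef f (v j)).
rewrite -frob_coefM e.
have fs (I : Type) (r : seq I) (F : I -> P) :
    frob_coef f (\sum_(i <- r) F i) = \sum_(i <- r) frob_coef f (F i).
  by elim/big_rec2: _ => [|i x y _ IH]; rewrite ?frob_coef0 // frob_coefD IH.
by rewrite fs; apply: eq_bigr => j _; rewrite mulrC frob_coefM mulrC.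
Qed.

Section Powers.
Variables (m : nat) (g : 'I_m -> P).
Definition ipow N : P -> Prop := gen (fun x => exists2 s : seq 'I_m, size s = N & x = \prod_(i <- s) g i).

Lemma ipowM N N' x y : ipow N x -> ipow N' y -> ipow (N + N') (x * y).
Proof.
have hI : idealP (ipow (N + N')) := gen_ideal _.
move=> hx hy; apply: (hx (fun x => ipow (N + N') (x * y))) => [|_ [s sN ->]].
  split=> [|a b ha hb|a b hb]; rewrite ?mul0r ?mulrDl -?mulrA.
  - exact: (idl0 hI).
  - exact: (idlD hI).
  - exact: (idlM hI).
apply: (hy (fun y => ipow (N + N') (_ * y))) => [|_ [s' sN' ->]].
  split=> [|a b ha hb|a b hb]; rewrite ?mulr0 ?mulrDr.
  - exact: (idl0 hI).
  - exact: (idlD hI).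
  - by rewrite mulrCA; exact: (idlM hI).
by apply: gen_sub; exists (s ++ s'); rewrite ?size_cat ?sN ?sN' ?big_cat.
Qed.

Lemma ipow1 x : presI g x -> ipow 1 x.
Proof.
apply: gen_min => [|_ [j ->]]; first exact: gen_ideal.
by apply: gen_sub; exists [:: j]; rewrite ?big_seq1.
Qed.

(** Pigeonhole: a product of more than m q of the m generators contains some g_j at least q
    times. *)
Lemma ipow_frob N x : (m * q < N)%N -> ipow N x -> presI (fun j => g j ^+ q) x.
Proof.
move=> lt; apply: gen_min => [|_ [s sN ->]]; first exact: gen_ideal.
have [j hj] : exists j, (q <= count_mem j s)%N.
  apply/existsP; apply: contraLR lt; rewrite negb_exists => /forallP h.
  rewrite -leqNgt -sN.
  have -> : size s = (\sum_(j < m) count_mem j s)%N.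
    rewrite -sum1_size (partition_big id predT) //=; apply: eq_bigr => j _.
    by rewrite -big_filter sum1_size size_filter.
  rewrite -[m in (m * q)%N]card_ord -sum_nat_const; apply: leq_sum => j _.
  by have := h j; rewrite -ltnNge => /ltnW.
rewrite (bigID (pred1 j)) /=.
rewrite (eq_bigr (fun=> g j)); last by move=> i /eqP ->.
rewrite big_const_seq iter_mulr_1 -(subnKC hj) exprD -mulrA.
apply: (idlMr (gen_ideal _)); by apply: gen_sub; exists j.
Qed.

Hypothesis q_gt1 : (1 < q)%N.
Variable v : 'I_n -> P.
Hypothesis hs : smooth_lift g v.

Lemma ipow_shift N x : ipow N x -> ipow (2 * N) (shift v x).
Proof.
have hI : idealP (ipow (2 * N)) := gen_ideal _.
move=> hx; apply: (hx (fun x => ipow (2 * N) (shift v x))) => [|_ [s sN ->]].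
  split=> [|a b ha hb|a b hb]; rewrite ?rmorph0 ?rmorphD ?rmorphM.
  - exact: (idl0 hI).
  - exact: (idlD hI).
  - exact: (idlM hI).
elim: s N {x hI hx} sN => [|j s IH] N /= <-.
  by rewrite big_nil rmorph1 muln0; apply: gen_sub; exists [::]; rewrite ?big_nil.
rewrite big_cons rmorphM mulnS; apply: ipowM; last exact: IH.
have [_ h] := hs; have /prodI_genP [w ->] := h j.
have hI : idealP (ipow 2) := gen_ideal _.
apply: (idl_sum hI) => i _; apply: (idl_sum hI) => l _; apply: (idlM hI).
by apply: gen_sub; exists [:: i; l]; rewrite // big_cons big_seq1.
Qed.

(* Flatness of the Frobenius of a smooth algebra over a perfect field: a
   relation a^q h = 0 is transported by the shift into arbitrarily high powers
   of the ideal, hence into its Frobenius power, and the polynomial ring is free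
   over its q-th powers. *)
Lemma smooth_frob_flat a h : presI g (a ^+ q * h) -> exists c : {ffun 'I_n -> 'I_q} -> P,
  (forall f, presI g (a * c f)) /\ presI g (h - \sum_f c f ^+ q * 'X_[resm f]).
Proof.
have hI : idealP (presI g) := gen_ideal _.
move=> h0; have hN N : ipow (2 ^ N) (iter N (shift v) a ^+ q * iter N (shift v) h).
  elim: N => [|N IH]; first exact: ipow1.
  by rewrite expnS !iterS -rmorphXn -rmorphM; apply: ipow_shift.
have lt : (m * q < 2 ^ (m * q))%N by apply: ltn_expl.
pose a' := iter (m * q) (shift v) a; pose h' := iter (m * q) (shift v) h.
have h1 := frob_flat (ipow_frob lt (hN _)).
exists (frob_coef^~ h'); split=> [f|].
  rewrite (_ : _ * _ = a' * frob_coef f h' - (a' - a) * frob_coef f h'); last by rewrite mulrBl subKr.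
  apply: (idlB hI); first exact: h1.
  by apply: (idlMr hI); apply: iter_shift_id.
rewrite -frob_expand -opprB; apply: (idlN hI); exact: iter_shift_id.
Qed.

(** [smooth_frob_flat] with h = 1 writes 1 as a combination of q-th powers of elements that b
    annihilates. *)
Lemma smooth_frob_reduced b : presI g (b ^+ q) -> presI g b.
Proof.
have hI : idealP (presI g) := gen_ideal _.
rewrite -[b ^+ q]mulr1 => /smooth_frob_flat [c [hc h1]].
rewrite -[b]mulr1 -(subrK (\sum_f c f ^+ q * 'X_[resm f]) 1) mulrDr.
apply: (idlD hI); first exact: (idlM hI).
rewrite mulr_sumr; apply: (idl_sum hI) => f _.
rewrite -(prednK q_gt0) exprS !mulrA -mulrA; exact: (idlMr hI).
Qed.

Lemma smooth_reduced b N : presI g (b ^+ N.+1) -> presI g b.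
Proof.
have hI : idealP (presI g) := gen_ideal _.
move=> h; have : presI g (b ^+ (q ^ N.+1)).
  have le : (N.+1 <= q ^ N.+1)%N by apply: ltnW; apply: ltn_expl.
  by rewrite -(subnKC le) exprD; apply: (idlMr hI).
elim: N.+1 => [|j IH]; first by rewrite expn0 expr1.
by rewrite expnSr exprM => /smooth_frob_reduced.
Qed.
End Powers.
End FrobeniusBasis.
End Frobenius.

(** * Reducedness and idempotent annihilators on charts *)

(** Nakayama's argument by elimination of generators: e in J is enlarged until (1 - e) J lies in the
    span of no generator. *)
Lemma idempotent_ideal (R : comNzRingType) (J : R -> Prop) : idealP J -> fgI J ->
  (forall x, J x -> prodI J J x) -> exists2 e, J e & forall x, J x -> x = e * x.
Proof.
move=> hJ [m [r [rJ rgen]]] hJJ; pose g i := nth 0 (codom r) i.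
have gE (i : 'I_m) : g i = r i.
  by rewrite /g codomE (nth_map i) ?size_enum_ord // nth_ord_enum.
suff [e Je he] : exists2 e, J e & forall x, J x -> spans g 0 ((1 - e) * x).
  exists e => // x /he [h]; rewrite big_ord0 mulrBl mul1r => /eqP.
  by rewrite subr_eq0 => /eqP.
have : forall d, (d <= m)%N -> exists2 e, J e & forall x, J x -> spans g (m - d) ((1 - e) * x).
  elim=> [|d IH] lt.
    exists 0; first exact: (idl0 hJ); move=> x /rgen [u ->]; rewrite subn0 subr0 mul1r.
    by exists u; apply: eq_bigr => i _; rewrite gE.
  have [e Je he] := IH (ltnW lt).
  have em : (m - d = (m - d.+1).+1)%N by lia.
  rewrite {}em in he; set n := (m - d.+1)%N in he *.
  have ln : (n < m)%N by rewrite /n; lia.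
  have Jg : J (g n) by rewrite (gE (Ordinal ln)); exact: rJ.
  have hS := spans_ideal g n.
  (* Since g_n lies in J J and (1 - e) J is spanned by the generators up to g_n, modulo the earlier
     ones (1 - e) g_n is a multiple of g_n by an element of J. *)
  have [j Jj hj] : exists2 j, J j & spans g n ((1 - e) * g n - j * g n).
    apply: (hJJ _ Jg (fun y => exists2 j, J j & spans g n ((1 - e) * y - j * g n)))
      => [|_ [x [y [Jx Jy ->]]]].
      split=> [|x y [j Jj hj] [j' Jj' hj']|c x [j Jj hj]].
      - by exists 0; rewrite ?mulr0 ?mul0r ?subr0; [exact: (idl0 hJ) | exact: (idl0 hS)].
      - exists (j + j'); first exact: (idlD hJ).
        by rewrite mulrDr [(j + j') * _]mulrDl opprD addrACA; exact: (idlD hS).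
      - exists (c * j); first exact: (idlM hJ).
        by rewrite mulrCA -mulrA -mulrBr; exact: (idlM hS).
    have [h e1] := he _ Jy; exists (x * h ord_max); first exact: (idlMr hJ).
    rewrite mulrCA e1 big_ord_recr /= mulrDr -!mulrA addrK.
    by exists (fun i => x * h (widen_ord (leqnSn n) i)); rewrite mulr_sumr; apply: eq_bigr => i _; rewrite mulrA.
  (* Chosen so that 1 minus the new element is (1 - e - j)(1 - e): the second factor reduces to the
     span up to g_n, the first removes g_n. *)
  exists (1 - (1 - e - j) * (1 - e)) => [|x Jx].
    have -> : 1 - (1 - e - j) * (1 - e) = e + j + (1 - e - j) * e by ring.
    by apply: (idlD hJ); [exact: (idlD hJ) | exact: (idlM hJ)].
  have [h e1] := he _ Jx; rewrite subKr -mulrA e1 big_ord_recr /= mulrDr.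
  apply: (idlD hS).
    by apply: (idlM hS); exists (fun i => h (widen_ord (leqnSn n) i)).
  by rewrite mulrCA; apply: (idlM hS); rewrite mulrBl.
by move=> /(_ m (leqnn m)); rewrite subnn.
Qed.

Section ChartPresentation.
Variables (k : fieldType) (T : kfunctor k) (zm : kmorph T (GL4 k)).
Implicit Types (A B C D E K R : comUnitAlgType k) (J : pred ('I_4 * 'I_4)) (Om : point_set T).
Hypothesis zm_smooth : formally_smooth zm.

Lemma chart_presentation Om J R (u : T R) U : chart zm Om J u U ->
  exists n (F : {rmorphism {mpoly k[n]} -> R}) m (r : 'I_m -> {mpoly k[n]}) v,
    [/\ forall c, F c%:MP = c%:A, forall a, exists x, F x = a, smooth_lift r v
      & forall P, presI r P <-> F P = 0].
Proof.
move=> hch; have [[zu iu] _ _ _ _ [l hl]] := hch; pose n := size l.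
pose F : {rmorphism {mpoly k[n]} -> R} := mmap (in_alg R) (fun i => nth 0 l i).
have FC c : F c%:MP = c%:A by exact: mmapC.
have Fs a : exists X, F X = a by have [G hG] := hl a; exists G.
have [Y0 hY0] := choice (fun ij : 'I_4 * 'I_4 => Fs (ent zm u ij.1 ij.2)).
pose Y : 'M[{mpoly k[n]}]_4 := \matrix_(i, j) if J (i, j) then 0 else Y0 (i, j).
have [|||m [r [v [hs hp]]]] := @chart_smooth k T zm zm_smooth Om J R u U k n idfun F Y hch (@noeth_field k) FC Fs.
- by move=> i j; rewrite mxE; case: ifP => [hJ|_]; [rewrite rmorph0 zu | exact: hY0].
- by move=> i j hJ; rewrite mxE hJ.
- by move=> D q g qc gY a; rewrite FC hom_alg qc.
by exists n, F, m, r, v.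
Qed.

Variable q : nat.
Hypotheses (q_pchar : [pchar k].-nat q) (q_root : forall c : k, exists d, d ^+ q = c) (q_gt1 : (1 < q)%N).

Lemma chart_reduced Om J R (u : T R) U (a : R) N : chart zm Om J u U -> a ^+ N = 0 -> a = 0.
Proof.
move=> /chart_presentation [n [F [m [r [v [FC Fs hs hp]]]]]].
have [x <-] := Fs a; case: N => [|N]; first by rewrite expr0 => /eqP; rewrite oner_eq0.
rewrite -rmorphXn => /hp h; apply/hp.
exact: (smooth_reduced q_pchar q_root q_gt1 hs h).
Qed.

Lemma chart_noeth Om J R (u : T R) U : chart zm Om J u U -> noeth R.
Proof.
move=> /chart_presentation [n [F [m [r [v [_ Fs _ _]]]]]].
apply: (noeth_im Fs); apply: noeth_mpoly; exact: noeth_field.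
Qed.

(* By flatness of Frobenius the annihilator J of a is generated by its q-th
   powers, so J = J^2: supports of functions on a chart are open and closed. *)
Lemma chart_annihilator Om J R (u : T R) U (a : R) : chart zm Om J u U ->
  exists2 e : R, e * a = 0 & forall b, b * a = 0 -> b = e * b.
Proof.
move=> hch; have [n [F [m [r [v [FC Fs hs hp]]]]]] := chart_presentation hch.
pose N := fun b : R => b * a = 0.
have hN : idealP N.
  split=> [|x y hx hy|c x hx]; first exact: mul0r; first by rewrite /N mulrDl hx hy addr0.
  by rewrite /N -mulrA hx mulr0.
apply: (idempotent_ideal hN); first exact: noeth_fg (chart_noeth hch).
move=> b hb; have [A hA] := Fs a; have [B hB] := Fs b.
have : presI r (A ^+ q * B).
  apply/hp; rewrite rmorphM rmorphXn hA hB -(prednK (q_gt0 q_pchar)) exprSr -mulrA.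
  by rewrite [a * b]mulrC hb mulr0.
case/(smooth_frob_flat q_pchar q_root hs) => c [hc /hp hc'].
have := hc'; rewrite rmorphB hB => /eqP; rewrite subr_eq0 => /eqP ->.
rewrite rmorph_sum; apply: (idl_sum (gen_ideal _)) => f _.
rewrite rmorphM; apply: (idlMr (gen_ideal _)); rewrite rmorphXn.
have Nf : N (F (c f)) by rewrite /N mulrC -hA -rmorphM; apply/hp; exact: hc.
rewrite (_ : q = (q - 2).+2); last by lia.
by rewrite exprS; apply: prodI_mul => //; exact: (idlX hN).
Qed.
End ChartPresentation.

(** * Gluing locally defined functions *)

Section Gluing.
Variable k : fieldType.
Implicit Types A B C D K : comUnitAlgType k.

Lemma eq_local A (a b : A) :
  (forall K (psi : {lrmorphism A -> K}), is_field K -> exists s, psi s != 0 /\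
     forall C (f : {lrmorphism A -> C}), f s \is a GRing.unit -> f a = f b) -> a = b.
Proof.
move=> h; apply/eqP; rewrite -subr_eq0; apply/eqP; apply: eq0_local => K psi hK.
have [s [s0 hs]] := h K psi hK.
have [B [p [[pu _ pk] _ _]]] := @loc_exists k A s (ex_intro _ K (ex_intro _ psi (conj hK s0))).
have [|n hn] := pk (a - b); first by rewrite rmorphB /= hs // subrr.
by exists (s ^+ n); split=> //; rewrite rmorphXn; apply: field_expf_neq0.
Qed.

Lemma unit_field_neq0 A K (psi : {lrmorphism A -> K}) (a : A) : a \is a GRing.unit -> psi a != 0.
Proof. by move=> /(rmorph_unit psi) h; apply: contraTneq h => /= ->; rewrite unitr0. Qed.

Lemma hom_compE A B C (g : {lrmorphism B -> C}) (f : {lrmorphism A -> B}) a : hom_comp g f a = g (f a).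
Proof. by []. Qed.

Variables (X : kfunctor k) (dom : forall A, X A -> Prop) (P : forall A, X A -> A -> Prop).
Hypothesis dom_fmap : forall A B (f : {lrmorphism A -> B}) t, dom t -> dom (fmap f t).
Hypothesis P_fmap : forall A B (f : {lrmorphism A -> B}) t c, P t c -> P (fmap f t) (f c).
Hypothesis P_uniq : forall A (t : X A) c c', dom t -> P t c -> P t c' -> c = c'.
Hypothesis P_local : forall A (t : X A) K (psi : {lrmorphism A -> K}), dom t -> is_field K ->
  exists s, psi s != 0 /\ forall C (f : {lrmorphism A -> C}), f s \is a GRing.unit ->
    exists c, P (fmap f t) c.

Lemma glue_at A (t : X A) : dom t -> exists a, forall C (f : {lrmorphism A -> C}) c, P (fmap f t) c -> f a = c.
Proof.
move=> ht.
(* s has a fraction a/s over D(s). *)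
pose G s a := forall C (f : {lrmorphism A -> C}) c, f s \is a GRing.unit -> P (fmap f t) c -> f s * c = f a.
have hG K (psi : {lrmorphism A -> K}) : is_field K -> exists s, (exists2 a, G s a &
    forall C (f : {lrmorphism A -> C}), f s \is a GRing.unit -> exists c, P (fmap f t) c) /\ psi s != 0.
  move=> hK; have [s [s0 hs]] := P_local psi ht hK.
  have [B [p [[pu ps pk] pl _]]] := @loc_exists k A s (ex_intro _ K (ex_intro _ psi (conj hK s0))).
  have [b hb] := hs B p pu; have [a [n e]] := ps b.
  exists (s ^+ n.+1); split; last by rewrite rmorphXn; apply: field_expf_neq0.
  exists (s * a) => [C f c|C f]; last by rewrite rmorphXn unitrX_pos // => fu; apply: hs.
  rewrite rmorphXn unitrX_pos // => fu hc; have [g hg] := pl C f fu.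
  have -> : c = g b.
    apply: (@P_uniq C (fmap f t)) => //; first exact: dom_fmap.
    have -> : fmap f t = fmap g (fmap p t).
      by rewrite -fmap_comp'; apply: fmap_ext => x; rewrite hom_compE hg.
    exact: P_fmap.
  rewrite rmorphM /= exprS -mulrA; congr (_ * _).
  by rewrite -[f a]hg e rmorphM rmorphXn /= hg mulrC.
have : gen (fun s => exists2 a, G s a &
    forall C (f : {lrmorphism A -> C}), f s \is a GRing.unit -> exists c, P (fmap f t) c) 1.
  apply: (ideal1_field (gen_ideal _)) => K psi hK.
  by have [s [hs s0]] := hG K psi hK; exists s; split=> //; apply: gen_sub.
move=> /gen_finite [n [s [v [hs e1]]]].
have hs' i : exists a, G (s i) a by have [a ha _] := hs i; exists a.
have [a ha] := choice hs'.
have overlap i j : exists M, (s i * s j) ^+ M * (s j * a i - s i * a j) = 0.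
  have [[K [psi [hK h0]]]|nh] := pselect (exists K (psi : {lrmorphism A -> K}), is_field K /\ psi (s i * s j) != 0).
    have [B [p [[pu _ pk] _ _]]] := @loc_exists k A (s i * s j) (ex_intro _ K (ex_intro _ psi (conj hK h0))).
    move: pu; rewrite rmorphM unitrM => /andP [ui uj].
    have [_ _ /(_ B p ui) [c hc]] := hs i.
    apply: pk; rewrite rmorphB !rmorphM /= -(ha i B p c ui hc) -(ha j B p c uj hc).
    by rewrite mulrCA subrr.
  have [N hN] : exists N, (s i * s j) ^+ N = 0.
    by apply: nil_field => K psi hK; apply/eqP; apply: contra_notT nh => h; exists K, psi.
  by exists N; rewrite hN mul0r.
have [M hM] := choice (fun ij : 'I_n * 'I_n => overlap ij.1 ij.2).
pose N := (\max_ij M ij)%N.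
(* With denominators s_i^(N+1) and numerators s_i^N a_i the fractions agree on overlaps exactly, and
   not only up to a power of s_i s_j. *)
have hN i j : s i ^+ N.+1 * (s j ^+ N * a j) = s j ^+ N.+1 * (s i ^+ N * a i).
  apply/esym/eqP; rewrite -subr_eq0.
  have le : (M (i, j) <= N)%N by apply: leq_bigmax.
  rewrite (_ : _ - _ = (s i * s j) ^+ (N - M (i, j)) * ((s i * s j) ^+ M (i, j) * (s j * a i - s i * a j))).
    by rewrite (hM (i, j)) mulr0.
  rewrite [RHS]mulrA -exprD subnK // exprMn !exprS.
  by move: (s i ^+ N) (s j ^+ N) => x y; ring.
have [w hw] : exists w : 'I_n -> A, \sum_i w i * s i ^+ N.+1 = 1.
  have : gen (fun y => exists j, y = s j ^+ N.+1) 1.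
    apply: (ideal1_field (gen_ideal _)) => K psi hK.
    have [i hi] : exists i, psi (s i) != 0.
      apply/existsP; apply: contraT => /existsPn h.
      have : psi 1 = 0.
        rewrite -e1 rmorph_sum big1 // => i _; rewrite rmorphM /=.
        by have /negPn/eqP -> := h i; rewrite mulr0.
      by rewrite rmorph1 => /eqP; rewrite oner_eq0.
    exists (s i ^+ N.+1); split; first by apply: gen_sub; exists i.
    by rewrite rmorphXn; apply: field_expf_neq0.
  by move=> /gen_finP [w e]; exists w.
exists (\sum_i w i * (s i ^+ N * a i)) => C f c hc.
apply: eq_local => K psi hK.
have [i hi] : exists i, psi (f (s i)) != 0.
  apply/existsP; apply: contraT => /existsPn h.
  have : psi (f 1) = 0.
    rewrite -e1 !rmorph_sum big1 // => i _; rewrite !rmorphM /=.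
    by have /negPn/eqP -> := h i; rewrite mulr0.
  by rewrite !rmorph1 => /eqP; rewrite oner_eq0.
exists (f (s i)); split=> // D g gu.
have ua : g (f (s i)) ^+ N.+1 \is a GRing.unit by rewrite unitrX.
apply: (mulrI ua).
have hc' : P (fmap (hom_comp g f) t) (g c) by rewrite fmap_comp'; apply: P_fmap.
have e2 := ha i D (hom_comp g f) (g c) gu hc'; rewrite !hom_compE in e2.
rewrite [in RHS]exprSr -mulrA e2 -rmorphXn -rmorphXn -!rmorphM /=.
have -> : s i ^+ N.+1 * (\sum_j w j * (s j ^+ N * a j)) = s i ^+ N * a i.
  rewrite mulr_sumr -[RHS]mul1r -hw mulr_suml; apply: eq_bigr => j _.
  by rewrite mulrCA hN -[RHS]mulrA.
by rewrite !rmorphM !rmorphXn.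
Qed.

(** P t c says that c is the value at t. Values need only exist locally on Spec A; the glued value
    is pinned down by all its restrictions, and this is what makes it natural. *)
Lemma glue_fun : exists phi : forall A, X A -> A,
  (forall A B (f : {lrmorphism A -> B}) t, dom t -> phi B (fmap f t) = f (phi A t)) /\
  forall A (t : X A) c, dom t -> P t c -> phi A t = c.
Proof.
pose H A (t : X A) a := dom t -> forall C (f : {lrmorphism A -> C}) c, P (fmap f t) c -> f a = c.
(* Outside [dom] the value 0 is taken by default. *)
have hH A (t : X A) : exists a, H A t a.
  by have [/glue_at [a ha]|n] := pselect (dom t); [exists a => _ | exists 0 => /n].
exists (fun A t => projT1 (cid (hH A t))); split=> [A B f t ht|A t c ht hc].
  case: cid => b /= /(_ (dom_fmap f ht)) hb; case: cid => a /= /(_ ht) ha.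
  apply: eq_local => K psi hK; have [s [s0 hs]] := P_local psi (dom_fmap f ht) hK.
  exists s; split=> // C g /hs [c hc]; rewrite (hb _ _ _ hc).
  by rewrite -[g (f a)]/(hom_comp g f a) (ha C _ c) // fmap_comp'.
case: cid => a /= /(_ ht) ha; have := ha A idfun c; rewrite fmap_id'; exact.
Qed.

End Gluing.

(** * The locus near which a function vanishes *)

Section Vanishing.
Variables (k : fieldType) (T : kfunctor k) (zm : kmorph T (GL4 k)) (q : nat).
Implicit Types (A B C D E K R : comUnitAlgType k) (J : pred ('I_4 * 'I_4)) (Om U V : point_set T).
Hypothesis zm_smooth : smooth_morphism zm.
Hypotheses (q_pchar : [pchar k].-nat q) (q_root : forall c : k, exists d, d ^+ q = c) (q_gt1 : (1 < q)%N).

Definition natural Om J (phi : forall A, T A -> A) :=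
  forall A B (f : {lrmorphism A -> B}) t, tmem zm Om J t -> phi B (fmap f t) = f (phi A t).

(* phi vanishes in a neighbourhood of t. *)
Definition vanish Om J (phi : forall A, T A -> A) : point_set T := fun K t =>
  exists U, [/\ p_open U, U K t & forall A (y : T A), tmem zm Om J y -> inside U y -> phi A y = 0].

Lemma open_local U A (t : T A) K (psi : {lrmorphism A -> K}) : p_open U -> is_field K -> U K (fmap psi t) ->
  exists s, psi s != 0 /\ forall C (f : {lrmorphism A -> C}), f s \is a GRing.unit -> inside U (fmap f t).
Proof.
move=> hU hK h; have [s [s0 hs]] := hU A t K psi hK h.
exists s; split=> // C f fs K' psi' hK'; rewrite -fmap_comp'; apply: hs => //.
exact: (unit_field_neq0 psi' fs).
Qed.

Lemma chart_point Om J R (u : T R) U K (t : T K) : chart zm Om J u U -> is_field K -> tmem zm Om J t -> U K t ->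
  exists th : {lrmorphism R -> K}, fmap th u = t.
Proof. by move=> h hK ht Ut; apply: (ch_rep h) => //; apply: inside_point (ch_open h) hK Ut. Qed.

Lemma chart_local Om J R (u : T R) U A (t : T A) K (psi : {lrmorphism A -> K}) :
  chart zm Om J u U -> tmem zm Om J t -> is_field K -> U K (fmap psi t) ->
  exists s, psi s != 0 /\ forall C (f : {lrmorphism A -> C}), f s \is a GRing.unit ->
    exists th : {lrmorphism R -> C}, fmap th u = fmap f t.
Proof.
move=> h ht hK Ut; have [s [s0 hs]] := open_local (ch_open h) hK Ut.
by exists s; split=> // C f fs; apply: (ch_rep h); [apply: tmem_fmap | apply: hs].
Qed.

(** The implication adds the complement of the closed locus T_J, so a set that is open relative to
    T_J becomes open in T. The witness is lifted from the quotient by the ideal of T_J, or is an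
    entry nonzero at the point. *)
Lemma p_open_closed J (Q : point_set T) :
  (forall A (t : T A) K (psi : {lrmorphism A -> K}), zeroes zm J t -> is_field K -> Q K (fmap psi t) ->
     exists s, psi s != 0 /\ forall K' (psi' : {lrmorphism A -> K'}), is_field K' -> psi' s != 0 ->
       Q K' (fmap psi' t)) ->
  p_open (fun K t => zeroes zm J t -> Q K t).
Proof.
move=> h A t K psi hK hQ.
have [z|nz] := pselect (zeroes zm J (fmap psi t)); last first.
  have [i [j [hij n0]]] : exists i j, J (i, j) /\ psi (ent zm t i j) != 0.
    apply: contrapT => n; apply: nz => i j hij; rewrite ent_fmap; apply/eqP.
    by apply: contra_notT n => n0; exists i, j.
  exists (ent zm t i j); split=> // K' psi' hK' /eqP n1 /(_ i j hij).
  by rewrite ent_fmap.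
pose I := gen (fun a => exists i j, J (i, j) /\ a = ent zm t i j).
have kI B (f : {lrmorphism A -> B}) : zeroes zm J (fmap f t) -> forall a, I a -> f a = 0.
  move=> zf a ha; apply: (ha (fun a => f a = 0)) => [|_ [i [j [hij ->]]]].
    split=> [|x y hx hy|c x hx]; first exact: rmorph0.
      by rewrite rmorphD /= hx hy addr0.
    by rewrite rmorphM /= hx mulr0.
  by rewrite -ent_fmap zf.
have I1 : ~ I 1 by move=> /(kI K psi z) /eqP; rewrite rmorph1 oner_eq0.
have [B [p [psurj pker pfac]]] := @qalg_exists k A I (gen_ideal _) I1.
have [g hg] := pfac K psi (kI K psi z).
have gp : fmap psi t = fmap g (fmap p t) by rewrite -fmap_comp'; apply: fmap_ext => x; rewrite hom_compE hg.
have zp : zeroes zm J (fmap p t).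
  by move=> i j hij; rewrite ent_fmap; apply/pker; apply: gen_sub; exists i, j.
have [|s [s0 hs]] := h B (fmap p t) K g zp hK; first by rewrite -gp; exact: hQ.
have [a ha] := psurj s; exists a; split=> [|K' psi' hK' n0 z']; first by rewrite -hg ha.
have [g' hg'] := pfac K' psi' (kI K' psi' z').
have -> : fmap psi' t = fmap g' (fmap p t) by rewrite -fmap_comp'; apply: fmap_ext => x; rewrite hom_compE hg'.
by apply: hs => //; rewrite -ha hg'.
Qed.

(* The last clause repeats the first two to be open by itself. *)
Definition chart_locus Om J R (u : T R) U (s : R) : point_set T := fun K y => Om K y /\ (U K y /\
  (zeroes zm J y -> [/\ Om K y, U K y & forall th : {lrmorphism R -> K}, fmap th u = y -> th s != 0])).

Lemma chart_open Om J R (u : T R) U (s : R) : p_open Om -> chart zm Om J u U -> p_open (chart_locus Om J u U s).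
Proof.
move=> hOm hch; apply: p_openI => //; apply: (p_openI (ch_open hch)).
apply: p_open_closed => A t K psi zt hK [hO hU hs].
have [a [a0 ha]] := open_local hOm hK hO.
have [b [b0 hb]] := open_local (ch_open hch) hK hU.
have ab0 : psi (a * b) != 0 by rewrite rmorphM; apply: field_mulf_neq0.
have [B [p [[pu psurj pker] pl _]]] := @loc_exists k A (a * b) (ex_intro _ K (ex_intro _ psi (conj hK ab0))).
move: (pu); rewrite rmorphM unitrM => /andP [ua ub].
have mp : tmem zm Om J (fmap p t) by split; [exact: zeroes_fmap | exact: ha].
have [th hth] := ch_rep hch mp (hb B p ub).
have [c [n hc]] := psurj (th s).
have fac K' (psi' : {lrmorphism A -> K'}) : is_field K' -> psi' (a * b) != 0 ->
    exists g : {lrmorphism B -> K'}, psi' c = g (th s) * psi' (a * b) ^+ n /\ fmap g (fmap p t) = fmap psi' t.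
  move=> hK' n0; have [g hg] := pl K' psi' (hK' _ n0); exists g; split.
    by rewrite -hg hc rmorphM rmorphXn; congr (_ * _ ^+ _); exact: hg.
  by rewrite -fmap_comp'; apply: fmap_ext => x; rewrite hom_compE hg.
exists (a * b * c); split=> [|K' psi' hK' n0].
  have [g [hg eg]] := fac K psi hK ab0.
  have -> : psi (a * b * c) = psi (a * b) * (g (th s) * psi (a * b) ^+ n) by rewrite -hg; exact: rmorphM.
  apply: field_mulf_neq0 => //; apply: field_mulf_neq0 => //; last exact: field_expf_neq0.
  by rewrite -[g _]/(hom_comp g th s); apply: hs; rewrite fmap_comp' hth.
have n1 : psi' (a * b) != 0 by apply: contraNneq n0 => e; rewrite rmorphM /= e mul0r.
have [g [hg eg]] := fac K' psi' hK' n1.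
split.
- by apply: inside_field => //; rewrite -eg; apply: inside_fmap; apply: ha.
- by apply: inside_field => //; rewrite -eg; apply: inside_fmap; apply: hb.
move=> th' hth'; have -> : th' s = g (th s).
  by rewrite -[g _]/(hom_comp g th s); apply: (ch_ext hch); rewrite fmap_comp' hth hth'.
apply: contraNneq n0 => e; apply/eqP; transitivity (psi' (a * b) * psi' c); first exact: rmorphM.
by rewrite hg e mul0r mulr0.
Qed.

Section OnCharts.
Variables (Om : point_set T) (J : pred ('I_4 * 'I_4)) (phi : forall A, T A -> A).
Hypothesis hOm : p_open Om.
Hypothesis hphi : natural Om J phi.

Lemma vanish_chart R (u : T R) U K (t : T K) (th : {lrmorphism R -> K}) : chart zm Om J u U -> is_field K ->
  U K t -> fmap th u = t -> vanish Om J phi t <-> exists s, th s != 0 /\ s * phi u = 0.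
Proof.
move=> hch hK Ut eth; have [zu iu] := ch_mem hch; split.
  case=> V [Vo Vt hV]; have [|s [s0 hs]] := @open_local V R u K th Vo hK; first by rewrite eth.
  have [B [p [[pu _ pk] _ _]]] := @loc_exists k R s (ex_intro _ K (ex_intro _ th (conj hK s0))).
  have := hV B (fmap p u) (tmem_fmap p (ch_mem hch)) (hs B p pu).
  rewrite hphi; last exact: (ch_mem hch); move=> /pk [n hn].
  by exists (s ^+ n); split=> //; rewrite rmorphXn; apply: field_expf_neq0.
case=> s [s0 hs]; exists (chart_locus Om J u U s).
have Ot : Om t by rewrite -eth; apply: iu.
split; first exact: chart_open.
  split=> //; split=> // _; split=> // th' e'.
  suff -> : th' s = th s by [].
  by apply: (ch_ext hch); rewrite e' eth.
move=> A y hy hV.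
have [|f hf] := ch_rep hch hy; first by move=> K' psi hK'; have [_ []] := hV K' psi hK'.
rewrite -hf hphi; last exact: (ch_mem hch).
have fu : f s \is a GRing.unit.
  apply: unit_field => K' psi hK'; have [_ [_ h]] := hV K' psi hK'.
  have [_ _ h'] := h (zeroes_fmap psi (proj1 hy)).
  by rewrite -[psi _]/(hom_comp psi f s); apply: h'; rewrite fmap_comp' hf.
apply: (mulrI fu); rewrite -rmorphM /= hs rmorph0 mulr0 //.
Qed.

Lemma vanish_ext K K' (f : {lrmorphism K -> K'}) (t : T K) : is_field K -> is_field K' -> tmem zm Om J t ->
  vanish Om J phi (fmap f t) <-> vanish Om J phi t.
Proof.
move=> hK hK' mt; split; last first.
  by case=> V [Vo Vt hV]; exists V; split=> //; apply: p_open_ext.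
have [R [u [U [hch Ut]]]] := chart_exists (proj2 zm_smooth) hOm hK mt.
have [th eth] := chart_point hch hK mt Ut.
have Uft : U K' (fmap f t) by apply: p_open_ext => //; exact: (ch_open hch).
move=> /(@vanish_chart R u U K' (fmap f t) (hom_comp f th) hch hK' Uft) [|s [s0 hs]].
  by rewrite fmap_comp' eth.
apply/(vanish_chart hch hK Ut eth); exists s; split=> //.
by apply: contraNneq s0 => e; rewrite hom_compE e rmorph0.
Qed.

(** The annihilator of phi on a chart is generated by an idempotent e, so near a point where phi is
    not locally 0 the function 1 - e is nonzero, and this prevents local vanishing. Local vanishing
    is open by definition. *)
Lemma vanish_locally_constant K (t : T K) : is_field K -> tmem zm Om J t ->
  exists V, [/\ p_open V, V K t & forall K' (y : T K'), is_field K' -> tmem zm Om J y -> V K' y ->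
    (vanish Om J phi y <-> vanish Om J phi t)].
Proof.
move=> hK mt.
have [R [u [U [hch Ut]]]] := chart_exists (proj2 zm_smooth) hOm hK mt.
have [th eth] := chart_point hch hK mt Ut.
have [nt|nn] := pselect (vanish Om J phi t).
  by have [V [Vo Vt hV]] := nt; exists V; split=> // K' y hK' my Vy; split=> // _; exists V.
have [e ea he] := chart_annihilator (proj1 zm_smooth) q_pchar q_root q_gt1 (phi u) hch.
pose V := chart_locus Om J u U (1 - e).
have thE K' (th' : {lrmorphism R -> K'}) s : is_field K' -> s * phi u = 0 -> th' s != 0 -> th' (1 - e) = 0.
  move=> hK' /he es s0; apply: (@field_mul0 k K' _ _ hK' s0).
  by rewrite -rmorphM mulrBr mulr1 mulrC -es subrr rmorph0.
have [_ iu] := ch_mem hch.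
have te : th (1 - e) != 0.
  rewrite rmorphB rmorph1 subr_eq0; apply: contra_notN nn => /eqP e1.
  by apply/(vanish_chart hch hK Ut eth); exists e; rewrite -e1 oner_eq0.
exists V; split.
- exact: chart_open.
- split; first by rewrite -eth; apply: iu.
  split=> // _; split=> //; first by rewrite -eth; apply: iu.
  move=> th' e'; suff -> : th' (1 - e) = th (1 - e) by [].
  by apply: (ch_ext hch); rewrite e' eth.
move=> K' y hK' my [Oy [Uy /(_ (proj1 my)) [_ _ hy]]]; split=> // vy; exfalso.
have [th' eth'] := chart_point hch hK' my Uy.
have [s [s0 hs]] := (iffLR (vanish_chart hch hK' Uy eth') vy).
by have := hy th' eth'; rewrite (thE K' th' s hK' hs s0) eqxx.
Qed.

Lemma vanish_all A (t : T A) : tmem zm Om J t ->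
  (forall K (psi : {lrmorphism A -> K}), is_field K -> vanish Om J phi (fmap psi t)) -> phi t = 0.
Proof.
move=> mt h; apply: eq_local => K psi hK; have [V [Vo Vt hV]] := h K psi hK.
have [s [s0 hs]] := open_local Vo hK Vt; exists s; split=> // C f fu.
rewrite rmorph0 -hphi //; apply: hV; [exact: tmem_fmap | exact: hs].
Qed.

End OnCharts.
End Vanishing.

(** * The zip group and the flag group in matrix entries *)

Section ZipGroup.
Variables (k : fieldType) (q : nat).
Implicit Types A B C K : comUnitAlgType k.
Hypothesis q_pchar : [pchar k].-nat q.

Lemma algD A (x y : A) : (x + y) ^+ q = x ^+ q + y ^+ q.
Proof. exact: (frobD q_pchar (in_alg A)). Qed.

Lemma ord4_ind (P : 'I_4 -> Prop) : P 0 -> P 1 -> P 2%:R -> P 3%:R -> forall i, P i.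
Proof.
move=> h0 h1 h2 h3 [[|[|[|[|//]]]] h]; [move: h0|move: h1|move: h2|move: h3];
  by congr P; apply/val_inj.
Qed.

Lemma sum4 (V : nmodType) (F : 'I_4 -> V) : \sum_i F i = F 0 + (F 1 + (F 2%:R + F 3%:R)).
Proof.
rewrite !big_ord_recl big_ord0 addr0; congr (_ + (_ + (_ + _)));
  by congr F; apply/val_inj.
Qed.

Lemma det_mu (R : comNzRingType) : \det (mu 'X) = 'X^3 :> {poly R}.
Proof. by rewrite det_diag !big_ord_recl big_ord0 !mxE /= !mulr1. Qed.

Lemma mulX3I (R : comNzRingType) (r s : {poly R}) : 'X^3 * r = 'X^3 * s -> r = s.
Proof.
move=> /polyP h; apply/polyP => i; have := h (3 + i)%N.
by rewrite !coefXnM ltnNge leq_addr /= addKn.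
Qed.

Lemma det_extends A (x : 'M[A]_4) (p : 'M[{poly A}]_4) : x \in unitmx ->
  \det (mu 'X) * \det p = \det (mu 'X) * \det (map_mx polyC x) -> invertible_mx p.
Proof.
rewrite det_mu => xu /mulX3I dE; pose d : {poly A} := ((\det x)^-1)%:P.
have du : d * \det p = 1 by rewrite dE det_map_mx -polyCM mulVr -?unitmxE // polyC1.
exists (d *: \adj p); split.
  by rewrite -scalemxAr mul_mx_adj scale_scalar_mx du.
by rewrite -scalemxAl mul_adj_mx scale_scalar_mx du.
Qed.

Lemma mul_muE (R : nzRingType) (x : 'M[R]_4) t i j : (x *m mu t) i j = x i j * (if (j < 3)%N then t else 1).
Proof. by rewrite /mu mul_mx_diag !mxE. Qed.

Lemma mu_mulE (R : nzRingType) (x : 'M[R]_4) t i j : (mu t *m x) i j = (if (i < 3)%N then t else 1) * x i j.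
Proof. by rewrite /mu mul_diag_mx !mxE. Qed.

(* The Levi components are the upper left block and the last diagonal entry. *)
Definition zip_entries A (e : 'M[A]_4 * 'M[A]_4) :=
  [/\ e.1 \in unitmx, e.2 \in unitmx,
      forall i : 'I_4, (i < 3)%N -> e.1 i 3%:R = 0 /\ e.2 3%:R i = 0,
      forall i j : 'I_4, (i < 3)%N -> (j < 3)%N -> e.2 i j = e.1 i j ^+ q
    & e.2 3%:R 3%:R = e.1 3%:R 3%:R ^+ q].

(** A constant divisible by the variable t is 0, which gives the vanishing blocks of P and Q; the
    remaining entries of the extensions are constant on the Levi blocks, so evaluation at t = 0
    reads them off. *)
Lemma zip_groupP A (e : 'M[A]_4 * 'M[A]_4) : zip_group q e <-> zip_entries e.
Proof.
have q0 := q_gt0 q_pchar.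
have c0 (a : A) (p : {poly A}) : a%:P = 'X * p -> a = 0.
  by move=> /polyP /(_ 0%N); rewrite coefXM coefC eqxx.
have ord3 (i : 'I_4) : (i < 3)%N || (i == 3%:R) by elim/ord4_ind: i.
split=> [[u1 u2 [p [r [[_ hp] [_ hr] hE]]]]|[u1 u2 h3 hq hq3]].
  have hp' (i j : 'I_4) : (e.1 i j)%:P * (if (j < 3)%N then 'X else 1) = (if (i < 3)%N then 'X else 1) * p i j.
    by have /matrixP/(_ i j) := hp; rewrite mul_muE mu_mulE mxE.
  have hr' (i j : 'I_4) : (if (i < 3)%N then 'X else 1) * (e.2 i j)%:P = r i j * (if (j < 3)%N then 'X else 1).
    by have /matrixP/(_ i j) := hr; rewrite mul_muE mu_mulE mxE.
  have hE' (i j : 'I_4) : (p i j).[0] ^+ q = (r i j).[0] by have /matrixP/(_ i j) := hE; rewrite !mxE.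
  have XI (a b : {poly A}) : 'X * a = 'X * b -> a = b.
    by move=> /polyP h; apply/polyP => i; have := h i.+1; rewrite !coefXM.
  split=> // [i i3|i j i3 j3|].
  - split.
      by have := hp' i 3%:R; rewrite i3 /= mulr1 => /c0.
    by have := hr' 3%:R i; rewrite i3 /= mul1r mulrC => /c0.
  - have := hp' i j; rewrite i3 j3 mulrC => /XI e1.
    have := hr' i j; rewrite i3 j3 [RHS]mulrC => /XI e2.
    by have := hE' i j; rewrite -e1 -e2 !hornerC.
  - have := hp' 3%:R 3%:R; rewrite /= mulr1 mul1r => e1.
    have := hr' 3%:R 3%:R; rewrite /= mulr1 mul1r => e2.
    by have := hE' 3%:R 3%:R; rewrite -e1 -e2 !hornerC.
pose t (i : 'I_4) : {poly A} := if (i < 3)%N then 'X else 1.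
pose p : 'M[{poly A}]_4 := \matrix_(i, j) if (i < 3)%N then (e.1 i j)%:P else (e.1 i j)%:P * t j.
pose r : 'M[{poly A}]_4 := \matrix_(i, j) if (j < 3)%N then (e.2 i j)%:P else t i * (e.2 i j)%:P.
have ep : map_mx polyC e.1 *m mu 'X = mu 'X *m p.
  apply/matrixP => i j; rewrite mul_muE mu_mulE !mxE /t.
  case: ifP => hj; case: ifP => hi; rewrite ?mul1r ?mulr1 ?[_ * 'X]mulrC //.
  have /h3 [e0 _] := hi; have /orP := ord3 j; rewrite hj => -[//|/eqP ->].
  by rewrite e0 polyC0 mulr0.
have er : mu 'X *m map_mx polyC e.2 = r *m mu 'X.
  apply/matrixP => i j; rewrite mul_muE mu_mulE !mxE /t.
  case: ifP => hi; case: ifP => hj; rewrite ?mul1r ?mulr1 ?[_ * 'X]mulrC //.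
  have /h3 [_ e0] := hj; have /orP := ord3 i; rewrite hi => -[//|/eqP ->].
  by rewrite e0 polyC0 mulr0.
split=> //; exists p, r; split.
- by split=> //; apply: (det_extends u1); rewrite -det_mulmx -ep det_mulmx mulrC.
- by split=> //; apply: (det_extends u2); rewrite [LHS]mulrC -!det_mulmx -er.
apply/matrixP => i j; rewrite !mxE /t.
have [hi|hi] := boolP (i < 3)%N; have [hj|hj] := boolP (j < 3)%N; rewrite ?hornerM ?hornerX ?mulr0 ?mul0r ?hornerC.
- by rewrite hq.
- have /orP := ord3 j; rewrite (negbTE hj) => -[//|/eqP ->].
  by rewrite (h3 i hi).1 expr0n (gtn_eqF q0).
- by rewrite expr0n (gtn_eqF q0); have /orP := ord3 i; rewrite (negbTE hi) => -[//|/eqP ->]; rewrite (h3 j hj).2.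
- have /orP := ord3 i; rewrite (negbTE hi) => -[//|/eqP ->].
  have /orP := ord3 j; rewrite (negbTE hj) => -[//|/eqP ->].
  by rewrite ?mulr1 ?mul1r hq3.
Qed.

Lemma zip_fmap A B (f : {lrmorphism A -> B}) (e : 'M[A]_4 * 'M[A]_4) :
  zip_group q e -> zip_group q (map_mx f e.1, map_mx f e.2).
Proof.
move=> /zip_groupP [u1 u2 h3 hq hq3]; apply/zip_groupP; split=> /= [||i i3|i j i3 j3|].
- exact: Defs.map_mx_unit.
- exact: Defs.map_mx_unit.
- by have [a b] := h3 i i3; rewrite !mxE a b rmorph0.
- by rewrite !mxE hq // rmorphXn.
- by rewrite !mxE hq3 // rmorphXn.
Qed.

Lemma flag_fmap A B (f : {lrmorphism A -> B}) (e : 'M[A]_4 * 'M[A]_4) :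
  flag_group q e -> flag_group q (map_mx f e.1, map_mx f e.2).
Proof.
case=> h /andP [u /is_trig_mxP tr]; split; first exact: zip_fmap.
apply/andP; split; first exact: Defs.map_mx_unit.
by apply/is_trig_mxP => i j lt; rewrite mxE tr // rmorph0.
Qed.

Lemma zip_mul A (e e' : 'M[A]_4 * 'M[A]_4) : zip_group q e -> zip_group q e' ->
  zip_group q (e.1 *m e'.1, e.2 *m e'.2).
Proof.
move=> /zip_groupP [u1 u2 h3 hq hq3] /zip_groupP [u1' u2' h3' hq' hq3']; apply/zip_groupP.
split=> /= [||i i3|i j i3 j3|]; rewrite ?unitmx_mul ?u1 ?u2 //.
- rewrite !mxE !sum4 (h3 i i3).1 (h3' i i3).2 (h3 0 isT).2 (h3 1 isT).2 (h3 2%:R isT).2.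
  by rewrite (h3' 0 isT).1 (h3' 1 isT).1 (h3' 2%:R isT).1 !(mulr0, mul0r, addr0).
- rewrite !mxE !sum4 (h3' j j3).2 (h3 i i3).1 !(mulr0, mul0r, addr0) !algD !exprMn.
  by rewrite !hq ?hq'.
- rewrite !mxE !sum4 (h3 0 isT).2 (h3 1 isT).2 (h3 2%:R isT).2.
  by rewrite (h3' 0 isT).1 (h3' 1 isT).1 (h3' 2%:R isT).1 !(mulr0, mul0r, add0r) exprMn hq3 hq3'.
Qed.

Lemma flag_mul A (e e' : 'M[A]_4 * 'M[A]_4) : flag_group q e -> flag_group q e' ->
  flag_group q (e.1 *m e'.1, e.2 *m e'.2).
Proof.
case=> h /andP [u tr] [h' /andP [u' tr']]; split; first exact: zip_mul.
apply/andP; split; first by rewrite unitmx_mul u u'.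
apply/is_trig_mxP => i j lt; rewrite mxE big1 // => l _.
have [le|le] := leqP l i; last by rewrite (is_trig_mxP tr) ?mul0r.
by rewrite (is_trig_mxP tr') ?mulr0 //; apply: leq_ltn_trans lt.
Qed.

End ZipGroup.

(** * The generic element of E' *)

Section UniversalFlagElement.
Variables (k : fieldType) (q : nat).
Implicit Types A B C K : comUnitAlgType k.
Hypothesis q_pchar : [pchar k].-nat q.

(* The element of E' whose first component is the lower triangular part of Z;
   the remaining entries of the second component are those of Z above the
   diagonal. *)
Definition flag_elt (R : comNzRingType) (Z : 'M[R]_4) : 'M[R]_4 * 'M[R]_4 :=
  (\matrix_(i, j) if (j <= i)%N then Z i j else 0,
   \matrix_(i, j) if (j < 3)%N then (if (j <= i < 3)%N then Z i j ^+ q else 0)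
                   else if (i < 3)%N then Z i j else Z i j ^+ q).

Lemma flag_elt_map (R S : comNzRingType) (f : {rmorphism R -> S}) (Z : 'M[R]_4) :
  flag_elt (map_mx f Z) = (map_mx f (flag_elt Z).1, map_mx f (flag_elt Z).2).
Proof.
congr (_, _); apply/matrixP => i j; rewrite !mxE; first by case: ifP; rewrite ?rmorph0.
by do ! case: ifP => _; rewrite ?rmorph0 ?rmorphXn.
Qed.

Lemma flag_eltP A (e : 'M[A]_4 * 'M[A]_4) : flag_group q e ->
  exists Z, flag_elt Z = e /\ forall i, Z i i = e.1 i i.
Proof.
case=> /(zip_groupP q_pchar) [u1 u2 h3 hq hq3] /andP [_ /is_trig_mxP tr].
exists (\matrix_(i, j) if (j <= i)%N then e.1 i j else e.2 i j); split=> [|i]; last by rewrite mxE leqnn.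
rewrite [RHS]surjective_pairing; congr (_, _); apply/matrixP => i j; rewrite !mxE.
  by case: leqP => // h; rewrite tr.
have [j3|j3] := boolP (j < 3)%N.
  have [i3|i3] := boolP (i < 3)%N; last first.
    rewrite andbF; have -> : i = 3%:R by apply/val_inj; move: i3 (ltn_ord i) => /=; lia.
    by rewrite (h3 j j3).2.
  rewrite andbT hq //; case: leqP => // h; rewrite tr // expr0n gtn_eqF //; exact: q_gt0 q_pchar.
have -> : j = 3%:R by apply/val_inj; move: j3 (ltn_ord j) => /=; lia.
have [i3|i3] := boolP (i < 3)%N; first by rewrite leqNgt i3.
have -> : i = 3%:R by apply/val_inj; move: i3 (ltn_ord i) => /=; lia.
by rewrite leqnn hq3.
Qed.

Lemma flag_elt_group A (Z : 'M[A]_4) : (forall i, Z i i \is a GRing.unit) -> flag_group q (flag_elt Z).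
Proof.
move=> hZ.
have tr1 : is_trig_mx (flag_elt Z).1.
  by apply/is_trig_mxP => i j lt; rewrite mxE leqNgt lt.
have u1 : (flag_elt Z).1 \in unitmx.
  by rewrite unitmxE det_trig // big_ord_recl !big_ord_recl big_ord0 !mxE !leqnn !unitrM !hZ unitr1.
split; last by apply/andP.
apply/(zip_groupP q_pchar); split=> // [|i i3|i j i3 j3|].
- rewrite unitmxE (expand_det_row _ 3%:R) sum4 !mxE /= !mul0r !add0r unitrM unitrX ?hZ //=.
  rewrite /cofactor unitrM unitrX ?unitrN1 //= det_trig.
    rewrite !big_ord_recl big_ord0 !mxE /= !unitrM !unitrX ?unitr1 //.
  apply/is_trig_mxP => i j lt; rewrite !mxE !lift_max ltn_ord /= leqNgt.
  by rewrite lt.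
- split; last by rewrite !mxE i3 andbF.
  by rewrite mxE ifN // -ltnNge.
- by rewrite !mxE j3 i3 andbT; case: leqP => // _; rewrite expr0n gtn_eqF //; exact: q_gt0 q_pchar.
- by rewrite !mxE /=.
Qed.

Section Universal.
Variable A : comUnitAlgType k.
Local Notation S := {mpoly A[4 * 4]}.

Let var (i j : 'I_4) : S := 'X_(mxvec_index i j).
Let d : S := \prod_i var i i.
Let iotaS : {rmorphism k -> S} := @mpolyC (4 * 4) A \o in_alg A.

Lemma mpolyX_nzd i (P : S) : 'X_i * P = 0 -> P = 0.
Proof.
move=> /mpolyP h; apply/mpolyP => mo; have := h (U_(i) + mo)%MM.
by rewrite mulrC mcoeffMX !mcoeff0.
Qed.

Let d_nzd n (P : S) : d ^+ n * P = 0 -> P = 0.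
Proof.
elim: n P => [|n IH] P; first by rewrite expr0 mul1r.
rewrite exprSr -mulrA => /IH; rewrite /d !big_ord_recl big_ord0 mulr1 -!mulrA.
by do 4! move=> /mpolyX_nzd.
Qed.

Let d_nnil n : d ^+ n != 0.
Proof.
apply/eqP => e; have /eqP := @d_nzd n 1 (etrans (mulr1 _) e).
by rewrite oner_eq0.
Qed.

Lemma unit_factor B (x y : B) : x * y \is a GRing.unit -> x \is a GRing.unit.
Proof. by rewrite unitrM => /andP []. Qed.

(** B is a polynomial ring over A with the diagonal variables inverted, and Z is the generic matrix.
    The family c lists the coefficients of a numerator of b: through it, relations over B are
    brought back to A, and a point at which b is nonzero has some c_i nonzero. *)
Lemma universal_flag_elt : exists B (io : {lrmorphism A -> B}) (Z : 'M[B]_4),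
  [/\ forall i, Z i i \is a GRing.unit,
      forall C (f : {lrmorphism A -> C}) (Z' : 'M[C]_4), (forall i, Z' i i \is a GRing.unit) ->
        exists g : {lrmorphism B -> C}, (forall a, g (io a) = f a) /\ map_mx g Z = Z'
    & forall b : B, exists (I : Type) (c : I -> A),
        [/\ forall z, io z * b = 0 -> forall i, z * c i = 0, (forall i, c i = 0) -> b = 0
          & forall C (g : {lrmorphism B -> C}), g b != 0 -> exists i, g (io (c i)) != 0]].
Proof.
pose B := loc iotaS d_nnil.
pose lam : {rmorphism S -> B} := locmap iotaS d_nnil.
have lamu : lam d \is a GRing.unit by exact: locmap_unit.
pose io0 (a : A) : B := lam a%:MP.
have ioB : zmod_morphism io0 by move=> x y; rewrite /io0 !rmorphB.
have ioM : monoid_morphism io0 by split=> [|x y]; rewrite /io0 ?rmorph1 ?rmorphM.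
have ioZ c : io0 c%:A = c%:A by exact: (locmap_alg iotaS d_nnil c).
pose io : {lrmorphism A -> B} := mkhom ioB ioM ioZ.
have ioE a : io a = lam a%:MP by [].
pose Z : 'M[B]_4 := \matrix_(i, j) lam (var i j).
exists B, io, Z; split.
- move=> i; have e : d = var i i * \prod_(j | j != i) var j j by rewrite /d (bigD1 i).
  have e1 : lam d = lam (var i i) * lam (\prod_(j | j != i) var j j).
    by rewrite {1}e; exact: rmorphM.
  have : lam (var i i) * lam (\prod_(j | j != i) var j j) \is a GRing.unit by rewrite -e1.
  by move/unit_factor; rewrite mxE.
- move=> C f Z' uZ'.
  pose F : {rmorphism S -> C} := mmap f (fun x => mxvec Z' 0 x).
  have FC a : F a%:MP = f a by exact: mmapC.
  have FX i j : F (var i j) = Z' i j by rewrite -[RHS]mxvecE; exact: mmap_Xi.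
  have [||g hg] := @loc_hom k S iotaS d d_nnil C F.
  + by move=> c; rewrite FC hom_alg.
  + by rewrite /d rmorph_prod; apply: rpred_prod => i _; rewrite FX.
  exists g; split=> [a|]; first by rewrite ioE -FC; exact: hg.
  by apply/matrixP => i j; rewrite !mxE -FX; exact: hg.
move=> b; have [P [n hP]] : exists c n, lam c = b * lam d ^+ n by exact: locmap_surj.
have lam0 Q : lam Q = 0 -> Q = 0.
  move=> h; have [l hl] : exists n, d ^+ n * Q = 0 by exact: (locmap_ker h).
  exact: d_nzd hl.
exists 'X_{1..4 * 4}, (fun mo => P@_mo); split.
- move=> z e mo; suff : z%:MP * P = 0 by move=> /(congr1 (mcoeff mo)); rewrite mcoeffCM mcoeff0.
  by apply: lam0; rewrite rmorphM hP mulrA -ioE e mul0r.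
- move=> h; have P0 : P = 0.
    by apply/mpolyP => mo; rewrite h mcoeff0.
  apply: (mulIr (_ : lam d ^+ n \is a GRing.unit)); first by rewrite unitrX.
  by rewrite -hP P0 rmorph0 mul0r.
move=> C g; apply: contraNP => h; apply/eqP.
have gu : g (lam d ^+ n) \is a GRing.unit by apply: rmorph_unit; rewrite unitrX.
apply: (mulIr gu); rewrite -rmorphM -hP mul0r.
rewrite [P]mpolyE !rmorph_sum big1 // => mo _.
transitivity (g (io P@_mo) * g (lam 'X_[mo])).
  by rewrite -mul_mpolyC; exact: (etrans (congr1 g (rmorphM lam _ _)) (rmorphM g _ _)).
have e : g (io P@_mo) = 0.
  apply/eqP; apply: contra_notT h => n0.
  by exists mo.
exact: (etrans (congr1 (fun x => x * g (lam 'X_[mo])) e) (mul0r _)).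
Qed.

End Universal.
End UniversalFlagElement.

(** * Characters and invariant loci under E' *)

Section Characters.
Variable k : fieldType.
Implicit Types A B : comUnitAlgType k.

Lemma exprz_map A B (f : {lrmorphism A -> B}) (x : A) (n : int) : x \is a GRing.unit -> f (x ^ n) = f x ^ n.
Proof. by move=> ux; case: n => n; rewrite ?NegzE -?exprnN ?exprnP ?rmorphV ?unitrX // rmorphXn. Qed.

Lemma character_map A B (f : {lrmorphism A -> B}) (w : 'rV[int]_4) (x : 'M[A]_4) :
  (forall i, x i i \is a GRing.unit) -> character w (map_mx f x) = f (character w x).
Proof. move=> ux; rewrite rmorph_prod; apply: eq_bigr => i _; rewrite mxE; apply/esym; exact: (exprz_map f _ (ux i)). Qed.

Lemma characterD A (w w' : 'rV[int]_4) (x : 'M[A]_4) : (forall i, x i i \is a GRing.unit) ->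
  character (w + w') x = character w x * character w' x.
Proof. by move=> ux; rewrite -big_split; apply: eq_bigr => i _; rewrite mxE exprzDr. Qed.

Lemma character_unit A (w : 'rV[int]_4) (x : 'M[A]_4) : (forall i, x i i \is a GRing.unit) ->
  character w x \is a GRing.unit.
Proof. by move=> ux; apply: rpred_prod => i _; rewrite rpredXz. Qed.

Lemma character0 A (x : 'M[A]_4) : character 0 x = 1.
Proof. by rewrite /character big1 // => i _; rewrite mxE expr0z. Qed.

Lemma characterMn A (w : 'rV[int]_4) (x : 'M[A]_4) n : (forall i, x i i \is a GRing.unit) ->
  character (w *+ n) x = character w x ^+ n.
Proof.
move=> ux; elim: n => [|n IH]; first by rewrite mulr0n character0.
by rewrite mulrSr characterD // IH exprSr.
Qed.

Lemma borel_diag A (b : 'M[A]_4) : borel b -> forall i, b i i \is a GRing.unit.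
Proof.
case/andP; rewrite unitmxE => u tr i; move: u; rewrite det_trig // (bigD1 i) //= unitrM.
by case/andP.
Qed.

End Characters.

Section Equivariance.
Variables (k : fieldType) (q : nat) (S : kfunctor k) (zeta : zip_morphism q S).
Implicit Types (A B C D E K R : comUnitAlgType k) (J : pred ('I_4 * 'I_4)) (Om U V : point_set (ztot zeta)).
Hypothesis cond_a : zip_smooth zeta.
Hypotheses (q_pchar : [pchar k].-nat q) (q_root : forall c : k, exists d, d ^+ q = c) (q_gt1 : (1 < q)%N).

Local Notation T := (ztot zeta).
Local Notation zm := (zmap zeta).
Local Notation act := (zip_act (zact zeta)).

Lemma act_fmap A B (f : {lrmorphism A -> B}) (e : 'M[A]_4 * 'M[A]_4) (h : zip_group q e)
    (e' : 'M[B]_4 * 'M[B]_4) (h' : zip_group q e') (t : T A) :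
  e' = (map_mx f e.1, map_mx f e.2) -> act h' (fmap f t) = fmap f (act h t).
Proof. by move=> E; subst e'; apply: act_nat. Qed.

(** These are columns j < 3 of X' e.2 = e.1 X, where e.2 is there the Frobenius twist of e.1 and its
    last row vanishes. *)
Lemma act_rel A (e : 'M[A]_4 * 'M[A]_4) (h : zip_group q e) (t : T A) (i j : 'I_4) : (j < 3)%N ->
  ent zm (act h t) i 0 * e.1 0 j ^+ q + (ent zm (act h t) i 1 * e.1 1 j ^+ q
    + ent zm (act h t) i 2%:R * e.1 2%:R j ^+ q) =
  e.1 i 0 * ent zm t 0 j + (e.1 i 1 * ent zm t 1 j + (e.1 i 2%:R * ent zm t 2%:R j + e.1 i 3%:R * ent zm t 3%:R j)).
Proof.
move=> j3; have [_ u2 h3 hq _] := iffLR (zip_groupP q_pchar _) h.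
have e1 : sval (zm A (act h t)) *m e.2 = e.1 *m sval (zm A t).
  by rewrite zmap_equivariant mulmxKV.
have /matrixP/(_ i j) := e1; rewrite !mxE !sum4 (h3 j j3).2 mulr0 addr0.
by rewrite (hq 0 j) // (hq 1 j) // (hq 2%:R j).
Qed.

Lemma flag_tri A (e : 'M[A]_4 * 'M[A]_4) (i j : 'I_4) : flag_group q e -> (i < j)%N -> e.1 i j = 0.
Proof. by case=> _ /andP [_ /is_trig_mxP]; apply. Qed.

Lemma flag_diag A (e : 'M[A]_4 * 'M[A]_4) : flag_group q e -> forall i, e.1 i i \is a GRing.unit.
Proof. by case=> _ /borel_diag. Qed.

(** Triangularity of e.1 and the vanishing entries leave one term on each side of [act_rel]. This is
    the origin of the weight e_i - q e_j of X_ij. *)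
Lemma act_entry A (e : 'M[A]_4 * 'M[A]_4) (h : zip_group q e) (t : T A) (i j : 'I_4) :
  flag_group q e -> (j < 3)%N ->
  (forall i' : 'I_4, (i' < i)%N -> ent zm t i' j = 0) ->
  (forall j' : 'I_4, (j < j' < 3)%N -> ent zm (act h t) i j' = 0) ->
  ent zm (act h t) i j * e.1 j j ^+ q = e.1 i i * ent zm t i j.
Proof.
move=> fe j3 hi hj; have := act_rel h t i j3.
have hL (l : 'I_4) : (l < 3)%N -> l != j -> ent zm (act h t) i l * e.1 l j ^+ q = 0.
  move=> l3 nl; have [lt|lt|/val_inj e1] := ltngtP l j.
  - by rewrite (flag_tri fe lt) expr0n gtn_eqF ?mulr0 //; exact: q_gt0 q_pchar.
  - by rewrite hj ?mul0r // lt.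
  - by rewrite e1 eqxx in nl.
have hR (l : 'I_4) : l != i -> e.1 i l * ent zm t l j = 0.
  move=> nl; have [lt|lt|/val_inj e1] := ltngtP l i.
  - by rewrite hi ?mulr0.
  - by rewrite (flag_tri fe lt) mul0r.
  - by rewrite e1 eqxx in nl.
have -> : ent zm (act h t) i j * e.1 j j ^+ q = \sum_l (if l == j then ent zm (act h t) i l * e.1 l j ^+ q else 0).
  by rewrite -big_mkcond big_pred1_eq.
have -> : e.1 i i * ent zm t i j = \sum_l (if l == i then e.1 i l * ent zm t l j else 0).
  by rewrite -big_mkcond big_pred1_eq.
have L0 : (if 3%:R == j then ent zm (act h t) i 3%:R * e.1 3%:R j ^+ q else 0) = 0.
  by case: eqP => // e1; rewrite -e1 in j3.
rewrite !sum4 L0 addr0.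
have sL (l : 'I_4) : (l < 3)%N -> (if l == j then ent zm (act h t) i l * e.1 l j ^+ q else 0) = ent zm (act h t) i l * e.1 l j ^+ q.
  by move=> l3; case: eqP => // /eqP nl; rewrite hL.
have sR (l : 'I_4) : (if l == i then e.1 i l * ent zm t l j else 0) = e.1 i l * ent zm t l j.
  by case: eqP => // /eqP nl; rewrite hR.
by rewrite !sL // !sR.
Qed.

(** Closure under moving up and to the right within the first three columns, the condition under
    which E' preserves T_J ([zeroes_act]). *)
Definition upper J := forall i j i' j' : 'I_4, J (i, j) -> (j < 3)%N /\
  ((i' <= i)%N -> (j <= j' < 3)%N -> J (i', j')).

Lemma zeroes_act J A (e : 'M[A]_4 * 'M[A]_4) (h : zip_group q e) (t : T A) :
  upper J -> flag_group q e -> zeroes zm J t -> zeroes zm J (act h t).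
Proof.
move=> uJ fe zt; suff H n (i j : 'I_4) : (3 - j <= n)%N -> J (i, j) -> ent zm (act h t) i j = 0.
  by move=> i j; apply: (H 3%N); apply: leq_subr.
elim: n i j => [|n IH] i j le hJ.
  by have [j3 _] := uJ i j i j hJ; move: le j3; lia.
have [j3 _] := uJ i j i j hJ.
have ud := flag_diag fe j.
have uq : e.1 j j ^+ q \is a GRing.unit by rewrite unitrX.
apply: (mulIr uq); rewrite mul0r act_entry //.
- by rewrite zt // mulr0.
- move=> i' lt; apply: zt; have [_ h'] := uJ i j i' j hJ; apply: h'; [exact: ltnW | by rewrite leqnn].
move=> j' /andP [lt j'3]; apply: IH; first by move: le lt; lia.
by have [_ h'] := uJ i j i j' hJ; apply: h' => //; rewrite ltnW.
Qed.

Definition stable Om := forall K (e : 'M[K]_4 * 'M[K]_4) (h : zip_group q e) (t : T K), is_field K ->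
  flag_group q e -> Om K t -> Om K (act h t).

Lemma inside_act Om A (e : 'M[A]_4 * 'M[A]_4) (h : zip_group q e) (t : T A) :
  stable Om -> flag_group q e -> inside Om t -> inside Om (act h t).
Proof.
move=> hO fe it K psi hK; rewrite -(act_fmap h (zip_fmap q_pchar psi h)) //.
by apply: hO => //; [exact: flag_fmap | exact: it].
Qed.

Lemma tmem_act Om J A (e : 'M[A]_4 * 'M[A]_4) (h : zip_group q e) (t : T A) :
  stable Om -> upper J -> flag_group q e -> tmem zm Om J t -> tmem zm Om J (act h t).
Proof. by move=> hO uJ fe [zt it]; split; [exact: zeroes_act | exact: inside_act]. Qed.

Definition weight Om J (w : 'rV[int]_4) (phi : forall A, T A -> A) :=
  forall A (e : 'M[A]_4 * 'M[A]_4) (h : zip_group q e) (t : T A), flag_group q e -> tmem zm Om J t ->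
    phi A (act h t) = character w e.1 * phi A t.

(** Translate the chart point u by the generic element of E'. On an open set of the chart times E'
    containing the given translate, phi vanishes, and there it is an invertible character times
    phi(u). Hence s^n phi(u) = 0 for a function s nonzero at the point, and a coefficient of s^n
    kills phi(u) and is nonzero at t. *)
Lemma vanish_act Om J w (phi : forall A, T A -> A) K (e : 'M[K]_4 * 'M[K]_4) (h : zip_group q e) (t : T K) :
  p_open Om -> stable Om -> upper J -> natural zm Om J phi -> weight Om J w phi ->
  is_field K -> flag_group q e -> tmem zm Om J t ->
  vanish zm Om J phi (act h t) -> vanish zm Om J phi t.
Proof.
move=> oO sO uJ hn hw hK fe mt [V [Vo Vt hV]].
have [R [u [U [hch Ut]]]] := chart_exists (proj2 cond_a) oO hK mt.
have [th eth] := chart_point hch hK mt Ut.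
have [B [io [Z [uZ hom coef]]]] := universal_flag_elt R.
have fZ := flag_elt_group q_pchar uZ; have hZ := proj1 fZ.
have [Z0 [eZ0 dZ0]] := flag_eltP q_pchar fe.
have [|g [hg gZ]] := hom K th Z0; first by move=> i; rewrite dZ0; apply: flag_diag.
pose y := act hZ (fmap io u).
have gy : fmap g y = act h t.
  rewrite -(act_fmap hZ (e' := e) h); last by rewrite -eZ0 -gZ flag_elt_map.
  by congr act; rewrite -fmap_comp' -eth; apply: fmap_ext => x; rewrite hom_compE hg.
have [|s [s0 hs]] := @open_local k T V B y K g Vo hK; first by rewrite gy.
have [C [p [[pu _ pk] _ _]]] := @loc_exists k B s (ex_intro _ K (ex_intro _ g (conj hK s0))).
have mu0 : tmem zm Om J (fmap io u) by apply: tmem_fmap; exact: (ch_mem hch).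
have my : tmem zm Om J y by exact: tmem_act.
have := hV C (fmap p y) (tmem_fmap p my) (hs C p pu).
rewrite hn // /y hw // hn; last exact: (ch_mem hch).
have uc := character_unit w (flag_diag fZ).
rewrite rmorphM /= => e0; have {}e0 : p (io (phi R u)) = 0.
  by apply: (mulrI (rmorph_unit p uc)); rewrite mulr0.
have [n hsn] := pk _ e0.
have [I [c [c1 _ c3]]] := coef (s ^+ n).
have [i hi] : exists i, g (io (c i)) != 0.
  by apply: c3; rewrite rmorphXn; apply: field_expf_neq0.
apply/(vanish_chart oO hn hch hK Ut eth).
exists (c i); split; first by rewrite -hg.
by rewrite mulrC; apply: c1; rewrite mulrC.
Qed.

End Equivariance.

(** * Division by a nonzerodivisor *)

Section Division.
Variables (k : fieldType) (T : kfunctor k) (zm : kmorph T (GL4 k)).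
Implicit Types (A B C D E K R : comUnitAlgType k) (J : pred ('I_4 * 'I_4)) (Om U V : point_set T).
Hypothesis zm_smooth : smooth_morphism zm.

Lemma chart_widen Om Om' J R (u : T R) U : p_open Om' -> (forall K (y : T K), Om' K y -> Om K y) ->
  chart zm Om' J u U -> chart zm Om J u (fun K y => Om' K y /\ U K y).
Proof.
move=> o' sub [[zu iu] inU oU rep ext gen]; split=> //.
- by split=> // K psi hK; apply: sub; apply: iu.
- by move=> K psi hK; split; [apply: iu | apply: inU].
- exact: p_openI.
by move=> C t [zt it] h; apply: rep => [|K psi hK]; [split=> // K psi hK|]; have [] := h K psi hK.
Qed.

Variables (Om : point_set T) (J : pred ('I_4 * 'I_4)) (x phi : forall A, T A -> A).
Hypothesis hOm : p_open Om.
Hypotheses (hx : natural zm Om J x) (hphi : natural zm Om J phi).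
Hypothesis x_nzd : forall R (u : T R) U z, chart zm Om J u U -> x u * z = 0 -> z = 0.
Hypothesis phi0 : forall A (t : T A), tmem zm Om J t -> x t = 0 -> phi t = 0.

Let P A (y : T A) (c : A) := exists R (u : T R) U (th : {lrmorphism R -> A}) r,
  [/\ chart zm Om J u U, fmap th u = y, phi u = x u * r & c = th r].

(** The hypothesis [phi0] is used over the quotient ring R/(x): phi vanishes there as a function on
    a scheme, so it lies in the ideal (x). *)
Lemma chart_quotient R (u : T R) U : chart zm Om J u U -> exists r, phi u = x u * r.
Proof.
move=> hch; pose I (a : R) := exists r, a = x u * r.
have hI : idealP I.
  split=> [|_ _ [r ->] [r' ->]|a _ [r ->]]; first by exists 0; rewrite mulr0.
    by exists (r + r'); rewrite mulrDr.
  by exists (a * r); rewrite mulrCA.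
have [[r e]|n1] := pselect (I 1); first by exists (r * phi u); rewrite mulrA -e mul1r.
have [B [p [_ pk _]]] := qalg_exists hI n1.
apply/pk; rewrite -hphi; last exact: (ch_mem hch).
apply: phi0; first by apply: tmem_fmap; exact: (ch_mem hch).
by rewrite hx; [apply/pk; exists 1; rewrite mulr1 | exact: (ch_mem hch)].
Qed.

Let P_uniq A (y : T A) c c' : tmem zm Om J y -> P y c -> P y c' -> c = c'.
Proof.
move=> my [R [u [U [th [r [hch e er ->]]]]]] [R' [u' [U' [th' [r' [hch' e' er' ->]]]]]].
apply: eq_local => K psi hK.
have inP (W : point_set T) Q (v : T Q) (f : {lrmorphism Q -> A}) : inside W v -> fmap f v = y -> W K (fmap psi y).
  by move=> iv <-; rewrite -fmap_comp'; apply: iv.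
have Uy := inP _ _ _ _ (ch_in hch) e; have U'y := inP _ _ _ _ (ch_in hch') e'.
(* Two local quotients are compared on a chart of the intersection of both charts, where x is still
   a nonzerodivisor. *)
pose Om' : point_set T := fun K y => Om y /\ (U K y /\ U' K y).
have oOm' : p_open Om' by apply: p_openI => //; apply: p_openI; [exact: (ch_open hch) | exact: (ch_open hch')].
have [zy iy] := tmem_fmap psi my.
have Oy : Om' K (fmap psi y) by split=> //; apply: inside_field.
have my' : tmem zm Om' J (fmap psi y) by split=> //; exact: inside_point.
have [Q [v [V [hv Vy]]]] := chart_exists (proj2 zm_smooth) oOm' hK my'.
have subO K0 (y0 : T K0) : Om' K0 y0 -> Om y0 by case.
have hv' := chart_widen oOm' subO hv.
have [zv iv] := ch_mem hv.
have [g hg] := ch_rep hch (ch_mem hv') (fun K0 f hK0 => proj1 (proj2 (iv K0 f hK0))).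
have [g' hg'] := ch_rep hch' (ch_mem hv') (fun K0 f hK0 => proj2 (proj2 (iv K0 f hK0))).
have eg : g r = g' r'.
  apply/eqP; rewrite -subr_eq0; apply/eqP; apply: (x_nzd hv').
  have mu := ch_mem hch; have mu' := ch_mem hch'.
  have e1 : phi v = x v * g r by rewrite -hg hx // hphi // er rmorphM.
  have e2 : phi v = x v * g' r' by rewrite -hg' hx // hphi // er' rmorphM.
  by rewrite mulrBr -e1 -e2 subrr.
have [s [s0 hs]] := @chart_local k T zm Om J Q v _ A y K psi hv' my hK (conj Oy Vy).
exists s; split=> // C f /hs [ph hph].
have -> : f (th r) = ph (g r).
  by apply: (ch_ext hch (f := hom_comp f th) (f' := hom_comp ph g)); rewrite !fmap_comp' e hg hph.
have -> : f (th' r') = ph (g' r').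
  by apply: (ch_ext hch' (f := hom_comp f th') (f' := hom_comp ph g')); rewrite !fmap_comp' e' hg' hph.
by rewrite eg.
Qed.

Let P_local A (t : T A) K (psi : {lrmorphism A -> K}) : tmem zm Om J t -> is_field K ->
  exists s, psi s != 0 /\ forall C (f : {lrmorphism A -> C}), f s \is a GRing.unit -> exists c, P (fmap f t) c.
Proof.
move=> mt hK; have [R [u [U [hch Ut]]]] := chart_exists (proj2 zm_smooth) hOm hK (tmem_fmap psi mt).
have [r er] := chart_quotient hch.
have [s [s0 hs]] := chart_local hch mt hK Ut; exists s; split=> // C f /hs [th hth].
by exists (th r), R, u, U, th, r.
Qed.

Lemma division : exists phi' : forall A, T A -> A, natural zm Om J phi' /\
  forall A (t : T A), tmem zm Om J t -> phi t = x t * phi' A t.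
Proof.
have [|A B f t c|A t c c'|A t K psi|phi' [n1 n2]] := @glue_fun k T (fun A t => tmem zm Om J t) P.
- by move=> A B f t; exact: tmem_fmap.
- move=> [R [u [U [th [r [hch e er ->]]]]]]; exists R, u, U, (hom_comp f th), r; split=> //.
  by rewrite fmap_comp' e.
- exact: P_uniq.
- exact: P_local.
exists phi'; split=> // A t mt; apply: eq_local => K psi hK.
have [s [s0 hs]] := P_local psi mt hK; exists s; split=> // C f /hs [c hc].
rewrite -hphi // rmorphM /= -hx // -n1 // (n2 _ _ c) //; last exact: tmem_fmap.
have [R [u [U [th [r [hch e er ->]]]]]] := hc.
rewrite -e hx ?hphi; try exact: (ch_mem hch).
by rewrite er rmorphM.
Qed.

End Division.

Section EquivariantDivision.
Variables (k : fieldType) (q : nat) (S : kfunctor k) (zeta : zip_morphism q S).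
Implicit Types (A B C D E K R : comUnitAlgType k) (J : pred ('I_4 * 'I_4)) (Om U V : point_set (ztot zeta)).
Hypothesis cond_a : zip_smooth zeta.
Hypotheses (q_pchar : [pchar k].-nat q) (q_root : forall c : k, exists d, d ^+ q = c) (q_gt1 : (1 < q)%N).

Local Notation T := (ztot zeta).
Local Notation zm := (zmap zeta).
Local Notation act := (zip_act (zact zeta)).

(** On the generic translate of a chart, both sides of the equivariance relation agree after
    multiplication by x. The coefficients of their difference lie in R, where x can be cancelled; an
    arbitrary translate is a specialization. *)
Lemma division_weight Om J (w wx : 'rV[int]_4) (x phi phi' : forall A, T A -> A) :
  p_open Om -> stable Om -> upper J ->
  natural zm Om J x -> weight Om J wx x -> natural zm Om J phi' -> weight Om J w phi ->
  (forall R (u : T R) U z, chart zm Om J u U -> x R u * z = 0 -> z = 0) ->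
  (forall A (t : T A), tmem zm Om J t -> phi A t = x A t * phi' A t) ->
  weight Om J (w - wx) phi'.
Proof.
move=> oO sO uJ nx wtx n' wt nzd e1 A e h t fe mt.
have uni R (u : T R) U B (io : {lrmorphism R -> B}) (Z : 'M[B]_4) (hZ : zip_group q (flag_elt q Z)) :
    chart zm Om J u U -> (forall i, Z i i \is a GRing.unit) ->
    (forall b : B, exists (I : Type) (c : I -> R),
        (forall z, io z * b = 0 -> forall i, z * c i = 0) /\ ((forall i, c i = 0) -> b = 0)) ->
    phi' B (act hZ (fmap io u)) = character (w - wx) (flag_elt q Z).1 * phi' B (fmap io u).
  move=> hch uZ coef; have fZ := flag_elt_group q_pchar uZ; have mu := ch_mem hch.
  have mu' := tmem_fmap io mu; have dZ := flag_diag fZ.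
  apply: (mulrI (character_unit wx dZ)).
  rewrite mulrA -characterD // [wx + _]addrC subrK.
  apply/eqP; rewrite -subr_eq0; apply/eqP.
  have [I [c [c1 c2]]] := coef (character wx (flag_elt q Z).1 * phi' B (act hZ (fmap io u)) -
    character w (flag_elt q Z).1 * phi' B (fmap io u)).
  apply: c2 => i; apply: (nzd _ _ _ _ hch); apply: c1.
  have my : tmem zm Om J (act hZ (fmap io u)) by exact: tmem_act.
  rewrite -nx // mulrBr mulrCA [X in X - _]mulrA -wtx // -e1 // wt //.
  by rewrite [X in _ - X]mulrCA -e1 // subrr.
apply: eq_local => K psi hK.
have [R [u [U [hch Ut]]]] := chart_exists (proj2 cond_a) oO hK (tmem_fmap psi mt).
have [s [s0 hs]] := chart_local hch mt hK Ut; exists s; split=> // C f /hs [th hth].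
have [B [io [Z [uZ hom coef]]]] := universal_flag_elt R.
have fZ := flag_elt_group q_pchar uZ; have hZ := proj1 fZ.
have coef' (b : B) : exists (I : Type) (c : I -> R),
    (forall z, io z * b = 0 -> forall i, z * c i = 0) /\ ((forall i, c i = 0) -> b = 0).
  by have [I [c [c1 c2 _]]] := coef b; exists I, c.
have {}uni := uni R u U B io Z hZ hch uZ coef'.
have ffe := flag_fmap q_pchar f fe.
have [Z0 [eZ0 dZ0]] := flag_eltP q_pchar ffe.
have [|g [hg gZ]] := hom C th Z0; first by move=> i; rewrite dZ0; apply: (flag_diag ffe).
have gu : fmap g (fmap io u) = fmap f t.
  by rewrite -fmap_comp' -hth; apply: fmap_ext => y; rewrite hom_compE hg.
have ee : (map_mx f e.1, map_mx f e.2) = (map_mx g (flag_elt q Z).1, map_mx g (flag_elt q Z).2).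
  by rewrite -flag_elt_map gZ eZ0.
have gy : fmap g (act hZ (fmap io u)) = fmap f (act h t).
  rewrite -(act_fmap h (proj1 ffe)) // -gu -(act_fmap hZ (proj1 ffe)) //.
have mu' := tmem_fmap io (ch_mem hch).
rewrite rmorphM /= -!n' //; try exact: tmem_act.
rewrite -gy -gu n'; last exact: tmem_act.
rewrite [in RHS]n' //.
rewrite uni [LHS]rmorphM; congr (_ * _).
apply: etrans (esym (character_map g _ (flag_diag fZ))) _.
apply: etrans _ (character_map f _ (flag_diag fe)).
by case: ee => -> _.
Qed.

End EquivariantDivision.

(** * Descent from the torsor to the flag space *)

Section FlagStrata.
Variables (k : fieldType) (q : nat) (S : kfunctor k) (zeta : zip_morphism q S) (Fl : flag_space zeta).
Implicit Types (A B C D E K R : comUnitAlgType k) (J : pred ('I_4 * 'I_4)) (Om U V : point_set (ztot zeta)).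
Hypothesis cond_a : zip_smooth zeta.
Hypotheses (q_pchar : [pchar k].-nat q) (q_root : forall c : k, exists d, d ^+ q = c) (q_gt1 : (1 < q)%N).

Local Notation T := (ztot zeta).
Local Notation zm := (zmap zeta).
Local Notation act := (zip_act (zact zeta)).
Local Notation pr := (flag_proj Fl).

Lemma flag_proj_eq A (t t' : T A) : pr A t = pr A t' <->
  exists (e : 'M[A]_4 * 'M[A]_4) (h : zip_group q e), flag_group q e /\ act h t = t'.
Proof. by have [h _ _] := flag_proj_torsor Fl; apply: h. Qed.

Lemma act_inv A (e : 'M[A]_4 * 'M[A]_4) (h : zip_group q e) (t : T A) : flag_group q e ->
  exists (e' : 'M[A]_4 * 'M[A]_4) (h' : zip_group q e'), flag_group q e' /\ act h' (act h t) = t.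
Proof. by move=> fe; apply/flag_proj_eq/esym/flag_proj_eq; exists e, h. Qed.

Lemma stable_iff Om : stable Om -> forall K (e : 'M[K]_4 * 'M[K]_4) (h : zip_group q e) (t : T K),
  is_field K -> flag_group q e -> Om K (act h t) -> Om K t.
Proof.
move=> sO K e h t hK fe O1; have [e' [h' [fe' <-]]] := act_inv h t fe.
exact: sO.
Qed.

Lemma stableC Om : stable Om -> stable (fun K t => ~ Om K t).
Proof. by move=> sO K e h t hK fe nO /(stable_iff sO hK fe). Qed.

Lemma zeroes_proj J A (t t' : T A) : upper J -> pr A t = pr A t' -> zeroes zm J t -> zeroes zm J t'.
Proof. by move=> uJ /flag_proj_eq [e [h [fe <-]]]; apply: zeroes_act. Qed.

Lemma zeroes_inj J A B (f : {lrmorphism A -> B}) (t : T A) : injective f -> zeroes zm J (fmap f t) -> zeroes zm J t.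
Proof. by move=> inj z i j hij; apply: inj; rewrite -ent_fmap z // rmorph0. Qed.

Section Lifts.
Variable J : pred ('I_4 * 'I_4).
Hypothesis uJ : upper J.

Lemma lifts_stable A B (f : {lrmorphism A -> B}) (y : flag_base Fl A) :
  (forall C (g : {lrmorphism A -> C}) (x : T C), pr C x = fmap g y -> zeroes zm J x) ->
  (forall C (g : {lrmorphism B -> C}) (x : T C), pr C x = fmap g (fmap f y) -> zeroes zm J x).
Proof. by move=> h C g x; rewrite -fmap_comp'; apply: h. Qed.

(** The locus of the flag space under T_J. Quantifying over all lifts after base change makes it a
    subfunctor at once; by stability of T_J one lift decides ([lifts_zero_point]). *)
Definition lifts_zero : subfunctor (flag_base Fl) := SubFunctor lifts_stable.

Lemma lifts_zero_point A (y : flag_base Fl A) (x : T A) : pr A x = y -> zeroes zm J x -> lifts_zero A y.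
Proof.
move=> e zx C g x' e'; apply: (zeroes_proj uJ (t := fmap g x)); last exact: zeroes_fmap.
by rewrite kapp_nat e e'.
Qed.

(** On an etale cover with a lift x the locus is cut out by the entries of x in J. Two lifts differ
    by E', which preserves T_J, so this ideal descends by [etale_closed]. *)
Lemma lifts_zero_closed : is_closed lifts_zero.
Proof.
move=> A y; have [_ _ tors] := flag_proj_torsor Fl; have [B [phi [x [ec ex]]]] := tors A y.
pose P := ('I_4 * 'I_4)%type.
pose c (l : 'I_#|{: P}|) : B := if J (enum_val l) then ent zm x (enum_val l).1 (enum_val l).2 else 0.
have cE D (d : {lrmorphism B -> D}) : (forall l, d (c l) = 0) <-> zeroes zm J (fmap d x).
  split=> [h i j hij|h l].
    by have := h (enum_rank (i, j)); rewrite /c enum_rankK hij ent_fmap.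
  rewrite /c; case: ifP => [hl|_]; last exact: rmorph0.
  by rewrite -ent_fmap h //; case: (enum_val l) hl.
have [I hI] : exists I : A -> Prop, forall C (psi : {lrmorphism A -> C}),
    (forall a, I a -> psi a = 0) <->
    (forall D (g : {lrmorphism C -> D}) (d : {lrmorphism B -> D}),
       (forall a, g (psi a) = d (phi a)) -> forall i, d (c i) = 0).
  apply: (etale_closed ec) => D d1 d2 hd l.
  have [h1|h1] := pselect (gen (fun y => exists j, y = d2 (c j)) 1).
    by rewrite -[d1 _]mulr1; apply: (idlM (gen_ideal _)).
  have [Q [p [_ pk _]]] := qalg_exists (gen_ideal _) h1.
  apply/pk; apply: (iffRL (cE Q (hom_comp p d1))).
  apply: (zeroes_proj uJ (t := fmap (hom_comp p d2) x)).
    rewrite !fmap_comp' !kapp_nat ex -!fmap_comp'; apply: fmap_ext => a.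
    by rewrite !hom_compE hd.
  by apply/cE => l'; rewrite hom_compE; apply/pk; apply: gen_sub; exists l'.
exists I => C psi; rewrite hI; split=> [h D g d hd|h D f x' ex'].
  apply/cE; apply: (h D g); rewrite kapp_nat ex -!fmap_comp'.
  by apply: fmap_ext => a; rewrite !hom_compE hd.
have [E [g [d [hd inj]]]] := etale_pushout (hom_comp f psi) ec.
apply: (zeroes_inj inj).
apply: (zeroes_proj uJ (t := fmap d x)).
  rewrite !kapp_nat ex ex' -!fmap_comp'; apply: fmap_ext => a.
  by rewrite !hom_compE -hd.
by apply/cE; apply: (h E (hom_comp g f)) => a; rewrite -hd.
Qed.

Lemma lifts_zero_ext K K' (f : {lrmorphism K -> K'}) (y : flag_base Fl K) : is_field K ->
  lifts_zero K' (fmap f y) -> lifts_zero K y.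
Proof.
move=> hK h; have [I hI] := lifts_zero_closed y.
have hf := iffLR (hI K' f) h.
have := iffRL (hI K idfun); rewrite fmap_id'; apply=> a Ia.
by apply: (field_hom_inj hK (f := f)); rewrite rmorph0 hf.
Qed.

(* A function on T_J invariant under E' is a function on the locus of the flag
   space over which T_J lies. *)
Lemma invariant_descent (h : forall A, T A -> A) :
  (forall A B (f : {lrmorphism A -> B}) t, zeroes zm J t -> h B (fmap f t) = f (h A t)) ->
  (forall A (e : 'M[A]_4 * 'M[A]_4) (z : zip_group q e) t, flag_group q e -> zeroes zm J t -> h A (act z t) = h A t) ->
  forall Z : subfunctor (flag_base Fl), (forall A y, Z A y -> lifts_zero A y) ->
  exists hZ : regular_function (sub_kfunctor Z), forall A (y : sub_kfunctor Z A) (x : T A),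
    pr A x = sval y -> hZ A y = h A x.
Proof.
move=> nh ih Z hZ.
have ph A (t t' : T A) : pr A t = pr A t' -> zeroes zm J t -> h A t = h A t'.
  by move=> /flag_proj_eq [e [z [fe <-]]] zt; rewrite ih.
have ex A (y : sub_kfunctor Z A) : exists a, forall C (f : {lrmorphism A -> C}) x,
    pr C x = fmap f (sval y) -> f a = h C x.
  have [_ _ tors] := flag_proj_torsor Fl; have [B [phi [x [ec exy]]]] := tors A (sval y).
  have zx C (f : {lrmorphism A -> C}) x' : pr C x' = fmap f (sval y) -> zeroes zm J x'.
    exact: (hZ A (sval y) (svalP y)).
  have zx0 := zx B phi x exy.
  have [a ha] : exists a, phi a = h B x.
    apply: (etale_descent ec) => D d1 d2 hd; rewrite -!nh //.
    apply: ph; last exact: zeroes_fmap.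
    rewrite !kapp_nat exy -!fmap_comp'; apply: fmap_ext => a.
    by rewrite !hom_compE hd.
  exists a => C f x' e'; have [E [g [d [hd inj]]]] := etale_pushout f ec.
  apply: inj; rewrite hd ha -!nh //; last exact: (zx C f).
  apply: ph; last exact: zeroes_fmap.
  rewrite !kapp_nat exy e' -!fmap_comp'; apply: fmap_ext => b.
  by rewrite !hom_compE hd.
pose v A (y : sub_kfunctor Z A) := projT1 (cid (ex A y)).
have vP A (y : sub_kfunctor Z A) : forall C (f : {lrmorphism A -> C}) x,
    pr C x = fmap f (sval y) -> f (v A y) = h C x by rewrite /v; case: cid.
have vn A B (f : {lrmorphism A -> B}) (y : sub_kfunctor Z A) : v B (fmap f y) = @fmap k (A1 k) A B f (v A y).
  have [_ _ tors] := flag_proj_torsor Fl; have [C [phi [x [ec exy]]]] := tors B (fmap f (sval y)).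
  have [E [g [d [hd inj]]]] := etale_pushout idfun ec.
  apply: inj; rewrite -[g (v _ _)]/(g (idfun (v B (fmap f y)))).
  have e1 := vP B (fmap f y) C phi x exy.
  have e2 : hom_comp phi f (v A y) = h C x by apply: vP; rewrite exy fmap_comp'.
  by rewrite hd e1 -[fmap f _]/(f (v A y)) -[g _]/(g (idfun (f (v A y)))) hd -e2.
exists (@KMorph k (sub_kfunctor Z) (A1 k) v vn) => A y x e.
by have := vP A y A idfun x; rewrite fmap_id' => /(_ e).
Qed.

End Lifts.
End FlagStrata.

(** * Vanishing on the pseudo-complete curves *)

Section EntryWeights.
Variables (k : fieldType) (q : nat) (S : kfunctor k) (zeta : zip_morphism q S).
Implicit Types (A B C D E K R : comUnitAlgType k) (J : pred ('I_4 * 'I_4)) (Om U V : point_set (ztot zeta)).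
Hypotheses (q_pchar : [pchar k].-nat q) (q_gt1 : (1 < q)%N).
Local Notation T := (ztot zeta).
Local Notation zm := (zmap zeta).
Local Notation act := (zip_act (zact zeta)).

Lemma character_delta A (x : 'M[A]_4) i : character (delta_mx 0 i) x = x i i.
Proof.
rewrite /character (bigD1 i) //= mxE !eqxx expr1z big1 ?mulr1 // => j /negbTE nj.
by rewrite mxE nj andbF expr0z.
Qed.

Definition ew (i j : 'I_4) : 'rV[int]_4 := delta_mx 0 i - delta_mx 0 j *+ q.

Lemma character_ew A (x : 'M[A]_4) i j : (forall i, x i i \is a GRing.unit) ->
  character (ew i j) x * x j j ^+ q = x i i.
Proof. by move=> ux; rewrite -(character_delta x j) -characterMn // -characterD // subrK character_delta. Qed.

Lemma entry_natural Om J i j : natural zm Om J (fun A t => ent zm t i j).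
Proof. by move=> A B f t _; rewrite ent_fmap. Qed.

Lemma entry_weight Om J (i j : 'I_4) : upper J -> (j < 3)%N ->
  (forall i' : 'I_4, (i' < i)%N -> J (i', j)) -> (forall j' : 'I_4, (j < j' < 3)%N -> J (i, j')) ->
  weight Om J (ew i j) (fun A (t : T A) => ent zm t i j).
Proof.
move=> uJ j3 hi hj A e h t fe [zt it].
have ud := flag_diag fe.
have uq : e.1 j j ^+ q \is a GRing.unit by rewrite unitrX ?ud.
have zt' : zeroes zm J (act h t) by exact: zeroes_act.
apply: (mulIr uq); rewrite act_entry //.
- by rewrite [RHS]mulrAC character_ew //; exact: flag_diag.
- by move=> i' lt; apply: zt; apply: hi.
- by move=> j' lt; apply: zt'; apply: hj.
Qed.
End EntryWeights.

Section Kill.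
Variables (k : fieldType) (q : nat) (S : kfunctor k) (zeta : zip_morphism q S) (Fl : flag_space zeta).
Implicit Types (A B C D E K R : comUnitAlgType k) (J : pred ('I_4 * 'I_4)) (Om U V : point_set (ztot zeta)).
Hypothesis cond_a : zip_smooth zeta.
Hypotheses (q_pchar : [pchar k].-nat q) (q_root : forall c : k, exists d, d ^+ q = c) (q_gt1 : (1 < q)%N).

Local Notation T := (ztot zeta).
Local Notation zm := (zmap zeta).
Local Notation act := (zip_act (zact zeta)).
Local Notation pr := (flag_proj Fl).

Definition everywhere : point_set T := fun _ _ => True.

(** On T_J the set Om is both open and closed, so phi may be set to 0 off Om. Pseudo-completeness
    concerns functions on the whole curve, hence the need for this extension. *)
Lemma extension_by_zero Om J w (phi : forall A, T A -> A) : p_open Om -> stable Om ->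
  p_open (fun K t => zeroes zm J t -> ~ Om K t) -> upper J -> natural zm Om J phi -> weight Om J w phi ->
  exists phi0 : forall A, T A -> A, [/\ natural zm everywhere J phi0, weight everywhere J w phi0
    & forall A (t : T A), tmem zm Om J t -> phi0 A t = phi A t].
Proof.
move=> oO sO cO uJ nphi wphi.
have nO : stable (fun K t => ~ Om K t) by exact: stableC.
pose P A (t : T A) c := zeroes zm J t /\
  ((inside Om t /\ c = phi A t) \/ (inside (fun K t => ~ Om K t) t /\ c = 0)).
have loc A (t : T A) K (psi : {lrmorphism A -> K}) : zeroes zm J t -> is_field K ->
    exists s, psi s != 0 /\ forall C (f : {lrmorphism A -> C}), f s \is a GRing.unit ->
      inside Om (fmap f t) \/ inside (fun K t => ~ Om K t) (fmap f t).
  move=> zt hK; have [Ot|nOt] := pselect (Om K (fmap psi t)).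
    by have [s [s0 hs]] := open_local oO hK Ot; exists s; split=> // C f /hs; left.
  have [s [s0 hs]] := open_local cO hK (fun _ => nOt).
  exists s; split=> // C f fu; right => K' psi' hK'; apply: hs => //; exact/zeroes_fmap/zeroes_fmap.
have disj A (t : T A) : inside Om t -> inside (fun K t => ~ Om K t) t -> False.
  by move=> h1 h2; have [K [psi hK]] := field_points A; apply: (h2 K psi hK); apply: h1.
have [|A B f t c [zt hc]|A t c c' zt [_ hc] [_ hc']|A t K psi zt hK|phi0 [n1 n2]] :=
  @glue_fun k T (fun A t => zeroes zm J t) P.
- by move=> A B f t; exact: zeroes_fmap.
- split; first exact: zeroes_fmap.
  case: hc => -[it ->]; [left | right]; (split; first exact: inside_fmap).
    by rewrite nphi.
  by rewrite rmorph0.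
- by case: hc hc' => -[it ->] [] [it' ->] //; [case: (disj A t it it') | case: (disj A t it' it)].
- have [s [s0 hs]] := loc A t K psi zt hK; exists s; split=> // C f /hs [it|it].
    by exists (phi C (fmap f t)); split; [exact: zeroes_fmap | left].
  by exists 0; split; [exact: zeroes_fmap | right].
have ev A (t : T A) : tmem zm Om J t -> phi0 A t = phi A t by move=> [zt it]; apply: n2 => //; split=> //; left.
exists phi0; split=> // [A B f t [zt _]|A e h t fe [zt _]]; first exact: n1.
apply: eq_local => K psi hK; have [s [s0 hs]] := loc A t K psi zt hK.
have zt' : zeroes zm J (act h t) by exact: zeroes_act.
exists s; split=> // C f /hs it.
have fe' := flag_fmap q_pchar f fe.
have eC : fmap f (act h t) = act (proj1 fe') (fmap f t) by rewrite (act_fmap h (proj1 fe')).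
rewrite rmorphM /= -!n1 // eC; case: it => it.
  have mt : tmem zm Om J (fmap f t) by split; [exact: zeroes_fmap|].
  rewrite !ev ?wphi //; last exact: tmem_act.
  by congr (_ * _); exact: (character_map f w (flag_diag fe)).
rewrite !(n2 _ _ 0) ?mulr0 //; try exact: zeroes_fmap.
- by split; [exact: zeroes_fmap | right].
- by apply: zeroes_act => //; exact: zeroes_fmap.
split; first by apply: zeroes_act => //; exact: zeroes_fmap.
by right; split=> //; apply: inside_act.
Qed.

Variables (J : pred ('I_4 * 'I_4)) (m : 'I_4) (w : 'S_4).
Hypotheses (uJ : upper J) (m3 : (m < 3)%N) (mJ : ~~ J (m, m)).
Hypothesis Jm : forall i : 'I_4, ((i < m)%N -> J (i, m)) /\ ((m < i < 3)%N -> J (m, i)).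
Hypothesis stratum_zero : forall K (g : GL4 k K), is_field K -> flag_stratum w g ->
  forall i j, J (i, j) -> sval g i j = 0.
Hypothesis zero_stratum : forall K (g : GL4 k K), is_field K ->
  (forall i j, J (i, j) -> sval g i j = 0) -> sval g m m != 0 -> flag_stratum w g.
Hypothesis complete : pseudo_complete (sub_kfunctor (reduced_closure (Flag_stratum (Fl := Fl) w))).

Local Notation Z := (reduced_closure (Flag_stratum (Fl := Fl) w)).

Lemma curve_lifts A y : Z A y -> lifts_zero Fl J A y.
Proof.
move=> h; apply: h; first exact: lifts_zero_closed.
move=> K y' hK [K' [f [x [hK' e st]]]]; have hy : lifts_zero Fl J K' (fmap f y').
  by apply: (lifts_zero_point q_pchar q_gt1 uJ e) => i j; apply: stratum_zero.
exact: lifts_zero_ext hK hy.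
Qed.

(** A function killed at all points of the stratum, that is where X_mm is nonzero, becomes nilpotent
    after multiplication by X_mm. The chart is reduced and X_mm is a nonzerodivisor, so the whole
    chart maps to the reduced closure. *)
Lemma chart_in_curve Om R (u : T R) U : chart zm Om J u U -> Z R (pr R u).
Proof.
move=> hch Y cY hY; have [I hI] := cY R (pr R u).
have := iffRL (hI R idfun); rewrite fmap_id'; apply=> a Ia /=.
apply: (chart_nzd (proj1 cond_a) hch mJ).
have [n hn] : exists n, (ent zm u m m * a) ^+ n = 0.
  apply: nil_field => K psi hK; rewrite rmorphM /=.
  have [->|x0] := eqVneq (psi (ent zm u m m)) 0; first exact: mul0r.
  have -> : psi a = 0; last exact: mulr0.
  apply: (iffLR (hI K psi)) => //; apply: hY => //.
  exists K, idfun, (fmap psi u); split=> //; first by rewrite fmap_id' kapp_nat.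
  apply: zero_stratum => // [i j hij|].
    by have [zu _] := tmem_fmap psi (ch_mem hch); exact: zu.
  have x1 : ent zm (fmap psi u) m m != 0 by rewrite ent_fmap.
  exact: x1.
exact: (chart_reduced (proj1 cond_a) q_pchar q_root q_gt1 hch hn).
Qed.

(* phi^N v X^n, with X the coordinate of T_J vanishing at the given points, is
   invariant under E' and descends to the pseudo-complete curve, where it is
   locally constant. *)
Lemma curve_vanish Om mu wv (phi v : forall A, T A -> A) N n K (t : T K) :
  p_open Om -> stable Om -> p_open (fun K t => zeroes zm J t -> ~ Om K t) ->
  natural zm Om J phi -> weight Om J mu phi ->
  natural zm everywhere J v -> weight everywhere J wv v ->
  (forall A (t : T A), zeroes zm J t -> v A t \is a GRing.unit) ->
  (0 < n)%N -> (mu *+ N.+1 + wv) + ew q m m *+ n = 0 ->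
  is_field K -> tmem zm Om J t -> ent zm t m m = 0 -> vanish zm Om J phi t.
Proof.
move=> oO sO cO nphi wphi nv wtv uv n0 ew0 hK mt t0.
have [phi0 [n1 w1 e1]] := extension_by_zero oO sO cO uJ nphi wphi.
pose h A (t : T A) := phi0 A t ^+ N.+1 * v A t * ent zm t m m ^+ n.
have ev A (y : T A) : zeroes zm J y -> tmem zm everywhere J y by [].
have nh A B (f : {lrmorphism A -> B}) y : zeroes zm J y -> h B (fmap f y) = f (h A y).
  by move=> zy; rewrite /h n1 ?nv ?ent_fmap //; rewrite !rmorphM !rmorphXn.
have wX := entry_weight (Om := everywhere) q_pchar q_gt1 uJ m3 (fun i => proj1 (Jm i)) (fun i => proj2 (Jm i)).
have ih A (e : 'M[A]_4 * 'M[A]_4) (z : zip_group q e) y : flag_group q e -> zeroes zm J y -> h A (act z y) = h A y.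
  move=> fe zy; have de := flag_diag fe.
  have c1 : character mu e.1 ^+ N.+1 * character wv e.1 * character (ew q m m) e.1 ^+ n = 1.
    by rewrite -!characterMn // -!characterD // ew0 character0.
  have wX' : ent zm (act z y) m m = character (ew q m m) e.1 * ent zm y m m by exact: wX.
  rewrite /h w1 // wtv // wX' !exprMn.
  by rewrite [X in X * _]mulrACA [LHS]mulrACA c1 mul1r.
have [hZ hhZ] := invariant_descent nh ih curve_lifts.
have [R [u [U [hch Ut]]]] := chart_exists (proj2 cond_a) oO hK mt.
have [th eth] := chart_point hch hK mt Ut.
have mu0 := ch_mem hch; have [zu iu] := mu0.
pose y : sub_kfunctor Z R := exist _ (pr R u) (chart_in_curve hch).
have hy : hZ R y = h R u by apply: hhZ.
have [W [c [oW Wt hc]]] := complete hZ (fmap th y) hK.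
(* The constant is read off at t, where the positive power of X_mm vanishes. *)
have c0 : c%:A = 0 :> K.
  rewrite -(hc K _ Wt) kapp_nat hy -[LHS]/(th (h R u)) -nh // eth.
  by rewrite /h t0 expr0n gtn_eqF // mulr0.
have {}c0 : c = 0.
  by apply/eqP; apply: contra_eqT c0 => cn0; rewrite scaler_eq0 negb_or cn0 oner_eq0.
have [s [s0 hs]] := open_point oW hK Wt.
have [C [p [[pu _ pk] _ _]]] := @loc_exists k R s (ex_intro _ K (ex_intro _ th (conj hK s0))).
have [|l hl] := pk (h R u).
  by have := hc C _ (hs C p pu); rewrite kapp_nat hy c0 scale0r.
apply/(vanish_chart oO nphi hch hK Ut eth); exists (s ^+ l); split.
  by rewrite rmorphXn; apply: field_expf_neq0.
(* From s^l phi^(N+1) v X_mm^n = 0 one cancels the nonzerodivisor X_mm^n and the unit v; then s^l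
   phi is nilpotent on a reduced chart. *)
apply: (chart_reduced (proj1 cond_a) q_pchar q_root q_gt1 hch (N := N.+1)).
have nzd j z : ent zm u m m ^+ j * z = 0 -> z = 0.
  elim: j z => [|j IH] z; first by rewrite mul1r.
  by rewrite exprSr -mulrA => /IH /(chart_nzd (proj1 cond_a) hch mJ).
apply: (nzd n); apply: (mulIr (uv R u zu)); rewrite mul0r.
rewrite exprMn [s ^+ l ^+ N.+1]exprSr -!mulrA.
rewrite mulrCA; have -> : ent zm u m m ^+ n * (s ^+ l * (phi R u ^+ N.+1 * v R u)) = s ^+ l * h R u.
  by rewrite /h e1 // mulrCA [_ * (phi R u ^+ _ * _)]mulrC.
by rewrite hl mulr0.
Qed.

End Kill.

(** * Strata of simple reflections in terms of entries *)

Section Strata.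
Variable k : fieldType.
Implicit Types (A K : comUnitAlgType k).

(* Zero conditions are imposed on the entries on or above the diagonal in the
   first three columns, except on those in F. *)
Definition up (F : seq (nat * nat)) : pred ('I_4 * 'I_4) :=
  fun c => (c.1 <= c.2 < 3)%N && (((c.1 : nat), (c.2 : nat)) \notin F).

Lemma zpermE : [/\ zperm 0 = 1, zperm 1 = 2%:R, zperm 2%:R = 3%:R & zperm 3%:R = 0].
Proof.
have iE n (i : 'I_4) : i = n :> nat -> inord n = i by move=> <-; exact: inord_val.
have w0E (i : 'I_4) : w0 i = rev_ord i by exact: permE.
have L : w0I 0 = 2%:R by rewrite -(iE 0%N 0 erefl) -(iE 2%N 2%:R erefl); exact: tpermL.
have R : w0I 2%:R = 0 by rewrite -(iE 0%N 0 erefl) -(iE 2%N 2%:R erefl); exact: tpermR.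
have D (i : 'I_4) : i != 0 -> i != 2%:R -> w0I i = i.
  by rewrite -{1}(iE 0%N 0 erefl) -{1}(iE 2%N 2%:R erefl) ![i == _]eq_sym; exact: tpermD.
by split; rewrite /zperm permM w0E ?L ?R ?D //; apply/val_inj.
Qed.

Lemma zperm_next (j : 'I_4) : (j < 3)%N -> zperm j = j.+1 :> nat.
Proof. by have [z0 z1 z2 _] := zpermE; elim/ord4_ind: j => // _; rewrite ?z0 ?z1 ?z2. Qed.

Lemma mul_zperm A (g : 'M[A]_4) i j : (g *m perm_mx zperm) i (zperm j) = g i j.
Proof. by rewrite -(invgK zperm) -col_permE mxE permKV ?invgK ?permK. Qed.

Lemma flag_stratumP w K (g : GL4 k K) : flag_stratum w g <->
  exists b b' : 'M[K]_4, [/\ borel b, borel b' & sval g *m perm_mx zperm = b *m perm_mx w *m b'].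
Proof.
have zu : perm_mx zperm \in @unitmx K 4 by exact: unitmx_perm.
split=> [] [b [b' [hb hb' e]]]; exists b, b'; split=> //.
  by rewrite e mulmxKV.
by rewrite -e mulmxK.
Qed.

Section Simple.
Variable i0 : 'I_3.
Let a : 'I_4 := inord i0.
Let c : 'I_4 := inord i0.+1.
Let aE : a = i0 :> nat. Proof. by rewrite inordK //; apply: leq_trans (ltn_ord i0) _. Qed.
Let cE : c = i0.+1 :> nat. Proof. by rewrite inordK // ltnS. Qed.
Let ac : a != c. Proof. by rewrite -val_eqE /= aE cE neq_ltn ltnSn. Qed.

Lemma simple_refl_length : has_length (simple_refl i0) 1.
Proof.
split; first by exists [:: i0]; rewrite // /is_word big_seq1.
case=> // /esym; rewrite /is_word big_nil => /permP /(_ a).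
rewrite tpermL perm1 => e; have e' : a = c := e.
by move: ac; rewrite e' eqxx.
Qed.

Lemma simple_stratum_zero K (g : GL4 k K) : flag_stratum (simple_refl i0) g ->
  forall i j, up [:: (i0 : nat, i0 : nat)] (i, j) -> sval g i j = 0.
Proof.
move=> /flag_stratumP [b [b' [/andP [_ /is_trig_mxP tb] /andP [_ /is_trig_mxP tb'] e]]] i j.
rewrite /up /= inE => /andP [/andP [ij j3] nij].
rewrite -mul_zperm e -mulmxA -row_permE mxE big1 // => l _; rewrite mxE.
have [lt|le] := ltnP i l; first by rewrite tb ?mul0r.
rewrite tb' ?mulr0 //= zperm_next //.
case: (tpermP a c l) => [el|el|_ _].
- rewrite cE ltnS ltn_neqAle; move: le; rewrite el aE => le.
  move: nij; rewrite xpair_eqE; case: ltngtP ij le => //=; case: ltngtP => //=; try lia.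
- by rewrite aE; move: le; rewrite el cE; lia.
- by lia.
Qed.

(** Only the entry (a, c) above the diagonal is nonzero, and it is invertible: subtracting a
    multiple of column c from column a clears (a, a), after which exchanging the two columns leaves
    a lower triangular matrix. *)
Lemma simple_bruhat A (M : 'M[A]_4) : M \in unitmx -> M a c \is a GRing.unit ->
  (forall i j : 'I_4, (i < j)%N -> (i != a) || (j != c) -> M i j = 0) ->
  exists b b' : 'M[A]_4, [/\ borel b, borel b' & M = b *m perm_mx (simple_refl i0) *m b'].
Proof.
move=> Mu yu M0; set y := M a c in yu.
pose s := M a a / y; set E : 'M[A]_4 := delta_mx c a.
have EE : E *m E = 0 by rewrite mul_delta_mx_0 // eq_sym.
set be := 1%:M + s *: E; set be' := 1%:M - s *: E.
have bb : be' *m be = 1%:M.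
  by rewrite mulmxDr mulmx1 -scalemxAr mulmxBl mul1mx -scalemxAl EE scaler0 subr0 subrK.
have [ub' ub] := mulmx1_unit bb.
have Pu : perm_mx (simple_refl i0) \in @unitmx A 4 by exact: unitmx_perm.
have PP : perm_mx (simple_refl i0) *m perm_mx (simple_refl i0) = 1%:M :> 'M[A]_4.
  by rewrite -perm_mxM tperm2 perm_mx1.
exists (M *m be' *m perm_mx (simple_refl i0)), be; split.
- apply/andP; split; first by rewrite 2!unitmx_mul Mu ub' Pu.
  apply/is_trig_mxP => i j lt.
  have sV : ((simple_refl i0)^-1)%g = simple_refl i0 by exact: tpermV.
  have -> : (M *m be' *m perm_mx (simple_refl i0)) i j = (M *m be') i (simple_refl i0 j).
    by rewrite -[in LHS]sV -col_permE mxE.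
  have eMb l : (M *m be') i l = M i l - s * M i c * (l == a)%:R.
    rewrite mulmxBr mulmx1 -scalemxAr 3!mxE; congr (_ - _).
    rewrite -mulrA mxE (bigD1 c) //= big1 => [|l' nl]; last by rewrite mxE (negbTE nl) mulr0.
    by rewrite mxE eqxx addr0.
  rewrite eMb; case: (tpermP a c j) => [ej|ej|/eqP nja /eqP njc].
  + have ia : (i < a)%N by rewrite -ej.
    rewrite eq_sym (negbTE ac) mulr0 subr0 M0 //; first by move: ia; rewrite aE cE; lia.
    by rewrite -val_eqE /= neq_ltn ia.
  + rewrite eqxx mulr1; have [->|ni] := eqVneq i a; first by rewrite divrK ?subrr.
    have ia : (i < a)%N by move: lt ni; rewrite -val_eqE /= ej cE aE; lia.
    rewrite !M0 ?ni ?mulr0 ?subr0 //; by move: ia; rewrite ?aE ?cE; lia.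
  + by rewrite (negbTE nja) mulr0 subr0 M0 // njc orbT.
- apply/andP; split=> //; apply/is_trig_mxP => i j lt; rewrite !mxE.
  rewrite -val_eqE /= ltn_eqF // add0r.
  case: eqP => [ei|] /=; rewrite ?mulr0 //; case: eqP => [ej|]; rewrite ?mulr0 //.
  by move: lt; rewrite ei ej aE cE; lia.
by rewrite -!mulmxA (mulmxA (perm_mx _)) PP mul1mx bb mulmx1.
Qed.

Lemma zero_simple_stratum K (g : GL4 k K) : is_field K ->
  (forall i j, up [:: (i0 : nat, i0 : nat)] (i, j) -> sval g i j = 0) -> sval g a a != 0 ->
  flag_stratum (simple_refl i0) g.
Proof.
move=> hK h0 g0; apply/flag_stratumP; apply: simple_bruhat => [||i j lt n].
- by rewrite unitmx_mul (svalP g) unitmx_perm.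
- apply: hK; rewrite (_ : c = zperm a); first by rewrite mul_zperm.
  by apply/val_inj; rewrite /= zperm_next ?aE ?cE.
have [l el] : exists l, j = zperm l by exists ((zperm^-1)%g j); rewrite permKV.
have [l3|l3] := boolP (l < 3)%N; last first.
  have [_ _ _ z3] := zpermE; have e : l = 3%:R by apply/val_inj; move: l3 (ltn_ord l) => /=; lia.
  by move: lt; rewrite el e z3.
have jl : j = l.+1 :> nat by rewrite el zperm_next.
rewrite el mul_zperm; apply: h0; rewrite /up /= inE xpair_eqE l3.
move: lt n; rewrite -!val_eqE /= aE cE jl; lia.
Qed.

End Simple.
End Strata.

(** * Invertible sections on the curves *)

Section UnitFunctions.
Variables (k : fieldType) (q : nat) (S : kfunctor k) (zeta : zip_morphism q S).
Implicit Types (A B C D E K R : comUnitAlgType k) (J : pred ('I_4 * 'I_4)) (Om U V : point_set (ztot zeta)).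
Hypotheses (q_pchar : [pchar k].-nat q) (q_gt1 : (1 < q)%N).
Local Notation T := (ztot zeta).
Local Notation zm := (zmap zeta).
Local Notation act := (zip_act (zact zeta)).
Local Notation one := (everywhere (zeta := zeta)).

(** A nowhere vanishing section on T_J. Integer powers of such sections are used to move weights
    without changing where a section vanishes. *)
Definition unit_function J w (v : forall A, T A -> A) :=
  [/\ natural zm one J v, weight one J w v & forall A (t : T A), zeroes zm J t -> v A t \is a GRing.unit].

Lemma unit_functionM J w w' v v' : unit_function J w v -> unit_function J w' v' ->
  unit_function J (w + w') (fun A t => v A t * v' A t).
Proof.
move=> [nv wv uv] [nv' wv' uv']; split=> [A B f t mt|A e h t fe mt|A t zt].
- by rewrite nv // nv' // rmorphM.
- by have -> := wv A e h t fe mt; have -> := wv' A e h t fe mt; rewrite (characterD _ _ (flag_diag fe)) mulrACA.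
- by rewrite unitrM uv // uv'.
Qed.

Lemma unit_functionX J w v n : unit_function J w v -> unit_function J (w *+ n) (fun A t => v A t ^+ n).
Proof.
move=> [nv wv uv]; split=> [A B f t mt|A e h t fe mt|A t zt].
- by rewrite nv // rmorphXn.
- by have -> := wv A e h t fe mt; rewrite exprMn (characterMn _ _ (flag_diag fe)).
- by rewrite unitrX // uv.
Qed.

Lemma character_unitN A (w : 'rV[int]_4) (x : 'M[A]_4) : (forall i, x i i \is a GRing.unit) ->
  character (- w) x = (character w x)^-1.
Proof.
move=> ux; apply: (mulrI (character_unit w ux)).
by rewrite -characterD // subrr character0 mulrV // character_unit.
Qed.

Lemma unit_functionV J w v : unit_function J w v -> unit_function J (- w) (fun A t => (v A t)^-1).
Proof.
move=> [nv wv uv]; split=> [A B f t mt|A e h t fe mt|A t zt].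
- by rewrite nv // rmorphV ?uv //; case: mt.
- have ud := flag_diag fe.
  have -> := wv A e h t fe mt; have [zt _] := mt.
  rewrite invrM; [|exact: character_unit|exact: uv].
  by rewrite mulrC character_unitN.
- by rewrite unitrV uv.
Qed.

Lemma unit_functionZ J w v (n : int) : unit_function J w v -> exists v', unit_function J (w *~ n) v'.
Proof.
case: n => n h; first by exists (fun A t => v A t ^+ n); exact: unit_functionX.
exists (fun A t => (v A t ^+ n.+1)^-1); rewrite NegzE mulrNz.
by apply: unit_functionV; exact: unit_functionX.
Qed.

Lemma weight_cancel A (x : 'M[A]_4) (i j a b : 'I_4) (u u' : A) : (forall i, x i i \is a GRing.unit) ->
  u' * (x a a ^+ q * x b b ^+ q) = x i i * x j j * u -> u' = character (ew q i a + ew q j b) x * u.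
Proof.
move=> ux e; have uq l : x l l ^+ q \is a GRing.unit by rewrite unitrX ?ux.
apply: (mulIr (uq a)); apply: (mulIr (uq b)).
rewrite -mulrA e (characterD _ _ ux) -(character_ew q i a ux) -(character_ew q j b ux).
by move: (character _ x) (character _ x) (_ ^+ q) (_ ^+ q) => c d p r; ring.
Qed.

Lemma actE A (e : 'M[A]_4 * 'M[A]_4) (h : zip_group q e) (t : T A) i j :
  ent zm (act h t) i 0 * e.2 0 j + (ent zm (act h t) i 1 * e.2 1 j
    + (ent zm (act h t) i 2%:R * e.2 2%:R j + ent zm (act h t) i 3%:R * e.2 3%:R j)) =
  e.1 i 0 * ent zm t 0 j + (e.1 i 1 * ent zm t 1 j + (e.1 i 2%:R * ent zm t 2%:R j + e.1 i 3%:R * ent zm t 3%:R j)).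
Proof.
have [_ u2 h3 hq _] := iffLR (zip_groupP q_pchar _) h.
have e1 : sval (zm A (act h t)) *m e.2 = e.1 *m sval (zm A t).
  by rewrite zmap_equivariant mulmxKV.
by have /matrixP/(_ i j) := e1; rewrite !mxE !sum4.
Qed.

Lemma inv_entries A (t : T A) : exists y : 'I_4 -> 'I_4 -> A,
  (forall i j, ent zm t i 0 * y 0 j + (ent zm t i 1 * y 1 j + (ent zm t i 2%:R * y 2%:R j + ent zm t i 3%:R * y 3%:R j)) = (i == j)%:R) /\
  (forall i j, y i 0 * ent zm t 0 j + (y i 1 * ent zm t 1 j + (y i 2%:R * ent zm t 2%:R j + y i 3%:R * ent zm t 3%:R j)) = (i == j)%:R).
Proof.
have u := svalP (zm A t); exists (fun i j => invmx (sval (zm A t)) i j).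
split=> i j.
  by have /matrixP/(_ i j) := mulmxV u; rewrite [in X in X -> _]mxE [in X in X -> _]sum4 mxE.
by have /matrixP/(_ i j) := mulVmx u; rewrite [in X in X -> _]mxE [in X in X -> _]sum4 mxE.
Qed.

Lemma unit_of A (x y : A) : x * y = 1 -> x \is a GRing.unit.
Proof. by move=> e; apply/unitrPr; exists y. Qed.

Lemma det2_unit A (a b c d a' b' c' d' : A) : a * a' + b * c' = 1 -> a * b' + b * d' = 0 ->
  c * a' + d * c' = 0 -> c * b' + d * d' = 1 -> a * d - b * c \is a GRing.unit.
Proof.
move=> e1 e2 e3 e4; apply: (unit_of (y := a' * d' - b' * c')).
transitivity ((a * a' + b * c') * (c * b' + d * d') - (a * b' + b * d') * (c * a' + d * c')); first by ring.
by rewrite e1 e2 e4 mul1r mul0r subr0.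
Qed.

(** The first row of X reduces to X_03, which is therefore invertible and transforms by the first
    diagonal entry of e.1 and the last of e.2. *)
Lemma unit_entry_last J : (forall i : 'I_4, (i < 3)%N -> J (0, i)) -> upper J ->
  unit_function J (ew q 0 3%:R) (fun A t => ent zm t 0 3%:R).
Proof.
move=> hJ uJ; split=> [|A e h t fe [zt _]|A t zt].
- exact: entry_natural.
- have zt' : zeroes zm J (act h t) by exact: zeroes_act.
  have [_ _ h3 hq hq3] := iffLR (zip_groupP q_pchar _) h.
  have ud := flag_diag fe; have uq : e.1 3%:R 3%:R ^+ q \is a GRing.unit by rewrite unitrX ?ud.
  apply: (mulIr uq); rewrite [RHS]mulrAC character_ew // -hq3.
  have := actE h t 0 3%:R; rewrite (zt' 0 0 (hJ 0 isT)) (zt' 0 1 (hJ 1 isT)) (zt' 0 2%:R (hJ 2%:R isT)).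
  rewrite !mul0r !add0r => ->.
  have tri (j : 'I_4) : (0 < j)%N -> e.1 0 j = 0 by move=> lt; exact: (@flag_tri k q A e 0 j fe lt).
  by rewrite (tri 1) // (tri 2%:R) // (tri 3%:R) // !mul0r !addr0.
have [y [hy _]] := inv_entries t; have := hy 0 0.
rewrite (zt 0 0 (hJ 0 isT)) (zt 0 1 (hJ 1 isT)) (zt 0 2%:R (hJ 2%:R isT)) !mul0r !add0r.
exact: unit_of.
Qed.

Lemma unit_entry J (i j : 'I_4) : upper J -> (j < 3)%N ->
  (forall i' : 'I_4, (i' < i)%N -> J (i', j)) -> (forall j' : 'I_4, (j < j' < 3)%N -> J (i, j')) ->
  (forall A (t : T A), zeroes zm J t -> ent zm t i j \is a GRing.unit) ->
  unit_function J (ew q i j) (fun A t => ent zm t i j).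
Proof. by move=> uJ j3 hi hj hu; split=> //; [exact: entry_natural | exact: entry_weight]. Qed.


Lemma minor_relation A (p b c d p' b' c' d' x1 x2 x3 y1 y2 y3 : A) :
  p' * y1 + b' * y2 = x1 * p -> b' * y3 = x1 * b ->
  c' * y1 + d' * y2 = x2 * p + x3 * c -> d' * y3 = x2 * b + x3 * d ->
  (p' * d' - b' * c') * (y1 * y3) = x1 * x3 * (p * d - b * c).
Proof.
move=> e1 e2 e3 e4.
transitivity ((p' * y1 + b' * y2) * (d' * y3) - (b' * y3) * (c' * y1 + d' * y2)); first by ring.
by rewrite e1 e2 e3 e4; ring.
Qed.

(** The four relations say that the 2x2 block is transformed by triangular matrices on both sides,
    so its determinant is multiplied by the product of their diagonals. *)
Lemma unit_minor J (r r' c c' : 'I_4) : upper J ->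
  (forall A (t : T A), zeroes zm J t ->
     ent zm t r c * ent zm t r' c' - ent zm t r c' * ent zm t r' c \is a GRing.unit) ->
  (forall A (e : 'M[A]_4 * 'M[A]_4) (h : zip_group q e) (t : T A), flag_group q e -> zeroes zm J t ->
     zeroes zm J (act h t) -> exists y, [/\
     ent zm (act h t) r c * e.1 c c ^+ q + ent zm (act h t) r c' * y = e.1 r r * ent zm t r c,
     ent zm (act h t) r c' * e.1 c' c' ^+ q = e.1 r r * ent zm t r c',
     ent zm (act h t) r' c * e.1 c c ^+ q + ent zm (act h t) r' c' * y =
       e.1 r' r * ent zm t r c + e.1 r' r' * ent zm t r' c
   & ent zm (act h t) r' c' * e.1 c' c' ^+ q = e.1 r' r * ent zm t r c' + e.1 r' r' * ent zm t r' c']) ->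
  unit_function J (ew q r c + ew q r' c')
    (fun A t => ent zm t r c * ent zm t r' c' - ent zm t r c' * ent zm t r' c).
Proof.
move=> uJ hu hE; split=> // [A B f t _|A e h t fe [zt _]].
  by rewrite !ent_fmap rmorphB !rmorphM.
have zt' : zeroes zm J (act h t) by exact: zeroes_act.
have [y [e1 e2 e3 e4]] := hE A e h t fe zt zt'.
by apply: weight_cancel (flag_diag fe) _; apply: minor_relation e1 e2 e3 e4.
Qed.

End UnitFunctions.

Section CurveUnits.
Variables (k : fieldType) (q : nat) (S : kfunctor k) (zeta : zip_morphism q S).
Implicit Types (A B C D E K R : comUnitAlgType k).
Hypotheses (q_pchar : [pchar k].-nat q) (q_gt1 : (1 < q)%N).
Local Notation T := (ztot zeta).
Local Notation zm := (zmap zeta).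
Local Notation act := (zip_act (zact zeta)).

Definition positions : seq (nat * nat) := [:: (0, 0); (0, 1); (0, 2); (1, 1); (1, 2); (2, 2)]%N.

Lemma upper_up F : all (fun c : nat * nat => all (fun d : nat * nat =>
    [&& (c.1 <= d.1)%N, (d.2 <= c.2)%N & c \in F] ==> (d \in F)) positions) positions -> upper (up F).
Proof.
move=> h i j i' j'; rewrite /up /= => /andP [/andP [ij j3] nF]; split=> // ii /andP [jj j'3].
have ij' : (i' <= j')%N by apply: leq_trans jj; apply: leq_trans ij.
rewrite ij' j'3 /=; apply: contraNN nF => F'.
have pos (a b : nat) : (a <= b < 3)%N -> (a, b) \in positions.
  by case/andP; case: a b => [|[|[|a]]] [|[|[|b]]].
have /allP/(_ (nat_of_ord i', nat_of_ord j')) := h.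
rewrite pos ?ij' // => /(_ isT)/allP/(_ (nat_of_ord i, nat_of_ord j)).
by rewrite pos ?ij // => /(_ isT); rewrite /= ii jj F'.
Qed.

Section Facts.
Variables (A : comUnitAlgType k) (e : 'M[A]_4 * 'M[A]_4) (h : zip_group q e).
Hypothesis fe : flag_group q e.

Lemma flag_x : [/\ e.1 0 1 = 0, e.1 0 2%:R = 0, e.1 0 3%:R = 0 & [/\ e.1 1 2%:R = 0, e.1 1 3%:R = 0 & e.1 2%:R 3%:R = 0]].
Proof. by split; [..|split]; apply: (flag_tri fe). Qed.

Lemma flag_y : [/\ e.2 0 1 = 0, e.2 0 2%:R = 0, e.2 1 2%:R = 0 & forall j : 'I_4, (j < 3)%N -> e.2 3%:R j = 0] /\
  (forall i, e.2 i i = e.1 i i ^+ q).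
Proof.
have [_ _ h3 hq hq3] := iffLR (zip_groupP q_pchar _) h.
have [x01 x02 _ [x12 _ _]] := flag_x.
have q0 : (0 : A) ^+ q = 0 by rewrite expr0n gtn_eqF // ltnW.
split; last by apply: ord4_ind => //; apply: hq.
by split; [rewrite hq // x01 | rewrite hq // x02 | rewrite hq // x12 | move=> j /h3 []].
Qed.
End Facts.

Definition curve (m : nat) : pred ('I_4 * 'I_4) := up [:: (m, m)].

Lemma curve_upper m : upper (curve m).
Proof. apply: upper_up; case: m => [|[|[|m]]] //. Qed.

Ltac simplify_zeros :=
  repeat match goal with H : ?x = 0 |- context [?x] => rewrite H end;
  rewrite ?(mulr0, mul0r, add0r, addr0).

(** On the curve m the matrix X [zperm] is block triangular, with two blocks of size 1 and one of
    size 2 containing X_mm. The determinants of the blocks are the three units, here X_10, X_03 and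
    the minor in rows 2, 3 and columns 1, 2; the other two curves are treated alike. *)
Lemma curve2_units :
  [/\ unit_function (curve 2) (ew q 1 0) (fun A (t : T A) => ent zm t 1 0),
      unit_function (curve 2) (ew q 0 3%:R) (fun A (t : T A) => ent zm t 0 3%:R)
    & unit_function (curve 2) (ew q 2%:R 1 + ew q 3%:R 2%:R)
       (fun A (t : T A) => ent zm t 2%:R 1 * ent zm t 3%:R 2%:R - ent zm t 2%:R 2%:R * ent zm t 3%:R 1)].
Proof.
have uJ := @curve_upper 2.
have z A (t : T A) : zeroes zm (curve 2) t -> [/\ ent zm t 0 0 = 0, ent zm t 0 1 = 0, ent zm t 0 2%:R = 0,
    ent zm t 1 1 = 0 & ent zm t 1 2%:R = 0] by move=> zt; split; apply: zt.
have inv A (t : T A) : zeroes zm (curve 2) t -> exists y : 'I_4 -> 'I_4 -> A,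
    [/\ forall j, ent zm t 0 3%:R * y 3%:R j = (0 == j)%:R,
        forall j, ent zm t 1 0 * y 0 j + ent zm t 1 3%:R * y 3%:R j = (1 == j)%:R,
        forall j, j != 0 -> y 3%:R j = 0, forall j, j != 0 -> j != 1 -> y 0 j = 0
      & forall i j, j != 0 -> j != 1 -> ent zm t i 1 * y 1 j + ent zm t i 2%:R * y 2%:R j = (i == j)%:R].
  move=> zt; have [z00 z01 z02 z11 z12] := z A t zt; have [y [hy _]] := inv_entries t.
  have h0 j : ent zm t 0 3%:R * y 3%:R j = (0 == j)%:R.
    by have := hy 0 j; rewrite z00 z01 z02 !mul0r !add0r.
  have h1 j : ent zm t 1 0 * y 0 j + ent zm t 1 3%:R * y 3%:R j = (1 == j)%:R.
    by have := hy 1 j; rewrite z11 z12 !mul0r !add0r.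
  have u3 := unit_of (h0 0).
  have y3 j : j != 0 -> y 3%:R j = 0.
    by move=> nj; apply: (mulrI u3); rewrite mulr0 h0 eq_sym (negbTE nj).
  have u0 : ent zm t 1 0 \is a GRing.unit.
    by apply: (unit_of (y := y 0 1)); have := h1 1; rewrite y3 // mulr0 addr0.
  have y0 j : j != 0 -> j != 1 -> y 0 j = 0.
    move=> n0 n1; have := h1 j; rewrite y3 // mulr0 addr0 eq_sym (negbTE n1) => e0.
    by apply: (mulrI u0); rewrite mulr0.
  exists y; split=> // i j n0 n1.
  by have := hy i j; rewrite y0 // y3 // !mulr0 add0r addr0.
split.
- apply: unit_entry => // [|j|A t zt]; first by elim/ord4_ind.
    by case: j => [[|[|[|[|//]]]]].
  have [y [h0 h1 y3 _ _]] := inv A t zt.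
  by apply: (unit_of (y := y 0 1)); have := h1 1; rewrite y3 // mulr0 addr0.
- by apply: unit_entry_last => // ; elim/ord4_ind.
apply: unit_minor => // [A t zt|A e h t fe zt zt'].
  have [y [_ _ _ _ h2]] := inv A t zt.
  by apply: (det2_unit (h2 2%:R 2%:R isT isT) (h2 2%:R 3%:R isT isT) (h2 3%:R 2%:R isT isT) (h2 3%:R 3%:R isT isT)).
have [z00 z01 z02 z11 z12] := z A t zt; have [z00' z01' z02' z11' z12'] := z A _ zt'.
have [x01 x02 x03 [x12 x13 x23]] := flag_x fe.
have [[y01 y02 y12 y3] yd] := flag_y h fe; have y30 := y3 0 isT; have y31 := y3 1 isT; have y32 := y3 2%:R isT.
exists (e.2 2%:R 1); rewrite -!yd; split;
  [have := actE q_pchar h t 2%:R 1 | have := actE q_pchar h t 2%:R 2%:R | have := actE q_pchar h t 3%:R 1 | have := actE q_pchar h t 3%:R 2%:R];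
  simplify_zeros; exact.
Qed.

Lemma curve1_units :
  [/\ unit_function (curve 1) (ew q 0 3%:R) (fun A (t : T A) => ent zm t 0 3%:R),
      unit_function (curve 1) (ew q 3%:R 2%:R) (fun A (t : T A) => ent zm t 3%:R 2%:R)
    & unit_function (curve 1) (ew q 1 0 + ew q 2%:R 1)
       (fun A (t : T A) => ent zm t 1 0 * ent zm t 2%:R 1 - ent zm t 1 1 * ent zm t 2%:R 0)].
Proof.
have uJ := @curve_upper 1.
have z A (t : T A) : zeroes zm (curve 1) t -> [/\ ent zm t 0 0 = 0, ent zm t 0 1 = 0, ent zm t 0 2%:R = 0,
    ent zm t 2%:R 2%:R = 0 & ent zm t 1 2%:R = 0] by move=> zt; split; apply: zt.
split.
- by apply: unit_entry_last => //; elim/ord4_ind.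
- apply: unit_entry => // [|j|A t zt]; first by elim/ord4_ind.
    by case: j => [[|[|[|[|//]]]]].
  have [z00 z01 z02 z22 z12] := z A t zt; have [y [_ hy]] := inv_entries t.
  apply: (unit_of (y := y 2%:R 3%:R)); have := hy 2%:R 2%:R.
  by rewrite z02 z12 z22 !mulr0 !add0r mulrC.
apply: unit_minor => // [A t zt|A e h t fe zt zt'].
  have [z00 z01 z02 z22 z12] := z A t zt; have [y [hy _]] := inv_entries t.
  have h0 j : ent zm t 0 3%:R * y 3%:R j = (0 == j)%:R.
    by have := hy 0 j; rewrite z00 z01 z02 !mul0r !add0r.
  have u3 := unit_of (h0 0).
  have y3 j : j != 0 -> y 3%:R j = 0.
    by move=> nj; apply: (mulrI u3); rewrite mulr0 h0 eq_sym (negbTE nj).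
  have h2 i j : ent zm t i 2%:R = 0 -> j != 0 -> ent zm t i 0 * y 0 j + ent zm t i 1 * y 1 j = (i == j)%:R.
    by move=> zi nj; have := hy i j; rewrite zi (y3 j nj) mul0r mulr0 !addr0.
  by apply: (det2_unit (h2 1 1 z12 isT) (h2 1 2%:R z12 isT) (h2 2%:R 1 z22 isT) (h2 2%:R 2%:R z22 isT)).
have [z00 z01 z02 z22 z12] := z A t zt; have [z00' z01' z02' z22' z12'] := z A _ zt'.
have [x01 x02 x03 [x12 x13 x23]] := flag_x fe.
have [[y01 y02 y12 y3] yd] := flag_y h fe; have y30 := y3 0 isT; have y31 := y3 1 isT; have y32 := y3 2%:R isT; have z11 := z00; have z11' := z00'.
exists (e.2 1 0); rewrite -!yd; split;
  [have := actE q_pchar h t 1 0 | have := actE q_pchar h t 1 1 | have := actE q_pchar h t 2%:R 0 | have := actE q_pchar h t 2%:R 1];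
  simplify_zeros; exact.
Qed.

Lemma curve0_units :
  [/\ unit_function (curve 0) (ew q 3%:R 2%:R) (fun A (t : T A) => ent zm t 3%:R 2%:R),
      unit_function (curve 0) (ew q 2%:R 1) (fun A (t : T A) => ent zm t 2%:R 1)
    & unit_function (curve 0) (ew q 0 3%:R + ew q 1 0)
       (fun A (t : T A) => ent zm t 0 3%:R * ent zm t 1 0 - ent zm t 0 0 * ent zm t 1 3%:R)].
Proof.
have uJ := @curve_upper 0.
have z A (t : T A) : zeroes zm (curve 0) t -> [/\ ent zm t 1 1 = 0, ent zm t 0 1 = 0, ent zm t 0 2%:R = 0,
    ent zm t 2%:R 2%:R = 0 & ent zm t 1 2%:R = 0] by move=> zt; split; apply: zt.
have inv A (t : T A) : zeroes zm (curve 0) t -> exists y : 'I_4 -> 'I_4 -> A,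
    [/\ y 2%:R 3%:R * ent zm t 3%:R 2%:R = 1, y 1 2%:R * ent zm t 2%:R 1 = 1
      & forall i j, i != 1 -> i != 2%:R -> y i 0 * ent zm t 0 j + y i 1 * ent zm t 1 j = (i == j)%:R].
  move=> zt; have [z11 z01 z02 z22 z12] := z A t zt; have [y [_ hy]] := inv_entries t.
  have h2 i : y i 3%:R * ent zm t 3%:R 2%:R = (i == 2%:R)%:R.
    by have := hy i 2%:R; rewrite z02 z12 z22 !mulr0 !add0r.
  have h1 i : y i 2%:R * ent zm t 2%:R 1 + y i 3%:R * ent zm t 3%:R 1 = (i == 1)%:R.
    by have := hy i 1; rewrite z01 z11 !mulr0 !add0r.
  have u32 : ent zm t 3%:R 2%:R \is a GRing.unit.
    by apply: (unit_of (y := y 2%:R 3%:R)); rewrite mulrC h2.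
  have y3 i : i != 2%:R -> y i 3%:R = 0.
    by move=> ni; apply: (mulIr u32); rewrite mul0r h2 (negbTE ni).
  have e12 : y 1 2%:R * ent zm t 2%:R 1 = 1 by have := h1 1; rewrite y3 // mul0r addr0.
  have u21 : ent zm t 2%:R 1 \is a GRing.unit by apply: (unit_of (y := y 1 2%:R)); rewrite mulrC.
  have y2 i : i != 1 -> i != 2%:R -> y i 2%:R = 0.
    by move=> n1 n2; have := h1 i; rewrite y3 // mul0r addr0 (negbTE n1) => e0; apply: (mulIr u21); rewrite mul0r.
  exists y; split=> // i j n1 n2.
  by have := hy i j; rewrite y2 // y3 // !mul0r !addr0.
split.
- apply: unit_entry => // [|j|A t zt]; first by elim/ord4_ind.
    by case: j => [[|[|[|[|//]]]]].
  have [y [h2 _ _]] := inv A t zt.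
  by apply: (unit_of (y := y 2%:R 3%:R)); rewrite mulrC.
- apply: unit_entry => // [|j|A t zt]; first by elim/ord4_ind.
    by case: j => [[|[|[|[|//]]]]].
  have [y [_ h1 _]] := inv A t zt.
  by apply: (unit_of (y := y 1 2%:R)); rewrite mulrC.
apply: unit_minor => // [A t zt|A e h t fe zt zt'].
  have [y [_ _ h0]] := inv A t zt; rewrite [ent zm t 0 0 * _]mulrC.
  apply: (@det2_unit _ _ _ _ _ _ (y 3%:R 0) (y 0 0) (y 3%:R 1) (y 0 1)); rewrite ![ent zm t _ _ * y _ _]mulrC h0 //.
have [z11 z01 z02 z22 z12] := z A t zt; have [z11' z01' z02' z22' z12'] := z A _ zt'.
have [x01 x02 x03 [x12 x13 x23]] := flag_x fe.
have [[y01 y02 y12 y3] yd] := flag_y h fe; have y30 := y3 0 isT; have y31 := y3 1 isT; have y32 := y3 2%:R isT; have z00 := z11; have z00' := z11'.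
exists (e.2 0 3%:R); rewrite -!yd; split;
  [rewrite [LHS]addrC; have := actE q_pchar h t 0 3%:R | have := actE q_pchar h t 0 0 | rewrite [LHS]addrC; have := actE q_pchar h t 1 3%:R | have := actE q_pchar h t 1 0];
  simplify_zeros; exact.
Qed.

End CurveUnits.

(** * Sections of negative degree on the curves *)

Section Descent.
Variables (k : fieldType) (q : nat) (S : kfunctor k) (zeta : zip_morphism q S) (Fl : flag_space zeta).
Implicit Types (A B C D E K R : comUnitAlgType k) (J : pred ('I_4 * 'I_4)) (Om U V : point_set (ztot zeta)).
Hypothesis cond_a : zip_smooth zeta.
Hypothesis cond_c : flag_curves_pseudo_complete Fl.
Hypotheses (q_pchar : [pchar k].-nat q) (q_root : forall c : k, exists d, d ^+ q = c) (q_gt1 : (1 < q)%N).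
Local Notation T := (ztot zeta).
Local Notation zm := (zmap zeta).
Local Notation act := (zip_act (zact zeta)).
Local Notation T_e := (zeroes zm (up [::])).

(** Neighbourhoods of T_e stable under E'. The last field makes Om also closed in each curve, as
    [extension_by_zero] requires. *)
Record good Om : Prop := Good {
  good_open : p_open Om;
  good_stable : stable Om;
  good_Te : forall K (t : T K), is_field K -> T_e t -> Om K t;
  good_curve : forall m, (m < 3)%N -> p_open (fun K (t : T K) => zeroes zm (curve m) t -> ~ Om K t)
}.

Lemma zeroes_sub J J' A (t : T A) : (forall c, J c -> J' c) -> zeroes zm J' t -> zeroes zm J t.
Proof. by move=> h z i j /h; apply: z. Qed.

Lemma up_nil F c : up F c -> up [::] c.
Proof. by rewrite /up inE /= andbT => /andP []. Qed.

Lemma good_tmem Om F K (t : T K) : good Om -> is_field K -> T_e t -> tmem zm Om (up F) t.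
Proof.
move=> gO hK te; split; first by apply: zeroes_sub te => c; exact: up_nil.
apply: inside_point => //; [exact: good_open | exact: good_Te].
Qed.

Lemma good_everywhere : good (everywhere (zeta := zeta)).
Proof.
split=> // [A t K psi hK _|m m3]; first by exists 1; rewrite rmorph1 oner_eq0.
by apply: p_open_closed => A t K psi _ _ /(_ I).
Qed.

Lemma curve_kill (i0 : 'I_3) Om mu wv (phi v : forall A, T A -> A) N n K (t : T K) :
  good Om -> natural zm Om (curve i0) phi -> weight Om (curve i0) mu phi ->
  unit_function (zeta := zeta) (curve i0) wv v -> (0 < n)%N ->
  mu *+ N.+1 + wv + ew q (inord i0) (inord i0) *+ n = 0 ->
  is_field K -> T_e t -> vanish zm Om (curve i0) phi t.
Proof.
move=> gO nphi wphi [nv wtv uv] n0 e0 hK te; pose a : 'I_4 := inord i0.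
have aE : a = i0 :> nat by rewrite /a inordK //; apply: leq_trans (ltn_ord i0) _.
have mt := good_tmem [:: (i0 : nat, i0 : nat)] gO hK te.
apply: (@curve_vanish k q S zeta Fl cond_a q_pchar q_root q_gt1 (curve i0) a (simple_refl i0)
  (@curve_upper i0) _ _ _ _ _ _ Om mu wv phi v N n K t).
- by rewrite aE.
- by rewrite /curve /up /= aE leqnn ltn_ord inE eqxx.
- move=> i; rewrite /curve /up /= aE !inE !xpair_eqE; split=> [lt|/andP [lt lt3]].
    by rewrite (ltnW lt) (ltn_eqF lt) ltn_ord.
  by rewrite (ltnW lt) (gtn_eqF lt) lt3 andbF.
- by move=> K' g _; exact: simple_stratum_zero.
- by move=> K' g hK' h0 g0; exact: zero_simple_stratum.
- by apply: cond_c; exact: simple_refl_length.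
- exact: good_open.
- exact: good_stable.
- by apply: good_curve.
- exact: nphi.
- exact: wphi.
- exact: nv.
- exact: wtv.
- exact: uv.
- exact: n0.
- exact: e0.
- exact: hK.
- exact: mt.
by apply: te; rewrite /up /= aE leqnn ltn_ord.
Qed.

Lemma rv_scale (w : 'rV[int]_4) n i : (w *+ n) 0 i = w 0 i *+ n.
Proof. by elim: n => [|n IH]; rewrite ?mulr0n ?mxE // !mulrS mxE IH. Qed.

Lemma rv_scalez (w : 'rV[int]_4) (n : int) i : (w *~ n) 0 i = w 0 i * n.
Proof.
have h m : (w *~ Posz m) 0 i = w 0 i * Posz m by rewrite -[w *~ _]/(w *+ m) rv_scale -mulr_natr natz.
by case: n => // n; rewrite NegzE mulrNz mxE h mulrN.
Qed.

Let Q : int := (q%:Z ^+ 2 + q%:Z + 1).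
(** The linear form that vanishes on the weights of the three units of the curve m and equals q^3 -
    1 on the weight (1 - q) e_m of X_mm. It plays the role of the degree of a weight on this
    curve. *)
Definition deg (m : 'I_3) (w : 'rV[int]_4) : int :=
  match nat_of_ord m with
  | 0%N => - Q * w 0 0 + w 0 1 + q%:Z * w 0 2%:R + q%:Z ^+ 2 * w 0 3%:R
  | 1%N => q%:Z ^+ 2 * w 0 0 - Q * w 0 1 + w 0 2%:R + q%:Z * w 0 3%:R
  | _ => q%:Z * w 0 0 + q%:Z ^+ 2 * w 0 1 - Q * w 0 2%:R + w 0 3%:R
  end.

Lemma kill (m : 'I_3) Om w (phi : forall A, T A -> A) K (t : T K) : good Om -> natural zm Om (curve m) phi -> weight Om (curve m) w phi ->
  deg m w < 0 -> is_field K -> T_e t -> vanish zm Om (curve m) phi t.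
Proof.
move=> gO nphi wphi dlt hK te.
(* The invariant function is phi^(q^3 - 1) v X_mm^n with n = - deg w, so that the degrees of phi and
   X_mm cancel. *)
have [N hN] : exists N, (N.+1)%:R = q%:Z ^+ 3 - 1 :> int.
  have e : q%:Z ^+ 3 = (q * q * q)%N%:Z by rewrite !exprS expr0 mulr1 !PoszM mulrA.
  have q3 : (1 < q * q * q)%N by nia.
  by exists (q * q * q - 2)%N; rewrite natz e; lia.
have [n n0 hn] : exists2 n, (0 < n)%N & n%:R = - deg m w :> int.
  by exists `|deg m w|%N; [move: dlt; lia | rewrite natz; move: dlt; lia].
have rv (wv : 'rV[int]_4) : (forall i, w 0 i * (q%:Z ^+ 3 - 1) + wv 0 i + ew q (inord m) (inord m) 0 i * - deg m w = 0) ->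
    w *+ N.+1 + wv + ew q (inord m) (inord m) *+ n = 0.
  move=> h; apply/rowP => i; rewrite !mxE !rv_scale.
  by rewrite -mulr_natr hN -[X in _ + X]mulr_natr hn h.
have iE (i : 'I_4) : i = m :> nat -> inord m = i by move=> <-; exact: inord_val.
pose w0 := w 0 0; pose w1 := w 0 1; pose w2 := w 0 2%:R; pose w3 := w 0 3%:R; pose qz := q%:Z.
suff [wv [v [hv ew0]]] : exists wv v, unit_function (zeta := zeta) (curve m) wv v /\
   (forall i, w 0 i * (q%:Z ^+ 3 - 1) + wv 0 i + ew q (inord m) (inord m) 0 i * - deg m w = 0).
  exact: curve_kill gO nphi wphi hv n0 (rv _ ew0) hK te.
clear rv n n0 hn N hN dlt phi nphi wphi.
case: m iE => [[|[|[|//]]] m3] iE.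
- have [U1 U2 U3] := @curve0_units k q S zeta q_pchar q_gt1.
  have [v1 h1] := unit_functionZ (qz * w1 + qz ^+ 2 * w2 + w3) U1.
  have [v2 h2] := unit_functionZ (qz ^+ 2 * w1 + w2 + qz * w3) U2.
  have [v3 h3] := unit_functionZ (w1 + qz * w2 + qz ^+ 2 * w3) U3.
  do 2 eexists; split; first exact: (unit_functionM (unit_functionM h1 h2) h3).
  rewrite (iE 0) // /deg /= /w1 /w2 /w3 /qz; elim/ord4_ind; rewrite !(mxE, rv_scale, rv_scalez) /= ?(mulr0n, mulr1n, mul0rn); rewrite ?[_ *+ q]mulr_natr /Q; ring.
- have [U1 U2 U3] := @curve1_units k q S zeta q_pchar q_gt1.
  have [v1 h1] := unit_functionZ (w0 + qz * w2 + qz ^+ 2 * w3) U1.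
  have [v2 h2] := unit_functionZ (qz * w0 + qz ^+ 2 * w2 + w3) U2.
  have [v3 h3] := unit_functionZ (qz ^+ 2 * w0 + w2 + qz * w3) U3.
  do 2 eexists; split; first exact: (unit_functionM (unit_functionM h1 h2) h3).
  rewrite (iE 1) // /deg /= /w0 /w2 /w3 /qz; elim/ord4_ind; rewrite !(mxE, rv_scale, rv_scalez) /= ?(mulr0n, mulr1n, mul0rn); rewrite ?[_ *+ q]mulr_natr /Q; ring.
have [U1 U2 U3] := @curve2_units k q S zeta q_pchar q_gt1.
have [v1 h1] := unit_functionZ (qz ^+ 2 * w0 + w1 + qz * w3) U1.
have [v2 h2] := unit_functionZ (w0 + qz * w1 + qz ^+ 2 * w3) U2.
have [v3 h3] := unit_functionZ (qz * w0 + qz ^+ 2 * w1 + w3) U3.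
do 2 eexists; split; first exact: (unit_functionM (unit_functionM h1 h2) h3).
rewrite (iE 2%:R) // /deg /= /w0 /w1 /w3 /qz; elim/ord4_ind; rewrite !(mxE, rv_scale, rv_scalez) /= ?(mulr0n, mulr1n, mul0rn); rewrite ?[_ *+ q]mulr_natr /Q; ring.
Qed.
End Descent.

(** * Dividing by a coordinate, and indefinite divisibility *)

Section DescentStep.
Variables (k : fieldType) (q : nat) (S : kfunctor k) (zeta : zip_morphism q S) (Fl : flag_space zeta).
Implicit Types (A B C D E K R : comUnitAlgType k) (J : pred ('I_4 * 'I_4)) (Om U V : point_set (ztot zeta)).
Hypothesis cond_a : zip_smooth zeta.
Hypotheses (q_pchar : [pchar k].-nat q) (q_root : forall c : k, exists d, d ^+ q = c) (q_gt1 : (1 < q)%N).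
Local Notation T := (ztot zeta).
Local Notation zm := (zmap zeta).
Local Notation act := (zip_act (zact zeta)).
Local Notation T_e := (zeroes zm (up [::])).

(** Only points of T_J at which phi is not locally 0 are removed, so that phi vanishes on the whole
    of T_J inside the smaller set ([shrink_vanish]). *)
Definition shrink Om J (phi : forall A, T A -> A) : point_set T :=
  fun K t => Om K t /\ (zeroes zm J t -> vanish zm Om J phi t).

Lemma shrink_vanish Om J (phi : forall A, T A -> A) A (t : T A) : natural zm Om J phi ->
  tmem zm (shrink Om J phi) J t -> phi A t = 0.
Proof.
move=> nphi [zt it]; apply: (vanish_all nphi).
  by split=> // K psi hK; have [] := it K psi hK.
by move=> K psi hK; have [_ h] := it K psi hK; apply: h; exact: zeroes_fmap.
Qed.

(** By the hypothesis on m, a curve either lies in T_J or meets it inside T_e. In the first case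
    closedness along the curve follows from [vanish_locally_constant]; in the second phi is locally
    0 at the common points, so nothing is removed. *)
Lemma good_shrink Om J w (phi : forall A, T A -> A) : good Om -> upper J ->
  natural zm Om J phi -> weight Om J w phi ->
  (forall m, (m < 3)%N -> (forall c, J c -> curve m c) \/ (forall c, up [::] c -> J c \/ curve m c)) ->
  (forall K (t : T K), is_field K -> T_e t -> vanish zm Om J phi t) ->
  good (shrink Om J phi).
Proof.
move=> [oO sO eO cO] uJ nphi wphi hJ hv.
have memJ K (t : T K) : is_field K -> Om K t -> zeroes zm J t -> tmem zm Om J t.
  by move=> hK Ot zt; split=> //; exact: inside_point.
split.
- apply: p_openI => //; apply: p_open_closed => A t K psi zt hK [V [Vo Vt hV]].
  by have [s [s0 hs]] := Vo A t K psi hK Vt; exists s; split=> // K' psi' hK' /(hs _ _ hK') Vt'; exists V.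
- move=> K e h t hK fe [Ot vt]; have Oht : Om K (act h t) by exact: sO.
  split=> // zht; have [e' [h' [fe' e1]]] := act_inv Fl h t fe.
  apply: (vanish_act cond_a q_pchar q_gt1 (h := h') oO sO uJ nphi wphi hK fe'); first exact: memJ.
  rewrite e1; apply: vt; rewrite -e1; exact: zeroes_act.
- by move=> K t hK te; split=> [|zt]; [exact: eO | exact: hv].
move=> m m3; apply: p_open_closed => A t K psi zt hK nO'.
have zpt := zeroes_fmap psi zt.
have [Ot|nOt] := pselect (Om K (fmap psi t)); last first.
  have [s [s0 hs]] := cO m m3 A t K psi hK (fun _ => nOt).
  exists s; split=> // K' psi' hK' n0 [Ot' _].
  exact: (hs K' psi' hK' n0 (zeroes_fmap psi' zt) Ot').
have [zJ nv] : zeroes zm J (fmap psi t) /\ ~ vanish zm Om J phi (fmap psi t).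
  split; first by apply: contrapT => nz; apply: nO'; split=> // /nz.
  by move=> v; apply: nO'.
have [sub|cov] := hJ m m3; last first.
  case: nv; apply: hv => // i j hij; have [h|h] := cov (i, j) hij; [exact: zJ | exact: zpt].
have [V [oV Vt hV]] := vanish_locally_constant cond_a q_pchar q_root q_gt1 oO nphi hK (memJ _ _ hK Ot zJ).
have [s [s0 hs]] := p_openI oO oV hK (conj Ot Vt).
exists s; split=> // K' psi' hK' n0 [_ v']; have [Ot' Vt'] := hs K' psi' hK' n0.
have zJ' : zeroes zm J (fmap psi' t) by apply: zeroes_sub sub _; exact: zeroes_fmap.
by apply: nv; apply/(hV K' _ hK' (memJ _ _ hK' Ot' zJ') Vt'); apply: v'.
Qed.

(* The divisor along which a function on T_J is divided. *)
Record division_entry J (c : 'I_4 * 'I_4) J' : Prop := DivisionEntry {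
  de_free : ~~ J c;
  de_zero : forall d, J' d = J d || (d == c);
  de_upper : upper J';
  de_col : (c.2 < 3)%N;
  de_above : forall i : 'I_4, (i < c.1)%N -> J (i, c.2);
  de_right : forall j : 'I_4, (c.2 < j < 3)%N -> J (c.1, j);
  de_Te : up [::] c;
  de_curve : forall m, (m < 3)%N -> (forall d, J' d -> curve m d) \/ (forall d, up [::] d -> J' d \/ curve m d)
}.

(** After shrinking, phi vanishes on the divisor T_J' of T_J given by the coordinate c, which is a
    nonzerodivisor on the charts of T_J. *)
Lemma divide Om J c J' w (phi : forall A, T A -> A) : good Om -> upper J -> division_entry J c J' ->
  natural zm Om J phi -> weight Om J w phi ->
  (forall K (t : T K), is_field K -> T_e t -> vanish zm Om J' phi t) ->
  exists Om' phi', [/\ good Om', forall K (t : T K), Om' K t -> Om K t, natural zm Om' J phi',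
    weight Om' J (w - ew q c.1 c.2) phi'
    & forall A (t : T A), tmem zm Om' J t -> phi A t = ent zm t c.1 c.2 * phi' A t].
Proof.
move=> gO uJ [nc zJ' uJ' c3 above right _ hcurve] nphi wphi hv.
have sub A (t : T A) : tmem zm Om J' t -> tmem zm Om J t.
  by case=> zt it; split=> //; apply: zeroes_sub zt => d hd; rewrite zJ' hd.
have nphi' : natural zm Om J' phi by move=> A B f t mt; apply: nphi; exact: sub.
have wphi' : weight Om J' w phi by move=> A e h t fe mt; apply: wphi => //; exact: sub.
pose Om' := shrink Om J' phi.
have gO' : good Om' by exact: (good_shrink gO uJ' nphi' wphi' hcurve hv).
have subO K (t : T K) : Om' K t -> Om K t by case.
have sub' A (t : T A) : tmem zm Om' J t -> tmem zm Om J t by case=> zt it; split=> // K psi hK; apply: subO; apply: it.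
have n' : natural zm Om' J phi by move=> A B f t mt; apply: nphi; exact: sub'.
have w' : weight Om' J w phi by move=> A e h t fe mt; apply: wphi => //; exact: sub'.
have nx : natural zm Om' J (fun A (t : T A) => ent zm t c.1 c.2) by exact: entry_natural.
have wx : weight Om' J (ew q c.1 c.2) (fun A (t : T A) => ent zm t c.1 c.2) by exact: (entry_weight q_pchar q_gt1 uJ c3 above right).
have nzd R (u : T R) U z : chart zm Om' J u U -> ent zm u c.1 c.2 * z = 0 -> z = 0.
  by move=> hch; apply: (chart_nzd (proj1 cond_a) hch); case: (c) nc.
have v0 A (t : T A) : tmem zm Om' J t -> ent zm t c.1 c.2 = 0 -> phi A t = 0.
  move=> [zt it] t0; apply: (shrink_vanish nphi'); split=> // i j; rewrite zJ' => /orP [|/eqP e].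
    exact: zt.
  by rewrite -t0 -e.
have [phi' [n1 e1]] := division cond_a (good_open gO') nx n' nzd v0.
exists Om', phi'; split=> //.
exact: (division_weight cond_a q_pchar q_gt1 (good_open gO') (good_stable gO') uJ nx wx n1 w' nzd e1).
Qed.

(* Functions that can be divided indefinitely by coordinates vanishing at t
   vanish near t: the quotients generate a finitely generated ideal, and
   Nakayama applies to it. *)
Lemma divisible_vanish J K (t : T K) (Om : nat -> point_set T) (phi : nat -> forall A, T A -> A)
    (x : nat -> 'I_4 * 'I_4) : is_field K ->
  (forall n, p_open (Om n)) -> (forall n, tmem zm (Om n) J t) -> (forall n, natural zm (Om n) J (phi n)) ->
  (forall n K (t : T K), Om n.+1 K t -> Om n K t) ->
  (forall n A (t : T A), tmem zm (Om n.+1) J t -> phi n A t = ent zm t (x n).1 (x n).2 * phi n.+1 A t) ->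
  (forall n, ent zm t (x n).1 (x n).2 = 0) ->
  vanish zm (Om 0%N) J (phi 0%N) t.
Proof.
move=> hK oO mt nphi subO dvd x0.
have [R [u [U [hch Ut]]]] := chart_exists (proj2 cond_a) (oO 0%N) hK (mt 0%N).
have [th eth] := chart_point hch hK (mt 0%N) Ut; have [zu iu] := ch_mem hch.
(* All the functions phi_n are brought into the one ring R: after inverting s, nonzero at t, phi_n
   equals b_n up to a unit. *)
have exb n : exists sb : R * R, th sb.1 != 0 /\ forall C (f : {lrmorphism R -> C}), f sb.1 \is a GRing.unit ->
    tmem zm (Om n) J (fmap f u) /\ exists y : C, y \is a GRing.unit /\ f sb.2 = y * phi n C (fmap f u).
  have Ot : Om n K (fmap th u) by rewrite eth; apply: inside_field => //; case: (mt n).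
  have [s [s0 hs]] := open_local (oO n) hK Ot.
  have [B [p [[pu ps _] pl _]]] := @loc_exists k R s (ex_intro _ K (ex_intro _ th (conj hK s0))).
  have mp : tmem zm (Om n) J (fmap p u) by split; [exact: zeroes_fmap | exact: hs].
  have [b [l hb]] := ps (phi n B (fmap p u)).
  exists (s, b); split=> // C f fu /=.
  have mf : tmem zm (Om n) J (fmap f u) by split; [exact: zeroes_fmap | exact: hs].
  split=> //; exists (f s ^+ l); split; first by rewrite unitrX.
  have [g hg] := pl C f fu.
  have -> : fmap f u = fmap g (fmap p u) by rewrite -fmap_comp'; apply: fmap_ext => y; rewrite hom_compE hg.
  by rewrite nphi // -(hg b) hb rmorphM rmorphXn /= hg mulrC.
have [sb hsb] := choice exb; pose b n := (sb n).2.
(* The factor y contains the coordinate by which phi_n was divided, so it vanishes at t. *)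
have step n : exists s y, [/\ th s != 0, th y = 0 & s * b n = y * b n.+1].
  have [s0 h0] := hsb n; have [s1 h1] := hsb n.+1.
  have s01 : th ((sb n).1 * (sb n.+1).1) != 0 by rewrite rmorphM; exact: field_mulf_neq0.
  have [B [p [[pu ps pk] pl _]]] := @loc_exists k R _ (ex_intro _ K (ex_intro _ th (conj hK s01))).
  move: (pu); rewrite rmorphM unitrM => /andP [u0 u1].
  have [m0 [y0 [uy0 e0]]] := h0 B p u0; have [m1 [y1 [uy1 e1]]] := h1 B p u1.
  have [c0 [l0 hc0]] := ps y0; have [c1 [l1 hc1]] := ps y1.
  set sg := (sb n).1 * (sb n.+1).1 in pu pk hc0 hc1 s01.
  have eB : p (c1 * sg ^+ l0 * b n - c0 * sg ^+ l1 * ent zm u (x n).1 (x n).2 * b n.+1) = 0.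
    rewrite rmorphB !rmorphM !rmorphXn /= hc0 hc1 e0 e1 (dvd n) // ent_fmap.
    by move: (p sg ^+ l0) (p sg ^+ l1) (phi n.+1 B _) (p (ent _ _ _ _)) => d0 d1 d2 d3; ring.
  have [M hM] := pk _ eB.
  exists (sg ^+ M * (c1 * sg ^+ l0)), (sg ^+ M * (c0 * sg ^+ l1 * ent zm u (x n).1 (x n).2)); split.
  - rewrite !rmorphM !rmorphXn /=; apply: field_mulf_neq0 => //; first exact: field_expf_neq0.
    apply: field_mulf_neq0 => //; last exact: field_expf_neq0.
    have [g hg] := pl K th (hK _ s01).
    have -> : th c1 = g y1 * th sg ^+ l1 by rewrite -(hg c1) hc1 rmorphM rmorphXn /= hg.
    by apply: field_mulf_neq0 => //; [exact: unit_field_neq0 | exact: field_expf_neq0].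
  - rewrite !rmorphM /=; have -> : th (ent zm u (x n).1 (x n).2) = 0 by rewrite -ent_fmap eth.
    by rewrite !mulr0.
  by apply/eqP; rewrite -subr_eq0 -!mulrA -mulrBr !mulrA in hM *; apply/eqP.
have common n : exists s, th s != 0 /\ forall i, (i < n)%N -> exists y, th y = 0 /\ s * b i = y * b n.
  elim: n => [|n [s [s0 IH]]]; first by exists 1; rewrite rmorph1 oner_eq0.
  have [s' [y' [s'0 y'0 e']]] := step n.
  exists (s' * s); split=> [|i]; first by rewrite rmorphM; exact: field_mulf_neq0.
  rewrite ltnS leq_eqVlt => /orP [/eqP ->|/IH [y [y0 e]]].
    exists (y' * s); split; first by rewrite rmorphM /= y'0 mul0r.
    by rewrite mulrAC e' mulrAC.
  exists (y * y'); split; first by rewrite rmorphM /= y0 mul0r.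
  by rewrite -mulrA e mulrCA e' mulrA.
(* Nakayama: some b_n is a combination of earlier b_i, while s b_i = y_i b_n with y_i vanishing at
   t; hence (s - sum h_i y_i) b_n = 0 with a coefficient nonzero at t. *)
have [n [h hn]] := chart_noeth (proj1 cond_a) hch b.
have [s [s0 hs]] := common n.
have hs' (i : 'I_n) : exists y, th y = 0 /\ s * b i = y * b n by exact: hs.
have [y hy] := choice hs'.
have e1 : (s - \sum_(i < n) h i * y i) * b n = 0.
  rewrite mulrBl {1}hn mulr_sumr mulr_suml -sumrB big1 // => i _.
  by rewrite mulrCA (hy i).2 mulrA subrr.
have r0 : th (s - \sum_(i < n) h i * y i) != 0.
  by rewrite rmorphB rmorph_sum big1 ?subr0 // => i _; rewrite rmorphM /= (hy i).1 mulr0.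
have [s' [s'0 e0]] : exists s', th s' != 0 /\ s' * b 0%N = 0.
  case: n h hn s s0 hs hs' y hy e1 r0 => [|n] h hn s s0 hs hs' y hy e1 r0.
    by exists (s - \sum_(i < 0) h i * y i).
  have [y' [_ e']] := hs 0%N isT.
  exists ((s - \sum_(i < n.+1) h i * y i) * s); split; first by rewrite rmorphM; exact: field_mulf_neq0.
  by rewrite -mulrA e' mulrCA e1 mulr0.
apply/(vanish_chart (oO 0%N) (nphi 0%N) hch hK Ut eth).
have [sb0 hb0] := hsb 0%N.
have [B [p [[pu _ pk] _ _]]] := @loc_exists k R _ (ex_intro _ K (ex_intro _ th (conj hK sb0))).
have [_ [z [uz ez]]] := hb0 B p pu.
have [|M hM] := pk (s' * phi 0%N R u).
  apply: (mulrI uz); rewrite mulr0 rmorphM /= mulrCA -(nphi 0%N) // -ez -rmorphM /=.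
  by rewrite e0 rmorph0.
exists ((sb 0%N).1 ^+ M * s'); split; last by rewrite -mulrA.
by rewrite rmorphM rmorphXn; apply: field_mulf_neq0 => //; exact: field_expf_neq0.
Qed.

End DescentStep.

(** * The chain of weight conditions from the curves to D *)

Section DescentChain.
Variables (k : fieldType) (q : nat) (S : kfunctor k) (zeta : zip_morphism q S) (Fl : flag_space zeta).
Implicit Types (A B C D E K R : comUnitAlgType k) (J : pred ('I_4 * 'I_4)) (Om U V : point_set (ztot zeta)).
Hypothesis cond_a : zip_smooth zeta.
Hypothesis cond_c : flag_curves_pseudo_complete Fl.
Hypotheses (q_pchar : [pchar k].-nat q) (q_root : forall c : k, exists d, d ^+ q = c) (q_gt1 : (1 < q)%N).
Local Notation T := (ztot zeta).
Local Notation zm := (zmap zeta).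
Local Notation T_e := (zeroes zm (up [::])).

(* Every section over T_J with weight in W vanishes along T_e. *)
Definition vanishing J (W : 'rV[int]_4 -> Prop) := forall Om w (phi : forall A, T A -> A),
  good Om -> natural zm Om J phi -> weight Om J w phi -> W w ->
  forall K (t : T K), is_field K -> T_e t -> vanish zm Om J phi t.

Lemma good_tmem_sub Om J K (t : T K) : (forall c, J c -> up [::] c) -> good Om -> is_field K -> T_e t -> tmem zm Om J t.
Proof.
move=> hJ gO hK te; split; first by apply: zeroes_sub te.
by apply: inside_point => //; [exact: good_open | exact: good_Te].
Qed.

(** The step hypothesis returns a weight again in W, so a section can be divided without end;
    [divisible_vanish] then applies to the infinite sequence of quotients. *)
Lemma descent J (W : 'rV[int]_4 -> Prop) : upper J -> (forall c, J c -> up [::] c) ->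
  (forall w, W w -> exists c J' W', [/\ division_entry J c J', W (w - ew q c.1 c.2), vanishing J' W' & W' w]) ->
  vanishing J W.
Proof.
move=> uJ subJ step Om w phi gO nphi wphi hw K t hK te.
pose ok (s : point_set T * 'rV[int]_4 * (forall A, T A -> A)) :=
  [/\ good s.1.1, natural zm s.1.1 J s.2, weight s.1.1 J s.1.2 s.2 & W s.1.2].
have next (s : {s | ok s}) : exists cs : ('I_4 * 'I_4) * {s | ok s},
    let: (c, s') := cs in [/\ up [::] c, forall K (t : T K), (sval s').1.1 K t -> (sval s).1.1 K t
      & forall A (t : T A), tmem zm (sval s').1.1 J t -> (sval s).2 A t = ent zm t c.1 c.2 * (sval s').2 A t].
  case: s => [[[O v] ph] [/= g1 n1 w1 v1]].
  have [c [J' [W' [de Wv hJ' Wv']]]] := step v v1.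
  have hv : forall K (t : T K), is_field K -> T_e t -> vanish zm O J' ph t.
    apply: (hJ' O v ph) => // [A B f y my|A e h y fe my].
      by apply: n1; case: my => zy iy; split=> //; apply: zeroes_sub zy => d hd; rewrite (de_zero de) hd.
    by apply: w1 => //; case: my => zy iy; split=> //; apply: zeroes_sub zy => d hd; rewrite (de_zero de) hd.
  have [O' [ph' [g2 s2 n2 w2 e2]]] := divide Fl cond_a q_pchar q_root q_gt1 g1 uJ de n1 w1 hv.
  exists (c, exist ok (O', v - ew q c.1 c.2, ph') (And4 g2 n2 w2 Wv)).
  by split=> //; exact: (de_Te de).
have [nx hnx] := choice next.
pose s0 : {s | ok s} := exist ok (Om, w, phi) (And4 gO nphi wphi hw).
pose s n := iter n (fun s => (nx s).2) s0.
have okn n : ok (sval (s n)) by exact: svalP.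
have h n : [/\ up [::] (nx (s n)).1, forall K (t : T K), (sval (s n.+1)).1.1 K t -> (sval (s n)).1.1 K t
      & forall A (t : T A), tmem zm (sval (s n.+1)).1.1 J t ->
        (sval (s n)).2 A t = ent zm t (nx (s n)).1.1 (nx (s n)).1.2 * (sval (s n.+1)).2 A t].
  by have := hnx (s n); rewrite /s iterS; case: (nx _).
apply: (@divisible_vanish k q S zeta cond_a J K t (fun n => (sval (s n)).1.1)
  (fun n => (sval (s n)).2) (fun n => (nx (s n)).1) hK).
- by move=> n; have [g _ _ _] := okn n; exact: good_open g.
- by move=> n; have [g _ _ _] := okn n; exact: good_tmem_sub.
- by move=> n; have [_ g _ _] := okn n.
- by move=> n; have [_ g _] := h n.
- by move=> n; have [_ _ g] := h n.
by move=> n; have [g _ _] := h n; apply: te; case: (nx _).1 g.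
Qed.

Lemma division_entry_up F F' (c : 'I_4 * 'I_4) (p := (c.1 : nat, c.2 : nat)) :
  (c.1 <= c.2 < 3)%N -> p \in F -> F' =i [seq x <- F | x != p] -> upper (up F') ->
  (forall i : 'I_4, (i < c.1)%N -> up F (i, c.2)) ->
  (forall j : 'I_4, (c.2 < j < 3)%N -> up F (c.1, j)) ->
  division_entry (up F) c (up F').
Proof.
move=> c3 pF eF uF' above right; split=> //.
- by rewrite /up c3 /= negbK.
- move=> d; rewrite /up eF mem_filter negb_and negbK.
  have [->|nd] := eqVneq d c; first by rewrite c3 eqxx orbT.
  rewrite orbF; congr (_ && _); case: eqP => // -[e1 e2]; case/eqP: nd.
  by case: d c e1 e2 {p c3 pF eF above right} => [d1 d2] [c1 c2] /= /val_inj -> /val_inj ->.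
- by case/andP: c3.
- by rewrite /up c3.
(* If (m, m) is free in F' the curve m lies in T_J'; otherwise X_mm vanishes on T_J', which then
   meets the curve only in T_e. *)
move=> m m3; have [mF|mF] := boolP ((m, m) \in F'); [left | right] => d.
  by rewrite /curve /up => /andP [-> nF]; rewrite inE; apply: contraNneq nF => ->.
rewrite /curve /up !inE => /andP [-> _] /=.
by case: eqP => [->|_]; [left | right].
Qed.

Let qz : int := q%:Z.
(** All the conditions on weights, including the signs of [deg], are unchanged by multiples of (1,
    1, 1, 1). *)
Let b (w : 'rV[int]_4) (i : 'I_4) : int := w 0 i - w 0 3%:R.

Lemma b_ew w (i j l : 'I_4) : b (w - ew q i j) l =
  b w l - ((l == i)%:R - (3%:R == i)%:R) + ((l == j)%:R - (3%:R == j)%:R) * qz.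
Proof.
have e m : (w - ew q i j) 0 m = w 0 m - ((m == i)%:R - (m == j)%:R * qz).
  by rewrite mxE [X in _ + X]mxE /ew mxE [X in _ - (_ + X)]mxE rv_scale !mxE /= -[X in _ - (_ - X)]mulr_natr natz.
rewrite /b !e; move: (w 0 l) (w 0 3%:R) (_ == _) (_ == _) (_ == _) (_ == _) => x y b1 b2 b3 b4; ring.
Qed.

Lemma vanishing_curve (m : 'I_3) : vanishing (curve m) (fun w => deg q m w < 0).
Proof. by move=> Om w phi gO nphi wphi hw K t; apply: (kill cond_a cond_c) hw. Qed.

(** [W3] belongs to the threefold with free coordinates X_00, X_11, X_22; [W00] and [W11] belong to
    its surfaces X_00 = 0 and X_11 = 0; [W2] is the hypothesis of the theorem and serves for the
    last two loci. *)
Let W00 w := ((qz + 1) * b w 1 > qz * b w 0) \/ ((qz + 1) * b w 2%:R > qz * b w 0).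
Let W11 w := (qz + 1) * b w 0 > b w 1.
Let W3 w := [\/ b w 0 > 0, b w 1 > 0 | b w 2%:R > 0].
Let W2 w := qz ^+ 2 * b w 0 + qz * b w 1 + b w 2%:R > 0.

Let Q : int := qz ^+ 2 + qz + 1.

Lemma nonneg_factor (x y p r c : int) : 0 <= x -> 0 <= y -> 0 <= p -> 0 < r -> p * x + y = r * c -> 0 <= c.
Proof. move=> hx hy hp hr e; have h : 0 <= p * x by nia. nia. Qed.

Let qz_gt1 : 1 < qz. Proof. by rewrite /qz; lia. Qed.
Let r_gt0 : 0 < (qz ^+ 2 + 1) * (qz + 1). Proof. by have := qz_gt1; rewrite expr2; nia. Qed.

(** Nonnegative combinations of the degrees on the two curves of a surface yield the inequality of
    that surface: if neither degree is negative, the condition [W00] or [W11] fails. *)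
Lemma deg_relations w :
  [/\ Q * deg q (@Ordinal 3 1 isT) w + deg q (@Ordinal 3 2 isT) w =
        (qz ^+ 2 + 1) * (qz + 1) * (qz * b w 0 - (qz + 1) * b w 1),
      Q * deg q (@Ordinal 3 2 isT) w + qz ^+ 2 * deg q (@Ordinal 3 1 isT) w =
        (qz ^+ 2 + 1) * (qz + 1) * (qz * b w 0 - (qz + 1) * b w 2%:R)
    & Q * deg q (@Ordinal 3 0 isT) w + qz * deg q (@Ordinal 3 2 isT) w =
        (qz ^+ 2 + 1) * (qz + 1) * (b w 1 - (qz + 1) * b w 0)].
Proof. by split; rewrite /deg /= /b /Q -/qz; ring. Qed.

(** On one of the two curves X_11 = 0 and X_22 = 0 the degree is negative, and one divides by the
    equation of that curve. Dividing by X_ii raises b_i by q - 1, so [W00] persists. *)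
Lemma vanishing_surface00 : vanishing (up [:: (1, 1); (2, 2)]%N) W00.
Proof.
apply: descent => [|c|w hw]; first exact: upper_up; first exact: up_nil.
have q1 := qz_gt1; have r0 := r_gt0.
have Q0 : 0 <= Q by rewrite /Q expr2; nia.
have q20 : 0 <= qz ^+ 2 by rewrite expr2; nia.
have [e1 e2 _] := deg_relations w.
have [d2|d2] := boolP (deg q (@Ordinal 3 2 isT) w < 0).
  exists (1, 1), (up [:: (2, 2)]%N), (fun w => deg q (@Ordinal 3 2 isT) w < 0); split=> //.
  - apply: division_entry_up => //; first [exact: upper_up | by elim/ord4_ind].
  - by rewrite /W00 !b_ew /=; case: hw => h; [left | right]; nia.
  - exact: (@vanishing_curve (@Ordinal 3 2 isT)).
have [d1|d1] := boolP (deg q (@Ordinal 3 1 isT) w < 0).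
  exists (2%:R, 2%:R), (up [:: (1, 1)]%N), (fun w => deg q (@Ordinal 3 1 isT) w < 0); split=> //.
  - apply: division_entry_up => //; first [exact: upper_up | by elim/ord4_ind].
  - by rewrite /W00 !b_ew /=; case: hw => h; [left | right]; nia.
  - exact: (@vanishing_curve (@Ordinal 3 1 isT)).
exfalso; have {}d1 : 0 <= deg q (@Ordinal 3 1 isT) w by lia.
have {}d2 : 0 <= deg q (@Ordinal 3 2 isT) w by lia.
have c1 := nonneg_factor d1 d2 Q0 r0 e1.
have q2d1 : 0 <= qz ^+ 2 * deg q (@Ordinal 3 1 isT) w by nia.
have c2 := nonneg_factor d2 q2d1 Q0 r0 e2.
by case: hw; lia.
Qed.

(** As for the other surface, with the curves X_00 = 0 and X_22 = 0; raising b_0 or b_2 preserves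
    [W11]. *)
Lemma vanishing_surface11 : vanishing (up [:: (0, 0); (2, 2)]%N) W11.
Proof.
apply: descent => [|c|w hw]; first exact: upper_up; first exact: up_nil.
have q1 := qz_gt1; have r0 := r_gt0.
have Q0 : 0 <= Q by rewrite /Q expr2; nia.
have [_ _ e1] := deg_relations w.
have [d2|d2] := boolP (deg q (@Ordinal 3 2 isT) w < 0).
  exists (0, 0), (up [:: (2, 2)]%N), (fun w => deg q (@Ordinal 3 2 isT) w < 0); split=> //.
  - apply: division_entry_up => //; first [exact: upper_up | by elim/ord4_ind].
  - by rewrite /W11 !b_ew /=; rewrite /W11 in hw; nia.
  - exact: (@vanishing_curve (@Ordinal 3 2 isT)).
have [d1|d1] := boolP (deg q (@Ordinal 3 0 isT) w < 0).
  exists (2%:R, 2%:R), (up [:: (0, 0)]%N), (fun w => deg q (@Ordinal 3 0 isT) w < 0); split=> //.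
  - apply: division_entry_up => //; first [exact: upper_up | by elim/ord4_ind].
  - by rewrite /W11 !b_ew /=; rewrite /W11 in hw; nia.
  - exact: (@vanishing_curve (@Ordinal 3 0 isT)).
exfalso; have {}d1 : 0 <= deg q (@Ordinal 3 0 isT) w by lia.
have {}d2 : 0 <= qz * deg q (@Ordinal 3 2 isT) w by nia.
have c1 := nonneg_factor d1 d2 Q0 r0 e1.
by rewrite /W11 in hw; lia.
Qed.

Lemma vanishing3 : vanishing (up [:: (0, 0); (1, 1); (2, 2)]%N) W3.
Proof.
apply: descent => [|c|w hw]; first exact: upper_up; first exact: up_nil.
have q1 := qz_gt1.
have [h1|h1] := boolP ((qz + 1) * b w 0 > b w 1).
  exists (1, 1), (up [:: (0, 0); (2, 2)]%N), W11; split=> //.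
  - apply: division_entry_up => //; first [exact: upper_up | by elim/ord4_ind].
  - by rewrite /W3 !b_ew /=; case: hw => h; [apply: Or31 | apply: Or32 | apply: Or33]; lia.
  - exact: vanishing_surface11.
exists (0, 0), (up [:: (1, 1); (2, 2)]%N), W00; split=> //.
- apply: division_entry_up => //; first [exact: upper_up | by elim/ord4_ind].
- by rewrite /W3 !b_ew /=; case: hw => h; [apply: Or31 | apply: Or32 | apply: Or33]; lia.
- exact: vanishing_surface00.
(* When [W11] and the first half of [W00] fail, (q + 1)^2 b_0 <= q b_0, so b_0 and b_1 are at most
   0; then [W3] gives b_2 > 0 and the second half of [W00]. *)
rewrite /W00; have [|h2] := boolP ((qz + 1) * b w 1 > qz * b w 0); first by left.
right; have h0 : b w 0 <= 0.
  have [//|h] := boolP (b w 0 <= 0).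
  have : qz * ((qz + 1) * b w 0) <= qz * b w 1 by nia.
  have : (qz + 1) * b w 1 <= qz * b w 0 by lia.
  nia.
have h1' : b w 1 <= 0 by nia.
by case: hw => h; nia.
Qed.

(** The form in [W2] is 0 on the weight e_1 - q e_2 of X_12, so [W2] is unchanged by division, and
    its positivity forces some b_i > 0. *)
Lemma vanishing4 : vanishing (up [:: (0, 0); (1, 1); (2, 2); (1, 2)]%N) W2.
Proof.
apply: descent => [|c|w hw]; first exact: upper_up; first exact: up_nil.
have q1 := qz_gt1.
exists (1, 2%:R), (up [:: (0, 0); (1, 1); (2, 2)]%N), W3; split=> //.
- apply: division_entry_up => //; first [exact: upper_up | by elim/ord4_ind].
- by rewrite /W2 !b_ew /=; rewrite /W2 in hw; lia.
- exact: vanishing3.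
rewrite /W3; have [|h0] := boolP (b w 0 > 0); first by move=> h; apply: Or31.
have [|h1] := boolP (b w 1 > 0); first by move=> h; apply: Or32.
apply: Or33; rewrite /W2 in hw.
have : qz ^+ 2 * b w 0 <= 0 by rewrite expr2; nia.
have : qz * b w 1 <= 0 by nia.
lia.
Qed.

(** Only the position (0, 2) is left, so T_J is the locus D. *)
Definition JD : pred ('I_4 * 'I_4) := up [:: (0, 0); (1, 1); (2, 2); (1, 2); (0, 1)]%N.

Lemma JD_upper : upper JD. Proof. exact: upper_up. Qed.

(** The weight e_0 - q e_1 of X_01 is again killed by the form in [W2]. *)
Lemma vanishing_divisor : vanishing JD W2.
Proof.
apply: descent => [|c|w hw]; first exact: upper_up; first exact: up_nil.
have q1 := qz_gt1.
exists (0, 1), (up [:: (0, 0); (1, 1); (2, 2); (1, 2)]%N), W2; split=> //.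
- apply: division_entry_up => //; first [exact: upper_up | by elim/ord4_ind].
- by rewrite /W2 !b_ew /=; rewrite /W2 in hw; rewrite expr2 in hw *; lia.
- exact: vanishing4.
Qed.

Lemma vanish_Te w (phi : forall A, T A -> A) : natural zm (everywhere (zeta := zeta)) JD phi ->
  weight (everywhere (zeta := zeta)) JD w phi ->
  0 < q%:Z ^+ 2 * (w 0 0 - w 0 3%:R) + q%:Z * (w 0 1 - w 0 3%:R) + (w 0 2%:R - w 0 3%:R) ->
  forall K (t : T K), is_field K -> T_e t -> vanish zm (everywhere (zeta := zeta)) JD phi t.
Proof. by move=> nphi wphi hw; apply: vanishing_divisor wphi hw => //; exact: good_everywhere. Qed.

End DescentChain.

(** * Punctured lines and Levi elements *)

Section Lines.
Variable k : fieldType.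
Implicit Types (A B C D E K R L : comUnitAlgType k).

Definition no_zero_divisors (R : comNzRingType) := forall a b : R, a * b = 0 -> a = 0 \/ b = 0.

(** The spectrum of a domain is irreducible: neighbourhoods of any two points meet, so a locally
    constant property is constant. *)
Lemma connected_points A (Q : forall K, {lrmorphism A -> K} -> Prop) : no_zero_divisors A ->
  (forall K (psi : {lrmorphism A -> K}), is_field K -> exists s, psi s != 0 /\
     forall K' (psi' : {lrmorphism A -> K'}), is_field K' -> psi' s != 0 -> (Q K' psi' <-> Q K psi)) ->
  forall K K' (psi : {lrmorphism A -> K}) (psi' : {lrmorphism A -> K'}), is_field K -> is_field K' ->
    Q K psi -> Q K' psi'.
Proof.
move=> nzd loc K K' psi psi' hK hK' Qp; apply: contrapT => nQ.
have [s [s0 hs]] := loc K psi hK; have [s' [s'0 hs']] := loc K' psi' hK'.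
have [n hn] : exists n, (s * s') ^+ n = 0.
  apply: nil_field => L ps hL; apply/eqP; apply: contraT; rewrite rmorphM => n0.
  have a0 : ps s != 0 by apply: contraNneq n0 => e; rewrite /= e mul0r.
  have a1 : ps s' != 0 by apply: contraNneq n0 => e; rewrite /= e mulr0.
  by case: nQ; apply/(hs' L ps hL a1); apply/(hs L ps hL a0).
have : s * s' = 0.
  elim: n hn => [/eqP|n IH]; first by rewrite expr0 oner_eq0.
  by rewrite exprS => /nzd [].
by case/nzd => e; [move: s0; rewrite e | move: s'0; rewrite e]; rewrite rmorph0 eqxx.
Qed.

Lemma poly_field_nzd K : is_field K -> no_zero_divisors {poly K}.
Proof.
move=> hK p r pr0; have [->|p0] := eqVneq p 0; [by left | right].
apply/eqP; apply: contraT => r0.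
have l0 : lead_coef p * lead_coef r != 0 by apply: field_mulf_neq0; rewrite ?lead_coef_eq0.
by have := lead_coef_proper_mul l0; rewrite pr0 lead_coef0 => e; rewrite -e eqxx in l0.
Qed.

Lemma nzd_nonnil (R : comNzRingType) (s : R) : no_zero_divisors R -> s != 0 -> forall n, s ^+ n != 0.
Proof.
move=> nzd s0; elim=> [|n IH]; first by rewrite expr0 oner_eq0.
by apply/eqP; rewrite exprS => /nzd [/eqP|/eqP]; apply/negP.
Qed.

Lemma loc_nzd (R : comNzRingType) (iota : {rmorphism k -> R}) (s : R) (hs : forall n, s ^+ n != 0) :
  no_zero_divisors R -> no_zero_divisors (loc iota hs).
Proof.
move=> nzd a b ab; pose lam : {rmorphism R -> loc iota hs} := locmap iota hs.
have [c [n hc]] : exists c n, lam c = a * lam s ^+ n by exact: locmap_surj.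
have [d [m hd]] : exists c n, lam c = b * lam s ^+ n by exact: locmap_surj.
have u : lam s \is a GRing.unit by exact: locmap_unit.
have cd0 : lam (c * d) = 0 by rewrite rmorphM hc hd mulrACA ab mul0r.
have [l hl] : exists n, s ^+ n * (c * d) = 0 by exact: (locmap_ker cd0).
have : c * d = 0.
  by have [e|//] := nzd _ _ hl; have := hs l; rewrite e eqxx.
case/nzd => e; [left | right].
  by apply: (mulIr (rpredX n u)); rewrite -hc e rmorph0 mul0r.
by apply: (mulIr (rpredX m u)); rewrite -hd e rmorph0 mul0r.
Qed.

(* The line over K with the zeros of s removed. *)
Lemma punctured_line K (s : {poly K}) : is_field K -> s != 0 ->
  exists B (lam : {rmorphism {poly K} -> B}) (io : {lrmorphism K -> B}),
    [/\ no_zero_divisors B, lam s \is a GRing.unit, forall c, io c = lam c%:P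
      & forall L (f : {lrmorphism K -> L}) (a : L), is_field L -> (map_poly f s).[a] != 0 ->
          exists g : {lrmorphism B -> L}, (forall p, g (lam p) = (map_poly f p).[a]) /\ (forall c, g (io c) = f c)].
Proof.
move=> hK s0; pose iota : {rmorphism k -> {poly K}} := polyC \o in_alg K.
have nzd := poly_field_nzd hK; have hs := nzd_nonnil nzd s0.
pose B := loc iota hs; pose lam : {rmorphism {poly K} -> B} := locmap iota hs.
pose io0 (c : K) : B := lam c%:P.
have ioB : zmod_morphism io0 by move=> x y; rewrite /io0 !rmorphB.
have ioM : monoid_morphism io0 by split=> [|x y]; rewrite /io0 ?rmorph1 ?rmorphM.
have ioZ c : io0 c%:A = c%:A by exact: (locmap_alg iota hs c).
exists B, lam, (mkhom ioB ioM ioZ); split.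
- exact: loc_nzd.
- exact: locmap_unit.
- by [].
move=> L f a hL n0; pose F : {rmorphism {poly K} -> L} := horner_eval a \o map_poly f.
have FE p : F p = (map_poly f p).[a] by [].
have [||g hg] := @loc_hom k _ iota s hs L F.
- by move=> c; rewrite FE /iota /= map_polyC hornerC /= hom_alg.
- by rewrite FE; apply: hL.
exists g; split=> [p|c]; first by rewrite -FE; exact: hg.
rewrite -[f c](_ : F c%:P = _); first exact: hg.
by rewrite FE map_polyC hornerC.
Qed.

End Lines.

Section LeviElements.
Variables (k : fieldType) (q : nat).
Implicit Types (A B C D E K R L : comUnitAlgType k).
Hypotheses (q_pchar : [pchar k].-nat q) (q_gt1 : (1 < q)%N).

(** Elements of E with both components in the Levi subgroups, the second being the Frobenius twist
    of the first; [levi_zip] gives the condition on x. *)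
Definition levi A (x : 'M[A]_4) : 'M[A]_4 * 'M[A]_4 := (x, map_mx (fun a => a ^+ q) x).

Lemma levi_zip A (x : 'M[A]_4) : x \in unitmx ->
  (forall i : 'I_4, (i < 3)%N -> x i 3%:R = 0 /\ x 3%:R i = 0) -> zip_group q (levi x).
Proof.
move=> ux x0; have q0 : (0 : A) ^+ q = 0 by rewrite expr0n gtn_eqF // ltnW.
apply/(zip_groupP q_pchar); split=> //= [|i i3|i j _ _|]; try by rewrite mxE.
  have h : map_mx (fun a => a ^+ q) x *m map_mx (fun a => a ^+ q) (invmx x) = 1%:M.
    apply/matrixP => i j; have /matrixP/(_ i j) := mulmxV ux; rewrite [in X in X -> _]mxE => e.
    rewrite mxE; under eq_bigr => l _ do rewrite !mxE -exprMn.
    rewrite -(frob_sum q_pchar (in_alg A)) e !mxE.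
    by case: eqP; rewrite ?expr1n ?q0.
  by have [] := mulmx1_unit h.
by rewrite !mxE; have [-> ->] := x0 i i3; rewrite q0.
Qed.

Definition gl2 (R : comNzRingType) (a b c d : R) : 'M[R]_4 :=
  \matrix_(i, j) nth 0 (nth [::] [:: [:: a; b; 0; 0]; [:: c; d; 0; 0]; [:: 0; 0; 1; 0]; [:: 0; 0; 0; 1]] i) j.

Lemma gl2_unit A (a b c d : A) : a * d - b * c \is a GRing.unit -> gl2 a b c d \in unitmx.
Proof.
move=> /unitrPr [D uD].
have h : gl2 a b c d *m gl2 (d * D) (- b * D) (- c * D) (a * D) = 1%:M.
  apply/matrixP; elim/ord4_ind; elim/ord4_ind; rewrite !mxE sum4 !mxE /= ?(mulr0, mul0r, addr0, add0r, mulr1) //.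
  - by rewrite -uD; ring.
  - by ring.
  - by ring.
  - by rewrite -uD; ring.
by have [] := mulmx1_unit h.
Qed.

Definition shear (R : comNzRingType) (s a b : R) : 'M[R]_4 :=
  \matrix_(i, j) nth 0 (nth [::] [:: [:: s; 0; a; 0]; [:: 0; s; b; 0]; [:: 0; 0; 1; 0]; [:: 0; 0; 0; 1]] i) j.

Lemma shear_unit A (s a b : A) : s \is a GRing.unit -> shear s a b \in unitmx.
Proof.
move=> u; have uD := mulrV u.
have h : shear s a b *m shear s^-1 (- a * s^-1) (- b * s^-1) = 1%:M.
  apply/matrixP; elim/ord4_ind; elim/ord4_ind; rewrite !mxE sum4 !mxE /= ?(mulr0, mul0r, addr0, add0r, mulr1) //.
  - by rewrite mulrCA uD mulr1 addrC subrr.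
  - by rewrite mulrCA uD mulr1 addrC subrr.
by have [] := mulmx1_unit h.
Qed.

End LeviElements.

(** * Connectedness of the fibres of D over S *)

Section Fibres.
Variables (k : fieldType) (q : nat) (S : kfunctor k) (zeta : zip_morphism q S).
Implicit Types (A B C D E K R L : comUnitAlgType k).
Hypotheses (q_pchar : [pchar k].-nat q) (q_gt1 : (1 < q)%N).
Local Notation T := (ztot zeta).
Local Notation zm := (zmap zeta).
Local Notation act := (zip_act (zact zeta)).
Local Notation X t := (ent zm t).

Lemma act_act A (e e' : 'M[A]_4 * 'M[A]_4) (h : zip_group q e) (h' : zip_group q e') (t : T A) :
  exists h'' : zip_group q (e.1 *m e'.1, e.2 *m e'.2), act h'' t = act h (act h' t).
Proof. by exists (zip_mul q_pchar h h'); rewrite (Defs.actM _ h h'). Qed.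

Lemma act_invE A (e : 'M[A]_4 * 'M[A]_4) (h : zip_group q e) (t : T A) :
  exists e' (h' : zip_group q e'), act h' (act h t) = t /\ e'.1 *m e.1 = 1%:M.
Proof.
have [orb free _] := zproj_torsor zeta.
have [e' [h' [_ e1]]] := iffLR (orb A (act h t) t) (esym (iffRL (orb A t (act h t)) (ex_intro _ e (ex_intro _ h (conj h erefl))))).
exists e', h'; split=> //; have [h'' e2] := act_act h' h t.
by have := free A _ h'' t h''; rewrite e2 e1 => /(_ erefl) [].
Qed.

(** If e.1 sends the vector w to a multiple of the third basis vector, the third column of the
    translate is, up to a scalar, e.1 applied to X times the Frobenius twist of w. Membership of D
    thus becomes a condition on flags. *)
Lemma act_vec A (e : 'M[A]_4 * 'M[A]_4) (h : zip_group q e) (t : T A) (w0 w1 w2 : A) i :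
  e.1 0 0 * w0 + e.1 0 1 * w1 + e.1 0 2%:R * w2 = 0 ->
  e.1 1 0 * w0 + e.1 1 1 * w1 + e.1 1 2%:R * w2 = 0 ->
  let v l := X t l 0 * w0 ^+ q + X t l 1 * w1 ^+ q + X t l 2%:R * w2 ^+ q in
  X (act h t) i 2%:R * (e.1 2%:R 0 * w0 + e.1 2%:R 1 * w1 + e.1 2%:R 2%:R * w2) ^+ q =
  e.1 i 0 * v 0 + e.1 i 1 * v 1 + e.1 i 2%:R * v 2%:R + e.1 i 3%:R * v 3%:R.
Proof.
move=> z0 z1 v.
have fr a b c : (a * w0 + b * w1 + c * w2) ^+ q = a ^+ q * w0 ^+ q + b ^+ q * w1 ^+ q + c ^+ q * w2 ^+ q.
  by rewrite !(algD q_pchar) !exprMn.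
have q0 : (0 : A) ^+ q = 0 by rewrite expr0n gtn_eqF // ltnW.
have {}z0 := congr1 (fun a => a ^+ q) z0; have {}z1 := congr1 (fun a => a ^+ q) z1.
rewrite /= fr q0 in z0; rewrite /= fr q0 in z1; rewrite fr.
have e0 := act_rel q_pchar h t i (j := 0) isT; have e1 := act_rel q_pchar h t i (j := 1) isT.
have e2 := act_rel q_pchar h t i (j := 2%:R) isT.
rewrite /v; move: (w0 ^+ q) (w1 ^+ q) (w2 ^+ q) z0 z1 => W0 W1 W2 z0 z1.
transitivity (X (act h t) i 0 * 0 + X (act h t) i 1 * 0 + X (act h t) i 2%:R *
    (e.1 2%:R 0 ^+ q * W0 + e.1 2%:R 1 ^+ q * W1 + e.1 2%:R 2%:R ^+ q * W2)); first by rewrite !mulr0 !add0r.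
rewrite -{1}z0 -z1.
move: (e.1 0 0 ^+ q) (e.1 0 1 ^+ q) (e.1 0 2%:R ^+ q) (e.1 1 0 ^+ q) (e.1 1 1 ^+ q) (e.1 1 2%:R ^+ q)
  (e.1 2%:R 0 ^+ q) (e.1 2%:R 1 ^+ q) (e.1 2%:R 2%:R ^+ q) e0 e1 e2 {z0 z1} => a0 a1 a2 b0 b1 b2 c0 c1 c2 e0 e1 e2.
rewrite (_ : _ + _ = (X (act h t) i 0 * a0 + (X (act h t) i 1 * b0 + X (act h t) i 2%:R * c0)) * W0 +
  (X (act h t) i 0 * a1 + (X (act h t) i 1 * b1 + X (act h t) i 2%:R * c1)) * W1 +
  (X (act h t) i 0 * a2 + (X (act h t) i 1 * b2 + X (act h t) i 2%:R * c2)) * W2); last by ring.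
by rewrite e0 e1 e2; ring.
Qed.

Local Notation D t := (X t 0 2%:R = 0).
Variable P : point_set T.
Hypothesis P_ext : forall K L (f : {lrmorphism K -> L}) (t : T K), is_field K -> is_field L -> D t ->
  (P (fmap f t) <-> P t).
Hypothesis P_flag : forall K (e : 'M[K]_4 * 'M[K]_4) (h : zip_group q e) (t : T K), is_field K ->
  flag_group q e -> D t -> (P (act h t) <-> P t).
Hypothesis P_loc : forall A (t : T A), D t -> forall K (psi : {lrmorphism A -> K}), is_field K ->
  exists s, psi s != 0 /\ forall L (psi' : {lrmorphism A -> L}), is_field L -> psi' s != 0 ->
    (P (fmap psi' t) <-> P (fmap psi t)).

Lemma P_connected A (t : T A) K L (psi : {lrmorphism A -> K}) (psi' : {lrmorphism A -> L}) :
  no_zero_divisors A -> D t -> is_field K -> is_field L -> P (fmap psi' t) <-> P (fmap psi t).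
Proof.
move=> nzd Dt hK hL; split; apply: (connected_points (Q := fun K psi => P (fmap psi t))) => // M ps hM;
  exact: P_loc.
Qed.

Lemma D_fmap A B (f : {lrmorphism A -> B}) (t : T A) : D t -> D (fmap f t).
Proof. by move=> Dt; rewrite ent_fmap Dt rmorph0. Qed.

Lemma levi_map A B (g : {lrmorphism A -> B}) (x : 'M[A]_4) :
  levi q (map_mx g x) = (map_mx g (levi q x).1, map_mx g (levi q x).2).
Proof. by congr (_, _); apply/matrixP => i j; rewrite !mxE rmorphXn. Qed.

Lemma gl2_quotient A (a b c : A) (G E : 'M[A]_4) : a - b * c = 1 -> G *m gl2 a b c 1 = E ->
  E 0 0 = a -> E 0 1 = b -> G 0 1 = 0 /\ forall i, G i 2%:R = E i 2%:R.
Proof.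
move=> abc eM ea eb.
have G2 i : G i 2%:R = E i 2%:R.
  by have /matrixP/(_ i 2%:R) := eM; rewrite mxE sum4 !mxE /= !(mulr0, add0r, addr0, mulr1).
split=> //; have := congr1 (fun M : 'M[A]_4 => M 0 0) eM; rewrite mxE sum4 !mxE /= !(mulr0, add0r, addr0, mulr1, mul1r).
have := congr1 (fun M : 'M[A]_4 => M 0 1) eM; rewrite mxE sum4 !mxE /= !(mulr0, add0r, addr0, mulr1, mul1r).
rewrite ea eb => e3 e4.
have e5 : G 0 0 - 1 = 0.
  rewrite -[LHS]mulr1 -[Y in _ * Y]abc.
  transitivity (G 0 0 * a + G 0 1 * c - a - c * (G 0 0 * b + G 0 1 - b)); first by ring.
  by rewrite e3 e4 !subrr mulr0 subrr.
move/eqP: e5; rewrite subr_eq0 => /eqP e6; move: e3; rewrite e6 mul1r => /(congr1 (fun z => z - b)).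
by rewrite addrAC subrr add0r.
Qed.

Lemma zip_col A (e : 'M[A]_4 * 'M[A]_4) (h : zip_group q e) (i : 'I_4) : (i < 3)%N -> e.1 i 3%:R = 0.
Proof. by have [_ _ h3 _ _] := iffLR (zip_groupP q_pchar _) h; case/h3. Qed.

Lemma flag_of_zip A (e : 'M[A]_4 * 'M[A]_4) (h : zip_group q e) :
  e.1 0 1 = 0 -> e.1 0 2%:R = 0 -> e.1 1 2%:R = 0 -> flag_group q e.
Proof.
move=> e01 e02 e12; split=> //; have [u _ _ _ _] := iffLR (zip_groupP q_pchar _) h.
apply/andP; split=> //; apply/is_trig_mxP; elim/ord4_ind; elim/ord4_ind => //= _; exact: zip_col.
Qed.

(** If e.1 is not already in the Borel, membership of both points in D forces X_12 = 0 besides X_02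
    = 0, so the GL_2 in rows 0 and 1 preserves D. A line in it joins a lower triangular element to
    one with the same first row as e.1, and the rest is a flag element. *)
Lemma parabolic K (e : 'M[K]_4 * 'M[K]_4) (h : zip_group q e) (t : T K) : is_field K ->
  e.1 0 2%:R = 0 -> e.1 1 2%:R = 0 -> D t -> D (act h t) -> (P (act h t) <-> P t).
Proof.
move=> hK e02 e12 Dt Dh.
have [b0|b0] := eqVneq (e.1 0 1) 0; first by apply: P_flag => //; exact: flag_of_zip.
have X12 : X t 1 2%:R = 0.
  have := act_rel q_pchar h t 0 (j := 2%:R) isT.
  rewrite Dh Dt e02 e12 (zip_col h) // expr0n gtn_eqF; last exact: ltnW.
  rewrite !(mulr0, mul0r, add0r, addr0) => /esym; exact: field_mul0.
set a := e.1 0 0; set b := e.1 0 1 in b0; have bu : b \is a GRing.unit by exact: hK.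
(* With this c the matrix with rows (1 + r (a - 1), r b) and (c, 1) has determinant 1 for every
   r. *)
pose c := (a - 1) / b; have cb : b * c = a - 1 by rewrite /c mulrC divrK.
have [B [lam [io [nzd _ ioE ev]]]] := @punctured_line k K 1 hK (oner_neq0 _).
pose x := gl2 (lam (1 + 'X * (a - 1)%:P)) (lam ('X * b%:P)) (lam c%:P) (lam 1).
have ux : x \in unitmx.
  apply: gl2_unit; rewrite -!rmorphM -rmorphB mulr1 -mulrA -polyCM cb addrK rmorph1; exact: unitr1.
have zx : zip_group q (levi q x).
  by apply: (levi_zip q_pchar q_gt1 ux); elim/ord4_ind => //= _; rewrite !mxE.
pose tB := act zx (fmap io t).
have DB : D tB.
  have := act_rel q_pchar zx (fmap io t) 0 (j := 2%:R) isT.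
  rewrite !mxE /= !ent_fmap Dt X12 rmorph0 expr0n gtn_eqF; last exact: ltnW.
  by rewrite !(mulr0, mul0r, add0r, addr0) expr1n mulr1.
have evK r : exists g : {lrmorphism B -> K}, (forall p, g (lam p) = p.[r]) /\ fmap g (fmap io t) = t.
  have [|g [h1 h2]] := ev K idfun r hK; first by rewrite rmorph1 hornerC oner_eq0.
  exists g; split=> [p|]; first by rewrite h1 map_poly_id.
  by rewrite -fmap_comp'; apply: fmap_id => z; rewrite hom_compE h2.
have gl (g : {lrmorphism B -> K}) r : (forall p, g (lam p) = p.[r]) -> fmap g (fmap io t) = t ->
    exists h' : zip_group q (levi q (gl2 (1 + r * (a - 1)) (r * b) c 1)), fmap g tB = act h' t.
  move=> hg gt.
  have eM : levi q (gl2 (1 + r * (a - 1)) (r * b) c 1) = (map_mx g (levi q x).1, map_mx g (levi q x).2).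
    have e1 : gl2 (1 + r * (a - 1)) (r * b) c 1 = map_mx g x.
      have E0 : g (lam (1 + 'X * (a - 1)%:P)) = 1 + r * (a - 1) by rewrite hg hornerD hornerM hornerX !hornerC.
      have E1 : g (lam ('X * b%:P)) = r * b by rewrite hg hornerM hornerX hornerC.
      have E2 : g (lam c%:P) = c by rewrite hg hornerC.
      have E3 : g (lam 1) = 1 by rewrite hg hornerC.
      by apply/matrixP; elim/ord4_ind; elim/ord4_ind; rewrite !mxE //= ?E0 ?E1 ?E2 ?E3 //;
        first [exact: esym (rmorph0 g) | exact: esym (rmorph1 g)].
    by rewrite -levi_map -e1.
  have h' : zip_group q (levi q (gl2 (1 + r * (a - 1)) (r * b) c 1)) by rewrite eM; exact: zip_fmap.
  exists h'; have e3 : act h' (fmap g (fmap io t)) = fmap g tB.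
    by rewrite /tB; apply: act_fmap.
  by rewrite -e3 gt.
have [g0 [g0E g0t]] := evK 0; have [g1 [g1E g1t]] := evK 1.
have [h0 e0] := gl g0 0 g0E g0t; have [h1 e1] := gl g1 1 g1E g1t.
have P0 : P (act h0 t) <-> P t.
  by apply: P_flag => //; apply: flag_of_zip; rewrite // !mxE /= ?mul0r.
have P1 : P (act h1 t) <-> P t.
  by apply: iff_trans P0; rewrite -e0 -e1; exact: P_connected.
apply: iff_trans P1.
have [e' [h' [act' inv']]] := act_invE h1 t.
have [h2 eh2] := act_act h h' (act h1 t).
have -> : act h t = act h2 (act h1 t) by rewrite eh2 act'.
have eM : (e.1 *m e'.1) *m gl2 (1 + 1 * (a - 1)) (1 * b) c 1 = e.1 by rewrite -mulmxA inv' mulmx1.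
have abc : 1 + 1 * (a - 1) - 1 * b * c = 1 by rewrite !mul1r cb addrK.
have ea : e.1 0 0 = 1 + 1 * (a - 1) by rewrite mul1r addrCA subrr addr0.
have eb : e.1 0 1 = 1 * b by rewrite mul1r.
have [G01 G2] := gl2_quotient abc eM ea eb.
have Dh1 : D (act h1 t) by rewrite -e1; exact: D_fmap.
by apply: P_flag => //; apply: flag_of_zip; rewrite //= G2.
Qed.

(** Cancelling common factors of the variable, by induction on the sizes, leaves a relation that
    does not vanish identically at 0. *)
Lemma primitive_relation K (al be : {poly K}) : exists v0 v1 : {poly K},
  v0 * al + v1 * be = 0 /\ (v0.[0] != 0 \/ v1.[0] != 0).
Proof.
have [n] := ubnP (size al + size be)%N; elim: n al be => // n IH al be lt.
have [a0|a0] := eqVneq al.[0] 0; last by exists be, (- al); rewrite mulNr mulrC subrr hornerN oppr_eq0; split; [|right].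
have [b0|b0] := eqVneq be.[0] 0; last by exists be, (- al); rewrite mulNr mulrC subrr; split; [|left].
have div p : p.[0] = 0 -> exists p' : {poly K}, p = p' * 'X.
  by move=> /eqP; rewrite -rootE => /factor_theorem [p' ->]; exists p'; rewrite polyC0 subr0.
have [al' eal] := div _ a0; have [be' ebe] := div _ b0.
have [al0|al0] := eqVneq al' 0.
  have [be0|be0] := eqVneq be' 0.
    exists 1, 0; rewrite hornerC oner_eq0 eal ebe al0 be0 !mul0r mulr0 addr0; split=> //; by left.
  have [|v0 [v1 [e h]]] := IH al' be'.
    by move: lt; rewrite eal ebe al0 mul0r size_mulX // size_poly0; lia.
  by exists v0, v1; rewrite eal ebe !mulrA -mulrDl e mul0r.
have [|v0 [v1 [e h]]] := IH al' be'.
  move: lt; rewrite eal ebe size_mulX //; have [->|be0] := eqVneq be' 0; first by rewrite mul0r size_poly0; lia.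
  by rewrite size_mulX //; lia.
by exists v0, v1; rewrite eal ebe !mulrA -mulrDl e mul0r.
Qed.

Definition sends A (x : 'M[A]_4) (w0 w1 w2 : A) := [/\ x 0 0 * w0 + x 0 1 * w1 + x 0 2%:R * w2 = 0,
  x 1 0 * w0 + x 1 1 * w1 + x 1 2%:R * w2 = 0
  & x 2%:R 0 * w0 + x 2%:R 1 * w1 + x 2%:R 2%:R * w2 \is a GRing.unit].

Lemma vec_mul A (M N : 'M[A]_4) (w0 w1 w2 : A) i : M i 3%:R = 0 ->
  (M *m N) i 0 * w0 + (M *m N) i 1 * w1 + (M *m N) i 2%:R * w2 =
  M i 0 * (N 0 0 * w0 + N 0 1 * w1 + N 0 2%:R * w2) + M i 1 * (N 1 0 * w0 + N 1 1 * w1 + N 1 2%:R * w2) +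
  M i 2%:R * (N 2%:R 0 * w0 + N 2%:R 1 * w1 + N 2%:R 2%:R * w2).
Proof. by move=> e; rewrite !mxE !sum4 e; ring. Qed.

Lemma sends_map A B (g : {lrmorphism A -> B}) (x : 'M[A]_4) w0 w1 w2 : sends x w0 w1 w2 ->
  sends (map_mx g x) (g w0) (g w1) (g w2).
Proof.
by case=> h0 h1 h2; split; rewrite !mxE -!rmorphM -!rmorphD ?h0 ?h1 ?rmorph0 //; apply: rmorph_unit.
Qed.

(* The flags in the fibre of D lie over lines w in K^3; over the line joining
   the standard one to w they can be followed by a section. *)
Lemma line_section K (t : T K) (w0 w1 w2 : K) : is_field K -> D t -> exists s : {poly K}, s.[0] != 0 /\
  forall L (f : {lrmorphism K -> L}) (a : L), is_field L -> (map_poly f s).[a] != 0 ->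
    exists e (h : zip_group q e), [/\ D (act h (fmap f t)), P (act h (fmap f t)) <-> P t
      & sends e.1 (a * f w0) (a * f w1) (1 - a + a * f w2)].
Proof.
move=> hK Dt.
(* The segment (1 - r) e_2 + r w, with r the variable and e_2 the third basis vector; [v] is X
   applied to its Frobenius twist. *)
pose u0 : {poly K} := 'X * w0%:P; pose u1 : {poly K} := 'X * w1%:P; pose u2 : {poly K} := 1 - 'X + 'X * w2%:P.
pose v l : {poly K} := (X t l 0)%:P * u0 ^+ q + (X t l 1)%:P * u1 ^+ q + (X t l 2%:R)%:P * u2 ^+ q.
(* This relation is the condition X_02 = 0 for the translate by a matrix whose first row is built
   from v0 and v1; r0 and r1 complete it to a matrix invertible at 0. *)
have [v0 [v1 [rel v00]]] := primitive_relation (u2 * v 0 - u0 * v 2%:R) (u2 * v 1 - u1 * v 2%:R).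
have [r0 [r1 dn]] : exists r0 r1 : {poly K}, (v0 * r1 - v1 * r0).[0] != 0.
  case: v00 => n0; [exists 0, 1 | exists (- 1), 0].
    by rewrite mulr1 mulr0 subr0.
  by rewrite mulr0 mulrN1 sub0r opprK.
have u20 : u2.[0] = 1 by rewrite /u2 !hornerE /= subr0.
exists (u2 * (v0 * r1 - v1 * r0)); split; first by rewrite hornerM u20 mul1r.
move=> L f a hL n0.
have s0 : u2 * (v0 * r1 - v1 * r0) != 0.
  by apply: contraNneq n0 => ->; rewrite rmorph0 horner0.
have [B [lam [io [nzd lu ioE ev]]]] := punctured_line hK s0.
move: lu; rewrite rmorphM unitrM => /andP [ul2 ld].
pose x := gl2 (lam v0) (lam v1) (lam r0) (lam r1) *m shear (lam u2) (- lam u0) (- lam u1).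
have ux : x \in unitmx.
  by rewrite unitmx_mul shear_unit // gl2_unit // -!rmorphM -rmorphB.
have xE : [/\ x 0 0 = lam v0 * lam u2, x 0 1 = lam v1 * lam u2, x 0 2%:R = - (lam v0 * lam u0 + lam v1 * lam u1),
    x 1 2%:R = - (lam r0 * lam u0 + lam r1 * lam u1) & [/\ x 1 0 = lam r0 * lam u2, x 1 1 = lam r1 * lam u2,
    x 2%:R 0 = 0, x 2%:R 1 = 0 & x 2%:R 2%:R = 1]].
  by split; [..|split]; rewrite !mxE sum4 !mxE /= ?(mulr0, mul0r, addr0, add0r, mulr1, mul1r) // opprD !mulrN.
have x3 (i : 'I_4) : (i < 3)%N -> x i 3%:R = 0 /\ x 3%:R i = 0.
  by elim/ord4_ind: i => // _; rewrite !mxE !sum4 !mxE /= ?(mulr0, mul0r, addr0, add0r, mulr1).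
have zx : zip_group q (levi q x) := levi_zip q_pchar q_gt1 ux x3.
have sx : sends x (lam u0) (lam u1) (lam u2).
  have [x00 x01 x02 x12 [x10 x11 x20 x21 x22]] := xE.
  split; rewrite ?x00 ?x01 ?x02 ?x10 ?x11 ?x12; [by ring | by ring |].
  by rewrite x20 x21 x22 !mul0r !add0r mul1r.
pose tB := act zx (fmap io t).
have DB : D tB.
  have [x00 x01 x02 x12 [x10 x11 x20 x21 x22]] := xE; have [h0 h1 h2] := sx.
  have := act_vec zx (fmap io t) 0 h0 h1; rewrite /= x20 x21 x22 !mul0r !add0r mul1r => e.
  apply: (mulIr (_ : lam u2 ^+ q \is a GRing.unit)); first by rewrite unitrX.
  rewrite mul0r /tB e x00 x01 x02 (x3 0 isT).1 mul0r addr0 !ent_fmap !ioE.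
  have vE l : lam (X t l 0)%:P * lam u0 ^+ q + lam (X t l 1)%:P * lam u1 ^+ q + lam (X t l 2%:R)%:P * lam u2 ^+ q = lam (v l).
    by rewrite /v; move: (u0) (u1) (u2) => p0 p1 p2; rewrite !rmorphD !rmorphM !rmorphXn.
  have rel' : lam v0 * (lam u2 * lam (v 0) - lam u0 * lam (v 2%:R)) +
      lam v1 * (lam u2 * lam (v 1) - lam u1 * lam (v 2%:R)) = 0.
    by rewrite -!(rmorphM lam) -!(rmorphB lam) -!(rmorphM lam) -(rmorphD lam) rel rmorph0.
  rewrite !vE -rel'; move: (lam v0) (lam v1) (lam u0) (lam u1) (lam u2) (lam (v 0)) (lam (v 1)) (lam (v 2%:R)).
  by move=> *; ring.
have [g [gE gio]] := ev L f a hL n0.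
have [|g0 [g0E g0io]] := ev K idfun 0 hK.
  by rewrite map_poly_id // hornerM u20 mul1r.
have gt (M : comUnitAlgType k) (ff : {lrmorphism K -> M}) (gg : {lrmorphism B -> M}) : (forall c, gg (io c) = ff c) ->
    exists (h : zip_group q (levi q (map_mx gg x))), act h (fmap ff t) = fmap gg tB.
  move=> hg; have eM := levi_map gg x.
  have h : zip_group q (levi q (map_mx gg x)) by rewrite eM; exact: zip_fmap.
  exists h; rewrite /tB -(act_fmap zx h) //; congr act; rewrite -fmap_comp'.
  by apply: fmap_ext => c; rewrite hom_compE hg.
have [h eh] := gt L f g gio; have [h0 eh0] := gt K idfun g0 g0io.
exists (levi q (map_mx g x)), h; split.
- by rewrite eh; exact: D_fmap.
- rewrite eh; apply: iff_trans (P_connected g0 g nzd DB hK hL) _.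
  rewrite -eh0 fmap_id'.
  have [x00 x01 x02 x12 _] := xE.
  have gu0 : g0 (lam u0) = 0 by rewrite g0E map_poly_id // hornerM hornerX mul0r.
  have gu1 : g0 (lam u1) = 0 by rewrite g0E map_poly_id // hornerM hornerX mul0r.
  apply: parabolic => //=.
  + rewrite mxE x02; move: (lam u0) (lam u1) gu0 gu1 => p0 p1 gp0 gp1.
    by rewrite rmorphN rmorphD !rmorphM /= gp0 gp1 !mulr0 addr0 oppr0.
  + rewrite mxE x12; move: (lam u0) (lam u1) gu0 gu1 => p0 p1 gp0 gp1.
    by rewrite rmorphN rmorphD !rmorphM /= gp0 gp1 !mulr0 addr0 oppr0.
  + by have := D_fmap g0 DB; rewrite -eh0 fmap_id'.
have E0 : (map_poly f u0).[a] = a * f w0 by rewrite /u0 rmorphM /= map_polyX map_polyC /= !hornerE.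
have E1 : (map_poly f u1).[a] = a * f w1 by rewrite /u1 rmorphM /= map_polyX map_polyC /= !hornerE.
have E2 : (map_poly f u2).[a] = 1 - a + a * f w2.
  by rewrite /u2 rmorphD rmorphB rmorphM rmorph1 /= map_polyX map_polyC /= !hornerE.
by have := sends_map g sx; rewrite !gE E0 E1 E2; apply.
Qed.

(** The two points are followed along segments of lines that the element e matches: the parameter a
    on one side corresponds to 1 - a on the other. At a common admissible parameter both flags lie
    over the same line, and [parabolic] concludes. *)
Lemma fibre K (e : 'M[K]_4 * 'M[K]_4) (h : zip_group q e) (t : T K) : is_field K ->
  D t -> D (act h t) -> (P (act h t) <-> P t).
Proof.
move=> hK Dt Dh.
have [e' [h' [act' inv']]] := act_invE h t.
have inv : e.1 *m e'.1 = 1%:M by exact: mulmx1C.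
have invE (i : 'I_4) (c := fun l => e'.1 l 2%:R) : (i < 3)%N ->
    e.1 i 0 * c 0 + e.1 i 1 * c 1 + e.1 i 2%:R * c 2%:R = (i == 2%:R)%:R.
  move=> i3; have /matrixP/(_ i 2%:R) := inv; rewrite mxE sum4 mxE (zip_col h i3) mul0r addr0 => <-.
  by rewrite !addrA.
have [s1 [s10 hs1]] := line_section (e'.1 0 2%:R) (e'.1 1 2%:R) (e'.1 2%:R 2%:R) hK Dt.
have [s2 [s20 hs2]] := line_section (e.1 0 2%:R) (e.1 1 2%:R) (e.1 2%:R 2%:R) hK Dh.
have n1 : s1 != 0 by apply: contraNneq s10 => ->; rewrite horner0.
have n2 : s2 \Po (1 - 'X) != 0.
  apply: contraNneq s20 => e0; have := congr1 (fun p : {poly K} => p.[1]) e0.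
  by rewrite horner_comp !hornerE subrr => ->.
have n12 : s1 * (s2 \Po (1 - 'X)) != 0.
  by apply/eqP => /(poly_field_nzd hK) [] /eqP; apply/negP.
have [B [lam [io [_ lu ioE _]]]] := punctured_line hK n12.
have [L [g hL]] := field_points B.
pose f : {lrmorphism K -> L} := hom_comp g io; pose a : L := g (lam 'X).
have evE p : (map_poly f p).[a] = g (lam p).
  pose F : {rmorphism {poly K} -> L} := horner_eval a \o map_poly f.
  pose F' : {rmorphism {poly K} -> L} := g \o lam.
  have FC c : F c%:P = F' c%:P by rewrite /F /= /horner_eval map_polyC hornerC /= ioE.
  have FX : F 'X = F' 'X by rewrite /F /= /horner_eval map_polyX hornerX.
  suff : F p = F' p by [].
  elim/poly_ind: p => [|p c IH]; first by rewrite !rmorph0.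
  by rewrite !rmorphD !rmorphM FC FX IH.
have u12 : g (lam (s1 * (s2 \Po (1 - 'X)))) != 0 by exact: unit_field_neq0.
have m1 : (map_poly f s1).[a] != 0.
  by rewrite evE; apply: contraNneq u12 => e0; rewrite !rmorphM /= e0 mul0r.
have m2 : (map_poly f s2).[1 - a] != 0.
  apply: contraNneq u12 => e0; rewrite !rmorphM /= -(evE (_ \Po _)) map_comp_poly horner_comp.
  by rewrite rmorphB rmorph1 /= map_polyX !hornerE e0 mulr0.
have [ea [ha [Da Pa sa]]] := hs1 L f a hL m1.
have [eb [hb [Db Pb sb]]] := hs2 L f (1 - a) hL m2.
apply: iff_trans (iff_sym Pb) _; apply: iff_trans _ Pa.
have hf := zip_fmap q_pchar f h.
have ef : fmap f (act h t) = act hf (fmap f t) by rewrite (act_fmap h hf).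
have [hbf ebf] := act_act hb hf (fmap f t).
have [ea' [ha' [acta inva]]] := act_invE ha (fmap f t).
have [hp ehp] := act_act hbf ha' (act ha (fmap f t)).
have ep : act hp (act ha (fmap f t)) = act hb (fmap f (act h t)) by rewrite ehp acta ebf ef.
rewrite -ep; have GE : (eb.1 *m map_mx f e.1 *m ea'.1) *m ea.1 = eb.1 *m map_mx f e.1.
  by rewrite -mulmxA inva mulmx1.
have Dp : D (act hp (act ha (fmap f t))) by rewrite ep.
have [s0 s1' s2'] := sa; have [t0 t1 t2] := sb.
(* e.1 carries the vector at parameter a of the first segment to the vector at parameter 1 - a of
   the second. *)
have fe (i : 'I_4) : (i < 3)%N -> f (e.1 i 0) * (a * f (e'.1 0 2%:R)) + f (e.1 i 1) * (a * f (e'.1 1 2%:R)) +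
    f (e.1 i 2%:R) * (1 - a + a * f (e'.1 2%:R 2%:R)) = a * (i == 2%:R)%:R + (1 - a) * f (e.1 i 2%:R).
  move=> i3; rewrite -(rmorph_nat f) -(invE i i3) !rmorphD !rmorphM /=; ring.
have G2 (i : 'I_4) : (i < 2)%N -> (eb.1 *m map_mx f e.1 *m ea'.1) i 2%:R = 0.
  move=> i2; have i3 : (i < 3)%N by apply: ltn_trans i2 _.
  have z3 := zip_col hp i3; rewrite /= in z3.
  apply: (mulIr s2'); rewrite mul0r.
  transitivity ((eb.1 *m map_mx f e.1) i 0 * (a * f (e'.1 0 2%:R)) + (eb.1 *m map_mx f e.1) i 1 * (a * f (e'.1 1 2%:R)) +
    (eb.1 *m map_mx f e.1) i 2%:R * (1 - a + a * f (e'.1 2%:R 2%:R))).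
    have ev := vec_mul ea.1 (a * f (e'.1 0 2%:R)) (a * f (e'.1 1 2%:R)) (1 - a + a * f (e'.1 2%:R 2%:R)) z3.
    by rewrite GE s0 s1' !mulr0 !add0r in ev.
  rewrite (vec_mul _ _ _ _ (zip_col hb i3)) !mxE !fe //= !mulr0 !add0r mulr1.
  have e2 : a + (1 - a) * f (e.1 2%:R 2%:R) = 1 - (1 - a) + (1 - a) * f (e.1 2%:R 2%:R) by rewrite subKr.
  by rewrite e2; move: i2; elim/ord4_ind: i {i3 z3} => // _.
by apply: parabolic => //; apply: G2.
Qed.

End Fibres.

(** * Moving points of T into D locally over S *)

Section Slices.
Variables (k : fieldType) (q : nat) (S : kfunctor k) (zeta : zip_morphism q S).
Implicit Types (A B C D E K R L : comUnitAlgType k).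
Hypotheses (q_pchar : [pchar k].-nat q) (q_gt1 : (1 < q)%N).
Variable c0 : k.
Hypothesis c0q : c0 ^+ q != c0.
Local Notation T := (ztot zeta).
Local Notation zm := (zmap zeta).
Local Notation act := (zip_act (zact zeta)).
Local Notation X t := (ent zm t).

Definition mx4 (R : nzRingType) (s : seq (seq R)) : 'M[R]_4 := \matrix_(i, j) (nth [::] s i)`_j.

Definition rot0 (R : nzRingType) (c : R) := mx4 [:: [:: 0; 1; 0; 0]; [:: - c; 0; 1; 0]; [:: 1; 0; 0; 0]; [:: 0; 0; 0; 1]].
Definition rot1 (R : nzRingType) (c : R) := mx4 [:: [:: 1; 0; 0; 0]; [:: 0; - c; 1; 0]; [:: 0; 1; 0; 0]; [:: 0; 0; 0; 1]].

Lemma rot0_unit A (c : A) : rot0 c \in unitmx.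
Proof.
suff /mulmx1_unit [] : rot0 c *m mx4 [:: [:: 0; 0; 1; 0]; [:: 1; 0; 0; 0]; [:: 0; 1; c; 0]; [:: 0; 0; 0; 1]] = 1%:M by [].
apply/matrixP; elim/ord4_ind; elim/ord4_ind; rewrite !mxE sum4 !mxE /= ?(mulr0, mul0r, addr0, add0r, mulr1) //.
by rewrite mul1r addNr.
Qed.

Lemma rot1_unit A (c : A) : rot1 c \in unitmx.
Proof.
suff /mulmx1_unit [] : rot1 c *m mx4 [:: [:: 1; 0; 0; 0]; [:: 0; 0; 1; 0]; [:: 0; 1; c; 0]; [:: 0; 0; 0; 1]] = 1%:M by [].
apply/matrixP; elim/ord4_ind; elim/ord4_ind; rewrite !mxE sum4 !mxE /= ?(mulr0, mul0r, addr0, add0r, mulr1) //.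
by rewrite mul1r addNr.
Qed.

Lemma point_rank K (t : T K) : is_field K ->
  ~ (forall i j : 'I_4, (i < 2)%N -> (j < 3)%N -> X t i j = 0).
Proof.
move=> hK z; pose Y := invmx (sval (zm K t)).
have XY : sval (zm K t) *m Y = 1%:M by rewrite mulmxV //; exact: svalP (zm K t).
have r (i j : 'I_4) : (i < 2)%N -> X t i 3%:R * Y 3%:R j = (i == j)%:R.
  move=> i2; have /matrixP/(_ i j) := XY; rewrite mxE sum4 [in RHS]mxE => <-.
  have z' (j' : 'I_4) : (j' < 3)%N -> sval (zm K t) i j' = 0 by exact: z.
  by rewrite (z' 0) // (z' 1) // (z' 2%:R) // !mul0r !add0r.
have r00 := r 0 0 isT; have r01 := r 0 1 isT; have r11 := r 1 1 isT.
rewrite /= in r00 r01 r11.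
have a0 : X t 0 3%:R != 0 by apply: contraTneq isT => e; move/eqP: r00; rewrite e mul0r eq_sym oner_eq0.
by move/eqP: r11; rewrite (field_mul0 hK a0 r01) mulr0 eq_sym oner_eq0.
Qed.

(** If both entries vanished for every translate, testing the vectors (0, 0, 1), (1, 0, c) and (0,
    1, c) with c in k would kill the first three columns of rows 0 and 1, against [point_rank]. *)
Lemma slice_aux A (t : T A) K (psi : {lrmorphism A -> K}) : is_field K ->
  exists e (h : zip_group q e), psi (X (act h t) 0 2%:R) != 0 \/ psi (X (act h t) 1 2%:R) != 0.
Proof.
move=> hK; apply: contrapT => no; apply: (point_rank (t := fmap psi t) hK).
have z e (h : zip_group q e) : psi (X (act h t) 0 2%:R) = 0 /\ psi (X (act h t) 1 2%:R) = 0.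
  by split; apply/eqP/negP => /negP n; apply: no; exists e, h; [left|right].
have one : zip_group q (levi q (1%:M : 'M[A]_4)).
  by apply: levi_zip => // [|i i3]; rewrite ?unitmx1 // !mxE; case: i i3 => [] [|[|[|]]].
have q0 : (q == 0%N) = false by rewrite gtn_eqF // ltnW.
have z0 (c : A) : zip_group q (levi q (rot0 c)).
  by apply: levi_zip => // [|i]; [exact: rot0_unit|elim/ord4_ind: i => // _; rewrite !mxE].
have z1 (c : A) : zip_group q (levi q (rot1 c)).
  by apply: levi_zip => // [|i]; [exact: rot1_unit|elim/ord4_ind: i => // _; rewrite !mxE].
pose n i j := psi (X t i j).
have [n02 n12] : n 0 2%:R = 0 /\ n 1 2%:R = 0.
  have [e0 e1] := z _ one; split; rewrite /n.
    have := act_vec q_pchar q_gt1 one t (w0 := 0) (w1 := 0) (w2 := 1) 0; rewrite /= !mxE /=.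
    rewrite !(mulr0, mul0r, addr0, add0r, mulr1, mul1r, expr1n, expr0n, q0) => h.
    by rewrite -(h erefl erefl).
  have := act_vec q_pchar q_gt1 one t (w0 := 0) (w1 := 0) (w2 := 1) 1; rewrite /= !mxE /=.
  rewrite !(mulr0, mul0r, addr0, add0r, mulr1, mul1r, expr1n, expr0n, q0) => h.
  by rewrite -(h erefl erefl).
have a c : n 1 0 = 0 /\ c%:A * n 0 0 = n 2%:R 0 + (c ^+ q)%:A * n 2%:R 2%:R.
  have [e0 e1] := z _ (z0 c%:A); split.
    have := act_vec q_pchar q_gt1 (z0 c%:A) t (w0 := 1) (w1 := 0) (w2 := c%:A) 0; rewrite /= !mxE /=.
    rewrite !(mulr0, mul0r, addr0, add0r, mulr1, mul1r, expr1n, expr0n, q0) => /(_ erefl (addNr _)) /(congr1 psi).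
    by rewrite e0 rmorphD rmorphM /= -!/(n _ _) n12 mul0r addr0.
  have := act_vec q_pchar q_gt1 (z0 c%:A) t (w0 := 1) (w1 := 0) (w2 := c%:A) 1; rewrite /= !mxE /=.
  rewrite !(mulr0, mul0r, addr0, add0r, mulr1, mul1r, expr1n, expr0n, q0) => /(_ erefl (addNr _)) /(congr1 psi).
  rewrite e1 rmorphD rmorphM !rmorphD !rmorphM rmorphN rmorphXn /= !rmorph_alg -!/(n _ _) n02 mul0r addr0 mulNr => /esym/eqP.
  by rewrite addrC subr_eq0 => /eqP <-; rewrite exprZn expr1n [_ * (_ *: _)]mulrC.
have b c : n 0 1 = 0 /\ c%:A * n 1 1 = n 2%:R 1 + (c ^+ q)%:A * n 2%:R 2%:R.
  have [e0 e1] := z _ (z1 c%:A); split.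
    have := act_vec q_pchar q_gt1 (z1 c%:A) t (w0 := 0) (w1 := 1) (w2 := c%:A) 0; rewrite /= !mxE /=.
    rewrite !(mulr0, mul0r, addr0, add0r, mulr1, mul1r, expr1n, expr0n, q0) => /(_ erefl (addNr _)) /(congr1 psi).
    by rewrite e0 rmorphD rmorphM /= -!/(n _ _) n02 mul0r addr0.
  have := act_vec q_pchar q_gt1 (z1 c%:A) t (w0 := 0) (w1 := 1) (w2 := c%:A) 1; rewrite /= !mxE /=.
  rewrite !(mulr0, mul0r, addr0, add0r, mulr1, mul1r, expr1n, expr0n, q0) => /(_ erefl (addNr _)) /(congr1 psi).
  rewrite e1 rmorphD rmorphM !rmorphD !rmorphM rmorphN rmorphXn /= !rmorph_alg -!/(n _ _) n12 mul0r addr0 mulNr => /esym/eqP.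
  by rewrite addrC subr_eq0 => /eqP <-; rewrite exprZn expr1n [_ * (_ *: _)]mulrC.
(* c = 0 gives y = 0, c = 1 gives x = y2, and an element [c0] not fixed by Frobenius then gives x =
   0. *)
have sol (x y y2 : K) : (forall c : k, c%:A * x = y + (c ^+ q)%:A * y2) -> x = 0.
  move=> h; have := h 0; rewrite expr0n q0 !scale0r !mul0r addr0 => y0; rewrite -y0 in h.
  have := h 1; rewrite expr1n !scale1r !mul1r add0r => e; rewrite e.
  have := h c0; rewrite add0r e => /eqP; rewrite -subr_eq0 -mulrBl -scalerBl => /eqP; apply: (field_mul0 hK).
  by rewrite scaler_eq0 oner_eq0 orbF subr_eq0 eq_sym.
have n00 : n 0 0 = 0 by apply: sol => c; have [_ ->] := a c.
have n11 : n 1 1 = 0 by apply: sol => c; have [_ ->] := b c.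
have [n10 _] := a 0; have [n01 _] := b 0.
by elim/ord4_ind; elim/ord4_ind => //= _ _; rewrite ent_fmap.
Qed.

(** Once X_02 or X_12 is invertible, a Levi element with first row (X_12, - X_02) is available and
    makes X_02 vanish. *)
Lemma slice A (t : T A) K (psi : {lrmorphism A -> K}) : is_field K ->
  exists s, psi s != 0 /\ forall C (f : {lrmorphism A -> C}), f s \is a GRing.unit ->
    exists e (h : zip_group q e), X (act h (fmap f t)) 0 2%:R = 0.
Proof.
move=> hK; have [e [h n]] := slice_aux t psi hK.
have fin C (f : {lrmorphism A -> C}) a b : X (act h t) 0 2%:R = X (act h t) 0 2%:R ->
    f (X (act h t) 1 2%:R) * b + f (X (act h t) 0 2%:R) * a \is a GRing.unit ->
    exists e (h : zip_group q e), X (act h (fmap f t)) 0 2%:R = 0.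
  move=> _ u; pose x := gl2 (f (X (act h t) 1 2%:R)) (- f (X (act h t) 0 2%:R)) a b.
  have ux : x \in unitmx by apply: gl2_unit; rewrite mulNr opprK.
  have zx : zip_group q (levi q x).
    by apply: levi_zip => // i; elim/ord4_ind: i => // _; rewrite !mxE.
  have hf := zip_fmap q_pchar f h.
  have [h'' e''] := act_act q_pchar zx hf (fmap f t).
  eexists; exists h''; rewrite e'' (act_fmap h hf) //.
  have := act_rel q_pchar zx (fmap f (act h t)) 0 (j := 2%:R) isT.
  have q0 : (q == 0%N) = false by rewrite gtn_eqF // ltnW.
  rewrite /= !mxE /= expr1n expr0n q0 !(mulr0, mul0r, addr0, add0r, mulr1) => ->.
  by rewrite !ent_fmap mulNr mulrC subrr.
have [n0|n1] := n; [exists (X (act h t) 0 2%:R)|exists (X (act h t) 1 2%:R)]; split=> // C f u.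
  by apply: (fin C f 1 0) => //; rewrite mulr0 add0r mulr1.
by apply: (fin C f 0 1) => //; rewrite mulr0 addr0 mulr1.
Qed.

End Slices.

(** * Descent along torsors and connected components *)

Section TorsorDescent.
Variables (k : fieldType) (q : nat) (Y Z : kfunctor k) (a : zip_action q Y).
Implicit Types (A B C D E : comUnitAlgType k).
Variables (H : forall A, 'M[A]_4 * 'M[A]_4 -> Prop) (pr : kmorph Y Z).
Hypothesis tors : is_torsor a H pr.
Variables (dom : forall A, Y A -> Prop) (h : forall A, Y A -> A) (V : subfunctor Z).
Hypothesis dom_fmap : forall A B (f : {lrmorphism A -> B}) t, dom t -> dom (fmap f t).
Hypothesis h_nat : forall A B (f : {lrmorphism A -> B}) t, dom t -> h (fmap f t) = f (h t).
Hypothesis h_inv : forall A (e : 'M[A]_4 * 'M[A]_4) (z : zip_group q e) t, H e -> dom t -> h (zip_act a z t) = h t.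
Hypothesis V_dom : forall A (y : Z A), V A y -> forall C (f : {lrmorphism A -> C}) x, pr C x = fmap f y -> dom x.

Lemma torsor_descent : exists hV : regular_function (sub_kfunctor V), forall A (y : sub_kfunctor V A) (x : Y A),
  pr A x = sval y -> hV A y = h x.
Proof.
have [orb _ sec] := tors.
have ph A (t t' : Y A) : pr A t = pr A t' -> dom t -> h t = h t'.
  by move=> /orb [e [z [fe <-]]] zt; rewrite h_inv.
have ex A (y : sub_kfunctor V A) : exists b, forall C (f : {lrmorphism A -> C}) x,
    pr C x = fmap f (sval y) -> f b = h x.
  have [B [phi [x [ec exy]]]] := sec A (sval y).
  have zx C (f : {lrmorphism A -> C}) x' : pr C x' = fmap f (sval y) -> dom x'.
    exact: (V_dom (svalP y)).
  have zx0 := zx B phi x exy.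
  have [b hb] : exists b, phi b = h x.
    apply: (etale_descent ec) => D d1 d2 hd; rewrite -!h_nat //.
    apply: ph; last exact: dom_fmap.
    rewrite !kapp_nat exy -!fmap_comp'; apply: fmap_ext => c.
    by rewrite !hom_compE hd.
  exists b => C f x' e'; have [E [g [d [hd inj]]]] := etale_pushout f ec.
  apply: inj; rewrite hd hb -!h_nat //; last exact: (zx C f).
  apply: ph; last exact: dom_fmap.
  rewrite !kapp_nat exy e' -!fmap_comp'; apply: fmap_ext => c.
  by rewrite !hom_compE hd.
pose v A (y : sub_kfunctor V A) := projT1 (cid (ex A y)).
have vP A (y : sub_kfunctor V A) : forall C (f : {lrmorphism A -> C}) x,
    pr C x = fmap f (sval y) -> f (v A y) = h x by rewrite /v; case: cid.
have vn A B (f : {lrmorphism A -> B}) (y : sub_kfunctor V A) : v B (fmap f y) = @fmap k (A1 k) A B f (v A y).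
  have [C [phi [x [ec exy]]]] := sec B (fmap f (sval y)).
  have [E [g [d [hd inj]]]] := etale_pushout idfun ec.
  apply: inj; rewrite -[g (v _ _)]/(g (idfun (v B (fmap f y)))).
  have e1 := vP B (fmap f y) C phi x exy.
  have e2 : hom_comp phi f (v A y) = h x by apply: vP; rewrite exy fmap_comp'.
  by rewrite hd e1 -[fmap f _]/(f (v A y)) -[g _]/(g (idfun (f (v A y)))) hd -e2.
exists (@KMorph k (sub_kfunctor V) (A1 k) v vn) => A y x e.
by have := vP A y A idfun x; rewrite fmap_id' => /(_ e).
Qed.

End TorsorDescent.

Section Topology.
Variables (k : fieldType) (Y : kfunctor k).
Implicit Types (A B K : comUnitAlgType k).

Lemma unit_locus_stable (h : regular_function Y) A B (f : {lrmorphism A -> B}) (y : Y A) :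
  h A y \is a GRing.unit -> h B (fmap f y) \is a GRing.unit.
Proof. by move=> u; rewrite kapp_nat; exact: (rmorph_unit f). Qed.

Definition unit_locus (h : regular_function Y) : subfunctor Y := SubFunctor (@unit_locus_stable h).

Lemma unit_locus_open (h : regular_function Y) : is_open (unit_locus h).
Proof.
move=> A y; exists (fun a => a = h A y) => B f /=; rewrite kapp_nat -[fmap f _]/(f (h A y)); split.
  move=> u; exists 1%N, (fun _ => h A y), (fun _ => (f (h A y))^-1); split=> //.
  by rewrite big_ord1 mulVr.
move=> [n [a [b [ha e1]]]]; apply/unitrPr; exists (\sum_i b i); rewrite mulrC mulr_suml -[RHS]e1.
by apply: eq_bigr => i _; rewrite ha.
Qed.

Lemma open_saturated (U : subfunctor Y) : is_open U -> saturated (fun K => U K).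
Proof.
move=> oU K K' f x hK hK'; split; last exact: smem_stable.
have [I hI] := oU K x; move=> /hI [n [a [b [ha e1]]]].
have [i ni] : exists i, a i != 0.
  apply/existsP; apply: contraT => /existsPn z.
  have : (1 : K') = 0 by rewrite -e1 big1 // => i _; have /negPn/eqP -> := z i; rewrite rmorph0 mulr0.
  by move/eqP; rewrite oner_eq0.
have := iffRL (hI K idfun); rewrite fmap_id'; apply.
by exists 1%N, (fun _ => a i), (fun _ => (a i)^-1); split=> //; rewrite big_ord1 /= mulVr //; exact: hK.
Qed.

Variables (K0 : comUnitAlgType k) (y0 : Y K0).
Hypothesis hK0 : is_field K0.

Definition component : point_set Y := fun K y =>
  exists C : point_set Y, [/\ saturated C, connected_set C, C K0 y0 & C K y].

(** The smallest saturated set through [y0], that is the corresponding point of |Y|; being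
    connected, it shows that [y0] lies in [component]. *)
Definition point_class : point_set Y := fun K y =>
  forall C : point_set Y, saturated C -> C K0 y0 -> C K y.

Lemma point_class_connected : saturated point_class /\ connected_set point_class.
Proof.
have sat : saturated point_class.
  by move=> K K' f x hK hK'; split=> h C sC C0; have := h C sC C0; rewrite (sC K K' f x hK hK').
split=> //; split; first by exists K0, y0; split=> // C _.
have memU U : is_open U -> inhabited_set (fun K x => point_class x /\ U K x) -> U K0 y0.
  move=> oU [K [x [hK [cx Ux]]]]; apply: contrapT => nU.
  apply: (cx (fun K x => ~ U K x)) => // L L' f z hL hL'.
  by split=> n Uz; apply: n; apply/(open_saturated oU f z hL hL').
move=> U V oU oV _ iU iV; exists K0, y0; split=> //; split; [|exact: memU|exact: memU].
by move=> C _.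
Qed.

Lemma component_connected : connected_component component.
Proof.
have [satc conc] := point_class_connected.
have c0 : component y0 by exists point_class; split=> // C _.
split.
- move=> K K' f x hK hK'; split=> -[C [sC cC C0 Cx]]; exists C; split=> //; exact/(sC K K' f x hK hK').
- split; first by exists K0, y0.
  have half U V : is_open U -> is_open V -> (forall K (x : Y K), is_field K -> component x -> U K x \/ V K x) ->
      U K0 y0 -> inhabited_set (fun K x => component x /\ V K x) ->
      inhabited_set (fun K x => [/\ component x, U K x & V K x]).
    move=> oU oV cov U0 [K [x [hK [[C [sC cC C0 Cx]] Vx]]]].
    have sub L (z : Y L) : C L z -> component z by move=> Cz; exists C.
    have [|||L [z [hL [Cz Uz Vz]]]] := cC.2 U V oU oV.
    + by move=> L z hL /sub; exact: cov.
    + by exists K0, y0.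
    + by exists K, x.
    by exists L, z; split=> //; split=> //; exact: sub.
  move=> U V oU oV cov iU iV; have [U0|V0] := cov K0 y0 hK0 c0; first exact: half.
  have [|L [z [hL [cz Vz Uz]]]] := half V U oV oU _ V0 iU; last by exists L, z.
  by move=> K x hK /(cov K x hK) []; [right|left].
- move=> C' sC' cC' sub K x hK Cx; exists C'; split=> //; exact: sub.
Qed.

End Topology.

(** * Spreading the vanishing over D by connectedness of S *)

Section Sweep.
Variables (k : fieldType) (q : nat) (S : kfunctor k) (zeta : zip_morphism q S).
Implicit Types (A B C D E K R L : comUnitAlgType k).
Hypotheses (q_pchar : [pchar k].-nat q) (q_gt1 : (1 < q)%N).
Variable c0 : k.
Hypothesis c0q : c0 ^+ q != c0.
Local Notation T := (ztot zeta).
Local Notation zm := (zmap zeta).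
Local Notation act := (zip_act (zact zeta)).
Local Notation X t := (ent zm t).
Local Notation D t := (X t 0 2%:R = 0).

(** The inverse image in T of the image in S of the part of D satisfying Q. *)
Definition sweep (Q : point_set T) : point_set T := fun K t =>
  exists e (h : zip_group q e), D (act h t) /\ Q K (act h t).

Lemma sweep_act (Q : point_set T) K (e : 'M[K]_4 * 'M[K]_4) (h : zip_group q e) (t : T K) :
  sweep Q t -> sweep Q (act h t).
Proof.
move=> [e1 [h1 [D1 Q1]]]; have [e' [h' [e2 _]]] := act_invE q_pchar h t.
have [h'' e3] := act_act q_pchar h1 h' (act h t).
by eexists; exists h''; rewrite e3 e2.
Qed.

Section Locus.
Variable Q : point_set T.
Hypothesis Q_fibre : forall K (e : 'M[K]_4 * 'M[K]_4) (h : zip_group q e) (t : T K), is_field K ->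
  D t -> D (act h t) -> (Q (act h t) <-> Q t).
Hypothesis Q_loc : forall A (t : T A), D t -> forall K (psi : {lrmorphism A -> K}), is_field K ->
  exists s, psi s != 0 /\ forall L (psi' : {lrmorphism A -> L}), is_field L -> psi' s != 0 ->
    (Q (fmap psi' t) <-> Q (fmap psi t)).

Lemma sweep_all K (t : T K) : is_field K -> sweep Q t -> forall e (h : zip_group q e), D (act h t) -> Q (act h t).
Proof.
move=> hK [e1 [h1 [D1 Q1]]] e h Dh; have [e' [h' [e2 _]]] := act_invE q_pchar h1 t.
have [h'' e3] := act_act q_pchar h h' (act h1 t); rewrite e2 in e3.
by rewrite -e3; apply/Q_fibre => //; rewrite e3.
Qed.

(** Locally [slice] moves the point into D, where Q is locally constant; by [Q_fibre] the answer
    does not depend on the translate. *)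
Lemma sweep_open : p_open (sweep Q).
Proof.
move=> A t K psi hK O; have [s [s0 hs]] := slice q_pchar q_gt1 c0q t psi hK.
have [B [p [[pu ps _] pl _]]] := @loc_exists k A s (ex_intro _ K (ex_intro _ psi (conj hK s0))).
have [e [h Dh]] := hs B p pu.
have [psiB hB] := pl K psi (hK _ s0).
have [s' [s'0 hs']] := Q_loc Dh psiB hK.
have [a [n ha]] := ps s'.
have tr L (g : {lrmorphism B -> L}) (f : {lrmorphism A -> L}) : (forall c, g (p c) = f c) ->
    exists e (h' : zip_group q e), D (act h' (fmap f t)) /\ act h' (fmap f t) = fmap g (act h (fmap p t)).
  move=> hg; eexists; exists (zip_fmap q_pchar g h).
  have e1 : act (zip_fmap q_pchar g h) (fmap f t) = fmap g (act h (fmap p t)).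
    rewrite -(act_fmap h (zip_fmap q_pchar g h)) //; congr act; rewrite -fmap_comp'.
    by apply: fmap_ext => c; rewrite hom_compE hg.
  by rewrite e1; split=> //; exact: D_fmap.
have QB : Q (fmap psiB (act h (fmap p t))).
  by have [e1 [h1 [D1 <-]]] := tr K psiB psi hB; exact: sweep_all.
have evL L (g : {lrmorphism B -> L}) (f : {lrmorphism A -> L}) : (forall c, g (p c) = f c) -> f a = g s' * f s ^+ n.
  by move=> hg; rewrite -hg ha rmorphM rmorphXn /= hg.
exists (s * a); split.
  rewrite rmorphM /= (evL K psiB psi hB); do 2!apply: (field_mulf_neq0 hK) => //; exact: field_expf_neq0.
move=> L f hL; rewrite rmorphM /= => n0.
have fs : f s != 0 by apply: contraNneq n0 => ->; rewrite mul0r.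
have [g hg] := pl L f (hL _ fs).
have gs : g s' != 0 by apply: contraNneq n0 => z; rewrite (evL L g f hg) z mul0r mulr0.
have [e1 [h1 [D1 E1]]] := tr L g f hg; exists e1, h1; split=> //; rewrite E1.
by apply/(hs' L g hL gs).
Qed.

End Locus.

Variable P : point_set T.
Hypothesis P_ext : forall K L (f : {lrmorphism K -> L}) (t : T K), is_field K -> is_field L -> D t ->
  (P (fmap f t) <-> P t).
Hypothesis P_flag : forall K (e : 'M[K]_4 * 'M[K]_4) (h : zip_group q e) (t : T K), is_field K ->
  flag_group q e -> D t -> (P (act h t) <-> P t).
Hypothesis P_loc : forall A (t : T A), D t -> forall K (psi : {lrmorphism A -> K}), is_field K ->
  exists s, psi s != 0 /\ forall L (psi' : {lrmorphism A -> L}), is_field L -> psi' s != 0 ->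
    (P (fmap psi' t) <-> P (fmap psi t)).

Local Notation nP := (fun K t => ~ P (K := K) t).

Lemma sweep_disjoint K (t : T K) : is_field K -> sweep P t -> ~ sweep nP t.
Proof.
move=> hK O [e [h [Dh n]]]; apply: n; apply: sweep_all => // L e' h' t' hL D1 D2.
exact: (fibre q_pchar q_gt1 P_flag P_loc).
Qed.

Lemma sweep_cover K (t : T K) : is_field K -> sweep P t \/ sweep nP t.
Proof.
move=> hK; have [s [s0 hs]] := slice q_pchar q_gt1 c0q t idfun hK.
have [e [h Dh]] := hs K idfun (hK _ s0); rewrite fmap_id' in Dh.
by have [p|n] := pselect (P (act h t)); [left|right]; exists e, h.
Qed.

Lemma sweep_open2 : p_open (sweep P) /\ p_open (sweep nP).
Proof.
have fib := fibre q_pchar q_gt1 P_flag P_loc.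
split; first exact: sweep_open.
apply: sweep_open => [K e h t hK D1 D2|A t Dt K psi hK].
  by have hh := fib K e h t hK D1 D2; split=> n p; apply: n; apply/hh.
have [s [s0 hs]] := P_loc Dt psi hK; exists s; split=> // L psi' hL s'0.
by have hh := hs L psi' hL s'0; split=> n p; apply: n; apply/hh.
Qed.

(** The sweeps of P and of its negation are open, disjoint and cover T, so their indicator function
    glues. It is invariant under E and descends to S. *)
Lemma sweep_idempotent : exists hS : regular_function S, forall K (t : T K), is_field K ->
  (sweep P t -> hS K (zproj zeta K t) = 1) /\ (sweep nP t -> hS K (zproj zeta K t) = 0).
Proof.
have [oP oN] := sweep_open2.
pose V A (t : T A) (c : A) := (c = 1 /\ inside (sweep P) t) \/ (c = 0 /\ inside (sweep nP) t).
have V_fmap A B (f : {lrmorphism A -> B}) t c : V A t c -> V B (fmap f t) (f c).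
  by move=> [[-> i]|[-> i]]; [left|right]; rewrite ?rmorph1 ?rmorph0; split=> //; exact: inside_fmap.
have dis A (t : T A) : inside (sweep P) t -> inside (sweep nP) t -> False.
  have [K [psi hK]] := field_points A; move=> i1 i2; exact: (sweep_disjoint hK (i1 K psi hK) (i2 K psi hK)).
have V_uniq A (t : T A) c c' : V A t c -> V A t c' -> c = c'.
  by move=> [[-> i]|[-> i]] [[-> i']|[-> i']] //; [have := dis A t i i'|have := dis A t i' i].
have V_local A (t : T A) K (psi : {lrmorphism A -> K}) : is_field K ->
    exists s, psi s != 0 /\ forall C (f : {lrmorphism A -> C}), f s \is a GRing.unit -> exists c, V C (fmap f t) c.
  move=> hK; have [O|O] := sweep_cover (fmap psi t) hK.
    have [s [s0 hs]] := open_local oP hK O; exists s; split=> // C f u; exists 1; left; split=> //; exact: hs.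
  have [s [s0 hs]] := open_local oN hK O; exists s; split=> // C f u; exists 0; right; split=> //; exact: hs.
have [phi [phi_nat phiE]] := @glue_fun k T (fun _ _ => True) V (fun _ _ _ _ _ => I) V_fmap
  (fun A t c c' _ => V_uniq A t c c') (fun A t K psi _ => V_local A t K psi).
have Vact A (e : 'M[A]_4 * 'M[A]_4) (h : zip_group q e) (t : T A) c : V A t c -> V A (act h t) c.
  have tr Q : inside (sweep Q) t -> inside (sweep Q) (act h t).
    move=> i K psi hK; rewrite -(act_fmap h (zip_fmap q_pchar psi h)) //.
    by apply: sweep_act; exact: i.
  by move=> [[-> i]|[-> i]]; [left|right]; split=> //; exact: tr.
have phi_inv A (e : 'M[A]_4 * 'M[A]_4) (h : zip_group q e) t : phi A (act h t) = phi A t.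
  apply: eq_local => K psi hK; have [s [s0 hs]] := V_local A t K psi hK; exists s; split=> // C f u.
  have [c hc] := hs C f u; rewrite -!phi_nat // (phiE C (fmap f t) c) //.
  by rewrite -(act_fmap h (zip_fmap q_pchar f h)) //; apply: phiE => //; exact: Vact.
pose full : subfunctor S := @SubFunctor k S (fun _ _ => True) (fun _ _ _ _ _ => I).
have [hV hVE] := @torsor_descent k q T S (zact zeta) _ _ (zproj_torsor zeta) (fun _ _ => True) phi full
  (fun _ _ _ _ _ => I) (fun A B f t _ => phi_nat A B f t I) (fun A e h t _ _ => phi_inv A e h t) (fun _ _ _ _ _ _ _ => I).
pose v A (s : S A) : A := hV A (exist _ s I).
have vn A B (f : {lrmorphism A -> B}) (s : S A) : v B (fmap f s) = @fmap k (A1 k) A B f (v A s).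
  by rewrite /v -kapp_nat; congr (hV B _); apply: sub_obj_inj.
exists (@KMorph k S (A1 k) v vn) => K t hK; have [oPt oNt] := (@inside_point _ _ _ K t oP hK, @inside_point _ _ _ K t oN hK).
have e : v K (zproj zeta K t) = phi K t by exact: hVE.
by split=> O; rewrite /= e; apply: phiE => //; [left|right]; split=> //; [exact: oPt|exact: oNt].
Qed.

Hypothesis cond_b : zip_surjective_on_components zeta.

Lemma sweep_spread : (forall K (t : T K), is_field K -> zeroes zm (up [::]) t -> P t) ->
  forall K (t : T K), is_field K -> D t -> P t.
Proof.
move=> te K0 t0 hK0 Dt0; apply: contrapT => n0.
have [hS hSE] := sweep_idempotent.
have act1' K (t : T K) : exists e (h : zip_group q e), act h t = t.
  have [orb _ _] := zproj_torsor zeta.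
  by have [e [h [_ e1]]] := iffLR (orb K t t) erefl; exists e, h.
have sweep_self (Q : point_set T) K (t : T K) : D t -> Q K t -> sweep Q t.
  by move=> Dt Qt; have [e [h e1]] := act1' K t; exists e, h; rewrite e1.
have s00 : hS K0 (zproj zeta K0 t0) = 0 by apply: (hSE K0 t0 hK0).2; exact: (sweep_self nP).
(* This permutation matrix has zeros at all six positions; by condition (b) it is attained over the
   component of the given point, so that component meets the image of T_e. *)
pose g : 'M[k^o]_4 := mx4 [:: [:: 0; 0; 0; 1]; [:: 1; 0; 0; 0]; [:: 0; 1; 0; 0]; [:: 0; 0; 1; 0]].
have gu : g \in unitmx.
  suff /mulmx1_unit [] : g *m mx4 [:: [:: 0; 1; 0; 0]; [:: 0; 0; 1; 0]; [:: 0; 0; 0; 1]; [:: 1; 0; 0; 0]] = 1%:M by [].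
  by apply/matrixP; elim/ord4_ind; elim/ord4_ind; rewrite !mxE sum4 !mxE /= ?(mulr0, mul0r, addr0, add0r, mulr1).
have hk : is_field (k^o : comUnitAlgType k) by move=> a; rewrite unitfE.
have [K [io [t [hK et [C [sC cC C0 Ct]]]]]] :=
  cond_b (@component_connected k S K0 (zproj zeta K0 t0) hK0) (exist _ g gu) hk.
have zt : zeroes zm (up [::]) t.
  move=> i j; rewrite /ent et /= mxE.
  by elim/ord4_ind: i; elim/ord4_ind: j => //= _; rewrite mxE /= rmorph0.
have Dt : D t by apply: zt.
have s1 : hS K (zproj zeta K t) = 1.
  by apply: (hSE K t hK).1; apply: (sweep_self P) => //; exact: te.
have valE L (y : S L) : is_field L -> hS L y = 1 \/ hS L y = 0.
  move=> hL; have [_ _ sec] := zproj_torsor zeta; have [B [phi [x [[_ _ sj] ex]]]] := sec L y.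
  have [L' [iota [chi [hL' hc]]]] := sj L idfun hL.
  have ey : zproj zeta L' (fmap chi x) = fmap iota y.
    by rewrite kapp_nat ex -fmap_comp'; apply: fmap_ext => c; rewrite hom_compE hc.
  have hy : hS L' (fmap iota y) = iota (hS L y) by rewrite kapp_nat.
  have := hSE L' (fmap chi x) hL'; rewrite ey hy => -[h1 h0].
  have inj := @field_hom_inj k L L' iota hL.
  by have [/h1|/h0] := sweep_cover (fmap chi x) hL' => e; [left|right]; apply: inj; rewrite e ?rmorph1 ?rmorph0.
have nv A B (f : {lrmorphism A -> B}) (y : S A) : 1 - hS B (fmap f y) = @fmap k (A1 k) A B f (1 - hS A y).
  by rewrite kapp_nat /fmap /= /A1_fmap rmorphB rmorph1.
pose hS' : regular_function S := @KMorph k S (A1 k) (fun A y => 1 - hS A y) nv.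
have [_ conn] := cC.
have [||| L [y [hL [_ Uy Vy]]]] := conn (unit_locus hS) (unit_locus hS') (unit_locus_open hS) (unit_locus_open hS').
- move=> L y hL _; have [e|e] := valE L y hL; [left|right]; rewrite /= e ?subr0 unitr1 //.
- by exists K, (zproj zeta K t); split=> //; split=> //=; rewrite s1 unitr1.
- by exists K0, (zproj zeta K0 t0); split=> //; split=> //=; rewrite s00 subr0 unitr1.
move: Uy Vy; rewrite /=; have [->|->] := valE L y hL; last by rewrite unitr0.
by rewrite subrr unitr0.
Qed.

End Sweep.

(** * Division by the partial Hasse invariant *)

Section Hasse.
Variables (k : fieldType) (q : nat) (S : kfunctor k) (zeta : zip_morphism q S) (Fl : flag_space zeta).
Implicit Types (A B C D E K R L : comUnitAlgType k).
Hypotheses (q_pchar : [pchar k].-nat q) (q_gt1 : (1 < q)%N) (q_root : forall c : k, exists d, d ^+ q = c).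
Variable c0 : k.
Hypothesis c0q : c0 ^+ q != c0.
Hypothesis cond_a : zip_smooth zeta.
Hypothesis cond_b : zip_surjective_on_components zeta.
Hypothesis cond_c : flag_curves_pseudo_complete Fl.
Local Notation T := (ztot zeta).
Local Notation zm := (zmap zeta).
Local Notation act := (zip_act (zact zeta)).
Local Notation all := (everywhere (zeta := zeta)).

Lemma everywhere_open : p_open all.
Proof. by move=> A t K psi hK _; exists 1; rewrite rmorph1 oner_eq0. Qed.

Lemma everywhere_stable : stable all. Proof. by []. Qed.

Lemma JD_zeroes A (t : T A) : ent zm t 0 2%:R = 0 -> zeroes zm JD t.
Proof.
move=> z i j; elim/ord4_ind: i; elim/ord4_ind: j => //= _; rewrite -[RHS]z; congr ent; exact/val_inj.
Qed.

(** P is local vanishing of the section on D: it holds along T_e by [vanish_Te], is locally constant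
    and invariant under E', and so spreads to D by [sweep_spread]. *)
Lemma section_vanish (lambda : 'rV[int]_4) (f : regular_function T) : flag_section lambda f ->
  0 < q%:Z ^+ 2 * (lambda 0 0 - lambda 0 3%:R) + q%:Z * (lambda 0 1 - lambda 0 3%:R) + (lambda 0 2%:R - lambda 0 3%:R) ->
  forall A (t : T A), ent zm t 0 2%:R = 0 -> f A t = 0.
Proof.
move=> wf pos; pose phi A (t : T A) : A := f A t.
have nphi : natural zm all JD phi by move=> A B g t _; rewrite /phi kapp_nat.
have wphi : weight all JD lambda phi by move=> A e h t fe _; exact: wf.
have mD A (t : T A) : ent zm t 0 2%:R = 0 -> tmem zm all JD t by move=> /JD_zeroes z; split.
have oall := everywhere_open; have sall := everywhere_stable.
pose P : point_set T := fun K t => vanish zm all JD phi t.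
have P1 K (e : 'M[K]_4 * 'M[K]_4) (h : zip_group q e) (t : T K) : is_field K -> flag_group q e ->
    ent zm t 0 2%:R = 0 -> P K (act h t) -> P K t.
  move=> hK fe Dt; exact: (vanish_act cond_a q_pchar q_gt1 oall sall JD_upper nphi wphi hK fe (mD K t Dt)).
have P_flag K (e : 'M[K]_4 * 'M[K]_4) (h : zip_group q e) (t : T K) : is_field K -> flag_group q e ->
    ent zm t 0 2%:R = 0 -> (P K (act h t) <-> P K t).
  move=> hK fe Dt; split; first exact: P1.
  have [e' [h' [fe' e1]]] := act_inv Fl h t fe.
  have Dt' : ent zm (act h t) 0 2%:R = 0.
    by apply: (zeroes_act q_pchar q_gt1 h JD_upper fe (JD_zeroes Dt)).
  by rewrite -{1}e1; apply: P1.
have P_loc A (t : T A) : ent zm t 0 2%:R = 0 -> forall K (psi : {lrmorphism A -> K}), is_field K ->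
    exists s, psi s != 0 /\ forall L (psi' : {lrmorphism A -> L}), is_field L -> psi' s != 0 ->
      (P L (fmap psi' t) <-> P K (fmap psi t)).
  move=> Dt K psi hK; have mt := mD A t Dt.
  have [V [oV Vt hV]] := vanish_locally_constant cond_a q_pchar q_root q_gt1 oall nphi hK (tmem_fmap psi mt).
  have [s [s0 hs]] := oV A t K psi hK Vt; exists s; split=> // L psi' hL s'0.
  by apply: hV => //; [exact: tmem_fmap|exact: hs].
have te K (t : T K) : is_field K -> zeroes zm (up [::]) t -> P K t.
  by move=> hK zt; exact: (vanish_Te cond_a cond_c q_pchar q_root q_gt1 nphi wphi pos hK zt).
move=> A t Dt; apply: (vanish_all nphi (mD A t Dt)) => K psi hK.
apply: (sweep_spread q_pchar q_gt1 c0q P_flag P_loc cond_b te hK).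
by rewrite ent_fmap Dt rmorph0.
Qed.

Lemma entry_stable A B (phi : {lrmorphism A -> B}) (g : GL4 k A) :
  sval g 0 2%:R = 0 -> sval (fmap phi g) 0 2%:R = 0.
Proof. by move=> z; rewrite mxE z rmorph0. Qed.

(** X_02 is the entry (0, 3) of g [zperm] = b w b'. Lower triangularity of b leaves row w(0) = 2 of
    b', whose last entry is 0. The condition is closed, so it holds on the reduced closure. *)
Lemma hasse_entry A (g : GL4 k A) :
  reduced_closure (flag_stratum (w0 * simple_refl ord_max)%g) A g -> sval g 0 2%:R = 0.
Proof.
move=> /(_ (SubFunctor entry_stable)); apply.
  move=> B y; exists (fun a => a = sval y 0 2%:R) => C phi /=; rewrite mxE.
  by split=> [z a ->|]; last apply.
move=> K y hK /flag_stratumP [b [b' [/andP [_ /is_trig_mxP tb] /andP [_ /is_trig_mxP tb'] e]]] /=.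
have [_ _ z2 _] := zpermE; rewrite -mul_zperm e z2 -mulmxA -row_permE mxE big1 // => l _; rewrite mxE.
have [->|l0] := eqVneq l 0; last by rewrite tb ?mul0r // lt0n.
have w00 : w0 0 = inord (@ord_max 2).+1 by apply/val_inj; rewrite /w0 permE /= inordK.
by rewrite tb' ?mulr0 // permM w00 tpermR /= inordK.
Qed.

Theorem hasse_divides (lambda lambda_Ha : 'rV[int]_4) (f : regular_function T) (Ha : regular_function (GL4 k)) :
  flag_section lambda f ->
  0 < q%:Z ^+ 2 * (lambda 0 0 - lambda 0 3%:R) + q%:Z * (lambda 0 1 - lambda 0 3%:R) + (lambda 0 2%:R - lambda 0 3%:R) ->
  partial_hasse q ord_max lambda_Ha Ha -> divisible_by lambda lambda_Ha f Ha.
Proof.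
move=> wf pos [wHa zHa]; pose phi A (t : T A) : A := f A t; pose x A (t : T A) : A := Ha A (zm A t).
have oall := everywhere_open; have sall := everywhere_stable.
have nphi : natural zm all xpred0 phi by move=> A B g t _; rewrite /phi kapp_nat.
have nx : natural zm all xpred0 x by move=> A B g t _; rewrite /x !kapp_nat.
have wphi : weight all xpred0 lambda phi by move=> A e h t fe _; exact: wf.
have wx : weight all xpred0 lambda_Ha x.
  by move=> A e h t fe _; apply: wHa => //; exact: zmap_equivariant.
have x0 A (t : T A) : x A t = 0 -> ent zm t 0 2%:R = 0 by move=> /zHa; exact: hasse_entry.
(* On charts X_02 vanishes where the pullback of Ha does, so it is a multiple of it; as X_02 is a
   nonzerodivisor, so is this pullback. *)
have nzd R (u : T R) U z : chart zm all xpred0 u U -> x R u * z = 0 -> z = 0.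
  move=> hch e; have ne : natural zm all xpred0 (fun A t => ent zm t 0 2%:R) by exact: entry_natural.
  have [r er] := chart_quotient nx ne (fun A t _ => x0 A t) hch.
  by apply: (chart_nzd (proj1 cond_a) hch (i0 := 0) (j0 := 2%:R)) => //; rewrite er mulrAC e mul0r.
have v0 A (t : T A) : tmem zm all xpred0 t -> x A t = 0 -> phi A t = 0.
  by move=> _ /x0; exact: section_vanish wf pos A t.
have [g [ng eg]] := division cond_a oall nx nphi nzd v0.
have wg := division_weight cond_a q_pchar q_gt1 oall sall (fun _ _ _ _ h => match notF h with end) nx wx ng wphi nzd eg.
have all_mem A (t : T A) : tmem zm all xpred0 t by split.
exists (@KMorph k T (A1 k) g (fun A B h t => ng A B h t (all_mem A t))).
  by move=> A e h t fe; exact: wg.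
by move=> A t; rewrite mulrC; exact: eg.
Qed.

End Hasse.

Lemma card_pchar (F : finFieldType) (k : fieldType) (iota : {rmorphism F -> k}) : [pchar k].-nat #|F|.
Proof.
have [p pr_p ch] := finPcharP F.
have : p.-nat #|F| by rewrite -cardsT; apply: abelem_pgroup; exact: fin_ring_pchar_abelem.
by apply: sub_in_pnat => l _ /eqP ->; rewrite (fmorph_pchar iota).
Qed.

Lemma closed_root (k : closedFieldType) (n : nat) (c d : k) : (1 < n)%N -> exists x, x ^+ n = c + d * x.
Proof.
case: n => [|[|n]] // _.
have [x hx] := @solve_monicpoly k n.+2 (fun i => nth 0 [:: c; d] i) isT; exists x; rewrite hx.
rewrite big_ord_recl big_ord_recl big1 => [|i _]; first by rewrite /= expr0 mulr1 expr1 addr0.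
by rewrite /= nth_nil mul0r.
Qed.

Theorem theorem4p2p6
  (Fq : finFieldType) (k : closedFieldType) (iota : {rmorphism Fq -> k})
  (k_algebraic : forall x : k, algebraicOver iota x)
  (S : kfunctor k) (S_scheme : is_scheme S)
  (zeta : zip_morphism #|Fq| S) (Fl : flag_space zeta)
  (cond_a : zip_smooth zeta)
  (cond_b : zip_surjective_on_components zeta)
  (cond_c : flag_curves_pseudo_complete Fl)
  (a1 a2 a3 a4 : int)
  (lambda_pos :
    0 < (#|Fq|%:Z ^+ 2) * (a1 - a4) + #|Fq|%:Z * (a2 - a4) + (a3 - a4))
  (f : regular_function (ztot zeta))
  (f_section : flag_section (row4 a1 a2 a3 a4) f)
  (lambda_Ha : 'rV[int]_4) (Ha : regular_function (GL4 k))
  (Ha_hasse : partial_hasse #|Fq| (ord_max : 'I_3) lambda_Ha Ha) :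
  divisible_by (row4 a1 a2 a3 a4) lambda_Ha f Ha.
Proof.
have q_gt1 : (1 < #|Fq|)%N by exact: finNzRing_gt1.
(* A root of x^q = 1 + x is an element of k not fixed by Frobenius, as [slice_aux] needs. *)
have [c hc] := closed_root (1 : k) 1 q_gt1.
have cq : c ^+ #|Fq| != c by rewrite hc mul1r -subr_eq0 addrK oner_eq0.
have root (d : k) : exists x, x ^+ #|Fq| = d.
  by have [x hx] := closed_root d 0 q_gt1; exists x; rewrite hx mul0r addr0.
apply: (hasse_divides (card_pchar iota) q_gt1 root cq cond_a cond_b cond_c f_section _ Ha_hasse).
by rewrite !mxE.
Qed.
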